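(* Let $0<\alpha<1$, $\theta>0$, and let $H$ be a probability measure on $(0,\infty)$. Recall $M_{\alpha\theta}(\varrho_{\alpha,H})\overset{d}{=}M_{\alpha\theta}(\varrho_\alpha)[M_\theta(H)]^{1/\alpha}$ (independent factors). The cdf of $M_{\alpha\theta}(\varrho_{\alpha,H})$ is, for all $\alpha\theta>0$, $$\int_0^x(x-t)^{\alpha\theta-1}\Delta_{\theta\alpha}(t|\varrho_{\alpha,H})\,dt,\qquad \Delta_{\theta\alpha}(x|\varrho_{\alpha,H})=\frac1\pi\sin\big(\pi\theta\alpha\Upsilon_\alpha(x)\big)e^{-\theta\alpha\mathscr{S}^H_\alpha(x)},\qquad x>0.$$ $\Delta_1(x|\varrho_{\alpha,H})$ (the case $\alpha\theta=1$) is the density of $M_1(\varrho_{\alpha,H})$. Furthermore, a general expression for the density of $M_{\alpha\theta}(\varrho_{\alpha,H})$ is $\int_0^x(x-t)^{\alpha\theta-1}d_{\alpha\theta}(t|\varrho_{\alpha,H})\,dt$, $x>0$, with $$d_{\alpha\theta}(x|\varrho_{\alpha,H})=\frac{\alpha\theta}{\pi}e^{-\theta\alpha\mathscr{S}^H_\alpha(x)}\Big[\sin\big(\pi\alpha[1-\theta\Upsilon_\alpha(x)]\big)B^H_{\alpha,1}(x)-\sin\big(\pi\theta\alpha\Upsilon_\alpha(x)\big)B^H_{\alpha,2}(x)\Big],$$ where $$B^H_{\alpha,1}(x)=\int_0^\infty\frac{x^{\alpha-1}r}{x^{2\alpha}+2x^\alpha r\cos(\alpha\pi)+r^2}H(dr),\qquad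 B^H_{\alpha,2}(x)=\int_0^\infty\frac{x^{2\alpha-1}}{x^{2\alpha}+2x^\alpha r\cos(\alpha\pi)+r^2}H(dr).$$
   Context: Standing assumption: $\int\log(1+x)H(dx)<\infty$. For a probability measure $K$ on $[0,\infty)$ with $\int\log(1+x)K(dx)<\infty$ and $\tau>0$, $M_\tau(K)$ is the mean of a Dirichlet process with shape $\tau K$, characterized by $\mathbb{E}[(1+\lambda M_\tau(K))^{-\tau}]=\exp(-\tau\int\log(1+\lambda x)K(dx))$, $\lambda>0$. $\varrho_\alpha(y)=\frac{\sin(\pi\alpha)}{\pi}\frac{y^{\alpha-1}}{y^{2\alpha}+2y^\alpha\cos(\pi\alpha)+1}$, $y>0$, is the density of $X_\alpha$, the ratio of two iid positive $\alpha$-stable variables. $\varrho_{\alpha,H}(x)=\frac{\sin(\pi\alpha)}{\pi}\int_0^\infty\frac{x^{\alpha-1}r}{x^{2\alpha}+2x^\alpha r\cos(\alpha\pi)+r^2}H(dr)$, $x>0$, is the density of $X_\alpha R^{1/\alpha}$ with $R\sim H$ independent of $X_\alpha$; its cdf is $\Upsilon_\alpha(x)=1-\frac{1}{\pi\alpha}\int_0^\infty\cot^{-1}\!\big(\cot(\pi\alpha)+\frac{x^\alpha/r}{\sin(\pi\alpha)}\big)H(dr)$, with $\cot^{-1}$ valued in $(0,\pi)$. $\mathscr{S}^H_\alpha(x)=\mathbb{E}[\log|x-X_\alpha R^{1/\alpha}|]=\frac{1}{2\alpha}\int_0^\infty\log(x^{2\alpha}+2x^\alpha r\cos(\alpha\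pi)+r^2)H(dr)$.
   Formalization: The general density formula is proved when d_{αθ} is integrable near 0 and Δ_{θα}(0+)=0, which holds if ∫|log r|H(dr)<∞; under ∫log(1+x)H(dx)<∞ alone it can fail, since Δ_{θα} may blow up at 0 and the integral then diverges. *)

(* Defs.v *)
From HB Require Import structures.
From mathcomp Require Import all_boot all_order all_algebra.
From mathcomp Require Import all_classical all_reals all_analysis.
Set Implicit Arguments.
Unset Strict Implicit.
Unset Printing Implicit Defensive.
Import Order.TTheory GRing.Theory Num.Theory.
Import numFieldNormedType.Exports.
Local Open Scope classical_set_scope.
Local Open Scope ring_scope.

Section dirichlet_means.
Context {R : realType}.
Notation lambda := (@lebesgue_measure R).
Notation RR := (measurableTypeR R).

Definition mutually_independent k d (T : measurableType d)
    (Q : probability T R) (G : 'I_k -> {RV Q >-> RR}) :=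
  forall B : 'I_k -> set RR, (forall i, measurable (B i)) ->
    Q (\bigcap_(i in [set: 'I_k]) (G i @^-1` B i)) =
    (\prod_(i < k) Q (G i @^-1` B i))%E.

Definition Gamma_fun (a : R) : R :=
  \int[lambda]_(x in `]0, +oo[) (x `^ (a - 1) * expR (- x)).

(* The law gamma(a, 1), with the usual convention that gamma(0, 1) is the point
   mass at 0, so that Dirichlet parameters may vanish. *)
Definition gamma_law (a : R) (A : set RR) : \bar R :=
  if a == 0 then \d_(0 : RR) A
  else (\int[lambda]_(x in A `&` `]0%R, +oo[)
          (x `^ (a - 1) * expR (- x) / Gamma_fun a)%:E)%E.

(* V has the k-variate Dirichlet law with parameters a_i: it is distributed as
   (G_i / (G_1 + ... + G_k))_i with the G_i independent gamma(a_i, 1). *)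
Definition has_dirichlet_law k (a : 'I_k -> R) d (Om : measurableType d)
    (Pr : probability Om R) (V : 'I_k -> Om -> R) :=
  exists d' (T : measurableType d') (Q : probability T R)
         (G : 'I_k -> {RV Q >-> RR}),
    [/\ mutually_independent G,
        forall i (A : set RR), measurable A ->
          distribution Q (G i) A = gamma_law (a i) A &
        forall B : set (k.-tuple RR), measurable B ->
          Pr [set w | B [tuple V i w | i < k]] =
          Q [set t | B [tuple (G i t / \sum_(j < k) G j t : RR) | i < k]]].

(* Ferguson's definition: a random probability measure P on the line whose
   finite-dimensional laws are Dirichlet with parameters tau * K(C_i).  When K
   is carried by [0, +oo[, so is P almost surely. *)
Definition is_dirichlet_process (tau : R) (K : set RR -> \bar R)
    d (Om : measurableType d) (Pr : probability Om R) (P : R.-pker Om ~> RR) :=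
  forall k (C : 'I_k -> set RR),
    (forall i, measurable (C i)) -> trivIset [set: 'I_k] C ->
    \bigcup_(i in [set: 'I_k]) C i = [set: RR] ->
    has_dirichlet_law (fun i => tau * fine (K (C i))) Pr
      (fun i w => fine (P w (C i))).

(* mu is the law of M_tau(K) = \int x P(dx), P a Dirichlet process with shape
   tau K.  If \int log(1 + x) K(dx) < +oo this mean is almost surely finite, so
   it can be taken to be a real random variable. *)
Definition dirichlet_mean_law (tau : R) (K : set RR -> \bar R)
    (mu : set RR -> \bar R) :=
  exists d (Om : measurableType d) (Pr : probability Om R)
         (P : R.-pker Om ~> RR) (M : {RV Pr >-> RR}),
    [/\ is_dirichlet_process tau K Pr P,
        {ae Pr, forall w, (\int[P w]_x (x : R)%:E = (M w : R)%:E)%E} &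
        forall A, measurable A -> mu A = distribution Pr M A].

Definition with_density (f : R -> \bar R) (A : set RR) : \bar R :=
  (\int[lambda]_(x in A `&` `]0%R, +oo[) f x)%E.

Definition cot (x : R) : R := cos x / sin x.
(* The branch of the inverse cotangent with values in ]0, pi[. *)
Definition acot (x : R) : R := pi / 2 - atan x.

Definition rho (alpha y : R) : R :=
  sin (pi * alpha) / pi *
  (y `^ (alpha - 1) /
   (y `^ (2 * alpha) + 2 * y `^ alpha * cos (pi * alpha) + 1)).

Context (H : probability RR R).

Definition rhoH (alpha x : R) : R :=
  sin (pi * alpha) / pi *
  \int[H]_(r in `]0, +oo[)
    (x `^ (alpha - 1) * r /
     (x `^ (2 * alpha) + 2 * x `^ alpha * r * cos (alpha * pi) + r ^+ 2)).

Definition Upsilon (alpha x : R) : R :=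
  1 - (pi * alpha)^-1 *
      \int[H]_(r in `]0, +oo[)
        acot (cot (pi * alpha) + x `^ alpha / r / sin (pi * alpha)).

Definition calS (alpha x : R) : R :=
  (2 * alpha)^-1 *
  \int[H]_(r in `]0, +oo[)
    ln (x `^ (2 * alpha) + 2 * x `^ alpha * r * cos (alpha * pi) + r ^+ 2).

Definition Delta (alpha theta x : R) : R :=
  pi^-1 * sin (pi * theta * alpha * Upsilon alpha x) *
  expR (- (theta * alpha * calS alpha x)).

Definition B1 (alpha x : R) : R :=
  \int[H]_(r in `]0, +oo[)
    (x `^ (alpha - 1) * r /
     (x `^ (2 * alpha) + 2 * x `^ alpha * r * cos (alpha * pi) + r ^+ 2)).

Definition B2 (alpha x : R) : R :=
  \int[H]_(r in `]0, +oo[)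
    (x `^ (2 * alpha - 1) /
     (x `^ (2 * alpha) + 2 * x `^ alpha * r * cos (alpha * pi) + r ^+ 2)).

Definition dd (alpha theta x : R) : R :=
  alpha * theta / pi * expR (- (theta * alpha * calS alpha x)) *
  (sin (pi * alpha * (1 - theta * Upsilon alpha x)) * B1 alpha x
   - sin (pi * theta * alpha * Upsilon alpha x) * B2 alpha x).

(* dd is the derivative of Delta on ]0, +oo[, and \int_0^x (x-t)^(b-1) dd(t) dt
   can be the derivative of \int_0^x (x-t)^(b-1) Delta(t) dt only if dd is
   integrable at 0 and Delta vanishes there.  This may fail when
   \int |log r| H(dr) diverges at 0: then Delta(t) can tend to +oo. *)
Definition regular_at_0 (alpha theta : R) : Prop :=
  lambda.-integrable `]0, 1[ (EFin \o dd alpha theta) /\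
  Delta alpha theta t @[t --> 0^'+] --> (0 : R).

End dirichlet_means.

(* Main.v *)
Require Import Defs.
From HB Require Import structures.
From mathcomp Require Import all_boot all_order all_algebra.
From mathcomp Require Import all_classical all_reals all_analysis.
From mathcomp Require Import measurable_realfun lebesgue_integral_under.
From mathcomp Require Import ring lra zify.
Import Order.TTheory GRing.Theory Num.Theory.
Import numFieldNormedType.Exports.
Local Open Scope classical_set_scope.
Local Open Scope ring_scope.
Set Implicit Arguments.
Unset Strict Implicit.
Unset Printing Implicit Defensive.

(* If T_i are independent gamma(a_i) variables with total shape tau, the ratios
   T_i / \sum T_j are independent of the sum, so that the mean of a simple
   function under a Dirichlet process satisfies the Markov-Krein identity
   E[(1 + l M)^(- tau)] = exp (- tau \int log (1 + l x) K(dx)); bounded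
   convergence gives it in general.  With K of density rhoH this reads
   E[(z + M)^(- alpha theta)] = g(z) := exp (- theta \int log (z^alpha + r) H(dr)).
   Now g extends analytically to the plane cut along the negative axis, and
   Cauchy's theorem, in polar coordinates, turns the jump of g across the cut
   into g(z) = \int Delta(t) / (z + t) dt.  Both the cdf of M and the function
   x |-> \int_0^x (x - t)^(alpha theta - 1) Delta(t) dt integrate
   (z + x)^(- alpha theta - 1) to g(z) / (alpha theta), and a generalized Stieltjes
   transform determines its function, whence the formula for the cdf.  The
   density follows because dd is the derivative of Delta, which vanishes at 0. *)

(** * Derivatives and integrals *)

(** Analytic functions appear as pairs of real functions of (t, phi), and the integral along a ray
    phi = constant varies with phi by a boundary term on two arcs. All functions involved are real
    on phi = 0, so the upper half-plane suffices. Two obstacles shape the argument. The kernel 1 /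
    (w - z) has its pole on the ray phi = 0; subtracting from g the multiple of w^(-1/2) that takes
    the same value at z removes it. And g may be unbounded at 0, as no moment of log r is assumed
    there; but H has no atom at 0, and making H(]0, d[) small gives g(w) = O(|w|^(-1/2)) near 0 for
    every theta. The exponent 1/2 reappears in the bound of Delta, where it makes the integrals over
    ]0, x[ converge, and it gives the subtracted term an arctangent as primitive. Finally Delta and
    dd may change sign, so uniqueness and Fubini are needed for signed functions, and the sign of
    the density is deduced only at the end. *)

Section derivatives.
Context {R : realType}.
Implicit Types (f g : R -> R) (x a b c : R).

Lemma der_eq f x a b : is_derive x 1 f a -> a = b -> is_derive x 1 f b.
Proof. by move=> ? <-. Qed.

Lemma der_shift x c : is_derive x 1 (fun t : R => t + c) 1.
Proof. by apply: is_derive_eq; rewrite addr0. Qed.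

Lemma der_id x : is_derive x 1 (fun t : R => t) 1.
Proof. exact: is_derive_id. Qed.

Lemma der_cst x c : is_derive x 1 (fun=> c : R) 0.
Proof. exact: is_derive_cst. Qed.

Lemma der_add f g x a b : is_derive x 1 f a -> is_derive x 1 g b ->
  is_derive x 1 (fun t => f t + g t) (a + b).
Proof. by move=> fa gb; apply: is_derive_eq. Qed.

Lemma der_opp f x a : is_derive x 1 f a -> is_derive x 1 (fun t => - f t) (- a).
Proof. by move=> fa; apply: is_derive_eq. Qed.

Lemma der_mul f g x a b : is_derive x 1 f a -> is_derive x 1 g b ->
  is_derive x 1 (fun t => f t * g t) (f x * b + g x * a).
Proof. by move=> fa gb; apply: is_derive_eq. Qed.

Lemma der_mulr f x a c : is_derive x 1 f a -> is_derive x 1 (fun t => f t * c) (a * c).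
Proof.
move=> fa; apply: der_eq (der_mul fa (is_derive_cst c x 1)) _.
by rewrite mulr0 add0r mulrC.
Qed.

Lemma der_mull f x a c : is_derive x 1 f a -> is_derive x 1 (fun t => c * f t) (c * a).
Proof.
move=> fa; apply: der_eq (der_mul (is_derive_cst c x 1) fa) _.
by rewrite mulr0 addr0.
Qed.

Lemma der_inv f x a : f x != 0 -> is_derive x 1 f a ->
  is_derive x 1 (fun t => (f t)^-1) (- a / f x ^+ 2).
Proof.
move=> f0 fa; apply: der_eq (is_deriveV f0 fa) _.
by rewrite /GRing.scale /=; ring.
Qed.

Lemma der_div f g x a b : g x != 0 -> is_derive x 1 f a -> is_derive x 1 g b ->
  is_derive x 1 (fun t => f t / g t) ((a * g x - f x * b) / g x ^+ 2).
Proof.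
move=> g0 fa gb; apply: der_eq (der_mul fa (der_inv g0 gb)) _.
by field.
Qed.

Lemma der_comp f g x a b : is_derive (g x) 1 f a -> is_derive x 1 g b ->
  is_derive x 1 (fun t => f (g t)) (a * b).
Proof. exact: is_derive1_comp. Qed.

Lemma der_powR f x a p : 0 < f x -> is_derive x 1 f a ->
  is_derive x 1 (fun t => f t `^ p) (p * f x `^ (p - 1) * a).
Proof. by move=> f0 fa; apply: (@der_comp (fun t => t `^ p)) => //; exact: is_derive1_powR. Qed.

Lemma der_ln f x a : 0 < f x -> is_derive x 1 f a ->
  is_derive x 1 (fun t => ln (f t)) (a / f x).
Proof.
move=> f0 fa; apply: der_eq (@der_comp (@ln R) f x _ _ (is_derive1_ln f0) fa) _.
by rewrite mulrC.
Qed.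

Lemma der_expR f x a : is_derive x 1 f a -> is_derive x 1 (fun t => expR (f t)) (expR (f x) * a).
Proof. by move=> fa; apply: (@der_comp expR). Qed.

Lemma der_cos f x a : is_derive x 1 f a -> is_derive x 1 (fun t => cos (f t)) (- sin (f x) * a).
Proof. by move=> fa; apply: (@der_comp (@cos R)). Qed.

Lemma der_sin f x a : is_derive x 1 f a -> is_derive x 1 (fun t => sin (f t)) (cos (f x) * a).
Proof. by move=> fa; apply: (@der_comp (@sin R)). Qed.

Lemma der_atan f x a : is_derive x 1 f a ->
  is_derive x 1 (fun t => atan (f t)) (a / (1 + f x ^+ 2)).
Proof.
move=> fa; apply: der_eq (@der_comp (@atan R) f x _ _ (is_derive1_atan (f x)) fa) _.
by rewrite mulrC.
Qed.

Lemma der_continuous f x a : is_derive x 1 f a -> {for x, continuous f}.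
Proof. by case=> + _; move/derivable1_diffP/differentiable_continuous. Qed.

Lemma ler_powR_base (p x y : R) : 0 <= p -> 0 <= x -> x <= y -> x `^ p <= y `^ p.
Proof. by move=> p0 x0 xy; apply: ge0_ler_powR; rewrite ?nnegrE// (le_trans x0). Qed.

Lemma ler_powRN_base (p x y : R) : 0 <= p -> 0 < x -> x <= y -> y `^ (- p) <= x `^ (- p).
Proof.
move=> p0 x0 xy; rewrite !powRN lef_pV2 ?posrE ?powR_gt0// ?(lt_le_trans x0)//.
by apply: ler_powR_base => //; exact: ltW.
Qed.

End derivatives.

(** * Improper integrals, scaling, densities and Fubini on subdomains *)

Section tools.
Context {R : realType}.
Notation lambda := (@lebesgue_measure R).
Notation RR := (measurableTypeR R).

(** Since f is nonnegative, its integrals over the growing segments increase to the integral over D.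
    So f may be unbounded at the ends of D, and its integrability is a conclusion. *)
Lemma ge0_FTC_exhaust (f F : R -> R) (D : set R) (a b : nat -> R) (l0 l1 : R) :
  (forall n, a n < b n) -> nonincreasing_seq a -> nondecreasing_seq b ->
  D = \bigcup_n `[a n, b n]%classic -> open D ->
  (forall x, D x -> 0 <= f x) -> (forall x, D x -> is_derive x 1 F (f x)) ->
  (forall x, D x -> {for x, continuous f}) ->
  F (a n) @[n --> \oo] --> l0 -> F (b n) @[n --> \oo] --> l1 ->
  (\int[lambda]_(x in D) (f x)%:E = (l1 - l0)%:E)%E.
Proof.
move=> ab da ib DE oD f0 dF cf Fa Fb.
have sub n x : x \in `[a n, b n] -> D x by move=> xn; rewrite DE; exists n.
have cF x : D x -> {for x, continuous F}.
  by move=> Dx; apply: differentiable_continuous; apply/derivable1_diffP; case: (dF _ Dx).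
have E n : (\int[lambda]_(x in `[a n, b n]) (f x)%:E = (F (b n))%:E - (F (a n))%:E)%E.
  apply: continuous_FTC2 => //.
  - apply: continuous_in_subspaceT => x /set_mem xn; exact/cf/(sub n).
  - split.
    + move=> x xn; have /dF[] // : D x.
      by apply: (sub n); apply: subset_itv_oo_cc xn.
    + by apply: cvg_at_right_filter; apply: cF; apply: (sub n); rewrite in_itv/= lexx ltW.
    + by apply: cvg_at_left_filter; apply: cF; apply: (sub n); rewrite in_itv/= lexx ltW.
  - move=> x xn; have Dx : D x by apply: (sub n); apply: subset_itv_oo_cc xn.
    by have := dF x Dx => ?; rewrite derive1E derive_val.
have mf : measurable_fun D f.
  by apply: open_continuous_measurable_fun => // x /set_mem; exact: cf.
have := @ge0_nondecreasing_set_cvg_integral _ RR R (fun n => `[a n, b n]%classic) (EFin \o f : RR -> \bar R) lambda.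
rewrite -DE => H.
have {H}H : (\int[lambda]_(x in `[a n, b n]) (f x)%:E)%E @[n --> \oo] --> (\int[lambda]_(x in D) (f x)%:E)%E.
  apply: H => //.
  - move=> n m nm; apply/subsetPset; apply: subset_itvScc; rewrite bnd_simp; [exact: da|exact: ib].
  - move=> n; apply/measurable_EFinP; apply: measurable_funS mf => //; [exact: open_measurable|exact: sub].
  - by move=> n x xn; rewrite lee_fin f0//; exact: (sub n).
have H2 : (\int[lambda]_(x in `[a n, b n]) (f x)%:E)%E @[n --> \oo] --> (l1 - l0)%:E.
  under eq_fun do rewrite E -EFinB.
  apply: cvg_EFin; first exact: nearW.
  exact: cvgB.
exact: cvg_unique H H2.
Qed.

Lemma ge0_FTC_oy (f F : R -> R) (a l0 l1 : R) :
  (forall x, a < x -> 0 <= f x) -> (forall x, a < x -> is_derive x 1 F (f x)) ->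
  (forall x, a < x -> {for x, continuous f}) ->
  F x @[x --> a^'+] --> l0 -> F x @[x --> +oo] --> l1 ->
  (\int[lambda]_(x in `]a, +oo[) (f x)%:E = (l1 - l0)%:E)%E.
Proof.
move=> f0 dF cf Fa Fb.
have N1 n : 0 < (n.+1%:R^-1 : R) <= 1 by apply/andP; split; [rewrite invr_gt0 ltr0Sn|rewrite invf_le1 ?ler1n// ltr0Sn].
apply: (@ge0_FTC_exhaust f F _ (fun n => a + n.+1%:R^-1) (fun n => a + n.+2%:R)).
- by move=> n; rewrite ltrD2l (@le_lt_trans _ _ 1)// ?ltr1n//; case/andP: (N1 n).
- by move=> n m nm; rewrite lerD2l lef_pV2 ?posrE// ler_nat.
- by move=> n m nm; rewrite lerD2l ler_nat.
- apply/seteqP; split => x /=.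
  + rewrite in_itv/= andbT => ax.
    exists (maxn (Num.truncn (x - a)^-1) (Num.truncn (x - a))) => //=.
    have xa0 : 0 < x - a by rewrite subr_gt0.
    rewrite in_itv/=; apply/andP; split.
    * rewrite -lerBrDl invf_ple ?posrE// ltW//.
      apply: (lt_le_trans (truncnS_gt _)); rewrite ler_nat ltnS; exact: leq_maxl.
    * rewrite -lerBlDl ltW//; apply: (lt_le_trans (truncnS_gt _)); rewrite ler_nat ltnS.
      by apply: leqW; exact: leq_maxr.
  + move=> [n _] /=; rewrite !in_itv/= andbT => /andP[+ _]; apply: lt_le_trans.
    by rewrite ltrDl; case/andP: (N1 n).
- exact: interval_open.
- by move=> x /=; rewrite in_itv/= andbT; exact: f0.
- by move=> x /=; rewrite in_itv/= andbT; exact: dF.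
- by move=> x /=; rewrite in_itv/= andbT; exact: cf.
- apply: (cvg_at_rightP F a l0).1 => //; split; first by move=> n; rewrite ltrDl; case/andP: (N1 n).
  rewrite -[X in _ --> X]addr0; apply: cvgD; first exact: cvg_cst.
  exact: cvg_harmonic.
- move/cvg_pinftyP : Fb; apply; apply/cvgryPge => r.
  near=> n; rewrite -lerBlDl; apply: (@le_trans _ _ n%:R); last by rewrite ler_nat ltnW.
  by near: n; exact: nbhs_infty_ger.
Unshelve. all: end_near. Qed.

Lemma ge0_FTC_oo (f F : R -> R) (a b l0 l1 : R) : a < b ->
  (forall x, a < x < b -> 0 <= f x) -> (forall x, a < x < b -> is_derive x 1 F (f x)) ->
  (forall x, a < x < b -> {for x, continuous f}) ->
  F x @[x --> a^'+] --> l0 -> F x @[x --> b^'-] --> l1 ->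
  (\int[lambda]_(x in `]a, b[) (f x)%:E = (l1 - l0)%:E)%E.
Proof.
move=> ab f0 dF cf Fa Fb.
(* The shift by 3 keeps the trimmed ends in order: each moves by at most a third of b - a. *)
have N1 n : 0 < (n.+3%:R^-1 : R) <= 3^-1 by apply/andP; split; [rewrite invr_gt0 ltr0Sn|rewrite lef_pV2 ?posrE// ler_nat].
have ba0 : 0 < b - a by rewrite subr_gt0.
have cv : (b - a) * n.+3%:R^-1 @[n --> \oo] --> 0.
  rewrite -[X in _ --> X](mulr0 (b - a)); apply: cvgM; first exact: cvg_cst.
  apply: (@cvg_comp _ _ _ (fun n => n.+2) (@harmonic R)); last exact: cvg_harmonic.
  move=> A [n _ An]; exists n => // m nm; apply: An => /=; rewrite (leq_trans nm)//; lia.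
apply: (@ge0_FTC_exhaust f F _ (fun n => a + (b - a) * n.+3%:R^-1) (fun n => b - (b - a) * n.+3%:R^-1)).
- by move=> n; have /andP[n1 n2] := N1 n; set u := _^-1 in n1 n2 *; nra.
- by move=> n m nm; rewrite lerD2l ler_pM2l// lef_pV2 ?posrE// ler_nat.
- by move=> n m nm; rewrite lerD2l lerN2 ler_pM2l// lef_pV2 ?posrE// ler_nat.
- apply/seteqP; split => x /=.
  + rewrite in_itv/= => /andP[ax xb].
    exists (maxn (Num.truncn ((b - a) / (x - a))) (Num.truncn ((b - a) / (b - x)))) => //=.
    have xa0 : 0 < x - a by rewrite subr_gt0.
    have xb0 : 0 < b - x by rewrite subr_gt0.
    rewrite in_itv/=; apply/andP; split.
    * rewrite -lerBrDl ler_pdivrMr// mulrC -ler_pdivrMr// ltW//.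
      apply: (lt_le_trans (truncnS_gt _)); rewrite ler_nat ltnS.
      by do 2 apply: leqW; exact: leq_maxl.
    * rewrite lerBrDl -lerBrDr ler_pdivrMr// mulrC -ler_pdivrMr// ltW//.
      apply: (lt_le_trans (truncnS_gt _)); rewrite ler_nat ltnS.
      by do 2 apply: leqW; exact: leq_maxr.
  + move=> [n _] /=; rewrite !in_itv/= => /andP[h1 h2]; have /andP[n1 n2] := N1 n.
    by set u := _^-1 in n1 n2 h1 h2 *; apply/andP; split; nra.
- exact: interval_open.
- by move=> x /=; rewrite in_itv/=; exact: f0.
- by move=> x /=; rewrite in_itv/=; exact: cf.
- apply: (cvg_at_rightP F a l0).1 => //; split.
    by move=> n; rewrite ltrDl mulr_gt0//; case/andP: (N1 n).
  by rewrite -[X in _ --> X]addr0; apply: cvgD; first exact: cvg_cst.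
- apply: (cvg_at_leftP F b l1).1 => //; split.
    by move=> n; rewrite ltrBlDr ltrDl mulr_gt0//; case/andP: (N1 n).
  by rewrite -[X in _ --> X]subr0; apply: cvgB; first exact: cvg_cst.
Qed.

(** The image of lambda under x -> c x, multiplied by c, agrees with lambda on half-open intervals,
    hence is lambda. *)
Lemma ge0_integral_scale (c : R) (f : R -> \bar R) : 0 < c ->
  measurable_fun [set: R] f -> (forall x, (0 <= f x)%E) ->
  (\int[lambda]_(x in `]0%R, +oo[) f (c * x)%R = c^-1%:E * \int[lambda]_(x in `]0%R, +oo[) f x)%E.
Proof.
move=> c0 mf f0.
have mphi : measurable_fun [set: RR] (fun x : RR => c * x : RR) by exact: measurable_funM.
have c0' : 0 <= c by exact: ltW.
pose m' := mscale (NngNum c0') (pushforward lambda (fun x : RR => c * x : RR)).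
pose m : {measure set RR -> \bar R} := m' mphi.
have E A : measurable A -> lambda A = m A.
  apply: lebesgue_measure_unique => _ [[a b]] _ <-.
  rewrite /m /m' /= /mscale /= /pushforward.
  have -> : (fun x => c * x) @^-1` `]a, b] = `]a / c, b / c]%classic.
    by apply/seteqP; split => x /=; rewrite !in_itv/= ltr_pdivrMr// ler_pdivlMr// mulrC.
  rewrite !lebesgue_measure_itv/= !lte_fin ltr_pM2r ?invr_gt0//.
  case: ifPn => ab; last by rewrite mule0.
  by rewrite -!EFinB -EFinM -mulrBl mulrCA divff ?mulr1// gt_eqF.
have -> : (\int[lambda]_(x in `]0%R, +oo[) f x = \int[m]_(x in `]0%R, +oo[) f x)%E.
  by apply: eq_measure_integral => A mA _; exact: E.
rewrite ge0_integral_mscale//; last exact: measurable_funTS.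
rewrite muleA /= -EFinM mulVf ?gt_eqF// mul1e ge0_integral_pushforward//; last exact: measurable_funTS.
congr integral; apply/seteqP; split => x /=; rewrite !in_itv/= !andbT pmulr_rgt0//.
Qed.

Import HBNNSimple.

Lemma EFin_Rintegral d (X : measurableType d) (mu : {measure set X -> \bar R})
    (D : set X) (f : X -> R) : measurable D -> mu.-integrable D (EFin \o f) ->
  (\int[mu]_(x in D) (f x)%:E = (\int[mu]_(x in D) f x)%R%:E)%E.
Proof. by move=> mD If; rewrite /Rintegral fineK//; exact: integrable_fin_num. Qed.

(** [nu] is the image under [phi] of the measure of density [w]: the hypothesis is the claim for
    indicators, and increasing simple functions carry it to g. It is applied with [phi] a random
    variable and [w] a product of other factors, and with [phi] the identity for densities. *)
Lemma ge0_integral_comp_density d d' (X : measurableType d) (Y : measurableType d')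
    (mu : {measure set X -> \bar R}) (nu : {measure set Y -> \bar R})
    (phi : X -> Y) (w : X -> R) (g : Y -> \bar R) :
  measurable_fun [set: X] phi -> measurable_fun [set: X] w -> (forall x, 0 <= w x) ->
  (forall A, measurable A -> nu A = \int[mu]_(x in phi @^-1` A) (w x)%:E)%E ->
  measurable_fun [set: Y] g -> (forall y, 0 <= g y)%E ->
  (\int[nu]_y g y = \int[mu]_x (g (phi x) * (w x)%:E))%E.
Proof.
move=> mphi mw w0 E mg g0.
have mphiA (A : set Y) : measurable A -> measurable (phi @^-1` A).
  by move=> mA; rewrite -[_ @^-1` _]setTI; exact: mphi.
pose f_ := nnsfun_approx measurableT mg.
have cvf y : (f_ n y)%:E @[n --> \oo] --> g y by exact: cvg_nnsfun_approx.
have ndf n m y : (n <= m)%N -> (f_ n y <= f_ m y) by move=> nm; exact/lefP/nd_nnsfun_approx.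
transitivity (limn (fun n => \int[nu]_y (f_ n y)%:E)%E).
  rewrite -monotone_convergence//.
  - by apply: eq_integral => y _; apply/esym/cvg_lim => //; exact: cvf.
  - by move=> n; exact/measurable_EFinP/measurable_funP.
  - by move=> n y _; rewrite lee_fin.
  - by move=> y _ m n mn; rewrite lee_fin ndf.
rewrite [X in limn X](_ : _ = (fun n => \int[mu]_x ((f_ n (phi x))%:E * (w x)%:E))%E); last first.
  apply/funext => n; rewrite integralT_nnsfun sintegralE.
  transitivity (\sum_(r \in range (f_ n)) \int[mu]_x ((r * \1_(f_ n @^-1` [set r]) (phi x))%:E * (w x)%:E))%E.
    apply: eq_fsbigr => r _; rewrite E//.
    have [r0|r0] := leP 0 r; last first.
      rewrite (_ : f_ n @^-1` [set r] = set0) ?preimage_set0 ?integral_set0 ?mule0; last first.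
        exact: preimage_nnfun0.
      by rewrite integral0_eq// => x _; rewrite indic0 /= mulr0 mul0e.
    rewrite [X in (_ * X)%E]integral_mkcond -ge0_integralZl_EFin//.
    + apply: eq_integral => x _; rewrite EFinM -muleA; congr (_ * _)%E.
      rewrite patchE indicE; case: ifPn => [|/negP] h.
        by rewrite (_ : _ \in _ = true) ?mul1e//; move: h; rewrite !inE.
      by rewrite (_ : _ \in _ = false) ?mul0e//; apply/negP; rewrite inE => h'; apply: h; rewrite inE.
    + by move=> x _; rewrite patchE; case: ifP => _; rewrite lee_fin.
    + apply/(measurable_restrictT _ _).1 => //; first exact: mphiA.
      by apply: measurable_funTS; exact/measurable_EFinP.
  rewrite -ge0_integral_fsum//.
  - apply: eq_integral => x _; rewrite (fimfunE (f_ n)) -fsumEFin// ge0_mule_fsuml//.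
    by move=> r; rewrite lee_fin -/(_ <= _); case: (leP 0 r) => r0; [rewrite mulr_ge0|rewrite preimage_nnfun0// indic0 mulr0].
  - move=> r; apply: emeasurable_funM; apply/measurable_EFinP => //.
    by apply: measurable_funM => //; apply: measurableT_comp.
  - move=> r x _; apply: mule_ge0; rewrite lee_fin//.
    by case: (leP 0 r) => r0; [rewrite mulr_ge0|rewrite preimage_nnfun0// indic0 mulr0].
rewrite -monotone_convergence//.
- apply: eq_integral => x _; apply/cvg_lim => //.
  exact: cvgeZr.
- by move=> n; apply: emeasurable_funM; apply/measurable_EFinP => //; exact: measurableT_comp.
- by move=> n x _; rewrite mule_ge0// lee_fin.
- by move=> x _ m n mn; apply: lee_wpmul2r; rewrite lee_fin ?ndf.
Qed.

Lemma ge0_integral_density d (X : measurableType d) (mu nu : {measure set X -> \bar R})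
    (D : set X) (w : X -> R) (g : X -> \bar R) : measurable D ->
  measurable_fun D w -> (forall x, D x -> 0 <= w x) ->
  (forall A, measurable A -> nu A = \int[mu]_(x in A `&` D) (w x)%:E)%E ->
  measurable_fun [set: X] g -> (forall y, 0 <= g y)%E ->
  (\int[nu]_y g y = \int[mu]_(x in D) (g x * (w x)%:E))%E.
Proof.
move=> mD mw w0 E mg g0.
rewrite (@ge0_integral_comp_density _ _ X X mu nu idfun (w \_ D))//.
- rewrite [RHS]integral_mkcond; apply: eq_integral => x _; rewrite !patchE.
  by case: ifP => //; rewrite mule0.
- exact: measurable_id.
- by apply/(measurable_restrictT _ _).1.
- by move=> x; rewrite patchE; case: ifPn => // /set_mem; exact: w0.
- by move=> A mA; rewrite E// integral_mkcondr; apply: eq_integral => x _; rewrite restrict_EFin.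
Qed.

Lemma measure_eq_rays (m1 m2 : {measure set RR -> \bar R}) :
  (forall x, m1 `]-oo, x]%classic = m2 `]-oo, x]%classic) ->
  (forall x, m1 `]-oo, x]%classic < +oo)%E ->
  forall A, measurable A -> m1 A = m2 A.
Proof.
move=> m12 m1fin.
apply: (@measure_unique _ _ RR [set B | exists x : R, B = `]-oo, x]%classic] (fun n => `]-oo, n%:R]%classic)).
- rewrite eqEsubset; split => A.
    rewrite [X in X A -> _](RGenOInfty.measurableE R).
    apply: smallest_sub; first exact: smallest_sigma_algebra.
    move=> B [x ->]; rewrite -setCitvl; apply: sigma_algebraC; apply: sub_sigma_algebra.
    by exists x.
  apply: smallest_sub; first exact: sigma_algebra_measurable.
  by move=> B [x ->]; exact: measurable_itv.
- move=> _ _ [x ->] [y ->]; exists (Num.min x y).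
  by apply/seteqP; split => z /=; rewrite !in_itv/= le_min; [case=> -> ->|case/andP].
- by move=> n; exists n%:R.
- apply/seteqP; split => // x _; exists (Num.truncn x).+1 => //=.
  by rewrite in_itv/= ltW// truncnS_gt.
- by move=> _ [x ->].
- by move=> n; exact: m1fin.
Qed.

Lemma fubini_tonelli_in d d' (X : measurableType d) (Y : measurableType d')
    (m1 : {sigma_finite_measure set X -> \bar R}) (m2 : {sigma_finite_measure set Y -> \bar R})
    (D1 : set X) (D2 : set Y) (f : X * Y -> \bar R) :
  measurable D1 -> measurable D2 -> measurable_fun [set: X * Y] f ->
  (forall x y, D1 x -> D2 y -> 0 <= f (x, y))%E ->
  (\int[m1]_(x in D1) \int[m2]_(y in D2) f (x, y) = \int[m2]_(y in D2) \int[m1]_(x in D1) f (x, y))%E.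
Proof.
move=> mD1 mD2 mf f0.
pose g := f \_ (D1 `*` D2).
have mg : measurable_fun [set: X * Y] g.
  by apply/(measurable_restrictT _ _).1; [exact: measurableX|exact: measurable_funTS].
have g0 z : (0 <= g z)%E.
  by rewrite /g patchE; case: ifPn => // /set_mem; case: z => x y [/= *]; exact: f0.
have := @fubini_tonelli _ _ X Y R m1 m2 g mg g0.
have gE x y : g (x, y) = if (x \in D1) && (y \in D2) then f (x, y) else 0%E.
  by rewrite /g patchE in_setX.
have -> : (\int[m1]_x \int[m2]_y g (x, y) = \int[m1]_(x in D1) \int[m2]_(y in D2) f (x, y))%E.
  rewrite [RHS]integral_mkcond; apply: eq_integral => x _; rewrite patchE.
  case: ifPn => xD; last by rewrite integral0_eq// => y _; rewrite gE (negbTE xD).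
  by rewrite [RHS]integral_mkcond; apply: eq_integral => y _; rewrite gE xD patchE.
have -> // : (\int[m2]_y \int[m1]_x g (x, y) = \int[m2]_(y in D2) \int[m1]_(x in D1) f (x, y))%E.
rewrite [RHS]integral_mkcond; apply: eq_integral => y _; rewrite patchE.
case: ifPn => yD; last by rewrite integral0_eq// => x _; rewrite gE (negbTE yD) andbF.
by rewrite [RHS]integral_mkcond; apply: eq_integral => x _; rewrite gE yD andbT patchE.
Qed.

Lemma fubini_in d d' (X : measurableType d) (Y : measurableType d')
    (m1 : {sigma_finite_measure set X -> \bar R}) (m2 : {sigma_finite_measure set Y -> \bar R})
    (D1 : set X) (D2 : set Y) (f : X * Y -> \bar R) :
  measurable D1 -> measurable D2 -> measurable_fun [set: X * Y] f ->
  (\int[m1]_(x in D1) \int[m2]_(y in D2) `|f (x, y)| < +oo)%E ->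
  [/\ {ae m1, forall x, D1 x -> m2.-integrable D2 (fun y => f (x, y))},
    m1.-integrable D1 (fun x => \int[m2]_(y in D2) f (x, y))%E &
  (\int[m1]_(x in D1) \int[m2]_(y in D2) f (x, y) = \int[m2]_(y in D2) \int[m1]_(x in D1) f (x, y))%E].
Proof.
move=> mD1 mD2 mf fy.
pose g := f \_ (D1 `*` D2).
have mg : measurable_fun [set: X * Y] g.
  by apply/(measurable_restrictT _ _).1; [exact: measurableX|exact: measurable_funTS].
have gE x y : g (x, y) = if (x \in D1) && (y \in D2) then f (x, y) else 0%E.
  by rewrite /g patchE in_setX.
have ig : (m1 \x m2)%E.-integrable setT g.
  apply/(@integrable12ltyP _ _ X Y R m1 m2 g mg).
  apply: le_lt_trans fy; rewrite le_eqVlt; apply/orP; left; apply/eqP.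
  rewrite [RHS]integral_mkcond; apply: eq_integral => x _; rewrite patchE.
  case: ifPn => xD; last by rewrite integral0_eq// => y _; rewrite gE (negbTE xD) abse0.
  by rewrite [RHS]integral_mkcond; apply: eq_integral => y _; rewrite gE xD /= [RHS]patchE; case: ifP => _ //; rewrite abse0.
have E1 x : (\int[m2]_y g (x, y))%E = ((fun x => \int[m2]_(y in D2) f (x, y)) \_ D1)%E x.
  rewrite patchE; case: ifPn => xD; last by rewrite integral0_eq// => y _; rewrite gE (negbTE xD).
  by rewrite [RHS]integral_mkcond; apply: eq_integral => y _; rewrite gE xD patchE.
split.
- have := @ae_integrable1 _ _ X Y R m1 m2 g ig.
  apply: filterS => x h D1x.
  apply/(integrable_mkcond _ mD2).2; move: h; apply: eq_integrable => // y _.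
  by rewrite gE patchE mem_set.
- apply/(integrable_mkcond _ mD1).2.
  have := @integrable_fubini_F _ _ X Y R m1 m2 g ig.
  by apply: eq_integrable => // x _; rewrite /fubini_F E1.
have := @Fubini _ _ X Y R m1 m2 g ig.
have -> : (\int[m1]_x \int[m2]_y g (x, y) = \int[m1]_(x in D1) \int[m2]_(y in D2) f (x, y))%E.
  by rewrite [RHS]integral_mkcond; apply: eq_integral => x _; rewrite E1.
have -> // : (\int[m2]_y \int[m1]_x g (x, y) = \int[m2]_(y in D2) \int[m1]_(x in D1) f (x, y))%E.
rewrite [RHS]integral_mkcond; apply: eq_integral => y _; rewrite patchE.
case: ifPn => yD; last by rewrite integral0_eq// => x _; rewrite gE (negbTE yD) andbF.
by rewrite [RHS]integral_mkcond; apply: eq_integral => x _; rewrite gE yD andbT patchE.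
Qed.
End tools.
(** * Uniqueness of the generalized Stieltjes transform *)

Section uniqueness.
Context {R : realType}.
Notation lambda := (@lebesgue_measure R).
Notation RR := (measurableTypeR R).

Lemma measurable_fun_powR d (X : measurableType d) (D : set X) (f : X -> R) p :
  measurable_fun D f -> measurable_fun D (fun x => f x `^ p).
Proof. by move=> mf; exact: (measurableT_comp (measurable_powR p) mf). Qed.

Lemma measurable_fun_inv : measurable_fun [set: R] (fun x : R => x^-1).
Proof.
(* [powR] with exponent -1 is the inverse on nonnegative arguments only, whence the square; at 0
   both sides vanish. *)
rewrite (_ : (fun _ => _) = (fun x : R => x * (x ^+ 2) `^ (-1))); last first.
  apply/funext => x; rewrite powR_inv1 ?sqr_ge0//.
  have [->|x0] := eqVneq x 0; first by rewrite invr0 mul0r.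
  by field.
by apply: measurable_funM => //; apply: measurable_fun_powR; exact: measurable_funX.
Qed.

Lemma density_measure d (X : measurableType d) (mu : {measure set X -> \bar R})
    (D : set X) (w : X -> \bar R) : measurable D ->
  measurable_fun D w -> (forall x, D x -> 0 <= w x)%E ->
  exists nu : {measure set X -> \bar R}, forall A, measurable A -> nu A = (\int[mu]_(x in A `&` D) w x)%E.
Proof.
move=> mD mw w0.
pose m A := (\int[mu]_(x in A `&` D) w x)%E.
have m0 : m set0 = 0%E by rewrite /m set0I integral_set0.
have m_ge0 A : (0 <= m A)%E by apply: integral_ge0 => x [_]; exact: w0.
have mE A : m A = (\int[mu]_(x in A) (w \_ D) x)%E by rewrite /m integral_mkcondr.
have mwD : measurable_fun [set: X] (w \_ D) by apply/(measurable_restrictT _ _).1.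
have madd : semi_sigma_additive m.
  move=> F mF tF mUF; rewrite [in X in _ --> X]mE ge0_integral_bigcup//; first last.
  - by move=> x _; rewrite patchE; case: ifPn => // /set_mem; exact: w0.
  - exact: measurable_funTS.
  under eq_fun do under eq_bigr do rewrite mE.
  apply: is_cvg_nneseries => n _ _; rewrite -mE; exact: m_ge0.
pose mixin := isMeasure.Build d X R m m0 m_ge0 madd.
pose nu : {measure set X -> \bar R} := HB.pack m mixin.
by exists nu.
Qed.

(* [bern n g] is the Bernstein polynomial \sum_k 'C(n, k) g(k) X^k (1 - X)^(n - k),
   given by the recursion in [n] of the binomial law. *)
Fixpoint bern (n : nat) (g : nat -> R) : {poly R} :=
  if n is m.+1 then 'X * bern m (g \o S) + (1 - 'X) * bern m g else (g 0%N)%:P.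

Lemma bern_le n (g h : nat -> R) y : 0 <= y <= 1 ->
  (forall k, g k <= h k) -> (bern n g).[y] <= (bern n h).[y].
Proof.
move=> /andP[y0 y1]; elim: n g h => [|n IH] g h gh; first by rewrite !hornerC.
rewrite /= !hornerE; apply: lerD; apply: ler_wpM2l; rewrite ?subr_ge0//; apply: IH => // k.
exact: gh.
Qed.

Lemma bern_affine n (g : nat -> R) a b y :
  (bern n (fun k => a * g k + b)).[y] = a * (bern n g).[y] + b.
Proof.
elim: n g => [|n IH] g; first by rewrite !hornerC.
by rewrite /= !hornerE (IH (g \o S)) IH; ring.
Qed.

(** The offset a makes the induction close: conditioning on the first trial replaces it by a - 1 + y
    or a + y. With a = 0 this is the variance of the binomial law. *)
Lemma bern_variance n (a y : R) :
  (bern n (fun k => (k%:R - n%:R * y - a) ^+ 2)).[y] = n%:R * (y * (1 - y)) + a ^+ 2.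
Proof.
elim: n a => [|n IH] a; first by rewrite hornerC; ring.
rewrite /= !hornerE.
have -> : (fun k : nat => (k%:R - n.+1%:R * y - a) ^+ 2) \o succn = fun k : nat => (k%:R - n%:R * y - (a - 1 + y)) ^+ 2.
  by apply/funext => k /=; rewrite -!natr1; ring.
have -> : (fun k : nat => (k%:R - n.+1%:R * y - a) ^+ 2) = fun k : nat => (k%:R - n%:R * y - (a + y)) ^+ 2.
  by apply/funext => k /=; rewrite -!natr1; ring.
by rewrite !IH -natr1 /=; ring.
Qed.

(** Chebyshev's inequality. As phi is constant within distance e of y, the difference phi(k / n) -
    phi(y) vanishes there and is at most 2 elsewhere, hence is at most a multiple of (k - n y)^2 /
    n^2, whose binomial mean is O(1 / n). A jump of phi away from y does no harm, which lets
    indicators through. *)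
Lemma bern_cvg (phi : R -> R) (y e : R) : 0 <= y <= 1 -> 0 < e ->
  (forall s, `|phi s| <= 1) -> (forall s, `|s - y| < e -> phi s = phi y) ->
  (bern n.+1 (fun k => phi (k%:R / n.+1%:R))).[y] @[n --> \oo] --> phi y.
Proof.
move=> y01 e0 phi1 phie; have /andP[y0 y1] := y01.
have B n : `|(bern n.+1 (fun k => phi (k%:R / n.+1%:R))).[y] - phi y| <= 2 / e ^+ 2 * n.+1%:R^-1.
  pose c := 2 / (n.+1%:R * e) ^+ 2.
  have n0 : 0 < n.+1%:R :> R by rewrite ltr0Sn.
  have c0 : 0 < c by rewrite divr_gt0// exprn_gt0// mulr_gt0.
  have key k : `|phi (k%:R / n.+1%:R) - phi y| <= c * (k%:R - n.+1%:R * y - 0) ^+ 2.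
    have [h|h] := ltP `|k%:R / n.+1%:R - y| e.
      by rewrite phie// subrr normr0 mulr_ge0 ?sqr_ge0// ltW.
    apply: (@le_trans _ _ 2); first by rewrite (le_trans (ler_normB _ _))// (_ : 2 = 1 + 1)// lerD.
    rewrite /c -mulrA ler_peMr// mulrC ler_pdivlMr ?exprn_gt0 ?mulr_gt0// mul1r subr0.
    rewrite -[X in _ <= X]real_normK ?num_real// ler_sqr ?nnegrE ?mulr_ge0 ?(ltW e0) ?(ltW n0)//.
    rewrite (_ : k%:R - _ = n.+1%:R * (k%:R / n.+1%:R - y)); last by rewrite mulrBr mulrCA divff ?mulr1// gt_eqF.
    by rewrite normrM (gtr0_norm n0) ler_pM2l.
  have V := bern_variance n.+1 0 y; rewrite expr0n addr0 in V.
  have Vc : c * (n.+1%:R * (y * (1 - y))) <= 2 / e ^+ 2 * n.+1%:R^-1.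
    rewrite (_ : c * _ = 2 / e ^+ 2 * n.+1%:R^-1 * (y * (1 - y))); last first.
      by rewrite /c; move: n0 e0; set N := n.+1%:R => n0 e0; field; rewrite ?gt_eqF.
    rewrite ler_piMr ?mulr_ge0 ?invr_ge0 ?sqr_ge0// ?ltW//; nra.
  rewrite ler_norml; apply/andP; split.
  - rewrite lerBrDr addrC.
    apply: (@le_trans _ _ (bern n.+1 (fun k => (- c) * (k%:R - n.+1%:R * y - 0) ^+ 2 + phi y)).[y]).
      by rewrite bern_affine V mulNr [X in _ <= X]addrC lerD2l lerN2.
    by apply: bern_le => // k; have := key k; rewrite ler_norml => /andP[+ _]; lra.
  - rewrite lerBlDr.
    apply: (@le_trans _ _ (bern n.+1 (fun k => c * (k%:R - n.+1%:R * y - 0) ^+ 2 + phi y)).[y]).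
      by apply: bern_le => // k; have := key k; rewrite ler_norml => /andP[_]; lra.
    by rewrite bern_affine V lerD2r.
apply/cvgrPdist_le => d d0; near=> n.
rewrite distrC (le_trans (B n))//.
rewrite ler_pdivrMr// [X in _ <= X]mulrC -ler_pdivrMr//.
apply: (@le_trans _ _ n%:R); last by rewrite ler_nat.
by near: n; exact: nbhs_infty_ger.
Unshelve. all: end_near. Qed.

Lemma powR_shift_integrable (p q z : R) (f : R -> R) : 0 < p -> p <= q -> 0 < z ->
  lambda.-integrable `]0, +oo[ (fun x : R => ((1 + x) `^ (- p) * f x)%:E) ->
  measurable_fun [set: R] f ->
  lambda.-integrable `]0, +oo[ (fun x : R => ((z + x) `^ (- q) * f x)%:E).
Proof.
move=> p0 pq z0 If mf.
(* From z + x >= min(1, z) (1 + x) for the exponent p, and from z + x >= z for the excess q - p. *)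
pose K := z `^ (- (q - p)) * (Num.min 1 z) `^ (- p).
have m0 : 0 < Num.min 1 z by rewrite lt_min ltr01.
apply: (@le_integrable _ _ _ lambda _ _ _ (fun x : R => (K%:E * ((1 + x) `^ (- p) * f x)%:E)%E)) => //; last exact: integrableZl.
  apply/measurable_EFinP; apply: measurable_funM; last exact: measurable_funTS.
  by apply: measurable_fun_powR; exact: measurable_funD.
move=> x /=; rewrite in_itv/= andbT => x0.
rewrite lee_fin !normrM mulrA; apply: ler_wpM2r => //.
rewrite !ger0_norm ?powR_ge0// ?mulr_ge0 ?powR_ge0// /K.
have zx : 0 < z + x by rewrite addr_gt0.
rewrite (_ : - q = - (q - p) + - p); last by ring.
rewrite powRD; last by rewrite (gt_eqF zx) implybT.
  rewrite -mulrA; apply: ler_pM; rewrite ?powR_ge0//.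
    by apply: ler_powRN_base; rewrite ?subr_ge0// lerDl ltW.
  have x1 : 0 < 1 + x by rewrite addr_gt0.
  rewrite -powRM ?(ltW m0) ?(ltW x1)//.
  apply: ler_powRN_base; rewrite ?mulr_gt0 ?(ltW p0)//.
  have h1 : Num.min 1 z <= 1 by rewrite ge_min lexx.
  have h2 : Num.min 1 z <= z by rewrite ge_min lexx orbT.
  by rewrite mulrDr mulr1 lerD// ler_piMl// ltW.
Qed.

(** Differentiation under the integral sign multiplies by - q and raises the exponent by one; for
    arguments above a / 2 the derivative is dominated by its value at a / 2. *)
Lemma stieltjes_step (p q : R) (f : R -> R) : 0 < p -> p <= q ->
  lambda.-integrable `]0, +oo[ (fun x : R => ((1 + x) `^ (- p) * f x)%:E) ->
  measurable_fun [set: R] f ->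
  (forall z, 0 < z -> \int[lambda]_(x in `]0, +oo[) ((z + x) `^ (- q) * f x) = 0) ->
  forall z, 0 < z -> \int[lambda]_(x in `]0, +oo[) ((z + x) `^ (- (q + 1)) * f x) = 0.
Proof.
move=> p0 pq If mf Z a a0.
have q0 : 0 < q by exact: lt_le_trans pq.
pose F (z x : R) : R := (z + x) `^ (- q) * f x.
have dF (x z : R) : 0 < z -> 0 < x -> is_derive z 1 (F ^~ x) (- q * (z + x) `^ (- q - 1) * f x).
  move=> z0 x0; rewrite /F.
  have zx : 0 < z + x by rewrite addr_gt0.
  have h := @der_powR _ (fun t => t + x) z 1 (- q) zx (der_shift z x).
  by apply: der_eq (der_mulr (f x) h) _; rewrite mulr1.
have int (q' z : R) : 0 < z -> p <= q' -> lambda.-integrable `]0, +oo[ (fun x : R => ((z + x) `^ (- q') * f x)%:E).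
  by move=> z0 pq'; exact: (powR_shift_integrable p0).
have a20 : 0 < a / 2 by rewrite divr_gt0.
have := @differentiation_under_integral R _ RR lambda F `]0, +oo[%classic (measurable_itv _) a (a / 2) (a * 2).
move=> /(_ _ _ _ (fun x : R => `|q * ((a / 2 + x) `^ (- (q + 1)) * f x)|)).
have : derive1 (fun z : R => \int[lambda]_(x in `]0, +oo[) F z x) a = 0.
  rewrite derive1E; transitivity ('D_1 (cst (0 : R)) a : R); last exact: derive_cst.
  by apply: near_eq_derive; near=> z; rewrite Z//; near: z; exact: lt_nbhsr.
move=> -> H.
have {H} : 0 = \int[lambda]_(y in `]0, +oo[) partial1of2 F a y.
  apply: H => //.
  - by rewrite /= in_itv/=; apply/andP; split; lra.
  - by move=> x /=; rewrite in_itv/= => /andP[x0 _]; apply: int => //; exact: lt_trans x0.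
  - by move=> x y; rewrite /= !in_itv/= andbT => /andP[x0 _] y0; have [] := dF y x (lt_trans a20 x0) y0.
  - have pq1 : p <= q + 1 by rewrite (le_trans pq)// lerDl.
    have I2 : lambda.-integrable `]0, +oo[ (fun x : R => q%:E * ((a / 2 + x) `^ (- (q + 1)) * f x)%:E)%E.
      by apply: integrableZl => //; exact: int.
    have := integrable_abse I2.
    by apply: eq_integrable => // x _; rewrite /= EFinM.
  - move=> x y; rewrite /= !in_itv/= andbT => /andP[x0 _] y0.
    have x0' := lt_trans a20 x0.
    rewrite /partial1of2 derive1E; have [_ ->] := dF y x x0' y0.
    rewrite !normrM normrN -mulrA; apply: ler_wpM2l => //; apply: ler_wpM2r => //.
    rewrite !ger0_norm ?powR_ge0//.
    rewrite -[- q - 1]opprD; apply: ler_powRN_base; rewrite ?addr_gt0 ?addr_ge0 ?(ltW q0)//.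
    by rewrite lerD2r ltW.
rewrite (@eq_Rintegral _ _ _ lambda _ (fun x : R => - q * ((a + x) `^ (- (q + 1)) * f x))); last first.
  move=> x; rewrite inE/= in_itv/= andbT => x0; rewrite /partial1of2 derive1E.
  by have [_ ->] := dF x a a0 x0; rewrite opprD mulrA.
rewrite RintegralZl//; last by apply: int => //; rewrite (le_trans pq)// lerDl.
by move=> /esym/eqP; rewrite mulf_eq0 oppr_eq0 (gt_eqF q0)/= => /eqP.
Unshelve. all: end_near. Qed.
(** By [stieltjes_step] the transforms of exponents p + n vanish too. At z = 1 they say that w(x) =
    (1 + x)^(- p) f(x) is orthogonal to all powers of y = 1 / (1 + x). Bernstein polynomials in y
    converge boundedly to the indicator of y > 1 / (1 + X), that is of x < X, so every integral of w
    over ]0, X[ vanishes, and Lebesgue's differentiation theorem gives w = 0 almost everywhere. *)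
Lemma stieltjes_unique (p : R) (f : R -> R) : 0 < p -> measurable_fun [set: R] f ->
  lambda.-integrable `]0, +oo[ (fun x => ((1 + x) `^ (- p) * f x)%:E) ->
  (forall z, 0 < z -> \int[lambda]_(x in `]0, +oo[) ((z + x) `^ (- p) * f x) = 0) ->
  {ae lambda, forall x, 0 < x -> f x = 0}.
Proof.
move=> p0 mf If Z.
have Zn n : forall z, 0 < z -> \int[lambda]_(x in `]0, +oo[) ((z + x) `^ (- (p + n%:R)) * f x) = 0.
  elim: n => [|n IH] z z0; first by rewrite addr0 Z.
  by rewrite -natr1 addrA; apply: (stieltjes_step p0 _ If) => //; rewrite lerDl.
have In n : lambda.-integrable `]0, +oo[ (fun x : R => ((1 + x) `^ (- (p + n%:R)) * f x)%:E).
  by apply: (powR_shift_integrable p0) => //; rewrite lerDl.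
pose y (x : R) : R := (1 + x)^-1.
pose w (x : R) : R := (1 + x) `^ (- p) * f x.
have mw : measurable_fun [set: R] w.
  by apply: measurable_funM => //; apply: measurable_fun_powR; exact: measurable_funD.
have ZP (P : {poly R}) n :
    lambda.-integrable `]0, +oo[ (fun x : R => (P.[y x] * ((1 + x) `^ (- (p + n%:R)) * f x))%:E) /\
    \int[lambda]_(x in `]0, +oo[) (P.[y x] * ((1 + x) `^ (- (p + n%:R)) * f x)) = 0.
  elim/poly_ind: P n => [|P c IH] n.
    split.
      apply: (@eq_integrable _ RR R lambda _ _ (cst 0%E)) => //; last exact: integrable0.
      by move=> x _; rewrite horner0 mul0r.
    rewrite (@eq_Rintegral _ _ _ lambda _ (fun=> 0)) ?/Rintegral ?integral0//.
    by move=> x _; rewrite horner0 mul0r.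
  have E (x : R) : x \in `]0%R, +oo[%classic -> (P * 'X + c%:P).[y x] * ((1 + x) `^ (- (p + n%:R)) * f x) =
      P.[y x] * ((1 + x) `^ (- (p + n.+1%:R)) * f x) + c * ((1 + x) `^ (- (p + n%:R)) * f x).
    rewrite inE/= in_itv/= andbT => x0; have x1 : 0 < 1 + x by rewrite addr_gt0.
    rewrite hornerD hornerM hornerX hornerC (_ : - (p + n.+1%:R) = - (p + n%:R) + -1); last by rewrite -natr1; ring.
    rewrite powRD; last by rewrite (gt_eqF x1) implybT.
    by rewrite (powR_inv1 (ltW x1)) -/(y x); ring.
  have [I1 Z1] := IH n.+1; have I2 := In n.
  have I3 : lambda.-integrable `]0, +oo[ (fun x : R => c%:E * ((1 + x) `^ (- (p + n%:R)) * f x)%:E)%E by exact: integrableZl.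
  split.
    apply: eq_integrable (integrableD _ I1 I3) => // x /E ->; by rewrite EFinD EFinM.
  rewrite (@eq_Rintegral _ RR R lambda _ _ _ E) RintegralD// Z1 add0r RintegralZl//.
  by rewrite Zn// mulr0.
have Iw : lambda.-integrable `]0, +oo[ (EFin \o w) by [].
have wE (x : R) : w x = (1 + x) `^ (- (p + 0%:R)) * f x by rewrite addr0.
have W0 (X : R) : 0 < X -> (\int[lambda]_(x in `]0%R, X[) (w x)%:E = 0)%E.
  move=> X0; pose c := (1 + X)^-1.
  have X1 : 0 < 1 + X by rewrite addr_gt0.
  have c0 : 0 < c by rewrite invr_gt0.
  pose phi (s : R) : R := (c < s)%R%:R.
  have phi1 s : `|phi s| <= 1 by rewrite /phi; case: (c < s); rewrite ?normr1 ?normr0.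
  pose g n (x : R) : R := (bern n.+1 (fun k => phi (k%:R / n.+1%:R))).[y x] * w x.
  have y01 x : 0 < x -> 0 <= y x <= 1.
    move=> x0; have x1 : 0 < 1 + x by rewrite addr_gt0.
    by rewrite /y invr_ge0 (ltW x1)/= invf_le1// lerDl ltW.
  have := @dominated_convergence _ RR R lambda `]0%R, +oo[%classic (measurable_itv _)
     (fun n x => (g n x)%:E) (fun x => (phi (y x) * w x)%:E) (fun x => `|w x|%:E).
  have mg n : measurable_fun (`]0, +oo[%classic : set RR) (fun x => (g n x)%:E).
    have [/measurable_int h _] := ZP (bern n.+1 (fun k => phi (k%:R / n.+1%:R))) 0%N.
    by apply: (eq_measurable_fun _ _ h) => x _; rewrite /g wE.
  have my : measurable_fun (`]0, +oo[%classic : set RR) y.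
    apply: open_continuous_measurable_fun; first exact: interval_open.
    move=> x; rewrite inE/= in_itv/= andbT => x0; apply: (@der_continuous _ _ _ (- 1 / (1 + x) ^+ 2)).
    apply: der_inv; first by rewrite gt_eqF// addr_gt0.
    by apply: der_eq (der_add (is_derive_cst _ _ _) (is_derive_id x 1)) _; rewrite add0r.
  have mphi : measurable_fun [set: R] phi.
    have -> : phi = \1_(`]c, +oo[%classic : set R).
      apply/funext => s; rewrite /phi indicE; case: (ltP c s) => h.
        by rewrite mem_set//= in_itv/= andbT.
      by rewrite memNset//= in_itv/= andbT ltNge h.
    exact: measurable_indic.
  have mpw : measurable_fun (`]0, +oo[%classic : set RR) (fun x => (phi (y x) * w x)%:E).
    apply/measurable_EFinP; apply: measurable_funM; last exact: measurable_funTS.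
    exact: (measurableT_comp mphi).
  move=> /(_ mg mpw).
  (* Only at x = X, where y sits on the jump of [phi], may convergence fail. *)
  have cv : {ae lambda, forall x : R, `]0%R, +oo[%classic x -> (g n x)%:E @[n --> \oo] --> (phi (y x) * w x)%:E}.
    exists [set X]; split; [exact: measurable_set1|exact: lebesgue_measure_set1|].
    move=> x /= /not_implyP [x0 ncv]; apply: contrapT => xX; apply: ncv.
    move: x0; rewrite /= in_itv/= andbT => x0.
    have x1 : 0 < 1 + x by rewrite addr_gt0.
    have yc : y x != c.
      by apply/eqP => /invr_inj/addrI.
    apply: cvg_EFin; first exact: nearW.
    apply: cvgM; last exact: cvg_cst.
    apply: (@bern_cvg phi (y x) `|c - y x|); [exact: y01| |by []|].
      by rewrite normr_gt0 subr_eq0 eq_sym.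
    move=> s hs; rewrite /phi; congr (nat_of_bool _)%:R.
    by move: hs; case: (ltrgtP c (y x)) yc => // cy _ ; rewrite ltr_norml => /andP[h1 h2]; apply/idP/idP; lra.
  move=> /(_ cv (integrable_norm Iw)).
  case.
    apply: aeW => x n /=; rewrite in_itv/= andbT => x0; rewrite lee_fin normrM ler_piMl//.
    (* The Bernstein operator preserves constants, hence the bounds -1 and 1; constants are written
       as affine images of [phi] to reuse [bern_affine]. *)
    have B0 : forall a b, (bern n.+1 (fun k => 0 * phi (k%:R / n.+1%:R) + b)).[a] = b.
      by move=> a b; rewrite bern_affine mul0r add0r.
    rewrite ler_norml; apply/andP; split.
    + rewrite -[X in X <= _](B0 (y x)); apply: bern_le; first exact: y01.
      by move=> k; rewrite mul0r add0r; have := phi1 (k%:R / n.+1%:R); rewrite ler_norml => /andP[].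
    + rewrite -[X in _ <= X](B0 (y x)); apply: bern_le; first exact: y01.
      by move=> k; rewrite mul0r add0r; have := phi1 (k%:R / n.+1%:R); rewrite ler_norml => /andP[].
  move=> _ _ lim.
  have E0 : (\int[lambda]_(x in `]0%R, +oo[) (phi (y x) * w x)%:E = 0)%E.
    apply: (cvg_unique _ lim) => //.
    rewrite (_ : [sequence _]_n = fun=> 0%E); first exact: cvg_cst.
    apply/funext => n /=.
    have [I1 Z1] := ZP (bern n.+1 (fun k => phi (k%:R / n.+1%:R))) 0%N.
    transitivity (\int[lambda]_(x in `]0%R, +oo[) ((bern n.+1 (fun k => phi (k%:R / n.+1%:R))).[y x] * ((1 + x) `^ (- (p + 0%:R)) * f x))%:E)%E.
      by apply: eq_integral => x _; rewrite /g wE.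
    by rewrite EFin_Rintegral// Z1.
  rewrite -[RHS]E0 (_ : `]0%R, X[%classic = `]0%R, +oo[ `&` `]-oo, X[); last first.
    by apply/seteqP; split => x /=; rewrite !in_itv/= andbT; [case/andP|case=> -> ->].
  rewrite integral_mkcondr; apply: eq_integral => x; rewrite inE/= in_itv/= andbT => x0.
  have x1 : 0 < 1 + x by rewrite addr_gt0.
  rewrite patchE /phi /c /y ltf_pV2 ?posrE// ltrD2l.
  by case: ltP => xX; [rewrite mem_set ?mul1r//= in_itv|rewrite memNset ?mul0r//= in_itv/= ltNge xX].
pose w0 := w \_ (`]0, +oo[%classic : set R).
have Iw0 : lambda.-integrable setT (EFin \o w0).
  by rewrite /w0 -restrict_EFin; apply/(integrable_mkcond _ _).1.
have Iy (z : R) : lambda.-integrable `]0, z] (EFin \o w0) by exact: (integrableS measurableT).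
have Il : locally_integrable [set: R] w0.
  by have := integrable_locally measurableT Iw0; rewrite patch_setT.
pose F (x : R) := \int[lambda]_(t in `]0, x]) w0 t.
have : {ae lambda, forall x : R, (BRight 0 < BRight x)%O -> derivable F x 1 /\ derive1 F x = w0 x}.
  exact: FTC1 Iy Il.
apply: filterS; first exact: (ae_filter_ringOfSetsType lambda).
move=> x h x0; have {h} [_] := h (x0 : (BRight 0 < BRight x)%O).
have F0 : \near x, F x = 0.
  near=> z; have z0 : 0 < z by near: z; exact: lt_nbhsr.
  have -> : F z = fine (\int[lambda]_(x in `]0%R, z[) (w x)%:E)%E; last by rewrite W0.
  rewrite /F -Rintegral_itv_bndo_bndc; last exact: integrableS Iw0.
  congr fine; apply: eq_integral => t; rewrite inE/= in_itv/= => /andP[t0 _].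
  by rewrite /w0 patchE mem_set//= in_itv/= t0.
have -> : derive1 F x = 0.
  rewrite derive1E; transitivity ('D_1 (cst (0 : R)) x : R); last exact: derive_cst.
  exact: near_eq_derive.
rewrite /w0 patchE mem_set; last by rewrite /= in_itv/= x0.
move=> /esym/eqP; rewrite mulf_eq0 => /orP[|/eqP//].
by rewrite powR_eq0 (gt_eqF (addr_gt0 ltr01 x0)).
Unshelve. all: end_near. Qed.
End uniqueness.

(** * The Markov-Krein identity *)

Section markov_krein.
Lemma measurable_prod_cond (R : realType) d (T : measurableType d) (I : eqType) (s : seq I) (P : pred I)
    (h : I -> T -> R) :
  (forall i, P i -> measurable_fun [set: T] (h i)) ->
  measurable_fun [set: T] (fun x => \prod_(i <- s | P i) h i x)%R.
Proof.
move=> mh.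
rewrite (_ : (fun x => _) = (fun x => \prod_(i <- s) (if P i then h i x else 1))%R); last first.
  by apply/funext => x; rewrite big_mkcond.
by apply: measurable_prod => i _; case Pi : (P i); [exact: mh|exact: measurable_cst].
Qed.

Context {R : realType}.
Notation lambda := (@lebesgue_measure R).
Notation RR := (measurableTypeR R).
Local Open Scope ereal_scope.

(** Independence is given on events, that is for indicators. In [claim] the functions of index below
    j are arbitrary and the others are indicators. To free one more index, the induction hypothesis
    with an indicator at that place shows that the product of the other factors, integrated over
    events of the new variable, is a constant times the law of that variable, and
    [ge0_integral_comp_density] concludes. Finite integrals make the constant a real number. *)
Lemma indep_prod k d (T : measurableType d) (Q : probability T R) (G : 'I_k -> {RV Q >-> RR})
    (f : 'I_k -> R -> R) :
  mutually_independent G ->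
  (forall i, measurable_fun [set: R] (f i)) -> (forall i x, 0 <= f i x)%R ->
  (forall i, \int[Q]_t (f i (G i t))%:E < +oo) ->
  \int[Q]_t (\prod_(i < k) f i (G i t))%:E = \prod_(i < k) \int[Q]_t (f i (G i t))%:E.
Proof.
move=> indG.
suff claim j : forall f : 'I_k -> R -> R, (forall i, measurable_fun [set: R] (f i)) ->
    (forall i x, 0 <= f i x)%R -> (forall i, \int[Q]_t (f i (G i t))%:E < +oo) ->
    (forall i : 'I_k, (j <= i)%N -> exists2 B : set RR, measurable B & f i = \1_B) ->
    \int[Q]_t (\prod_(i < k) f i (G i t))%:E = \prod_(i < k) \int[Q]_t (f i (G i t))%:E.
  move=> mf f0 fy; apply: (claim k) => // i; by rewrite leqNgt ltn_ord.
elim: j => [|j IH] {}f mf f0 fy fB.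
  have /choice[B BE] : forall i : 'I_k, exists B : set RR, measurable B /\ f i = \1_B.
    by move=> i; have [B mB E] := fB i (leq0n _); exists B.
  have E1 i : \int[Q]_t (f i (G i t))%:E = Q (G i @^-1` B i).
    have [mB ->] := BE i.
    rewrite (_ : (fun t => _) = (fun t => (\1_(G i @^-1` B i) t)%:E)); last by apply/funext.
    by rewrite integral_indic ?setIT//; rewrite -[_ @^-1` _]setTI; exact: measurable_funP.
  rewrite (eq_bigr _ (fun i _ => E1 i)) -indG; last by move=> i; case: (BE i).
  have mI : measurable (\bigcap_(i in [set: 'I_k]) G i @^-1` B i).
    apply: fin_bigcap_measurable => // i _; have [mB _] := BE i.
    by rewrite -[_ @^-1` _]setTI; exact: measurable_funP.
  rewrite -[X in _ = Q X](setIT) -integral_indic//; apply: eq_integral => t _; congr EFin.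
  rewrite indicE; have [tI|tI] := boolP (t \in _).
    rewrite big1// => i _; have [_ ->] := BE i; rewrite indicE mem_set//.
    by move: tI; rewrite inE => /(_ i I).
  move: tI; rewrite notin_setE => /existsNP[i /not_implyP[_ ni]].
  by rewrite (bigD1 i)//=; have [_ ->] := BE i; rewrite indicE memNset ?mul0r.
have [jk|kj] := ltnP j k; last by apply: IH => // i ji; move: (ltn_ord i); rewrite ltnNge (leq_trans kj ji).
pose i0 := Ordinal jk.
pose W t : R := (\prod_(i < k | i != i0) f i (G i t))%R.
pose c : \bar R := \prod_(i < k | i != i0) \int[Q]_t (f i (G i t))%:E.
have c0 : 0 <= c by apply: prode_ge0 => i _; apply: integral_ge0 => t _; rewrite lee_fin.
have cfin : c \is a fin_num.
  apply: (big_ind (fun x : \bar R => x \is a fin_num)) => //; first by move=> x y; exact: fin_numM.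
  by move=> i _; rewrite ge0_fin_numE// integral_ge0// => t _; rewrite lee_fin.
have rc0 : (0 <= fine c)%R by exact: fine_ge0.
have W0 t : (0 <= W t)%R by apply: prodr_ge0.
have mW : measurable_fun [set: T] W.
  by apply: measurable_prod_cond => i _; exact: (measurableT_comp (mf i) (measurable_funP (G i))).
have E B : measurable B -> mscale (NngNum rc0) (distribution Q (G i0)) B = \int[Q]_(x in G i0 @^-1` B) (W x)%:E.
  move=> mB; rewrite /mscale /= fineK// /distribution /pushforward.
  pose f' i := if i == i0 then \1_B else f i.
  have mGB : measurable (G i0 @^-1` B) by rewrite -[_ @^-1` _]setTI; exact: measurable_funP.
  have E1 : \int[Q]_t (\1_B (G i0 t))%:E = Q (G i0 @^-1` B).
    rewrite (_ : (fun t => _) = (fun t => (\1_(G i0 @^-1` B) t)%:E)); last by apply/funext.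
    by rewrite integral_indic ?setIT.
  have := IH f'.
  rewrite (bigD1 i0)//= [in X in _ -> _ -> _ -> _ -> _ = X * _]/f' eqxx E1.
  rewrite (eq_bigr (fun i => \int[Q]_t (f i (G i t))%:E)); last by move=> i /negbTE ii; rewrite /f' ii.
  rewrite -/c muleC => <-.
  - rewrite [RHS]integral_mkcond; apply: eq_integral => t _.
    rewrite (bigD1 i0)//= {1}/f' eqxx (eq_bigr (fun i => f i (G i t))); last by move=> i /negbTE ii; rewrite /f' ii.
    rewrite -/(W t) patchE indicE; have [tB|tB] := boolP (G i0 t \in B).
      by rewrite mem_set ?mul1r//; move: tB; rewrite inE.
    by rewrite memNset ?mul0r//; move: tB; rewrite notin_setE.
  - by move=> i; rewrite /f'; case: ifP => // _; exact: measurable_indic.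
  - by move=> i x; rewrite /f'; case: ifP.
  - move=> i; rewrite /f'; case: ifPn => // /eqP ->; rewrite E1.
    by rewrite (le_lt_trans (probability_le1 _ _))// ltry.
  - move=> i ji; rewrite /f'; case: ifPn => [_|ii]; first by exists B.
    apply: fB; rewrite ltn_neqAle ji andbT; apply: contra ii => /eqP ji'.
    by apply/eqP/val_inj.
have := @ge0_integral_comp_density R _ _ T RR Q (mscale (NngNum rc0) (distribution Q (G i0))) (G i0) W (EFin \o f i0).
move=> /(_ _ mW W0 E _ _) H.
rewrite (bigD1 i0)//= -/c.
under eq_integral do rewrite (bigD1 i0)//= -/(W _) EFinM.
rewrite -H//; last 2 first.
- by apply/measurable_EFinP; exact: mf.
- by move=> y; rewrite lee_fin.
rewrite ge0_integral_mscale//=; last 2 first.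
- by apply/measurable_EFinP; exact: mf.
- by move=> y _; rewrite lee_fin.
rewrite fineK// muleC; congr (_ * _).
rewrite ge0_integral_distribution//; first by apply/measurable_EFinP; exact: mf.
by move=> y; rewrite lee_fin.
Qed.

(** The absolute value makes this nonnegative everywhere; the gamma variables to which it is applied
    are nonnegative only almost surely. *)
Definition gmono (m : nat) (v x : R) : R := (`|x| ^+ m * expR (- (v * `|x|)))%R.

Lemma gmono_ge0 m v x : (0 <= gmono m v x)%R.
Proof. by rewrite mulr_ge0 ?exprn_ge0 ?expR_ge0. Qed.

Lemma measurable_gmono m v : measurable_fun [set: R] (gmono m v).
Proof.
apply: measurable_funM; first by apply: measurable_funX; exact: normr_measurable.
apply: measurableT_comp => //; apply: measurableT_comp => //.
by apply: measurable_funM => //; exact: normr_measurable.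
Qed.

Lemma measurable_gamma_density (a : R) :
  measurable_fun [set: R] (fun x : R => x `^ (a - 1) * expR (- x) / Gamma_fun a)%R.
Proof.
apply: measurable_funM; last exact: measurable_cst.
apply: measurable_funM; first exact: measurable_powR.
by apply: measurableT_comp => //; exact: measurable_funN.
Qed.

Lemma integral_gamma_law d (T : measurableType d) (Q : probability T R) (G : {RV Q >-> RR}) (a : R)
    (f : R -> R) : (0 <= a)%R ->
  (forall A : set RR, measurable A -> distribution Q G A = gamma_law a A) ->
  measurable_fun [set: R] f -> (forall x, 0 <= f x)%R ->
  \int[Q]_t (f (G t))%:E =
  if a == 0%R then (f 0%R)%:E
  else \int[lambda]_(x in `]0%R, +oo[) ((f x)%:E * (x `^ (a - 1) * expR (- x) / Gamma_fun a)%:E).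
Proof.
move=> a0 law mf f0.
transitivity (\int[distribution Q G]_x (f x)%:E).
  by rewrite ge0_integral_distribution//; exact/measurable_EFinP.
have [a00|an0] := eqVneq a 0%R.
  rewrite (@eq_measure_integral _ _ _ _ (\d_(0%R : RR))); last first.
    by move=> A mA _; rewrite -[LHS]/(distribution Q G A) law// /gamma_law a00 eqxx.
  by rewrite integral_dirac// ?diracT ?mul1e//; apply/measurable_EFinP.
pose w x : R := (x `^ (a - 1) * expR (- x) / Gamma_fun a)%R.
apply: (@ge0_integral_density R _ RR lambda _ _ w) => //.
- by apply: measurable_funTS; exact: measurable_gamma_density.
- move=> x _; rewrite /w divr_ge0 ?mulr_ge0 ?powR_ge0 ?expR_ge0//.
  by apply: Rintegral_ge0 => y _; rewrite mulr_ge0 ?powR_ge0 ?expR_ge0.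
- by move=> A mA; rewrite -[LHS]/(distribution Q G A) law// /gamma_law (negbTE an0).
- exact/measurable_EFinP.
Qed.

(** Substitution of (1 + v) x in the gamma integral. As an identity in the extended reals it
    presupposes no finite moment; for m = 0 it even shows that exponential moments are finite. *)
Lemma gamma_law_scale d (T : measurableType d) (Q : probability T R) (G : {RV Q >-> RR}) (a v : R) m :
  (0 <= a)%R -> (-1 < v)%R ->
  (forall A : set RR, measurable A -> distribution Q G A = gamma_law a A) ->
  \int[Q]_t (gmono m v (G t))%:E = ((1 + v) `^ (- (a + m%:R)))%:E * \int[Q]_t (gmono m 0 (G t))%:E.
Proof.
move=> a0 v1 law.
have v0 : (0 < 1 + v)%R by lra.
rewrite !(integral_gamma_law a0 law); try exact: measurable_gmono; try exact: gmono_ge0.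
have [->|an0] := eqVneq a 0%R.
  rewrite /gmono normr0 !mulr0 oppr0 expR0 !mulr1 add0r -EFinM; congr EFin.
  by case: m => [|m]; rewrite ?expr0n/= ?mulr0// oppr0 powRr0 mulr1.
pose h x : R := (gmono m 0 x * (x `^ (a - 1) * expR (- x) / Gamma_fun a))%R.
have h0 x : (0 <= h x)%R.
  rewrite mulr_ge0 ?gmono_ge0// divr_ge0 ?mulr_ge0 ?powR_ge0 ?expR_ge0//.
  by apply: Rintegral_ge0 => y _; rewrite mulr_ge0 ?powR_ge0 ?expR_ge0.
have mh : measurable_fun [set: R] h.
  apply: measurable_funM; first exact: measurable_gmono.
  exact: measurable_gamma_density.
have S : \int[lambda]_(x in `]0%R, +oo[) (h ((1 + v) * x)%R)%:E = (1 + v)^-1%:E * \int[lambda]_(x in `]0%R, +oo[) (h x)%:E.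
  apply: (@ge0_integral_scale R (1 + v) (EFin \o h)) => //; exact/measurable_EFinP.
under [in RHS]eq_integral do rewrite -EFinM -/(h _).
rewrite (_ : - (a + m%:R) = - (a + m%:R - 1) + -1)%R; last by ring.
rewrite powRD; last by rewrite (gt_eqF v0) implybT.
rewrite (powR_inv1 (ltW v0)) EFinM -muleA -S -ge0_integralZl_EFin//; last 3 first.
- by move=> x _; rewrite lee_fin.
- apply/measurable_EFinP; apply: measurable_funTS; apply: measurableT_comp => //; exact: measurable_funM.
- exact: powR_ge0.
apply: eq_integral => x; rewrite inE/= in_itv/= andbT => x0.
rewrite -!EFinM; congr EFin; rewrite /h /gmono.
have vx : (0 < (1 + v) * x)%R by rewrite mulr_gt0.
rewrite !gtr0_norm// !mul0r oppr0 expR0 mulr1.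
rewrite powRM ?(ltW v0) ?(ltW x0)// exprMn.
rewrite (_ : - ((1 + v) * x) = - (v * x) + - x)%R; last by ring.
rewrite expRD powRN.
rewrite (_ : a + m%:R - 1 = m%:R + (a - 1))%R; last by ring.
have -> : ((1 + v) `^ (m%:R + (a - 1)) = (1 + v) ^+ m * (1 + v) `^ (a - 1))%R.
  by rewrite -powR_mulrn ?(ltW v0)// -powRD// (gt_eqF v0) implybT.
have p1 : ((1 + v) `^ (a - 1) != 0)%R by rewrite gt_eqF// powR_gt0.
have p2 : ((1 + v) ^+ m != 0)%R by rewrite gt_eqF// exprn_gt0.
set A := ((1 + v) `^ (a - 1))%R in p1 *; set B := ((1 + v) ^+ m)%R in p2 *.
set g := (Gamma_fun a)^-1%R.
rewrite invfM; field; by rewrite p1 p2.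
Qed.

Lemma gamma_law_moment_lty d (T : measurableType d) (Q : probability T R) (G : {RV Q >-> RR}) (a v : R) m :
  (0 <= a)%R -> (-1 < v)%R ->
  (forall A : set RR, measurable A -> distribution Q G A = gamma_law a A) ->
  \int[Q]_t (gmono m v (G t))%:E < +oo.
Proof.
move=> a0 v1 law.
have exp0 u : (-1 < u)%R -> \int[Q]_t (gmono 0 u (G t))%:E < +oo.
  move=> u1; rewrite (gamma_law_scale _ a0 u1 law).
  have -> : \int[Q]_t (gmono 0 0 (G t))%:E = 1; last by rewrite mule1 ltry.
  rewrite (_ : (fun t => _) = cst 1); last first.
    by apply/funext => t; rewrite /gmono expr0 mul0r oppr0 expR0 mulr1.
  by rewrite integral_cst// mul1e; exact: probability_setT.
(* u is halfway between -1 and v, so the exponential moment at u is finite, and e = v - u absorbs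
   the power through x^m <= (m! / e^m) exp(e x). *)
pose u := ((v - 1) / 2)%R.
have [e [e0 eE]] : exists e : R, (0 < e)%R /\ (e = (1 + v) / 2)%R by exists ((1 + v) / 2)%R; split => //; lra.
pose C := ((m`!)%:R / e ^+ m)%R.
have C0 : (0 <= C)%R by rewrite divr_ge0// exprn_ge0// ltW.
apply: (@le_lt_trans _ _ (\int[Q]_t (C%:E * (gmono 0 u (G t))%:E))).
  apply: ge0_le_integral => //.
  - by move=> t _; rewrite lee_fin gmono_ge0.
  - by apply/measurable_EFinP; apply: measurableT_comp => //; exact: measurable_gmono.
  - by apply: emeasurable_funM => //; apply/measurable_EFinP; apply: measurableT_comp => //; exact: measurable_gmono.
  move=> t _; rewrite -EFinM lee_fin /gmono expr0 mul1r; set x := `|G t|%R.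
  have x0 : (0 <= x)%R by rewrite /x.
  rewrite (_ : - (u * x) = e * x + - (v * x))%R; last by rewrite /u eE; field.
  rewrite expRD mulrA ler_wpM2r ?expR_ge0//.
  have [m0|m0] := posnP m.
    by rewrite /C m0 !expr0 fact0 divr1 mul1r -expR0 ler_expR mulr_ge0// ltW.
  have ex0 : (0 <= e * x)%R by rewrite mulr_ge0// ltW.
  have := expR_ge1Dxn m.-1 ex0; rewrite prednK// => h.
  have {}h : ((e * x) ^+ m / (m`!)%:R <= expR (e * x))%R by apply: le_trans h; rewrite lerDr.
  have : (C * ((e * x) ^+ m / (m`!)%:R) <= C * expR (e * x))%R by rewrite ler_wpM2l.
  apply: le_trans; rewrite /C exprMn le_eqVlt; apply/orP; left; apply/eqP.
  have em : (e ^+ m != 0)%R by rewrite gt_eqF// exprn_gt0.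
  have fm : ((m`!)%:R != 0 :> R)%R by rewrite pnatr_eq0 -lt0n fact_gt0.
  by move: em fm; set E := (e ^+ m)%R; set F := (_%:R)%R => em fm; field; rewrite ?em ?fm.
rewrite ge0_integralZl_EFin//; last 2 first.
- by move=> t _; rewrite lee_fin gmono_ge0.
- by apply/measurable_EFinP; apply: measurableT_comp => //; exact: measurable_gmono.
rewrite lte_mul_pinfty ?lee_fin//; apply: exp0; rewrite /u; lra.
Qed.
Lemma expR_nneseries (x : R) : (0 <= x)%R ->
  \sum_(j <oo) (x ^+ j / j`!%:R)%:E = (expR x)%:E.
Proof.
move=> x0; apply/cvg_lim => //.
have -> : (fun n => \sum_(0 <= j < n) (x ^+ j / j`!%:R)%:E) = EFin \o series (exp_coeff x).
  by apply/funext => n; rewrite /= /series /= sumEFin; congr EFin; apply: eq_bigr.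
apply: cvg_EFin; first exact: nearW.
by have := is_cvg_series_exp_coeff x.
Qed.

(** * Ratios of gamma variables *)

Section dirichlet_ratio.
Context (k : nat) d (T : measurableType d) (Q : probability T R)
  (G : 'I_k -> {RV Q >-> RR}) (a : 'I_k -> R) (tau : R).
Context (indG : mutually_independent G).
Context (a0 : forall i, (0 <= a i)%R).
Context (lawG : forall i (A : set RR), measurable A -> distribution Q (G i) A = gamma_law (a i) A).
Context (suma : (\sum_(i < k) a i = tau)%R).
Context (tau0 : (0 < tau)%R).

Let lin (e : 'I_k -> R) (t : T) : R := (\sum_(i < k) e i * `|G i t|)%R.
Let S := lin (fun=> 1%R).

Let lin_ge0 e t : (forall i, 0 <= e i)%R -> (0 <= lin e t)%R.
Proof. by move=> e0; apply: sumr_ge0 => i _; rewrite mulr_ge0. Qed.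

Let measurable_lin e : measurable_fun [set: T] (lin e).
Proof.
apply: measurable_sum => i; apply: measurable_funM => //.
by apply: measurableT_comp => //; exact: normr_measurable.
Qed.

Let measurable_gmonoG i m v : measurable_fun [set: T] (fun t => gmono m v (G i t)).
Proof. exact: (measurableT_comp (measurable_gmono m v) (measurable_funP (G i))). Qed.

Let prod_gmono (v : R) (m : 'I_k -> nat) t := (\prod_(i < k) gmono (m i) v (G i t))%R.

Let prod_gmono_ge0 v m t : (0 <= prod_gmono v m t)%R.
Proof. by apply: prodr_ge0 => i _; exact: gmono_ge0. Qed.

Let measurable_prod_gmono v m : measurable_fun [set: T] (prod_gmono v m).
Proof. by apply: measurable_prod => i _; exact: measurable_gmonoG. Qed.

(** Weighting by exp(- v S) amounts to dividing the gamma variables by 1 + v and contributes (1 +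
    v)^(- tau); a function homogeneous of degree n picks up a further (1 + v)^(- n). Expanding one
    factor of the power of [lin] at a time raises a single exponent m_i, which is why monomials with
    arbitrary exponents are carried through the induction on j. *)
Let lin_moment (e : 'I_k -> R) (j : nat) (m : 'I_k -> nat) (v : R) :
  (forall i, 0 <= e i)%R -> (-1 < v)%R ->
  \int[Q]_t (lin e t ^+ j * prod_gmono v m t)%:E =
    ((1 + v) `^ (- (tau + (\sum_(i < k) m i)%:R + j%:R)))%:E * \int[Q]_t (lin e t ^+ j * prod_gmono 0 m t)%:E
  /\ \int[Q]_t (lin e t ^+ j * prod_gmono v m t)%:E < +oo.
Proof.
move=> e0 v1; have v0 : (0 < 1 + v)%R by lra.
elim: j m => [|j IH] m.
  under eq_integral do rewrite expr0 mul1r.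
  under [in X in _ = _ * X]eq_integral do rewrite expr0 mul1r.
  have fin u i : (-1 < u)%R -> \int[Q]_t (gmono (m i) u (G i t))%:E < +oo.
    by move=> u1; exact: (gamma_law_moment_lty _ (a0 i) u1 (lawG i)).
  have E u : (-1 < u)%R -> \int[Q]_t (prod_gmono u m t)%:E = \prod_(i < k) \int[Q]_t (gmono (m i) u (G i t))%:E.
    move=> u1; apply: (indep_prod (f := fun i => gmono (m i) u)) => //.
    - by move=> i; exact: measurable_gmono.
    - by move=> i x; exact: gmono_ge0.
    - by move=> i; exact: fin.
  rewrite E// E ?ltrN10//; split.
    rewrite (eq_bigr (fun i => ((1 + v) `^ (- (a i + (m i)%:R)))%:E * \int[Q]_t (gmono (m i) 0 (G i t))%:E)); last first.
      by move=> i _; exact: (gamma_law_scale (m i) (a0 i) v1 (lawG i)).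
    rewrite big_split/=; congr (_ * _); rewrite prodEFin; congr EFin.
    rewrite addr0 natr_sum -suma -big_split/= -sumrN.
    elim/big_rec2 : _ => [|i x y _ ->]; first by rewrite powRr0.
    by rewrite powRD// (gt_eqF v0) implybT.
  rewrite ltey_eq; apply/orP; left.
  apply: (big_ind (fun x : \bar R => x \is a fin_num)) => //; first by move=> x y; exact: fin_numM.
  move=> i _; rewrite ge0_fin_numE ?fin// integral_ge0// => t _; rewrite lee_fin; exact: gmono_ge0.
pose bump i (l : 'I_k) := (m l + (l == i))%N.
have E u t : (lin e t ^+ j.+1 * prod_gmono u m t = \sum_(i < k) e i * (lin e t ^+ j * prod_gmono u (bump i) t))%R.
  rewrite exprSr {2}/lin -mulrA mulr_suml mulr_sumr; apply: eq_bigr => i _.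
  rewrite -!mulrA mulrCA; congr (_ * _)%R; congr (_ * _)%R.
  rewrite /prod_gmono (bigD1 i)//= [in RHS](bigD1 i)//= mulrA; congr (_ * _)%R.
    by rewrite /gmono /bump eqxx addn1 exprS mulrA.
  by apply: eq_bigr => l /negbTE li; rewrite /bump li addn0.
have I u : \int[Q]_t (lin e t ^+ j.+1 * prod_gmono u m t)%:E =
    \sum_(i < k) (e i)%:E * \int[Q]_t (lin e t ^+ j * prod_gmono u (bump i) t)%:E.
  under eq_integral do rewrite E -sumEFin.
  rewrite ge0_integral_sum//.
  - apply: eq_bigr => i _; under eq_integral do rewrite EFinM.
    rewrite ge0_integralZl_EFin//.
    + by move=> t _; rewrite lee_fin mulr_ge0// exprn_ge0// lin_ge0.
    + by apply/measurable_EFinP; apply: measurable_funM => //; exact: measurable_funX.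
  - move=> i; apply/measurable_EFinP; apply: measurable_funM => //.
    by apply: measurable_funM => //; exact: measurable_funX.
  - by move=> i t _; rewrite lee_fin !mulr_ge0// exprn_ge0// lin_ge0.
have sb i : (\sum_(l < k) bump i l = (\sum_(l < k) m l).+1)%N.
  rewrite big_split/= -addn1; congr addn.
  by rewrite (bigD1 i)//= eqxx big1 ?addn0// => l /negbTE ->.
rewrite !I; split.
  rewrite ge0_sume_distrr; last first.
    by move=> i _; rewrite mule_ge0 ?lee_fin// integral_ge0// => t _; rewrite lee_fin mulr_ge0// exprn_ge0// lin_ge0.
  apply: eq_bigr => i _; have [-> _] := IH (bump i).
  rewrite muleCA; congr (_ * (_ * _)); congr (_ `^ (- _))%:E.
  by rewrite sb -!natr1; ring.
apply: lte_sum_pinfty => i _; rewrite lte_mul_pinfty ?lee_fin//.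
by have [_] := IH (bump i).
Qed.

Let lin_expR e j v : (forall i, 0 <= e i)%R -> (-1 < v)%R ->
  \int[Q]_t (lin e t ^+ j * expR (- (v * S t)))%:E =
    ((1 + v) `^ (- (tau + j%:R)))%:E * \int[Q]_t (lin e t ^+ j)%:E.
Proof.
move=> e0 v1; have [H _] := @lin_moment e j (fun=> 0%N) v e0 v1.
have P u t : prod_gmono u (fun=> 0%N) t = expR (- (u * S t)).
  rewrite /prod_gmono /S /lin mulr_sumr -sumrN expR_sum; apply: eq_bigr => i _.
  by rewrite /gmono expr0 !mul1r.
move: H; under eq_integral do rewrite P; move=> ->.
congr (_ * _); first by rewrite sum_nat_const muln0 addr0.
by apply: eq_integral => t _; rewrite P mul0r oppr0 expR0 mulr1.
Qed.

Let lin_fin e j : (forall i, 0 <= e i)%R -> \int[Q]_t (lin e t ^+ j)%:E < +oo.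
Proof.
move=> e0; have [_] := @lin_moment e j (fun=> 0%N) 0 e0 (ltrN10 _).
congr (_ < _); apply: eq_integral => t _.
by rewrite /prod_gmono big1 ?mulr1// => i _; rewrite /gmono expr0 mul0r oppr0 expR0 mulr1.
Qed.
Let measurable_expS v : measurable_fun [set: T] (fun t => expR (- (v * S t))).
Proof.
apply: measurableT_comp => //; apply: measurableT_comp => //.
by apply: measurable_funM => //; exact: measurable_lin.
Qed.

Let S_gt0_ae : \int[Q]_t (0 < S t)%R%:R%:E = 1.
Proof.
have [i ai] : exists i, (0 < a i)%R.
  apply: contrapT => /forallNP h; move: tau0; rewrite -suma big1 ?ltxx// => i _.
  by apply/eqP; rewrite eq_le a0 andbT leNgt; apply/negP/h.
have G0 : Q (G i @^-1` [set 0%R]) = 0.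
  rewrite -[LHS]/(distribution Q (G i) [set 0%R : RR]) lawG ?measurable_set1//.
  rewrite /gamma_law (gt_eqF ai) (_ : _ `&` _ = set0) ?integral_set0//.
  by apply/seteqP; split => x //= [->]; rewrite in_itv/= ltxx.
have mG : measurable (G i @^-1` [set 0%R]).
  by rewrite -[_ @^-1` _]setTI; apply: measurable_funP => //; exact: measurable_set1.
transitivity (\int[Q]_t (cst 1 t)); last by rewrite integral_cst// mul1e; exact: probability_setT.
apply: ge0_ae_eq_integral => //.
- apply/measurable_EFinP.
  rewrite (_ : (fun t => _) = \1_(S @^-1` `]0%R, +oo[)).
    apply: measurable_indic; rewrite -[_ @^-1` _]setTI; exact: measurable_lin.
  apply/funext => t; rewrite indicE; case: (ltP 0%R (S t)) => h.
    by rewrite mem_set//= in_itv/= andbT.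
  by rewrite memNset//= in_itv/= andbT ltNge h.
exists (G i @^-1` [set 0%R]); split => // t /= /not_implyP[_ h].
apply: contrapT => Gi; apply: h.
have -> // : (0 < S t)%R.
rewrite /S /lin (bigD1 i)//= mul1r ltr_pwDl//; first by rewrite normr_gt0; apply/eqP.
by apply: sumr_ge0 => l _; rewrite mulr_ge0.
Qed.

(** This is what independence of the ratio and of the sum means for moments. Integrate
    E[lin^(j+1) exp(- v S)] = (1 + v)^(- tau - j - 1) E[lin^(j+1)] against v^j dv: by Tonelli the
    left side becomes E[(lin / S)^(j+1)] J and the right side b E[lin^(j+1)]. For lin = S this reads
    J = b E[S^(j+1)], and b cancels. J and b are never computed; only 0 < b < oo matters. *)
Let ratio_moment e j : (forall i, 0 <= e i)%R -> (forall i, e i <= 1)%R ->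
  \int[Q]_t ((lin e t / S t) ^+ j)%:E * \int[Q]_t (S t ^+ j)%:E = \int[Q]_t (lin e t ^+ j)%:E.
Proof.
move=> e0 e1.
have S0 t : (0 <= S t)%R by exact: lin_ge0.
have I1 : \int[Q]_t (cst 1 t) = 1 by rewrite integral_cst// mul1e; exact: probability_setT.
case: j => [|j].
  by rewrite (eq_integral (cst 1))// I1 mul1e.
pose J := \int[lambda]_(v in `]0%R, +oo[) (v ^+ j * expR (- v))%:E.
pose b := \int[lambda]_(v in `]0%R, +oo[) (v ^+ j * (1 + v) `^ (- (tau + j.+1%:R)))%:E.
have b0 : 0 <= b.
  apply: integral_ge0 => v /=; rewrite in_itv/= andbT => v0.
  by rewrite lee_fin mulr_ge0 ?exprn_ge0 ?powR_ge0// ltW.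
have mJ : measurable_fun [set: R] (fun v : R => v ^+ j * expR (- v))%R.
  apply: measurable_funM; first exact: measurable_funX.
  by apply: measurableT_comp => //; exact: measurable_funN.
have key f : (forall i, 0 <= f i)%R -> (forall i, f i <= 1)%R ->
    \int[Q]_t ((lin f t / S t) ^+ j.+1)%:E * J = b * \int[Q]_t (lin f t ^+ j.+1)%:E.
  move=> f0 f1.
  have fS t : (lin f t <= S t)%R.
    by apply: ler_sum => i _; rewrite ler_wpM2r.
  pose F (z : T * RR) := (lin f z.1 ^+ j.+1 * (z.2 ^+ j * expR (- (z.2 * S z.1))))%:E.
  have mF : measurable_fun [set: T * RR] F.
    apply/measurable_EFinP; apply: measurable_funM.
      by apply: measurable_funX; apply: (measurableT_comp (measurable_lin f)); exact: measurable_fst.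
    apply: measurable_funM; first by apply: measurable_funX; exact: measurable_snd.
    apply: measurableT_comp => //; apply: measurableT_comp => //; apply: measurable_funM.
      exact: measurable_snd.
    by apply: (measurableT_comp (measurable_lin _)); exact: measurable_fst.
  have F0 t v : [set: T] t -> `]0%R, +oo[%classic v -> 0 <= F (t, v).
    move=> _ /=; rewrite in_itv/= andbT => v0; rewrite lee_fin.
    by rewrite !mulr_ge0 ?exprn_ge0 ?expR_ge0 ?lin_ge0// ltW.
  have := @fubini_tonelli_in R _ _ T RR Q lambda setT `]0%R, +oo[%classic F measurableT (measurable_itv _) mF F0.
  have -> : \int[Q]_t \int[lambda]_(v in `]0%R, +oo[) F (t, v) = \int[Q]_t ((lin f t / S t) ^+ j.+1)%:E * J.
    rewrite -ge0_integralZr//.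
    - apply: eq_integral => t _; rewrite /F /=.
      (* Where S = 0 also [lin f t] = 0, as f_i <= 1, and both sides vanish because the exponent
         j.+1 is positive. *)
      have [St|St] := eqVneq (S t) 0%R.
        have -> : lin f t = 0%R by apply/eqP; rewrite eq_le lin_ge0// andbT -St fS.
        rewrite mul0r expr0n/= mul0e integral0_eq// => v _.
        by rewrite mul0r.
      have Sp : (0 < S t)%R by rewrite lt_def St S0.
      under eq_integral do rewrite EFinM.
      rewrite ge0_integralZl_EFin//; last 3 first.
      + move=> v /=; rewrite in_itv/= andbT => v0.
        by rewrite lee_fin mulr_ge0 ?exprn_ge0 ?expR_ge0 ?ltW.
      + apply/measurable_EFinP/measurable_funTS; apply: measurable_funM; first exact: measurable_funX.
        by apply: measurableT_comp => //; apply: measurableT_comp => //; exact: measurable_funM.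
      + by rewrite exprn_ge0// lin_ge0.
      have sc := @ge0_integral_scale R (S t) (fun v => `|v ^+ j * expR (- v)|%:E) Sp.
      have {}sc : \int[lambda]_(v in `]0%R, +oo[) ((S t * v) ^+ j * expR (- (S t * v)))%:E = (S t)^-1%:E * J.
        transitivity (\int[lambda]_(v in `]0%R, +oo[) `|(S t * v) ^+ j * expR (- (S t * v))|%:E).
          apply: eq_integral => v; rewrite inE/= in_itv/= andbT => v0.
          by rewrite ger0_norm// mulr_ge0 ?expR_ge0// exprn_ge0// mulr_ge0// ltW.
        rewrite sc//; last by apply/measurable_EFinP; exact: measurableT_comp.
        congr (_ * _); apply: eq_integral => v; rewrite inE/= in_itv/= andbT => v0.
        by rewrite ger0_norm// mulr_ge0 ?expR_ge0// exprn_ge0// ltW.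
      rewrite expr_div_n EFinM -muleA; congr (_ * _).
      rewrite [in RHS]exprSr invfM EFinM -muleA -sc -ge0_integralZl_EFin//; last 3 first.
      + move=> v /=; rewrite in_itv/= andbT => v0.
        by rewrite lee_fin mulr_ge0 ?exprn_ge0 ?expR_ge0// mulr_ge0// ltW.
      + apply/measurable_EFinP/measurable_funTS; apply: measurable_funM.
          by apply: measurable_funX; exact: measurable_funM.
        by apply: measurableT_comp => //; apply: measurableT_comp => //; exact: measurable_funM.
      + by rewrite invr_ge0 exprn_ge0.
      apply: eq_integral => v _; rewrite -EFinM; congr EFin.
      by rewrite exprMn mulrA mulrA mulVf ?mul1r ?expf_neq0// [(v * S t)%R]mulrC.
    - apply/measurable_EFinP; apply: measurable_funX; apply: measurable_funM => //.
      under eq_fun do rewrite -powR_inv1//.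
      by apply: measurable_fun_powR; exact: measurable_lin.
    - by move=> t _; rewrite lee_fin exprn_ge0// divr_ge0// lin_ge0.
    - apply: integral_ge0 => v /=; rewrite in_itv/= andbT => v0.
      by rewrite lee_fin mulr_ge0 ?exprn_ge0 ?expR_ge0// ltW.
  move=> ->; rewrite -ge0_integralZr//; last 3 first.
  - apply/measurable_EFinP/measurable_funTS; apply: measurable_funM; first exact: measurable_funX.
    by apply: measurable_fun_powR; exact: measurable_funD.
  - move=> v /=; rewrite in_itv/= andbT => v0.
    by rewrite lee_fin mulr_ge0 ?exprn_ge0 ?powR_ge0// ltW.
  - by apply: integral_ge0 => t _; rewrite lee_fin exprn_ge0// lin_ge0.
  apply: eq_integral => v; rewrite inE/= in_itv/= andbT => v0; rewrite /F /=.
  rewrite EFinM -muleA -lin_expR//; last by rewrite (lt_trans _ v0)// ltrN10.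
  rewrite -ge0_integralZl_EFin//.
  - by apply: eq_integral => t _; rewrite -EFinM mulrCA.
  - by move=> t _; rewrite lee_fin mulr_ge0 ?expR_ge0// exprn_ge0// lin_ge0.
  - by apply/measurable_EFinP; apply: measurable_funM => //; exact: measurable_funX.
  - by rewrite exprn_ge0// ltW.
have Jpos : 0 < J.
  apply: (@lt_le_trans _ _ (\int[lambda]_(v in `[1%R, 2%R]) (expR (-2))%:E)).
    rewrite integral_cst//= lebesgue_measure_itv/= lte_fin ltr1n -EFinD.
    by rewrite -EFinM lte_fin mulr_gt0 ?expR_gt0//; lra.
  apply: (@le_trans _ _ (\int[lambda]_(v in `[1%R, 2%R]) (v ^+ j * expR (- v))%:E)).
    apply: ge0_le_integral => //.
    - by apply/measurable_EFinP; exact: measurable_funTS.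
    - move=> v /=; rewrite in_itv/= => /andP[v1 v2]; rewrite lee_fin.
      rewrite -[X in (X <= _)%R]mul1r; apply: ler_pM => //; rewrite ?expR_ge0//.
        exact: exprn_ege1.
      by rewrite ler_expR lerN2.
  apply: ge0_subset_integral => //.
  - by apply/measurable_EFinP; exact: measurable_funTS.
  - move=> v /=; rewrite in_itv/= andbT => v0.
    by rewrite lee_fin mulr_ge0 ?exprn_ge0 ?expR_ge0// ltW.
  - by move=> v /=; rewrite !in_itv/= => /andP[v1 _]; rewrite andbT (lt_le_trans _ v1).
have keyS : J = b * \int[Q]_t (S t ^+ j.+1)%:E.
  rewrite -key//; rewrite -[LHS]mul1e; congr (_ * _); rewrite -S_gt0_ae.
  apply: eq_integral => t _; congr EFin.
  have [St|St] := eqVneq (S t) 0%R.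
    by rewrite St ltxx -/S St mul0r expr0n.
  by rewrite lt_def St S0 -/S divff// expr1n.
have Sfin := @lin_fin (fun=> 1%R) j.+1 (fun=> ler01).
have Sge0 : 0 <= \int[Q]_t (S t ^+ j.+1)%:E.
  by apply: integral_ge0 => t _; rewrite lee_fin exprn_ge0.
have bpos : 0 < b.
  by rewrite lt_def b0 andbT; apply/eqP => b00; move: Jpos; rewrite keyS b00 mul0e ltxx.
have Jfin : J < +oo.
  (* Half of the exponential absorbs the power: v^j / (2^j j!) is a single term of the series of
     exp(v / 2). *)
  have CB : forall v : R, (0 <= v)%R -> (v ^+ j * expR (- v) <= (j`!)%:R * 2 ^+ j * expR (- v / 2))%R.
    move=> v v0.
    have h : ((v / 2) ^+ j / (j`!)%:R <= expR (v / 2))%R.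
      have [->|j0] := posnP j.
        by rewrite expr0 fact0 divr1 -expR0 ler_expR divr_ge0.
      have := @expR_ge1Dxn R (v / 2) j.-1; rewrite prednK// => /(_ (divr_ge0 v0 (ler0n _ 2))).
      by apply: le_trans; rewrite lerDr.
    have fj : (0 < (j`!)%:R :> R)%R by rewrite ltr0n fact_gt0.
    rewrite ler_pdivrMr// in h.
    rewrite [X in (_ * expR X <= _)%R](_ : - v = - v / 2 + - v / 2)%R; last by field.
    rewrite {1}expRD mulrA ler_wpM2r ?expR_ge0//.
    have h2 : (v ^+ j <= (j`!)%:R * 2 ^+ j * expR (v / 2))%R.
      have := ler_wpM2l (exprn_ge0 j (ler0n R 2)) h.
      rewrite expr_div_n mulrCA divff ?mulr1 ?expf_neq0// => /le_trans; apply.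
      by rewrite le_eqVlt; apply/orP; left; apply/eqP; ring.
    have := ler_wpM2r (expR_ge0 (- v / 2)) h2; move/le_trans; apply.
    have E : (expR (v / 2) * expR (- v / 2) = 1)%R by rewrite -expRD mulNr subrr expR0.
    by rewrite -[X in (X <= _)%R]mulrA E mulr1.
  apply: (@le_lt_trans _ _ (\int[lambda]_(v in `]0%R, +oo[) ((j`!)%:R * 2 ^+ j * expR (- v / 2))%:E)).
    apply: ge0_le_integral => //.
    - move=> v /=; rewrite in_itv/= andbT => v0.
      by rewrite lee_fin mulr_ge0 ?exprn_ge0 ?expR_ge0// ltW.
    - by apply/measurable_EFinP; exact: measurable_funTS.
    - apply/measurable_EFinP/measurable_funTS; apply: measurable_funM => //.
      by apply: measurableT_comp => //; apply: measurable_funM => //; exact: measurable_funN.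
    - by move=> v /=; rewrite in_itv/= andbT => v0; rewrite lee_fin CB// ltW.
  pose C : R := ((j`!)%:R * 2 ^+ j)%R.
  have dexp (v : R) : is_derive v 1%R (fun t : R => expR (- t / 2)) (expR (- v / 2) * (- 1 / 2))%R.
    exact: (der_expR (der_mulr 2^-1 (der_opp (der_id v)))).
  have -> : \int[lambda]_(v in `]0%R, +oo[) ((j`!)%:R * 2 ^+ j * expR (- v / 2))%:E = (0 - (- 2 * C))%:E; last exact: ltry.
  apply: (@ge0_FTC_oy R _ (fun v : R => C * (-2 * expR (- v / 2)))%R).
  - by move=> v _; rewrite !mulr_ge0 ?exprn_ge0 ?expR_ge0.
  - by move=> v _; apply: der_eq (der_mull C (der_mull (- 2) (dexp v))) _; rewrite /C; field.
  - by move=> v _; apply: der_continuous (der_mull C (dexp v)).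
  - rewrite (_ : -2 * C = C * (-2 * expR (- 0 / 2)))%R; last by rewrite oppr0 mul0r expR0; ring.
    by apply: cvg_at_right_filter; apply: der_continuous (der_mull C (der_mull (- 2) (dexp 0%R))).
  - rewrite (_ : 0 = C * (-2 * 0))%R; last by rewrite !mulr0.
    apply: cvgMr; apply: cvgMr.
    rewrite (_ : (fun x : R => expR (- x / 2)) = (fun x => expR (- x)) \o (fun x => x / 2))%R; last first.
      by apply/funext => x /=; rewrite mulNr.
    apply: cvg_comp; last exact: cvgr_expR.
    by apply/cvgryPge => A; near=> x; rewrite ler_pdivlMr//; near: x; apply: nbhs_pinfty_ge; rewrite num_real.
have bfin : b < +oo.
  have Spos : 0 < \int[Q]_t (S t ^+ j.+1)%:E.
    by rewrite lt_def Sge0 andbT; apply/eqP => s0; move: Jpos; rewrite keyS s0 mule0 ltxx.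
  rewrite ltey; apply/eqP => b00; move: Jfin; rewrite keyS b00 gt0_mulye// ltxx.
have := key e e0 e1; rewrite keyS => H.
have bf : b \is a fin_num by rewrite ge0_fin_numE.
have : b * (\int[Q]_t ((lin e t / S t) ^+ j.+1)%:E * \int[Q]_t (S t ^+ j.+1)%:E) = b * \int[Q]_t (lin e t ^+ j.+1)%:E.
  by rewrite -H muleCA.
have bn0 : b != 0 by rewrite gt_eqF.
move: bf bn0 => /fineK <- bn0 /(congr1 (fun x => (fine b)^-1%:E * x)).
have fb0 : fine b != 0%R by move: bn0; rewrite eqe.
by rewrite !muleA -EFinM mulVf// !mul1e.
Unshelve. all: end_near. Qed.
(** For Y = lin / S in [0, 1[, (1 - Y)^(- tau) is the exponential moment at Y of an independent copy
    of S. Expand it in powers of Y: by [ratio_moment] the mean of the j-th term is E[lin^j] / j!,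
    and these add up to E[exp(lin)], which factors by independence. As the e_i are nonnegative, all
    exchanges of sum and integral are monotone; e_i < 1 keeps each factor finite. *)
Lemma dirichlet_ratio e : (forall i, 0 <= e i)%R -> (forall i, e i < 1)%R ->
  \int[Q]_t ((1 - (\sum_(i < k) e i * `|G i t|) / (\sum_(i < k) `|G i t|)) `^ (- tau))%:E =
  (\prod_(i < k) (1 - e i) `^ (- a i))%:E.
Proof.
move=> e0 e1.
have SE t : (\sum_(i < k) `|G i t|)%R = S t by apply: eq_bigr => i _; rewrite mul1r.
under eq_integral do rewrite SE -/(lin e _).
have S0 t : (0 <= S t)%R by exact: lin_ge0.
pose Y t := (lin e t / S t)%R.
have Y0 t : (0 <= Y t)%R by rewrite divr_ge0// lin_ge0.
have Y1 t : (Y t < 1)%R.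
  have [St|St] := eqVneq (S t) 0%R; first by rewrite /Y St invr0 mulr0 ltr01.
  have Sp : (0 < S t)%R by rewrite lt_def St S0.
  rewrite /Y ltr_pdivrMr// mul1r.
  have [i Gi] : exists i, (0 < `|G i t|)%R.
    apply: contrapT => /forallNP h; move: Sp; rewrite /S /lin big1 ?ltxx// => i _.
    by rewrite mul1r; apply/eqP; rewrite eq_le normr_ge0 andbT leNgt; apply/negP/h.
  rewrite /S /lin (bigD1 i)//= [X in (_ < X)%R](bigD1 i)//=.
  apply: ltr_leD; first by rewrite ltr_pM2r.
  by apply: ler_sum => l _; rewrite ler_wpM2r// ltW.
have mY : measurable_fun [set: T] Y.
  apply: measurable_funM => //; under eq_fun do rewrite -powR_inv1//.
  by apply: measurable_fun_powR; exact: measurable_lin.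
pose s j := \int[Q]_t (S t ^+ j)%:E.
have s0 j : 0 <= s j by apply: integral_ge0 => t _; rewrite lee_fin exprn_ge0.
have I1 : \int[Q]_t (cst 1 t) = 1 by rewrite integral_cst// mul1e; exact: probability_setT.
have fact0 j : (0 <= (j`!)%:R^-1 :> R)%R by rewrite invr_ge0.
transitivity (\sum_(j <oo) ((j`!)%:R^-1)%:E * (\int[Q]_t (Y t ^+ j)%:E * s j)).
  transitivity (\int[Q]_t \sum_(j <oo) ((Y t ^+ j)%:E * (((j`!)%:R^-1)%:E * s j))).
    apply: eq_integral => t _.
    have := @lin_expR (fun=> 0%R) 0 (- Y t)%R (fun=> lexx _).
    rewrite ltrN2 Y1 => /(_ isT); rewrite addr0.
    under [in X in _ = _ * X]eq_integral do rewrite expr0.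
    rewrite I1 mule1 => <-.
    transitivity (\int[Q]_u \sum_(j <oo) ((Y t * S u) ^+ j / (j`!)%:R)%:E).
      apply: eq_integral => u _; rewrite expR_nneseries; last exact: mulr_ge0 (Y0 t) (S0 u).
      by rewrite expr0 mul1r mulNr opprK.
    rewrite integral_nneseries//.
    - apply: eq_eseriesr => j _; rewrite /s -ge0_integralZl_EFin//.
      + rewrite -ge0_integralZl_EFin ?exprn_ge0//.
        * by apply: eq_integral => u _; rewrite -!EFinM; congr EFin; rewrite exprMn; ring.
        * by move=> u _; rewrite -EFinM lee_fin mulr_ge0// exprn_ge0.
        * by apply/measurable_EFinP; apply: measurable_funM => //; apply: measurable_funX; exact: measurable_lin.
      + by move=> u _; rewrite lee_fin exprn_ge0.
      + by apply/measurable_EFinP; apply: measurable_funX; exact: measurable_lin.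
    - move=> j; apply/measurable_EFinP; apply: measurable_funM => //; apply: measurable_funX.
      by apply: measurable_funM => //; exact: measurable_lin.
    - by move=> j u _; rewrite lee_fin divr_ge0// exprn_ge0// mulr_ge0.
  rewrite integral_nneseries//.
  - apply: eq_eseriesr => j _.
    rewrite ge0_integralZr//; first by rewrite muleCA.
    + by apply/measurable_EFinP; exact: measurable_funX.
    + by move=> t _; rewrite lee_fin exprn_ge0.
    + by rewrite mule_ge0// lee_fin.
  - move=> j; apply: emeasurable_funM; last exact: measurable_cst.
    by apply/measurable_EFinP; exact: measurable_funX.
  - by move=> j t _; rewrite !mule_ge0// lee_fin// exprn_ge0.
transitivity (\int[Q]_t (expR (lin e t))%:E).
  rewrite (eq_integral (fun t => \sum_(j <oo) (lin e t ^+ j / (j`!)%:R)%:E)); last first.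
    by move=> t _; rewrite expR_nneseries// lin_ge0.
  rewrite integral_nneseries//.
  - apply: eq_eseriesr => j _; rewrite ratio_moment//; last by move=> i; exact: ltW.
    rewrite -ge0_integralZl_EFin//.
    + by apply: eq_integral => t _; rewrite -EFinM mulrC.
    + by move=> t _; rewrite lee_fin exprn_ge0// lin_ge0.
    + by apply/measurable_EFinP; exact: measurable_funX.
  - by move=> j; apply/measurable_EFinP; apply: measurable_funM => //; exact: measurable_funX.
  - by move=> j t _; rewrite lee_fin divr_ge0// exprn_ge0// lin_ge0.
transitivity (\int[Q]_t (\prod_(i < k) gmono 0 (- e i)%R (G i t))%:E).
  apply: eq_integral => t _; rewrite /lin expR_sum; congr EFin; apply: eq_bigr => i _.
  by rewrite /gmono expr0 mul1r mulNr opprK.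
have me i : (-1 < - e i)%R by rewrite ltrN2.
rewrite (indep_prod (f := fun i => gmono 0 (- e i)%R))//.
- rewrite -prodEFin; apply: eq_bigr => i _.
  rewrite (gamma_law_scale 0 (a0 i) (me i) (lawG i)) addr0.
  rewrite (eq_integral (cst 1)) ?I1 ?mule1// => t _.
  by rewrite /gmono expr0 mul0r oppr0 expR0 mulr1.
- by move=> i; exact: measurable_gmono.
- by move=> i x; exact: gmono_ge0.
- by move=> i; exact: (gamma_law_moment_lty _ (a0 i) (me i) (lawG i)).
Qed.

End dirichlet_ratio.

Lemma gamma_law_ltr0 (a : R) : gamma_law a `]-oo, 0%R[%classic = 0.
Proof.
rewrite /gamma_law; case: ifPn => a0.
  by rewrite diracE memNset//= in_itv/= ltxx.
rewrite (_ : _ `&` _ = set0) ?integral_set0//.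
by apply/seteqP; split => x //=; rewrite !in_itv/= andbT => -[x0 /lt_trans /(_ x0)]; rewrite ltxx.
Qed.

Lemma gamma_law_set0 (a : R) : (0 < a)%R -> gamma_law a [set 0%R] = 0.
Proof.
move=> a0; rewrite /gamma_law gt_eqF// (_ : _ `&` _ = set0) ?integral_set0//.
by apply/seteqP; split => x //= [->]; rewrite in_itv/= ltxx.
Qed.

End markov_krein.

(** * From Dirichlet vectors to means of Dirichlet processes *)

Section dirichlet_transform.
Context {R : realType}.
Notation lambda := (@lebesgue_measure R).
Notation RR := (measurableTypeR R).
Local Open Scope ereal_scope.
Lemma dirichlet_mean_transform k (a : 'I_k -> R) d (Om : measurableType d)
    (Pr : probability Om R) (V : 'I_k -> Om -> R) (tau l : R) (c : 'I_k -> R) :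
  has_dirichlet_law a Pr V -> (forall i, measurable_fun [set: Om] (V i)) ->
  (forall i, 0 <= a i)%R -> (\sum_(i < k) a i = tau)%R -> (0 < tau)%R ->
  (0 < l)%R -> (forall i, 0 <= c i)%R ->
  \int[Pr]_w ((1 + l * \sum_(i < k) c i * V i w) `^ (- tau))%:E =
  (\prod_(i < k) (1 + l * c i) `^ (- a i))%:E.
Proof.
move=> [d' [T [Q [G [indG lawG lawV]]]]] mV a0 suma tau0 l0 c0.
pose X w := (\sum_(i < k) c i * V i w)%R.
pose X' t := (\sum_(i < k) c i * (G i t / \sum_(j < k) G j t))%R.
pose Phi (x : R) := ((1 + l * x) `^ (- tau))%:E.
have mPhi : measurable_fun [set: RR] Phi.
  apply/measurable_EFinP; apply: measurable_fun_powR; exact: measurable_funD.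
have Phi0 x : 0 <= Phi x by rewrite lee_fin powR_ge0.
have mX : measurable_fun [set: Om] X.
  by apply: measurable_sum => i; apply: measurable_funM.
have minv := @measurable_fun_inv R.
have mG i : measurable_fun [set: T] (G i : T -> R) := measurable_funP (G i).
have mX' : measurable_fun [set: T] X'.
  apply: measurable_sum => i; apply: measurable_funM => //; apply: measurable_funM => //.
  by apply: (measurableT_comp minv); exact: measurable_sum.
have XX' (A : set RR) : measurable A -> pushforward Pr X A = pushforward Q X' A.
  move=> mA; rewrite /pushforward.
  pose h (v : k.-tuple RR) : RR := (\sum_(i < k) c i * tnth v i)%R.
  have mh : measurable_fun [set: k.-tuple RR] h.
    by apply: measurable_sum => ?; apply: measurable_funM => //; exact: measurable_tnth.
  have := lawV (h @^-1` A) _.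
  rewrite -[X in measurable X]setTI => /(_ (mh measurableT A mA)).
  rewrite (_ : [set w | _] = X @^-1` A); last first.
    by apply/funext => w /=; rewrite /h/=; congr (A _); apply: eq_bigr => j _; rewrite tnth_mktuple.
  rewrite (_ : [set t | _] = X' @^-1` A)//.
  by apply/funext => w /=; rewrite /h/=; congr (A _); apply: eq_bigr => j _; rewrite tnth_mktuple.
transitivity (\int[pushforward Pr X]_x Phi x).
  by rewrite ge0_integral_pushforward.
rewrite (@eq_measure_integral _ _ _ _ (pushforward Q X')); last first.
  by move=> A mA _; exact: XX'.
rewrite ge0_integral_pushforward// preimage_setT.
(* D exceeds every 1 + l c_i, so 1 + l c_i = D (1 - e_i) with 0 <= e_i < 1, the range of
   [dirichlet_ratio]; as the a_i add up to tau, D^(- tau) factors out of the product. *)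
pose D := (1 + \sum_(i < k) (1 + l * c i))%R.
have lc i : (0 <= l * c i)%R by rewrite mulr_ge0// ltW.
have D0 i : (1 + l * c i < D)%R.
  rewrite /D (bigD1 i)//= addrCA ltrDl ltr_pwDl// sumr_ge0// => j _.
  by rewrite addr_ge0.
have Dp : (0 < D)%R by rewrite /D ltr_pwDl// sumr_ge0// => j _; rewrite addr_ge0.
pose e i := (1 - (1 + l * c i) / D)%R.
have e0 i : (0 <= e i)%R by rewrite subr_ge0 ler_pdivrMr// mul1r ltW.
have e1 i : (e i < 1)%R by rewrite ltrBlDr ltrDl divr_gt0// ltr_pwDl.
have -> : (\prod_(i < k) (1 + l * c i) `^ (- a i))%:E = (D `^ (- tau))%:E * (\prod_(i < k) (1 - e i) `^ (- a i))%:E.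
  rewrite -EFinM; congr EFin.
  have -> : (D `^ (- tau) = \prod_(i < k) D `^ (- a i))%R.
    rewrite -suma -sumrN; elim/big_rec2 : _ => [|i x y _ <-]; first by rewrite powRr0.
    by rewrite powRD// (gt_eqF Dp) implybT.
  rewrite -big_split/=; apply: eq_bigr => i _; rewrite -powRM ?(ltW Dp)//; last first.
    by rewrite subr_ge0 ltW.
  by congr powR; rewrite /e; field; rewrite gt_eqF.
rewrite -(dirichlet_ratio indG a0 lawG suma tau0 e0 e1) -ge0_integralZl_EFin; last 4 first.
- exact: measurableT.
- by move=> t _; rewrite lee_fin powR_ge0.
- apply/measurable_EFinP; apply: measurable_fun_powR; apply: measurable_funB => //.
  have mabs i : measurable_fun [set: T] (fun t => `|G i t|%R).
    by apply: measurableT_comp => //; exact: normr_measurable.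
  apply: measurable_funM; first by apply: measurable_sum => i; exact: measurable_funM.
  by apply: (measurableT_comp minv); apply: measurable_sum => j.
- exact: powR_ge0.
have mGi (B : set RR) i : measurable B -> measurable (G i @^-1` B).
  by move=> mB; rewrite -[_ @^-1` _]setTI; exact: (measurable_funP (G i)).
have [i1 ai1] : exists i, (0 < a i)%R.
  apply: contrapT => /forallNP h; move: tau0; rewrite -suma big1 ?ltxx// => i _.
  by apply/eqP; rewrite eq_le a0 andbT leNgt; apply/negP/h.
apply: ge0_ae_eq_integral => //.
- exact: (measurableT_comp mPhi).
- apply/measurable_EFinP; apply: measurable_funM => //; apply: measurable_fun_powR; apply: measurable_funB => //.
  have mabs i : measurable_fun [set: T] (fun t => `|G i t|%R).
    by apply: measurableT_comp => //; exact: normr_measurable.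
  apply: measurable_funM; first by apply: measurable_sum => i; exact: measurable_funM.
  by apply: (measurableT_comp minv); apply: measurable_sum => j.
- by move=> t _; exact: Phi0.
- by move=> t _; rewrite -EFinM lee_fin mulr_ge0 ?powR_ge0.
(* Almost surely the G_i are nonnegative, so the absolute values of [dirichlet_ratio] drop out, and
   one positive parameter makes the sum positive. *)
have N1 : {ae Q, forall t, forall i, (0 <= G i t)%R}.
  apply: filter_forall => i.
  exists (G i @^-1` `]-oo, 0%R[); split; first exact: mGi.
    by rewrite -[LHS]/(distribution Q (G i) `]-oo, 0%R[%classic) lawG// gamma_law_ltr0.
  by move=> t /= /negP; rewrite -ltNge in_itv.
have N2 : {ae Q, forall t, G i1 t != 0%R}.
  exists (G i1 @^-1` [set 0%R]); split; first exact: mGi.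
    by rewrite -[LHS]/(distribution Q (G i1) [set 0%R : RR]) lawG ?measurable_set1// gamma_law_set0.
  by move=> t /= /negP; rewrite negbK => /eqP.
apply: filterS2 N1 N2 => t Gt0 Gi1 _.
rewrite /= /Phi -EFinM; congr EFin.
have Gabs i : `|G i t|%R = G i t by rewrite ger0_norm.
have Sp : (0 < \sum_(j < k) G j t)%R.
  rewrite (bigD1 i1)//= ltr_pwDl//; first by rewrite lt_def Gi1 Gt0.
  by apply: sumr_ge0 => j _; exact: Gt0.
under [in RHS]eq_bigr do rewrite Gabs.
under [in X in (_ / X)%R]eq_bigr do rewrite Gabs.
rewrite -powRM ?(ltW Dp)//; last first.
  rewrite subr_ge0 ler_pdivrMr// mul1r; apply: ler_sum => i _.
  by rewrite ler_piMl// ltW.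
congr powR.
have h : (\sum_(i < k) e i * G i t = \sum_(j < k) G j t - (\sum_(i < k) (1 + l * c i) * G i t) / D)%R.
  rewrite mulr_suml -sumrB; apply: eq_bigr => i _; rewrite /e; ring.
rewrite h.
have h2 : (\sum_(i < k) (1 + l * c i) * G i t = \sum_(j < k) G j t + l * \sum_(i < k) c i * G i t)%R.
  by rewrite mulr_sumr -big_split/=; apply: eq_bigr => i _; ring.
rewrite h2 /X'.
have -> : (\sum_(i < k) c i * (G i t / \sum_(j < k) G j t) = (\sum_(i < k) c i * G i t) / \sum_(j < k) G j t)%R.
  by rewrite mulr_suml; apply: eq_bigr => i _; rewrite mulrA.
move: Sp; set Z := (\sum_(j < k) G j t)%R => Sp.
by field; rewrite !gt_eqF.
Qed.
Import HBNNSimple.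
Lemma integral_partition d (X : measurableType d) (nu : {measure set X -> \bar R}) k
    (C : 'I_k -> set X) (c : 'I_k -> R) (f : X -> R) :
  (forall i, measurable (C i)) -> trivIset [set: 'I_k] C ->
  \bigcup_(i in [set: 'I_k]) C i = [set: X] ->
  (forall i, 0 <= c i)%R -> (forall i x, C i x -> f x = c i) ->
  \int[nu]_x (f x)%:E = \sum_(i < k) (c i)%:E * nu (C i).
Proof.
move=> mC tC UC c0 fc.
have fE x : f x = (\sum_(i < k) c i * \1_(C i) x)%R.
  have [i _ Ci] : (\bigcup_(i in [set: 'I_k]) C i) x by rewrite UC.
  rewrite (bigD1 i)//= indicE mem_set// mulr1 big1 ?addr0 ?(fc i)// => j ji.
  rewrite indicE memNset ?mulr0// => Cj; move/eqP : ji; apply.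
  by apply: tC => //; exists x.
under eq_integral do rewrite fE -sumEFin.
rewrite ge0_integral_sum//.
- apply: eq_bigr => i _; under eq_integral do rewrite EFinM.
  rewrite ge0_integralZl_EFin//; last exact/measurable_EFinP.
  by rewrite integral_indic// setIT.
- by move=> i; apply/measurable_EFinP; apply: measurable_funM.
- by move=> i x _; rewrite lee_fin mulr_ge0.
Qed.

Lemma dirichlet_process_simple (tau l : R) (K : probability RR R) (K0 : set RR -> \bar R)
    d (Om : measurableType d) (Pr : probability Om R) (P : R.-pker Om ~> RR) (f : {nnsfun RR >-> R}) :
  (forall A, measurable A -> K0 A = K A) -> (0 < tau)%R -> (0 < l)%R ->
  is_dirichlet_process tau K0 Pr P ->
  \int[Pr]_w ((1 + l * fine (\int[P w]_x (f x)%:E)) `^ (- tau))%:E =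
  (expR (- (tau * fine (\int[K]_x (ln (1 + l * f x))%:E))))%:E.
Proof.
move=> KE tau0 l0 DP.
have /finite_seqP[s0 s0E] : finite_set (range f) by exact: fimfunP.
(* Distinct values make the level sets, indexed by position in the list, disjoint. *)
pose s := undup s0.
have su : uniq s by exact: undup_uniq.
have sE y : (y \in s) = (y \in s0) by rewrite mem_undup.
have sP x : f x \in s.
  by rewrite sE; have := imageT f x; rewrite s0E.
pose c (i : 'I_(size s)) : R := s`_i.
have c0 i : (0 <= c i)%R.
  have : c i \in s by exact: mem_nth.
  rewrite sE => h; have : [set` s0] (c i) by [].
  by rewrite -s0E => -[x _ <-].
pose C (i : 'I_(size s)) : set RR := f @^-1` [set c i].
have mC i : measurable (C i) by exact: measurable_sfunP.
have tC : trivIset [set: 'I_(size s)] C.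
  move=> i j _ _ [x [/= fi fj]]; apply/val_inj/eqP.
  have <- := nth_uniq 0%R (ltn_ord i) (ltn_ord j) su.
  by apply/eqP; exact: (etrans (esym fi) fj).
have UC : \bigcup_(i in [set: 'I_(size s)]) C i = [set: RR].
  apply/seteqP; split => // x _.
  have h : (index (f x) s < size s)%N by rewrite index_mem.
  by exists (Ordinal h) => //; rewrite /C /c/= nth_index.
have fC i x : C i x -> f x = c i by [].
pose V i w := fine (P w (C i)).
have Pfin w i : P w (C i) \is a fin_num.
  rewrite ge0_fin_numE// (@le_lt_trans _ _ 1)// ?ltry// -(prob_kernel (s := P) w).
  by apply: le_measure; rewrite ?inE.
have mV i : measurable_fun [set: Om] (V i).
  apply: (measurableT_comp (fine_measurable measurableT)) => //.
  exact: measurable_kernel.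
have sumK : (\sum_i tau * fine (K0 (C i)) = tau)%R.
  rewrite -mulr_sumr -[RHS]mulr1; congr (_ * _)%R; apply: EFin_inj.
  rewrite -sumEFin; transitivity (\int[K]_x (cst 1%R x)%:E); last first.
    by rewrite -[LHS]/(\int[K]_x (cst 1 x)) integral_cst// mul1e; exact: probability_setT.
  rewrite (@integral_partition _ _ K _ C (fun=> 1%R) (cst 1%R))//.
  by apply: eq_bigr => i _; rewrite mul1e KE// fineK// fin_num_measure.
have a0 i : (0 <= tau * fine (K0 (C i)))%R.
  by rewrite mulr_ge0 ?(ltW tau0)// KE// fine_ge0.
have := dirichlet_mean_transform (DP _ C mC tC UC) mV a0 sumK tau0 l0 c0.
under eq_integral => w _.
  rewrite (_ : (\sum_(i < size s) c i * V i w)%R = fine (\int[P w]_x (f x)%:E)); last first.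
    apply: EFin_inj; rewrite (@integral_partition _ _ (P w) _ C c f)//.
    rewrite fineK -?sumEFin; last by apply/sum_fin_numP => i _ _; rewrite fin_numM.
    by apply: eq_bigr => i _; rewrite EFinM /V fineK.
  over.
move=> ->; congr EFin.
have lc i : (0 < 1 + l * c i)%R by rewrite ltr_pwDl// mulr_ge0// ltW.
rewrite (@integral_partition _ _ K _ C (fun i => ln (1 + l * c i)%R))//; last 2 first.
- by move=> i; rewrite ln_ge0// lerDl mulr_ge0// ltW.
- by move=> i x /fC ->.
rewrite (_ : \sum_(i < _) _ = (\sum_(i < size s) ln (1 + l * c i) * fine (K0 (C i)))%R%:E); last first.
  by rewrite -sumEFin; apply: eq_bigr => i _; rewrite EFinM KE// fineK// fin_num_measure.
rewrite mulr_sumr -sumrN expR_sum; apply: eq_bigr => i _.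
by rewrite /powR gt_eqF//; congr expR; ring.
Qed.
(** Monotone convergence, applied below with the identity for the random measure and with ln (1 + l
    x) for its base measure. *)
Lemma cvg_nnsfun_integral (nu : {measure set RR -> \bar R}) (phi : R -> R) (f_ : nat -> {nnsfun RR >-> R}) (g : R -> R) :
  measurable_fun [set: R] phi -> (forall x y, 0 <= x -> x <= y -> phi x <= phi y)%R -> phi 0%R = 0%R ->
  (forall x, (0 < x)%R -> {for x, continuous phi}) ->
  (forall n m x, (n <= m)%N -> (f_ n x <= f_ m x)%R) ->
  (forall x, f_ n x @[n --> \oo] --> g x) ->
  \int[nu]_x (phi (f_ n x))%:E @[n --> \oo] --> \int[nu]_x (phi (g x))%:E.
Proof.
move=> mphi ndphi phi0 cphi ndf cvf.
have f0 n x : (0 <= f_ n x)%R by [].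
have le n m x : (n <= m)%N -> (phi (f_ n x) <= phi (f_ m x))%R.
  by move=> nm; apply: ndphi => //; exact: ndf.
rewrite [X in _ --> X](_ : _ = \int[nu]_x limn (fun n => (phi (f_ n x))%:E)); last first.
  apply: eq_integral => x _; apply/esym/cvg_lim => //.
  apply: cvg_EFin; first exact: nearW.
  have g0 : (0 <= g x)%R.
    by rewrite -(cvg_lim _ (cvf x))//; apply: limr_ge; [apply/cvg_ex; exists (g x)|exact: nearW].
  (* Continuity of [phi] is given on ]0, oo[; where the limit is 0, the nonnegative increasing
     sequence is 0 throughout. *)
  have [gx|gx] := eqVneq (g x) 0%R.
    rewrite (_ : fine \o _ = cst (phi (g x))); first exact: cvg_cst.
    apply/funext => n /=; rewrite gx; congr phi; apply/eqP; rewrite eq_le f0 andbT -gx.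
    rewrite -(cvg_lim _ (cvf x))//; apply: nondecreasing_cvgn_le; last by apply/cvg_ex; exists (g x).
    by move=> a b ab; exact: ndf.
  change (phi (f_ n x) @[n --> \oo] --> phi (g x)).
  apply: (@cvg_comp _ _ _ (fun n => f_ n x) phi _ (nbhs (g x : R))); first exact: cvf.
  by apply: cphi; rewrite lt_def gx.
apply: cvg_monotone_convergence => //.
- by move=> n; apply/measurable_EFinP; apply: (measurableT_comp mphi); exact: measurable_funP.
- by move=> n x _; rewrite lee_fin -phi0; apply: ndphi.
- by move=> x _ n m nm; rewrite lee_fin le.
Qed.

(** In the partition into ]-oo, 0[ and its complement, the negative cell has Dirichlet parameter 0;
    its gamma variable is then 0 almost surely, and so is the ratio. *)
Lemma dirichlet_process_ltr0 (tau : R) (K : probability RR R) (K0 : set RR -> \bar R)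
    d (Om : measurableType d) (Pr : probability Om R) (P : R.-pker Om ~> RR) :
  (forall A, measurable A -> K0 A = K A) -> K `]-oo, 0%R[%classic = 0 ->
  is_dirichlet_process tau K0 Pr P -> {ae Pr, forall w, P w `]-oo, 0%R[%classic = 0}.
Proof.
move=> KE KN DP.
pose C (i : 'I_2) : set RR := if i == ord0 then `]-oo, 0%R[%classic else `[0%R, +oo[%classic.
have mC i : measurable (C i) by rewrite /C; case: ifP.
have mP : measurable_fun [set: Om] (fun w => P w `]-oo, 0%R[%classic) by exact: measurable_kernel.
have [||d' [T [Q [G [_ lawG lawV]]]]] := DP _ C mC.
- move=> i j _ _ [x [/=]]; rewrite /C; case: (eqVneq i ord0) => [->|i0]; case: (eqVneq j ord0) => [->//|j0] /=; rewrite !in_itv/= ?andbT.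
  + by move=> x0; rewrite leNgt x0.
  + by move=> x0 xN; move: xN; rewrite ltNge x0.
  + by move=> _ _; move: i j i0 j0 => [[|[|//]] ?] [[|[|//]] ?]// _ _; exact: val_inj.
- apply/seteqP; split => // x _; have [x0|x0] := ltP x 0%R.
    by exists ord0 => //; rewrite /C eqxx /= in_itv.
  by exists ord_max => //; rewrite /C/= in_itv/= x0.
pose B : set (2.-tuple RR) := [set v | tnth v ord0 = 0%R].
have mB : measurable B.
  rewrite (_ : B = (fun v : 2.-tuple RR => tnth v ord0) @^-1` [set 0%R])//.
  by rewrite -[_ @^-1` _]setTI; apply: measurable_tnth => //; exact: measurable_set1.
have := lawV B mB.
have mGi (A : set RR) i : measurable A -> measurable (G i @^-1` A).
  by move=> mA; rewrite -[_ @^-1` _]setTI; exact: (measurable_funP (G i)).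
have Q1 : Q (G ord0 @^-1` [set 0%R]) = 1.
  rewrite -[LHS]/(distribution Q (G ord0) [set 0%R : RR]) lawG ?measurable_set1//.
  by rewrite /gamma_law /C eqxx KE// KN mulr0 eqxx diracE mem_set.
pose X w := fine (P w `]-oo, 0%R[%classic).
have mX : measurable_fun [set: Om] X.
  by apply: (measurableT_comp (fine_measurable measurableT)).
rewrite (_ : [set w | _] = X @^-1` [set 0%R]); last first.
  by apply/funext => w; rewrite /B /= tnth_mktuple /C eqxx.
have mX0 : measurable (X @^-1` [set 0%R]).
  by rewrite -[_ @^-1` _]setTI; apply: mX => //; exact: measurable_set1.
set D := [set t | _]; move=> XD.
have X1 : Pr (X @^-1` [set 0%R]) = 1.
  apply/eqP; rewrite eq_le probability_le1//= XD -Q1.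
  have mi i : measurable_fun [set: T] (G i : T -> R) := measurable_funP (G i).
  have mD : measurable D.
    rewrite /D /B (_ : [set t | _] = (fun t => \sum_(j < 2) G j t)%R @^-1` [set 0%R] `|` G ord0 @^-1` [set 0%R]).
      apply: measurableU; last exact: mGi.
      by rewrite -[_ @^-1` _]setTI; apply: measurable_sum => //; exact: measurable_set1.
    apply/seteqP; split => t /=; rewrite tnth_mktuple.
      by move=> /eqP; rewrite mulf_eq0 invr_eq0 => /orP[] /eqP; [right|left].
    by move=> [] ->; rewrite ?invr0 ?mulr0 ?mul0r.
  apply: le_measure; rewrite ?inE//.
  by move=> t /= Gt; rewrite /D /B /= tnth_mktuple Gt mul0r.
exists (~` (X @^-1` [set 0%R])); split; first exact: measurableC.
  by rewrite probability_setC// X1 subee.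
move=> w /= h Xw; apply: h.
suff /fineK <- : P w `]-oo, 0%R[%classic \is a fin_num by congr EFin.
rewrite ge0_fin_numE// (@le_lt_trans _ _ 1)// ?ltry// -(prob_kernel (s := P) w).
by apply: le_measure; rewrite ?inE.
Qed.
Lemma ln1D_log_bound (l x : R) : (0 < l)%R -> (0 <= x)%R ->
  (0 <= ln (1 + l * x) <= ln (1 + l) + ln (1 + x))%R.
Proof.
move=> l0 x0; have lx : (0 <= l * x)%R by rewrite mulr_ge0// ltW.
rewrite ln_ge0 ?lerDl//= -lnM ?posrE ?ltr_pwDl//; last exact: ltW.
rewrite ler_ln ?posrE ?mulr_gt0 ?ltr_pwDl//; [nra|exact: ltW].
Qed.

Lemma integrable_ln1D (K : probability RR R) (l : R) : (0 < l)%R ->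
  \int[K]_(x in `]0%R, +oo[) (ln (1 + x))%:E < +oo ->
  K.-integrable (`]0%R, +oo[%classic : set RR) (fun x : R => (ln (1 + l * x))%:E).
Proof.
move=> l0 Klog.
have mln (c : R) : measurable_fun [set: R] (fun x : R => ln (1 + c * x)%R).
  by apply: (measurableT_comp (@measurable_ln R)); apply: measurable_funD => //; exact: measurable_funM.
have mln1 : measurable_fun [set: R] (fun x : R => ln (1 + x)%R).
  by apply: (measurableT_comp (@measurable_ln R)); exact: measurable_funD.
apply/integrableP; split; first by apply/measurable_EFinP; apply: measurable_funTS; exact: mln.
apply: (@le_lt_trans _ _ (\int[K]_(x in (`]0%R, +oo[%classic : set RR)) ((ln (1 + l))%:E + (ln (1 + x))%:E))).
  apply: ge0_le_integral => //.
  - apply: measurableT_comp => //; apply/measurable_EFinP; apply: measurable_funTS; exact: mln.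
  - by apply/measurable_EFinP; apply: measurable_funD => //; exact: measurable_funTS.
  - move=> x /=; rewrite in_itv/= andbT => x0.
    have /andP[h1 h2] := ln1D_log_bound l0 (ltW x0).
    by rewrite -EFinD lee_fin ger0_norm.
rewrite ge0_integralD//.
- apply: lte_add_pinfty => //; rewrite integral_cst//.
  rewrite lte_mul_pinfty ?lee_fin ?ln_ge0 ?lerDl ?(ltW l0)//.
  by rewrite (le_lt_trans (probability_le1 _ _))// ltry.
- by move=> x /=; rewrite in_itv/= andbT => x0; rewrite lee_fin ln_ge0// lerDl ltW.
- by move=> x /=; rewrite in_itv/= andbT => x0; rewrite lee_fin ln_ge0// lerDl ltW.
- by apply/measurable_EFinP; exact: measurable_funTS.
Qed.

(* Bounded convergence transfers the Dirichlet identity from simple functions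
   increasing to [x |-> max(x, 0)]. *)
Lemma markov_krein (tau : R) (K : probability RR R) (K0 : set RR -> \bar R) (mu : probability RR R) :
  (forall A, measurable A -> K0 A = K A) -> K `]-oo, 0%R[%classic = 0 ->
  \int[K]_(x in `]0%R, +oo[) (ln (1 + x))%:E < +oo -> (0 < tau)%R ->
  dirichlet_mean_law tau K0 mu ->
  mu `]-oo, 0%R[%classic = 0 /\
  forall l : R, (0 < l)%R -> \int[mu]_y ((1 + l * y) `^ (- tau))%:E =
    (expR (- (tau * (\int[K]_(x in `]0%R, +oo[) ln (1 + l * x))%R)))%:E.
Proof.
move=> KE KN Klog tau0 [d [Om [Pr [P [M [DP PM muM]]]]]].
have PN := dirichlet_process_ltr0 KE KN DP.
pose g (x : R) := Num.max x 0%R.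
have mg : measurable_fun [set: R] g by exact: measurable_funrpos.
have mgE : measurable_fun [set: RR] (EFin \o g) by exact/measurable_EFinP.
pose f_ := nnsfun_approx measurableT mgE.
have g0 x : (0 <= g x)%R by rewrite le_max lexx orbT.
have cvf x : f_ n x @[n --> \oo] --> g x.
  have /fine_cvgP[_] : (EFin \o (f_ ^~ x)) n @[n --> \oo] --> (g x)%:E.
    by apply: cvg_nnsfun_approx => // y _; rewrite lee_fin.
  exact.
have ndf n m x : (n <= m)%N -> (f_ n x <= f_ m x)%R by move=> nm; exact/lefP/nd_nnsfun_approx.
(* Almost every realization of P ignores the negative axis, so replacing x by max(x, 0) changes no
   mean, and the new integrand is a limit of nonnegative simple functions. *)
have PMg : {ae Pr, forall w, \int[P w]_x (g x)%:E = (M w)%:E /\ (0 <= M w)%R}.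
  apply: filterS2 PN PM => w w0 wM.
  have E : \int[P w]_x (g x)%:E = (M w)%:E.
    rewrite -wM; apply: ae_eq_integral => //.
    exists `]-oo, 0%R[%classic; split => //.
    move=> x /= h; rewrite in_itv/= ltNge; apply/negP => x0; apply: h => _.
    by rewrite /g max_l.
  by split => //; rewrite -lee_fin -E integral_ge0// => x _; rewrite lee_fin.
have mM : measurable_fun [set: Om] (M : Om -> R) := measurable_funP M.
split.
  rewrite muM// /distribution /pushforward.
  have [N [mN N0 NP]] := PMg.
  apply/eqP; rewrite -measure_le0 -N0; apply: le_measure; rewrite ?inE//.
    by rewrite -[_ @^-1` _]setTI; exact: mM.
  move=> w /=; rewrite in_itv/= => Mw; apply: NP => /= -[_].
  by rewrite leNgt Mw.
move=> l l0.
have mPhi : measurable_fun [set: RR] (fun y : R => ((1 + l * y) `^ (- tau))%:E).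
  apply/measurable_EFinP; apply: measurable_fun_powR.
  by apply: measurable_funD => //; exact: measurable_funM.
transitivity (\int[Pr]_w ((1 + l * M w) `^ (- tau))%:E).
  rewrite (@eq_measure_integral _ _ _ _ (distribution Pr M)); last by move=> A mA _; exact: muM.
  by rewrite ge0_integral_distribution// => y; rewrite lee_fin powR_ge0.
pose I n w := fine (\int[P w]_x (f_ n x)%:E).
pose J n := fine (\int[K]_x (ln (1 + l * f_ n x))%:E).
have I0 n w : (0 <= I n w)%R by rewrite fine_ge0// integral_ge0// => x _; rewrite lee_fin.
have lp x : (0 <= x)%R -> (0 < 1 + l * x)%R by move=> x0; rewrite ltr_pwDl// mulr_ge0// ltW.
have mI n : measurable_fun [set: Om] (I n).
  apply: (measurableT_comp (fine_measurable measurableT)).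
  apply: measurable_fun_integral_kernel => //.
    by move=> A mA; exact: measurable_kernel.
    by move=> z; rewrite lee_fin.
  exact/measurable_EFinP/measurable_funP.
have IJ n : \int[Pr]_w ((1 + l * I n w) `^ (- tau))%:E = (expR (- (tau * J n)))%:E.
  exact: (dirichlet_process_simple (f_ n) KE tau0 l0 DP).
have cvL : \int[Pr]_w ((1 + l * I n w) `^ (- tau))%:E @[n --> \oo] --> \int[Pr]_w ((1 + l * M w) `^ (- tau))%:E.
  have mp n : measurable_fun [set: Om] (fun w => ((1 + l * I n w) `^ (- tau))%:E).
    apply/measurable_EFinP; apply: measurable_fun_powR.
    by apply: measurable_funD => //; exact: measurable_funM.
  have [] // := @dominated_convergence _ _ _ Pr setT measurableT
    (fun n w => ((1 + l * I n w) `^ (- tau))%:E) (fun w => ((1 + l * M w) `^ (- tau))%:E) (cst 1).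
  - apply/measurable_EFinP; apply: measurable_fun_powR.
    by apply: measurable_funD => //; exact: measurable_funM.
  - apply: filterS PMg => w [Mw M0] _.
    apply: cvg_EFin; first exact: nearW.
    have cI : I n w @[n --> \oo] --> (M w : R).
      have /fine_cvgP[_] // : \int[P w]_x (f_ n x)%:E @[n --> \oo] --> (M w)%:E.
      rewrite -Mw; apply: (@cvg_nnsfun_integral (P w) id f_ g) => //.
      by move=> x _; exact: cvg_id.
    apply: (@cvg_comp _ _ _ (fun n => I n w) (fun y => (1 + l * y) `^ (- tau))%R _ (nbhs (M w : R))) => //.
    have D1 := der_add (der_cst (M w : R) 1%R) (der_mull l (der_id (M w : R))).
    have D2 := @der_powR _ (fun y : R => 1 + l * y)%R (M w) _ (- tau) (lp _ M0) D1.
    exact: der_continuous D2.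
  - by apply/integrableP; split => //; under eq_integral do rewrite abse1; rewrite -[X in X < _]/(\int[Pr]_w cst 1 w) integral_cst// mul1e (le_lt_trans (probability_le1 _ _))// ltry.
  - apply: nearW => w n _; rewrite lee_fin ger0_norm ?powR_ge0//.
    have p1 : (1 `^ (- tau) = 1 :> R)%R by rewrite powR1.
    rewrite -[leRHS]p1; apply: ler_powRN_base => //; first exact: ltW.
    by rewrite lerDl mulr_ge0// ltW.
have cvJ : J n @[n --> \oo] --> (\int[K]_(x in `]0%R, +oo[) ln (1 + l * x))%R.
  have /fine_cvgP[_] // : \int[K]_x (ln (1 + l * f_ n x))%:E @[n --> \oo] --> (\int[K]_(x in `]0%R, +oo[) ln (1 + l * x))%R%:E.
  rewrite -EFin_Rintegral//; last exact: integrable_ln1D.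
  rewrite (_ : \int[K]_(x in _) _ = \int[K]_x (ln (1 + l * g x))%:E).
    apply: (@cvg_nnsfun_integral K (fun y => ln (1 + l * y)) f_ g) => //.
    - by apply: (measurableT_comp (@measurable_ln R)); apply: measurable_funD => //; exact: measurable_funM.
    - move=> x y x0 xy; rewrite ler_ln ?posrE ?lp//; last exact: le_trans xy.
      by rewrite lerD2l ler_wpM2l// ltW.
    - by rewrite mulr0 addr0 ln1.
    - move=> x x0; have D1 := der_add (der_cst x 1%R) (der_mull l (der_id x)).
      have D2 := @der_ln _ (fun y : R => 1 + l * y)%R x _ (lp _ (ltW x0)) D1.
      exact: der_continuous D2.
  rewrite integral_mkcond; apply: eq_integral => x _; rewrite patchE.
  case: ifPn; rewrite ?inE/= ?in_itv/= ?andbT => x0.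
    by rewrite /g max_l// ltW.
  have {}x0 : (x <= 0)%R.
    by rewrite leNgt; apply: contra x0; rewrite inE/= in_itv/= andbT.
  by rewrite /g max_r// mulr0 addr0 ln1.
have cvR : (expR (- (tau * J n)))%:E @[n --> \oo] -->
    (expR (- (tau * (\int[K]_(x in `]0%R, +oo[) ln (1 + l * x))%R)))%:E.
  apply: cvg_EFin; first exact: nearW.
  apply: (@cvg_comp _ _ _ J (fun y => expR (- (tau * y)))%R _ _ _ cvJ).
  exact: der_continuous (der_expR (der_opp (der_mull tau (der_id _)))).
rewrite -(cvg_lim _ cvL)// -(cvg_lim _ cvR)//.
by congr (limn _); apply/funext => n.
Qed.
End dirichlet_transform.

(** * A Stieltjes representation from the theorem of Cauchy *)

Section cauchy.
Context {R : realType}.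
Notation lambda := (@lebesgue_measure R).
Notation RR := (measurableTypeR R).
Lemma der_Rintegral d (Y : measurableType d) (mu : {measure set Y -> \bar R}) (B : set Y)
    (f df : R -> Y -> R) (G : Y -> R) (a u v : R) : measurable B -> u < a < v ->
  (forall x, u < x < v -> mu.-integrable B (EFin \o f x)) ->
  (forall x y, u < x < v -> B y -> is_derive x 1 (f ^~ y) (df x y)) ->
  (forall y, 0 <= G y) -> mu.-integrable B (EFin \o G) ->
  (forall x y, u < x < v -> B y -> `|df x y| <= G y) ->
  is_derive a 1 (fun x => \int[mu]_(y in B) f x y) (\int[mu]_(y in B) df a y).
Proof.
move=> mB uav intf derf G0 intG dfG.
have I x : `]u, v[%classic x -> u < x < v by rewrite /= in_itv.
have Ia : `]u, v[%classic a by rewrite /= in_itv.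
have derf1 x y : `]u, v[%classic x -> B y -> derivable (f ^~ y) x 1.
  by move=> /I Ix By; have [] := derf x y Ix By.
have d1E x y : u < x < v -> B y -> partial1of2 f x y = df x y.
  by move=> Ix By; rewrite partial1of2E; have [_] := derf x y Ix By.
have Gub x y : `]u, v[%classic x -> B y -> `|partial1of2 f x y| <= G y.
  by move=> /I Ix By; rewrite d1E// dfG.
have intf' x : `]u, v[%classic x -> mu.-integrable B (EFin \o f x) by move=> /I; exact: intf.
have D := derivable_under_integral mB Ia intf' derf1 G0 intG Gub.
have DE := differentiation_under_integral mB Ia intf' derf1 G0 intG Gub.
apply: DeriveDef => //; rewrite -derive1E DE.
by apply: eq_Rintegral => y; rewrite inE => By; exact: d1E.
Qed.

Lemma MVT_bound (f df : R -> R) (a b C : R) : a <= b ->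
  (forall x, a < x < b -> is_derive x 1 f (df x)) -> {within `[a, b], continuous f} ->
  (forall x, a < x < b -> `|df x| <= C) -> `|f b - f a| <= C * (b - a).
Proof.
move=> ab df_ cf dC; have [->|nab] := eqVneq a b; first by rewrite !subrr normr0 mulr0.
have {nab}ab : a < b by rewrite lt_neqAle nab.
have dfab x : x \in `]a, b[ -> is_derive x 1 f (df x) by rewrite in_itv; exact: df_.
have [c cab ->] := MVT ab dfab cf.
rewrite normrM [`|b - a|]ger0_norm ?subr_ge0 ?(ltW ab)// ler_wpM2r ?subr_ge0 ?(ltW ab)//.
by apply: dC; move: cab; rewrite in_itv.
Qed.

Lemma der_within (f df : R -> R) (a b : R) :
  (forall x, a <= x <= b -> is_derive x 1 f (df x)) -> {within `[a, b], continuous f}.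
Proof.
move=> D; apply: derivable_within_continuous => x; rewrite in_itv/= => xab.
by have [] := D x xab.
Qed.

Lemma FTC_der (F f : R -> R) (a b : R) : a < b ->
  (forall x, a <= x <= b -> is_derive x 1 F (f x)) -> {within `[a, b], continuous f} ->
  \int[lambda]_(x in `[a, b]) f x = F b - F a.
Proof.
move=> ab D cf; rewrite /Rintegral (continuous_FTC2 ab cf (F := F))//.
- have cF x : a <= x <= b -> {for x, continuous F} by move=> /D; exact: der_continuous.
  split.
  + move=> x; rewrite in_itv/= => /andP[ax xb].
    by have [] : is_derive x 1 F (f x) by apply: D; rewrite !ltW.
  + by apply: cvg_at_right_filter; apply: cF; rewrite lexx ltW.
  + by apply: cvg_at_left_filter; apply: cF; rewrite lexx ltW.
- move=> x; rewrite in_itv/= => /andP[ax xb].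
  have [_ <-] : is_derive x 1 F (f x) by apply: D; rewrite !ltW.
  by rewrite derive1E.
Qed.

Lemma within_continuous (f : R -> R) (a b : R) :
  (forall x, a <= x <= b -> {for x, continuous f}) -> {within `[a, b], continuous f}.
Proof. by move=> cf; apply: continuous_in_subspaceT => x; rewrite inE/= in_itv/=; exact: cf. Qed.

Lemma integrable_within (f : R -> R) (a b : R) :
  {within `[a, b], continuous f} -> lambda.-integrable `[a, b] (EFin \o f).
Proof.
move=> cf; apply: continuous_compact_integrable => //; exact: segment_compact.
Qed.

Lemma Rdominated_cvg d (X : measurableType d) (mu : {measure set X -> \bar R}) (D : set X)
    (f_ : nat -> X -> R) (f g : X -> R) : measurable D ->
  (forall n, measurable_fun D (f_ n)) -> measurable_fun D f ->
  {ae mu, forall x, D x -> f_ n x @[n --> \oo] --> f x} ->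
  mu.-integrable D (EFin \o g) -> (forall n x, D x -> `|f_ n x| <= g x) ->
  \int[mu]_(x in D) f_ n x @[n --> \oo] --> \int[mu]_(x in D) f x.
Proof.
move=> mD mf_ mf cvf ig fg.
have [] := @dominated_convergence _ _ _ mu D mD (fun n x => (f_ n x)%:E) (EFin \o f) (EFin \o g) _ _ _ ig _.
- by move=> n; exact/measurable_EFinP.
- exact/measurable_EFinP.
- apply: filterS cvf => x cx Dx; apply: cvg_EFin; first exact: nearW.
  exact: cx.
- by apply: nearW => x n Dx; rewrite lee_fin fg.
move=> If _ /= cvI; rewrite /Rintegral; apply: fine_cvg.
by rewrite fineK//; exact: integrable_fin_num.
Qed.

(* The Cauchy-Riemann equation d_phi F2 = t d_t F1 = A for an analytic
   F1 + i F2 makes \int F2(t, phi) dt / t independent of phi; it tends to 0 with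
   phi. *)
Lemma polar_cauchy (F1 F2 A : R -> R -> R) (G : R -> R) (b z : R) : pi < b ->
  (forall t phi : R, 0 < t -> 0 < phi < b -> is_derive t 1 (F1 ^~ phi) (A t phi / t : R)) ->
  (forall t phi : R, 0 < t -> 0 < phi < b -> is_derive phi 1 (F2 t) (A t phi)) ->
  (forall t phi : R, 0 < t -> 0 < phi < b -> {for t, continuous (A ^~ phi)}) ->
  (forall t phi : R, 0 < t -> 0 < phi < b -> {for t, continuous (F2 ^~ phi)}) ->
  (forall phi0 e N, 0 < phi0 <= pi -> 0 < e -> exists C, forall t phi, e <= t <= N -> phi0 <= phi < b -> `|A t phi| <= C) ->
  (forall e, 0 < e -> exists e0 N0, 0 < e0 /\ forall t phi, 0 < phi <= pi -> 0 < t -> (t <= e0 \/ N0 <= t) ->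
     `|F1 t phi| <= e) ->
  (forall t phi : R, 0 < t -> 0 < phi <= pi -> `|F2 t phi / t : R| <= G t) ->
  lambda.-integrable (`]0, +oo[%classic : set RR) (EFin \o G) ->
  (forall t : R, 0 < t -> t != z -> F2 t phi @[phi --> 0^'+] --> 0) ->
  \int[lambda]_(t in `]0, +oo[) (F2 t pi / t) = 0.
Proof.
move=> pib dF1 dF2 cA cF2 Aloc F1small F2G intG F2lim.
have p0 := pi_gt0 R.
(* The sector is truncated to eps n <= t <= N n and ph n <= phi <= pi, a single index driving all
   three limits. *)
pose eps n : R := n.+1%:R^-1.
pose N n : R := n.+2%:R.
pose ph n : R := pi / n.+2%:R.
have eps0 n : 0 < eps n by rewrite invr_gt0.
have epsN n : eps n < N n.
  by rewrite /eps /N (@le_lt_trans _ _ 1) ?invf_le1 ?ler1n// ltr1n.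
have ph0 n : 0 < ph n by rewrite divr_gt0.
have phpi n : ph n < pi by rewrite ltr_pdivrMr// ltr_pMr// ltr1n.
have phb n : ph n < b by rewrite (lt_trans (phpi n)).
have mF2 phi (D : set RR) : measurable D -> (D `<=` `]0, +oo[%classic) -> 0 < phi < b -> measurable_fun D (fun t : R => F2 t phi / t).
  move=> mD Dsub phib; apply: (@measurable_funS _ _ _ _ (`]0, +oo[%classic : set RR)) => //.
  apply: subspace_continuous_measurable_fun => //.
  apply: continuous_in_subspaceT => t; rewrite inE/= in_itv/= andbT => t0.
  apply: continuousM; first exact: cF2.
  by apply: continuousV; [rewrite gt_eqF|exact: cvg_id].
have sub n : (`[eps n, N n]%classic : set RR) `<=` `]0, +oo[%classic.
  by move=> t /=; rewrite !in_itv/= andbT => /andP[+ _]; exact: lt_le_trans.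
have intF2 phi : 0 < phi <= pi -> lambda.-integrable (`]0, +oo[%classic : set RR) (fun t : R => (F2 t phi / t)%:E).
  move=> /andP[phi0 phipi].
  apply: (le_integrable _ _ _ intG) => //.
    by apply/measurable_EFinP; apply: mF2 => //; rewrite phi0 (le_lt_trans phipi).
  move=> t /=; rewrite in_itv/= andbT => t0; rewrite lee_fin.
  by rewrite (le_trans (F2G t phi t0 _)) ?phi0// ler_norm.
pose Q n : set RR := `[eps n, N n]%classic.
have mQ n : measurable (Q n) by exact: measurable_itv.
pose h phi : RR -> R := fun t : R => F2 t phi / t.
pose J n phi := \int[lambda]_(t in Q n) h phi t.
have JE n phi : J n phi = \int[lambda]_(t in (`]0%R, +oo[%classic : set RR)) (h phi \_ (Q n)) t.
  by rewrite /J -Rintegral_mkcondr (setIidr (@sub n)).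
have mh n phi : 0 < phi <= pi -> measurable_fun (`]0, +oo[%classic : set RR) (h phi \_ (Q n)).
  move=> /andP[phi0 phipi]; apply: measurable_funTS.
  have m1 : measurable_fun (Q n) (h phi).
    apply: mF2 => //; first exact: sub.
    by rewrite phi0 (le_lt_trans phipi).
  exact: (measurable_restrictT _ (mQ n)).1 m1.
have hG n phi t : 0 < phi <= pi -> `]0, +oo[%classic t -> `|(h phi \_ (Q n)) t| <= G t.
  move=> phipi /=; rewrite in_itv/= andbT => t0.
  rewrite patchE; case: ifPn => _; first exact: F2G.
  by rewrite normr0 (le_trans _ (F2G t phi t0 phipi)).
have epsS e : 0 < e -> \forall n \near \oo, eps n <= e.
  by move=> e0; apply: filterS (near_infty_natSinv_lt (PosNum e0)) => n /ltW.
have NL r : \forall n \near \oo, r <= N n.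
  by apply: filterS (nbhs_infty_ger r) => n /le_trans; apply; rewrite ler_nat -addn2 leq_addr.
have phc : (forall n, 0 < ph n) /\ ph n @[n --> \oo] --> (0 : R).
  split => //; apply/cvgr0Pnorm_le => e e0; apply: filterS (NL (pi / e)) => n.
  by rewrite ger0_norm ?(ltW (ph0 n))// !ler_pdivrMr// mulrC.
have J0 : J n (ph n) @[n --> \oo] --> (0 : R).
  have phn n : 0 < ph n <= pi by rewrite ph0 ltW.
  have -> : (0 : R) = \int[lambda]_(t in (`]0%R, +oo[%classic : set RR)) (cst 0 t).
    by rewrite /Rintegral integral0.
  rewrite (_ : (fun n => J n (ph n)) = fun n => \int[lambda]_(t in (`]0%R, +oo[%classic : set RR)) (h (ph n) \_ (Q n)) t); last by apply/funext => n; exact: JE.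
  apply: (Rdominated_cvg _ _ _ _ intG) => //.
  - by move=> n; exact: mh.
  (* t = z is left out: no limit of F2 is assumed on the ray phi = 0 at the pole of the kernel. *)
  - exists [set z]; split; [exact: measurable_set1|exact: lebesgue_measure_set1|].
    move=> t /= /not_implyP[]; rewrite in_itv/= andbT => t0; apply: contra_notP => /eqP tz.
    have /cvg_at_rightP/(_ _ phc)/cvgr0Pnorm_le c := F2lim t t0 tz.
    apply/cvgr0Pnorm_le => e e0; apply: filterS (c (e * t) (mulr_gt0 e0 t0)) => n cn.
    rewrite patchE; case: ifPn => _; last by rewrite normr0 ltW.
    by rewrite /h normrM normfV (gtr0_norm t0) ler_pdivrMr.
  - by move=> n t; exact: hG.
have pipi : 0 < (pi : R) <= pi by rewrite pi_gt0 lexx.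
have J1 : J n pi @[n --> \oo] --> \int[lambda]_(t in `]0, +oo[) (F2 t pi / t).
  rewrite (_ : (fun n => J n pi) = fun n => \int[lambda]_(t in (`]0%R, +oo[%classic : set RR)) (h pi \_ (Q n)) t); last by apply/funext => n; exact: JE.
  apply: (Rdominated_cvg _ _ _ _ intG) => //.
  - by move=> n; exact: mh.
  - by apply: mF2 => //; rewrite pib pi_gt0.
  - apply: nearW => t; rewrite /= in_itv/= andbT => t0.
    apply: cvg_near_cst; near=> n; rewrite patchE mem_set// /Q /= in_itv/=; apply/andP; split.
      by near: n; exact: epsS.
    by near: n; exact: NL.
  - by move=> n t; exact: hG.
(* A / t is both the phi-derivative of the integrand and the t-derivative of F1, so the derivative
   of J is the increment of F1 between the two arcs, which [F1small] makes small uniformly in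
   phi. *)
have dJ n phi : 0 < phi <= pi -> is_derive phi 1 (J n) (F1 (N n) phi - F1 (eps n) phi).
  move=> /andP[phi0 phipi]; have phib : phi < b by exact: le_lt_trans pib.
  have [|C AC] := Aloc (phi / 2) (eps n) (N n) _ (eps0 n).
    by rewrite divr_gt0//= ler_pdivrMr// (le_trans phipi)// ler_peMr ?pi_ge0// ler1n.
  have p2 x : phi / 2 < x < b -> 0 < x < b by move=> /andP[+ ->]; rewrite andbT; apply: lt_trans; rewrite divr_gt0.
  have Qt t : Q n t -> 0 < t by move=> /sub; rewrite /= in_itv/= andbT.
  have D : is_derive phi 1 (J n) (\int[lambda]_(t in Q n) (A t phi / t)).
    apply: (@der_Rintegral _ _ lambda (Q n) h (fun p t => A t p / t) (fun=> `|C| / eps n) phi (phi / 2) b) => //.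
    - by rewrite phib andbT ltr_pdivrMr// ltr_pMr// ltr1n.
    - move=> x xb; apply: integrable_within; apply: within_continuous => t /= tQ.
      have t0 : 0 < t by apply: Qt; rewrite /Q /= in_itv.
      apply: continuousM; first by apply: cF2 => //; exact: p2.
      by apply: continuousV; [rewrite gt_eqF|exact: cvg_id].
    - by move=> x t xb /Qt t0; apply: der_mulr; apply: dF2 => //; exact: p2.
    - by move=> t; rewrite divr_ge0// ltW.
    - by apply: integrable_within; apply: within_continuous => t _; exact: cvg_cst.
    - move=> x t xb tQ; have t0 := Qt t tQ; move: tQ; rewrite /Q/= in_itv/= => tQ.
      rewrite normrM normfV (gtr0_norm t0) ler_pM ?invr_ge0 ?(ltW t0)//.
      + by rewrite (le_trans (AC _ _ tQ _)) ?ler_norm//; move/andP : xb => [/ltW -> ->].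
      + by rewrite lef_pV2 ?posrE//; case/andP : tQ.
  apply: der_eq D _; apply: (@FTC_der (F1 ^~ phi) (fun t => A t phi / t)) => //.
  - by move=> t /andP[te _]; apply: dF1; rewrite ?phi0// (lt_le_trans _ te).
  - apply: within_continuous => t /andP[te _]; have t0 : 0 < t by exact: lt_le_trans te.
    apply: continuousM; first by apply: cA => //; rewrite phi0.
    by apply: continuousV; [rewrite gt_eqF|exact: cvg_id].
have JJ : J n pi - J n (ph n) @[n --> \oo] --> (0 : R).
  apply/cvgr0Pnorm_le => e e0.
  have [|e1 [N0 [e10 F1e]]] := F1small (e / pi / 2); first by rewrite !divr_gt0.
  near=> n.
  have E1 : eps n <= e1 by near: n; exact: epsS.
  have E2 : N0 <= N n by near: n; exact: NL.
  apply: (@le_trans _ _ (e / pi * (pi - ph n))).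
    apply: (@MVT_bound _ (fun phi => F1 (N n) phi - F1 (eps n) phi)).
    - exact: ltW.
    - by move=> x /andP[xp /ltW xpi]; apply: dJ; rewrite (lt_trans _ xp).
    - by apply: der_within => x /andP[xp xpi]; apply: dJ; rewrite (lt_le_trans _ xp).
    - move=> x /andP[xp /ltW xpi]; have x0 : 0 < x <= pi by rewrite (lt_trans _ xp).
      apply: le_trans (ler_normB _ _) _.
      rewrite [leRHS]splitr.
      apply: lerD; apply: F1e => //; [by right|by left].
  rewrite -mulrA mulrC -[leRHS]mul1r ler_wpM2r ?(ltW e0)// mulrC ler_pdivrMr// mul1r gerBl ltW//.
have J2 : J n pi @[n --> \oo] --> (0 : R).
  rewrite (_ : (fun n => J n pi) = fun n => J n (ph n) + (J n pi - J n (ph n))); last first.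
    by apply/funext => n /=; rewrite addrC subrK.
  by rewrite -[X in _ --> X](addr0 0); apply: cvgD.
exact: cvg_unique J1 J2.
Unshelve. all: end_near. Qed.
(* The squared modulus and the argument of x e^(i psi) + r. *)
Definition pnorm (x psi r : R) := x ^+ 2 + 2 * x * r * cos psi + r ^+ 2.
Definition parg (x psi r : R) := psi - acot (cot psi + x / r / sin psi).

(** At cos psi = k - 1 the difference of the two sides is (1 - k) (x - r)^2. *)
Lemma pnorm_ge (k x psi r : R) : 0 <= x -> 0 <= r -> k <= 1 -> k - 1 <= cos psi ->
  k * (x ^+ 2 + r ^+ 2) <= pnorm x psi r.
Proof.
move=> x0 r0 k1 kc; rewrite /pnorm.
have : 0 <= 2 * x * r * (cos psi - (k - 1)) by rewrite !mulr_ge0// subr_ge0.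
have : 0 <= (1 - k) * (x - r) ^+ 2 by rewrite mulr_ge0 ?sqr_ge0// subr_ge0.
by set c := cos psi; move=> h1 h2; nra.
Qed.

Lemma pnorm_le (x psi r : R) : 0 <= x -> 0 <= r -> pnorm x psi r <= (x + r) ^+ 2.
Proof.
move=> x0 r0; have := cos_le1 psi; rewrite /pnorm; set c := cos psi => cosle1.
have : 0 <= 2 * x * r * (1 - c) by rewrite !mulr_ge0// subr_ge0.
by move=> h; nra.
Qed.

Lemma pnormE (x psi r : R) : pnorm x psi r = (x + r * cos psi) ^+ 2 + (r * sin psi) ^+ 2.
Proof. by rewrite /pnorm; have := cos2Dsin2 psi; move: (cos psi) (sin psi) => c s h; nra. Qed.

(** The mean value theorem gives sin y >= y cos(pi / 4) on [0, pi / 4]; doubling the angle, sin x =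
    2 sin(x / 2) cos(x / 2) >= x cos(pi / 4)^2 = x / 2. *)
Lemma sin_ge_half (x : R) : 0 <= x <= pi / 2 -> x / 2 <= sin x.
Proof.
move=> /andP[x0 xpi]; have p0 := pi_gt0 R.
have c4 (y : R) : 0 <= y <= pi / 4 -> y * cos (pi / 4) <= sin y.
  move=> /andP[y0 ypi].
  have dsin (u : R) : 0 <= u <= y -> is_derive u 1 (@sin R) (cos u) by move=> _; exact: is_derive_sin.
  have [c] := MVT_segment y0 (fun u _ => is_derive_sin u) (der_within dsin).
  rewrite in_itv/= => /andP[c0 cy]; rewrite sin0 !subr0 => ->.
  by rewrite mulrC ler_wpM2r// leNgt ltr_cos ?in_itv/= -?leNgt; lra.
have cq : cos (pi / 4 : R) ^+ 2 = 1 / 2.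
  have := @cos_mulr2n R (pi / 4); rewrite (_ : pi / 4 *+ 2 = pi / 2); last by rewrite -mulr_natl; field.
  by rewrite cos_pihalf; move: (cos _) => c h; lra.
have c0 : 0 <= cos (pi / 4 : R) by apply: cos_ge0_pihalf; apply/andP; split; lra.
have h := c4 (x / 2); rewrite (_ : x = x / 2 + x / 2); last by field.
rewrite sinD.
have {}h : x / 2 * cos (pi / 4) <= sin (x / 2) by apply: h; apply/andP; split; lra.
have h2 : cos (pi / 4) <= cos (x / 2).
  rewrite leNgt ltr_cos ?in_itv/= -?leNgt; lra.
have s0 : 0 <= sin (x / 2) by apply: le_trans h; rewrite mulr_ge0// divr_ge0.
move: h h2 s0 c0 cq; move: (cos (pi / 4)) (cos (x / 2)) (sin (x / 2)) => q c s h h2 s0 q0 q2.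
have : x / 2 * q * q <= s * c by apply: ler_pM => //; rewrite mulr_ge0// divr_ge0.
by rewrite -mulrA -expr2 q2; lra.
Qed.

Lemma acot_cot (psi : R) : 0 < psi < pi -> acot (cot psi) = psi.
Proof.
move=> /andP[p0 p1]; have s0 : sin psi != 0 by rewrite gt_eqF// sin_gt0_pi// p0.
rewrite /acot /cot (_ : cos psi / sin psi = tan (pi / 2 - psi)); last first.
  rewrite /tan sinB cosB cos_pihalf sin_pihalf !mul0r !mul1r ?subr0 ?add0r ?addr0//.
have -> : atan (tan (pi / 2 - psi)) = pi / 2 - psi by apply: tanK; rewrite in_itv/=; apply/andP; split; lra.
by rewrite opprB addrC subrK.
Qed.

Lemma parg_bound (x psi r : R) : 0 <= x -> 0 < r -> 0 < psi < pi -> 0 <= parg x psi r <= psi.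
Proof.
move=> x0 r0 pp; have s0 : 0 < sin psi by exact: sin_gt0_pi.
rewrite /parg; apply/andP; split.
  rewrite subr_ge0 -[leRHS]acot_cot// /acot lerD2l lerN2 le_atan//.
  by rewrite lerDl !divr_ge0// ltW.
by rewrite gerBl /acot subr_ge0 ltW// atan_ltpi2.
Qed.

Lemma der_pnorm_x (x psi r : R) : is_derive x 1 (fun u => pnorm u psi r) (2 * (x + r * cos psi)).
Proof.
have D1 := der_mul (der_id x) (der_id x).
have D2 := der_add (der_add D1 (der_mulr (2 * r * cos psi) (der_id x))) (der_cst x (r ^+ 2)).
rewrite (_ : (fun u => _) = (fun t => t * t + t * (2 * r * cos psi) + r ^+ 2)); last first.
  by apply/funext => u; rewrite /pnorm; ring.
apply: der_eq D2 _; ring.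
Qed.

Lemma der_pnorm_psi (x psi r : R) : is_derive psi 1 (fun p => pnorm x p r) (- (2 * x * r * sin psi)).
Proof.
have D1 := der_mull (2 * x * r) (der_cos (der_id psi)).
have D2 := der_add (der_add (der_cst psi (x ^+ 2)) D1) (der_cst psi (r ^+ 2)).
apply: der_eq D2 _; ring.
Qed.

Lemma parg_aux (x psi r : R) : 0 < r -> 0 < sin psi ->
  1 + (cot psi + x / r / sin psi) ^+ 2 = pnorm x psi r / (r * sin psi) ^+ 2.
Proof.
move=> r0 s0; rewrite pnormE /cot; field; rewrite !gt_eqF//.
Qed.

Lemma pnorm_gt0 (x psi r : R) : 0 < r -> 0 < sin psi -> 0 < pnorm x psi r.
Proof. by move=> r0 s0; rewrite pnormE ltr_pwDr ?sqr_ge0// exprn_gt0// mulr_gt0. Qed.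

Lemma der_parg_x (x psi r : R) : 0 < r -> 0 < psi < pi ->
  is_derive x 1 (fun u => parg u psi r) (r * sin psi / pnorm x psi r).
Proof.
move=> r0 pp; have s0 : 0 < sin psi by exact: sin_gt0_pi.
have D1 := der_add (der_cst x (cot psi)) (der_mulr (sin psi)^-1 (der_mulr r^-1 (der_id x))).
have D2 := der_add (der_cst x psi) (der_opp (der_add (der_cst x (pi / 2)) (der_opp (der_atan D1)))).
apply: der_eq D2 _; rewrite parg_aux//.
have := pnorm_gt0 x r0 s0; move: (pnorm _ _ _) => D D0.
by field; rewrite !gt_eqF.
Qed.

Lemma der_parg_psi (x psi r : R) : 0 < r -> 0 < psi < pi ->
  is_derive psi 1 (fun p => parg x p r) ((x ^+ 2 + x * r * cos psi) / pnorm x psi r).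
Proof.
move=> r0 pp; have s0 : 0 < sin psi by exact: sin_gt0_pi.
have sn0 : sin psi != 0 by rewrite gt_eqF.
have D0 := der_div sn0 (der_cos (der_id psi)) (der_sin (der_id psi)).
have D1 := der_add D0 (der_mull (x / r) (der_inv sn0 (der_sin (der_id psi)))).
have D2 := der_add (der_id psi) (der_opp (der_add (der_cst psi (pi / 2)) (der_opp (der_atan D1)))).
apply: der_eq D2 _; rewrite -/(cot psi) parg_aux//.
have := pnorm_gt0 x r0 s0; have := pnormE x psi r; have := cos2Dsin2 psi.
move: (pnorm _ _ _) => D; move: (cos psi) => c; move: s0 sn0; move: (sin psi) => s s0 sn0 cs DE D0'.
have -> : x ^+ 2 + x * r * c = D - r * (r + x * c).
  rewrite DE; have -> : (r * s) ^+ 2 = r ^+ 2 * (1 - c ^+ 2) by rewrite -cs; ring.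
  by ring.
rewrite !mulr1 (_ : - s * s - c * c = -1); last by rewrite -[in RHS]cs; ring.
by field; rewrite !gt_eqF.
Qed.
Lemma continuous_Rintegral d (Y : measurableType d) (mu : {measure set Y -> \bar R}) (B : set Y)
    (f : R -> Y -> R) (G : Y -> R) (a u v : R) : measurable B -> u < a < v ->
  (forall x, u < x < v -> mu.-integrable B (EFin \o f x)) ->
  (forall x y, u < x < v -> B y -> {for x, continuous (f ^~ y)}) ->
  mu.-integrable B (EFin \o G) ->
  (forall x y, u < x < v -> B y -> `|f x y| <= G y) ->
  {for a, continuous (fun x => \int[mu]_(y in B) f x y)}.
Proof.
move=> mB uav intf cf intG fG.
have I x : `]u, v[%classic x -> u < x < v by rewrite /= in_itv.
apply: (@continuity_under_integral _ _ _ mu f B mB u v _ _ G) => //.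
- by apply: nearW => y By x /set_mem /I Ix; exact: cf.
- by move=> x /I Ix; apply: nearW => y By; exact: fG.
- by rewrite inE /= in_itv.
Qed.

Lemma Rintegral_EFin_cst d (X : measurableType d) (P : {measure set X -> \bar R}) (D : set X) (c : R) :
  measurable D -> P D = 1%E -> \int[P]_(r in D) (c : R) = c.
Proof. by move=> mD P1; rewrite Rintegral_cst// P1 mulr1. Qed.

(** * The logarithmic potential of H on a sector *)

Section potential.
Context (H : probability RR R) (al : R).
Context (al0 : 0 < al) (al1 : al < 1).
Context (H_pos : H `]0%R, +oo[%classic = 1%E).
Context (H_log : (\int[H]_(r in `]0%R, +oo[) (ln (1 + (r : R)))%:E < +oo)%E).

Local Notation P0 := (`]0%R, +oo[%classic : set RR).

(* The rays |phi| < phimax extend beyond the cut phi = pi, while al * phi stays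
   in ]- pi, pi[: there log (w^al + r) is analytic. *)
Definition phimax := pi + pi * (1 - al) / 2.
(** The gap for which |w^al + r|^2 >= kappa (|w|^(2 al) + r^2) on the whole closed sector. *)
Definition kappa : R := 1 - `|cos (al * phimax)|.

(** The upper bound 3 pi / 2 keeps cos phi <= 0 for pi <= phi < phimax, as [En_ge_loc] requires. *)
Lemma phimax_bound : [/\ pi < phimax, 0 < al * phimax < pi & phimax < pi + pi / 2].
Proof.
have p0 := pi_gt0 R; have a0 := al0; have a1 := al1; rewrite /phimax.
have h1 : 0 < pi * (1 - al) by rewrite mulr_gt0// subr_gt0.
have h2 : 0 < pi * al by rewrite mulr_gt0.
have h3 : 0 < pi * ((1 - al) * (2 - al)) by apply: mulr_gt0 => //; apply: mulr_gt0; lra.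
by split; [lra|apply/andP; split; nra|nra].
Qed.

Lemma kap_bound : 0 < kappa <= 1.
Proof.
have [_ /andP[b0 b1] _] := phimax_bound; rewrite /kappa gerBl normr_ge0 andbT subr_gt0.
rewrite lt_neqAle cos_max andbT; apply/negP => /eqP h.
have : cos (al * phimax) ^+ 2 = 1 by rewrite -real_normK ?num_real// h expr1n.
have := cos2Dsin2 (al * phimax).
have := sin_gt0_pi (x := al * phimax); rewrite b0 b1 => /(_ isT).
by move: (cos _) (sin _) => c s s0 h1 h2; have := exprn_gt0 2 s0; lra.
Qed.

Lemma kap_le_cos phi : `|phi| <= phimax -> kappa - 1 <= cos (al * phi).
Proof.
move=> h; have [_ /andP[b0 b1] _] := phimax_bound.
have -> : cos (al * phi) = cos (al * `|phi|).
  by have [h0|h0] := lerP 0 phi; [rewrite ger0_norm|rewrite ltr0_norm// mulrN cosN].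
apply: (@le_trans _ _ (cos (al * phimax))).
  by rewrite /kappa addrC addrA addNr add0r lerNl -normrN ler_norm.
rewrite leNgt ltr_cos ?in_itv/= -?leNgt ?ler_wpM2l ?(ltW al0)//.
  by rewrite !ltW.
by rewrite mulr_ge0 ?(ltW al0)//= (le_trans _ (ltW b1))// ler_wpM2l// ltW.
Qed.

Lemma al_phi phi : 0 < phi < phimax -> 0 < al * phi < pi.
Proof.
move=> /andP[p0 p1]; have [_ /andP[b0 b1] _] := phimax_bound.
by rewrite mulr_gt0//= (lt_trans _ b1)// ltr_pM2l.
Qed.

Lemma pnorm_kap (x phi r : R) : 0 <= x -> 0 <= r -> `|phi| <= phimax ->
  kappa * (x ^+ 2 + r ^+ 2) <= pnorm x (al * phi) r.
Proof. by move=> x0 r0 h; apply: pnorm_ge => //; [case/andP: kap_bound|exact: kap_le_cos]. Qed.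

Lemma pnorm_pos (x phi r : R) : 0 <= x -> 0 < r -> `|phi| <= phimax -> 0 < pnorm x (al * phi) r.
Proof.
move=> x0 r0 h; apply: lt_le_trans (pnorm_kap x0 (ltW r0) h).
have /andP[k0 _] := kap_bound.
by apply: mulr_gt0 => //; have := exprn_gt0 2 r0; have := sqr_ge0 x; lra.
Qed.

(* At w = t e^(i phi), [log_mod + i arg_val] is log (w^al + r), and
   [re_dlog1 + i im_dlog1] is its derivative times w. *)
Definition log_mod (t phi r : R) := 2^-1 * ln (pnorm (t `^ al) (al * phi) r).
Definition arg_val (t phi r : R) := parg (t `^ al) (al * phi) r.
Definition re_dlog1 (t phi r : R) :=
  al * ((t `^ al) ^+ 2 + t `^ al * r * cos (al * phi)) / pnorm (t `^ al) (al * phi) r.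
Definition im_dlog1 (t phi r : R) :=
  al * (t `^ al * r * sin (al * phi)) / pnorm (t `^ al) (al * phi) r.

Lemma c1_bound t phi r : 0 < r -> `|phi| <= phimax -> `|re_dlog1 t phi r| <= 2 / kappa.
Proof.
move=> r0 h; have x0 := powR_ge0 t al; have D0 := pnorm_pos x0 r0 h.
have DK := pnorm_kap x0 (ltW r0) h; have /andP[k0 _] := kap_bound.
rewrite /re_dlog1 normrM normfV (gtr0_norm D0) ler_pdivrMr// [leRHS]mulrAC ler_pdivlMr// [leLHS]mulrC.
rewrite normrM (gtr0_norm al0) mulrCA.
have := cos_max (al * phi); move: x0 DK {D0}; move: (t `^ al) (cos _) (pnorm _ _ _) => x c D x0 DK.
rewrite ler_norml => /andP[c0 c1'].
have : `|x ^+ 2 + x * r * c| <= 2 * (x ^+ 2 + r ^+ 2).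
  have xr : 0 <= x * r by rewrite mulr_ge0// ltW.
  have e1 : 0 <= x * r * (1 - c) by rewrite mulr_ge0// subr_ge0.
  have e2 : 0 <= x * r * (1 + c) by rewrite mulr_ge0// -lerBlDl sub0r.
  have e3 := sqr_ge0 (x - r); have e4 := sqr_ge0 x; have e5 := sqr_ge0 r.
  by rewrite ler_norml; apply/andP; split; nra.
set y := `|_| => h2; apply: (@le_trans _ _ (kappa * y)).
  by apply: ler_piMl; [exact: mulr_ge0 (ltW k0) (normr_ge0 _)|exact: ltW].
apply: le_trans (ler_wpM2l (ltW k0) h2) _; nra.
Qed.

Lemma c2_bound t phi r : 0 < r -> `|phi| <= phimax -> `|im_dlog1 t phi r| <= 2 / kappa.
Proof.
move=> r0 h; have x0 := powR_ge0 t al; have D0 := pnorm_pos x0 r0 h.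
have DK := pnorm_kap x0 (ltW r0) h; have /andP[k0 _] := kap_bound.
rewrite /im_dlog1 normrM normfV (gtr0_norm D0) ler_pdivrMr// [leRHS]mulrAC ler_pdivlMr// [leLHS]mulrC.
rewrite normrM (gtr0_norm al0) mulrCA.
have := sin_max (al * phi); move: x0 DK {D0}; move: (t `^ al) (sin _) (pnorm _ _ _) => x c D x0 DK.
rewrite ler_norml => /andP[c0 c1'].
have : `|x * r * c| <= 2 * (x ^+ 2 + r ^+ 2).
  have xr : 0 <= x * r by rewrite mulr_ge0// ltW.
  have e1 : 0 <= x * r * (1 - c) by rewrite mulr_ge0// subr_ge0.
  have e2 : 0 <= x * r * (1 + c) by rewrite mulr_ge0// -lerBlDl sub0r.
  have e3 := sqr_ge0 (x - r); have e4 := sqr_ge0 x; have e5 := sqr_ge0 r.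
  by rewrite ler_norml; apply/andP; split; nra.
set y := `|_| => h2; apply: (@le_trans _ _ (kappa * y)).
  by apply: ler_piMl; [exact: mulr_ge0 (ltW k0) (normr_ge0 _)|exact: ltW].
apply: le_trans (ler_wpM2l (ltW k0) h2) _; nra.
Qed.

(** The first bound does not involve r and makes g decay like t^(- al th); the second does not
    involve t and controls g near 0 through the mass of H away from 0. *)
Lemma lg_ge t phi r : 0 < t -> 0 < r -> `|phi| <= phimax ->
  2^-1 * ln kappa + ln (t `^ al) <= log_mod t phi r /\ 2^-1 * ln kappa + ln r <= log_mod t phi r.
Proof.
move=> t0 r0 h; have x0 : 0 < t `^ al by rewrite powR_gt0.
have DK := pnorm_kap (ltW x0) (ltW r0) h; have /andP[k0 _] := kap_bound.
have D0 := pnorm_pos (ltW x0) r0 h.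
have ln2 (y : R) : 0 < y -> ln y = 2^-1 * ln (y ^+ 2).
  by move=> y0; rewrite [in RHS]expr2 lnM ?posrE//; field.
rewrite /log_mod; split.
  rewrite (ln2 _ x0) -mulrDr -lnM ?posrE ?exprn_gt0// ler_wpM2l// ler_ln ?posrE ?mulr_gt0 ?exprn_gt0//.
  by apply: le_trans DK; rewrite ler_wpM2l ?(ltW k0)// lerDl sqr_ge0.
rewrite (ln2 _ r0) -mulrDr -lnM ?posrE ?exprn_gt0// ler_wpM2l// ler_ln ?posrE ?mulr_gt0 ?exprn_gt0//.
by apply: le_trans DK; rewrite ler_wpM2l ?(ltW k0)// lerDr sqr_ge0.
Qed.

Lemma lg_le t phi r : 0 < t -> 0 < r -> `|phi| <= phimax ->
  log_mod t phi r <= ln (1 + t `^ al) + ln (1 + r).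
Proof.
move=> t0 r0 h; have x0 : 0 < t `^ al by rewrite powR_gt0.
have D0 := pnorm_pos (ltW x0) r0 h.
have D1 := pnorm_le (al * phi) (ltW x0) (ltW r0).
rewrite -lnM ?posrE ?ltr_pwDl//; try exact: ltW.
apply: (@le_trans _ _ (2^-1 * ln ((t `^ al + r) ^+ 2))).
  by rewrite ler_wpM2l// ler_ln ?posrE// exprn_gt0// addr_gt0.
have xr0 : 0 < t `^ al + r by rewrite addr_gt0.
rewrite expr2 lnM ?posrE// (_ : 2^-1 * _ = ln (t `^ al + r)); last by field.
rewrite ler_ln ?posrE ?mulr_gt0 ?addr_gt0//; nra.
Qed.

Lemma measurable_pnorm (x psi : R) : measurable_fun [set: R] (pnorm x psi).
Proof.
rewrite (_ : pnorm x psi = fun r => x ^+ 2 + (2 * x * cos psi) * r + r ^+ 2); last first.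
  by apply/funext => r; rewrite /pnorm; ring.
apply: measurable_funD; last exact: measurable_funX.
by apply: measurable_funD => //; exact: measurable_funM.
Qed.

Lemma measurable_lg t phi : measurable_fun [set: R] (log_mod t phi).
Proof.
apply: measurable_funM => //; apply: (measurableT_comp (@measurable_ln R)).
exact: measurable_pnorm.
Qed.

Lemma measurable_ag t phi : measurable_fun [set: R] (arg_val t phi).
Proof.
apply: measurable_funB => //; apply: measurable_funB => //.
apply: measurableT_comp.
  by apply: continuous_measurable_fun => u; exact: continuous_atan.
apply: measurable_funD => //; apply: measurable_funM => //; apply: measurable_funM => //.
exact: measurable_fun_inv.
Qed.

Lemma measurable_c1 t phi : measurable_fun [set: R] (re_dlog1 t phi).
Proof.
apply: measurable_funM.
  apply: measurable_funM => //; apply: measurable_funD => //.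
  by apply: measurable_funM => //; exact: measurable_funM.
exact: (measurableT_comp measurable_fun_inv (measurable_pnorm _ _)).
Qed.

Lemma measurable_c2 t phi : measurable_fun [set: R] (im_dlog1 t phi).
Proof.
apply: measurable_funM.
  apply: measurable_funM => //.
  by apply: measurable_funM => //; exact: measurable_funM.
exact: (measurableT_comp measurable_fun_inv (measurable_pnorm _ _)).
Qed.

Lemma integrable_cstH (c : R) : H.-integrable P0 (EFin \o (fun=> c)).
Proof.
apply/integrableP; split; first exact: measurable_cst.
rewrite /= (_ : (fun x => _) = cst `|c|%:E)// integral_cst// lte_mul_pinfty//.
by rewrite (le_lt_trans (probability_le1 _ _))// ltry.
Qed.

Lemma integrable_bounded (f : R -> R) (c : R) : measurable_fun [set: R] f ->
  (forall r, 0 < r -> `|f r| <= c) -> H.-integrable P0 (EFin \o f).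
Proof.
move=> mf fc; apply: (le_integrable _ _ _ (integrable_cstH c)) => //.
  by apply/measurable_EFinP; exact: measurable_funTS.
move=> r /=; rewrite in_itv/= andbT => r0; rewrite lee_fin.
by rewrite (le_trans (fc r r0))// ler_norm.
Qed.

Lemma integrable_ln1r : H.-integrable P0 (EFin \o (fun r => ln (1 + r))).
Proof.
have m : measurable_fun [set: R] (fun x : R => ln (1 + x)).
  by apply: (measurableT_comp (@measurable_ln R)); exact: measurable_funD.
apply/integrableP; split; first by apply/measurable_EFinP; exact: measurable_funTS.
rewrite (_ : \int[H]_(x in _) _ = \int[H]_(r in P0) (ln (1 + r))%:E)%E//.
apply: eq_integral => x; rewrite inE/= in_itv/= andbT => x0.
by rewrite ger0_norm// ln_ge0// lerDl ltW.
Qed.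

Lemma integrable_lg t phi : 0 < t -> `|phi| <= phimax -> H.-integrable P0 (EFin \o log_mod t phi).
Proof.
move=> t0 h; pose c := `|2^-1 * ln kappa + ln (t `^ al)| + ln (1 + t `^ al).
have I : H.-integrable P0 (EFin \o (fun r => c + ln (1 + r))).
  have J : H.-integrable P0 ((EFin \o (fun=> c)) \+ (EFin \o (fun r => ln (1 + r))))%E.
    by apply: integrableD => //; [exact: integrable_cstH|exact: integrable_ln1r].
  exact: J.
apply: (le_integrable _ _ _ I) => //.
  by apply/measurable_EFinP; apply: measurable_funTS; exact: measurable_lg.
move=> r /=; rewrite in_itv/= andbT => r0; rewrite lee_fin.
have [h1 _] := lg_ge t0 r0 h; have h2 := lg_le t0 r0 h.
have l1 : 0 <= ln (1 + r) by rewrite ln_ge0// lerDl ltW.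
have l2 : 0 <= ln (1 + t `^ al) by rewrite ln_ge0// lerDl powR_ge0.
have [l3 l4] : `|2^-1 * ln kappa + ln (t `^ al)| >= 0 /\ - `|2^-1 * ln kappa + ln (t `^ al)| <= 2^-1 * ln kappa + ln (t `^ al).
  by split => //; rewrite lerNl -normrN ler_norm.
rewrite /c [leRHS]ger0_norm ?addr_ge0// ler_norml.
move: h1 h2 l1 l2 l3 l4; move: (log_mod _ _ _) (2^-1 * _ + _) (ln (1 + r)) (ln (1 + t `^ al)) => a b d e.
by move=> *; apply/andP; split; lra.
Qed.

Lemma integrable_ag t phi : 0 < phi < phimax -> H.-integrable P0 (EFin \o arg_val t phi).
Proof.
move=> h; apply: (@integrable_bounded _ (al * phi)); first exact: measurable_ag.
move=> r r0; have /andP[a0 a1] := parg_bound (powR_ge0 t al) r0 (al_phi h).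
by rewrite ger0_norm.
Qed.

Lemma integrable_c1 t phi : `|phi| <= phimax -> H.-integrable P0 (EFin \o re_dlog1 t phi).
Proof.
move=> h; apply: (@integrable_bounded _ (2 / kappa)); first exact: measurable_c1.
by move=> r r0; exact: c1_bound.
Qed.

Lemma integrable_c2 t phi : `|phi| <= phimax -> H.-integrable P0 (EFin \o im_dlog1 t phi).
Proof.
move=> h; apply: (@integrable_bounded _ (2 / kappa)); first exact: measurable_c2.
by move=> r r0; exact: c2_bound.
Qed.
Lemma der_powR_t (t : R) : 0 < t -> is_derive t 1 (fun u => u `^ al) (al * t `^ al / t).
Proof.
move=> t0; apply: der_eq (der_powR al t0 (der_id t)) _.
by rewrite mulr1 powRB ?powRr1 ?mulrA ?ltW// (gt_eqF t0) implybT.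
Qed.

Lemma der_lg_t (t phi r : R) : 0 < t -> 0 < r -> `|phi| <= phimax ->
  is_derive t 1 (fun u => log_mod u phi r) (re_dlog1 t phi r / t).
Proof.
move=> t0 r0 h; have D0 := pnorm_pos (powR_ge0 t al) r0 h.
have D1 := @der_comp _ (fun x => pnorm x (al * phi) r) (fun u => u `^ al) t _ _ (der_pnorm_x (t `^ al) (al * phi) r) (der_powR_t t0).
have D2 := der_mull 2^-1 (@der_ln _ (fun u => pnorm (u `^ al) (al * phi) r) t _ D0 D1).
apply: der_eq D2 _; rewrite /re_dlog1; field; rewrite !gt_eqF//.
Qed.

Lemma der_lg_phi (t phi r : R) : 0 < t -> 0 < r -> `|phi| <= phimax ->
  is_derive phi 1 (fun p => log_mod t p r) (- im_dlog1 t phi r).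
Proof.
move=> t0 r0 h; have D0 := pnorm_pos (powR_ge0 t al) r0 h.
have D1 := @der_comp _ (fun q => pnorm (t `^ al) q r) (fun p => al * p) phi _ _
  (der_pnorm_psi (t `^ al) (al * phi) r) (der_mull al (der_id phi)).
have D2 := der_mull 2^-1 (@der_ln _ (fun p => pnorm (t `^ al) (al * p) r) phi _ D0 D1).
apply: der_eq D2 _; rewrite /im_dlog1; field; rewrite !gt_eqF//.
Qed.

Lemma der_ag_t (t phi r : R) : 0 < t -> 0 < r -> 0 < phi < phimax ->
  is_derive t 1 (fun u => arg_val u phi r) (im_dlog1 t phi r / t).
Proof.
move=> t0 r0 h.
have D1 := @der_comp _ (fun x => parg x (al * phi) r) (fun u => u `^ al) t _ _
  (der_parg_x (t `^ al) r0 (al_phi h)) (der_powR_t t0).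
have D0 := pnorm_gt0 (t `^ al) r0 (sin_gt0_pi (al_phi h)).
by apply: der_eq D1 _; rewrite /im_dlog1; field; rewrite !gt_eqF.
Qed.

Lemma der_ag_phi (t phi r : R) : 0 < t -> 0 < r -> 0 < phi < phimax ->
  is_derive phi 1 (fun p => arg_val t p r) (re_dlog1 t phi r).
Proof.
move=> t0 r0 h.
have D1 := @der_comp _ (fun q => parg (t `^ al) q r) (fun p => al * p) phi _ _
  (der_parg_psi (t `^ al) r0 (al_phi h)) (der_mull al (der_id phi)).
by apply: der_eq D1 _; rewrite /re_dlog1 mulr1 mulrC mulrA.
Qed.

Lemma continuous_c12 (t phi r : R) : 0 < t -> 0 < r -> `|phi| <= phimax ->
  {for t, continuous (fun u => re_dlog1 u phi r)} /\ {for t, continuous (fun u => im_dlog1 u phi r)}.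
Proof.
move=> t0 r0 h; have D0 := pnorm_pos (powR_ge0 t al) r0 h.
have Dn0 : pnorm (t `^ al) (al * phi) r != 0 by rewrite gt_eqF.
have P := der_powR_t t0.
have D1 := @der_comp _ (fun x => pnorm x (al * phi) r) (fun u => u `^ al) t _ _ (der_pnorm_x (t `^ al) (al * phi) r) P.
have N1 := der_mull al (der_add (der_mul P P) (der_mulr (cos (al * phi)) (der_mulr r P))).
have N2 := der_mull al (der_mulr (sin (al * phi)) (der_mulr r P)).
split.
  exact: der_continuous (@der_div _ _ (fun u => pnorm (u `^ al) (al * phi) r) t _ _ Dn0 N1 D1).
exact: der_continuous (@der_div _ _ (fun u => pnorm (u `^ al) (al * phi) r) t _ _ Dn0 N2 D1).
Qed.

Definition Upot (t phi : R) := \int[H]_(r in P0) log_mod t phi r.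
Definition Vpot (t phi : R) := \int[H]_(r in P0) arg_val t phi r.
Definition re_dlog (t phi : R) := \int[H]_(r in P0) re_dlog1 t phi r.
Definition im_dlog (t phi : R) := \int[H]_(r in P0) im_dlog1 t phi r.

Let in0 (r : R) : P0 r -> 0 < r. Proof. by rewrite /= in_itv/= andbT. Qed.

Let kap0 : 0 < kappa. Proof. by case/andP: kap_bound. Qed.

Let half (t x : R) : 0 < t -> t / 2 < x < t + 1 -> 0 < x.
Proof. by move=> t0 /andP[+ _]; apply: lt_trans; rewrite divr_gt0. Qed.

Let halft (t : R) : 0 < t -> t / 2 < t < t + 1.
Proof. by move=> t0; rewrite ltrDl ltr01 andbT ltr_pdivrMr// ltr_pMr// ltr1n. Qed.

Let bound_div (x t c : R) : 0 < t -> t / 2 < x < t + 1 -> `|c| <= 2 / kappa -> `|c / x| <= (2 / kappa) / (t / 2).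
Proof.
move=> t0 h hc; have x0 := half t0 h.
rewrite normrM normfV (gtr0_norm x0) ler_pM ?invr_ge0 ?(ltW x0)//.
by rewrite lef_pV2 ?posrE ?divr_gt0//; case/andP: h => /ltW.
Qed.

Lemma der_U_t (t phi : R) : 0 < t -> `|phi| <= phimax -> is_derive t 1 (fun u => Upot u phi) (re_dlog t phi / t).
Proof.
move=> t0 h.
have D : is_derive t 1 (fun u => \int[H]_(r in P0) log_mod u phi r) (\int[H]_(r in P0) (re_dlog1 t phi r / t)).
  apply: (@der_Rintegral _ _ H P0 (fun u r => log_mod u phi r) (fun u r => re_dlog1 u phi r / u)
    (fun=> (2 / kappa) / (t / 2)) t (t / 2) (t + 1)) => //.
  - exact: halft.
  - by move=> x /(half t0) x0; exact: integrable_lg.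
  - by move=> x r /(half t0) x0 /in0 r0; exact: der_lg_t.
  - by move=> _; rewrite !divr_ge0// ltW.
  - exact: integrable_cstH.
  - by move=> x r xt /in0 r0; apply: bound_div => //; exact: c1_bound.
apply: der_eq D _; rewrite /re_dlog RintegralZr//; exact: integrable_c1.
Qed.

Lemma der_V_t (t phi : R) : 0 < t -> 0 < phi < phimax -> is_derive t 1 (fun u => Vpot u phi) (im_dlog t phi / t).
Proof.
move=> t0 h; have h' : `|phi| <= phimax by case/andP : h => h0 /ltW h1; rewrite gtr0_norm.
have D : is_derive t 1 (fun u => \int[H]_(r in P0) arg_val u phi r) (\int[H]_(r in P0) (im_dlog1 t phi r / t)).
  apply: (@der_Rintegral _ _ H P0 (fun u r => arg_val u phi r) (fun u r => im_dlog1 u phi r / u)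
    (fun=> (2 / kappa) / (t / 2)) t (t / 2) (t + 1)).
  - exact: measurable_itv.
  - exact: halft.
  - by move=> x /(half t0) x0; exact: integrable_ag.
  - by move=> x r /(half t0) x0 /in0 r0; exact: der_ag_t.
  - by move=> _; rewrite !divr_ge0// ltW.
  - exact: integrable_cstH.
  - by move=> x r xt /in0 r0; apply: bound_div => //; exact: c2_bound.
apply: der_eq D _; rewrite /im_dlog RintegralZr//; exact: integrable_c2.
Qed.

Lemma der_U_phi (t phi : R) : 0 < t -> `|phi| < phimax -> is_derive phi 1 (Upot t) (- im_dlog t phi).
Proof.
move=> t0 h.
have D : is_derive phi 1 (fun p => \int[H]_(r in P0) log_mod t p r) (\int[H]_(r in P0) (- im_dlog1 t phi r)).
  apply: (@der_Rintegral _ _ H P0 (fun p r => log_mod t p r) (fun p r => - im_dlog1 t p r)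
    (fun=> 2 / kappa) phi (- phimax) phimax) => //.
  - by rewrite -ltr_norml.
  - by move=> p; rewrite -ltr_norml => /ltW ?; exact: integrable_lg.
  - by move=> p r; rewrite -ltr_norml => /ltW ? /in0 r0; exact: der_lg_phi.
  - by move=> _; rewrite !divr_ge0// ltW.
  - exact: integrable_cstH.
  - by move=> p r; rewrite -ltr_norml => /ltW ? /in0 r0; rewrite normrN; exact: c2_bound.
apply: der_eq D _; rewrite /im_dlog -mulN1r -RintegralZl//; last exact: integrable_c2 (ltW h).
by apply: eq_Rintegral => r _; rewrite mulN1r.
Qed.

Lemma der_V_phi (t phi : R) : 0 < t -> 0 < phi < phimax -> is_derive phi 1 (Vpot t) (re_dlog t phi).
Proof.
move=> t0 h.
suff D : is_derive phi 1 (fun p => \int[H]_(r in P0) arg_val t p r) (\int[H]_(r in P0) re_dlog1 t phi r) by exact: D.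
apply: (@der_Rintegral _ _ H P0 (fun p r => arg_val t p r) (fun p r => re_dlog1 t p r)
    (fun=> 2 / kappa) phi 0 phimax).
- exact: measurable_itv.
- exact: h.
- by move=> p ?; exact: integrable_ag.
- by move=> p r ? /in0 r0; exact: der_ag_phi.
- by move=> _; rewrite !divr_ge0// ltW.
- exact: integrable_cstH.
- by move=> p r /andP[p0 p1] /in0 r0; apply: c1_bound => //; rewrite gtr0_norm// ltW.
Qed.

Lemma continuous_C12 (t phi : R) : 0 < t -> `|phi| <= phimax ->
  {for t, continuous (re_dlog ^~ phi)} /\ {for t, continuous (im_dlog ^~ phi)}.
Proof.
move=> t0 h; split.
  apply: (@continuous_Rintegral _ _ H P0 (fun u r => re_dlog1 u phi r) (fun=> 2 / kappa) t (t / 2) (t + 1)) => //.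
  - exact: halft.
  - by move=> x _; exact: integrable_c1.
  - by move=> x r /(half t0) x0 /in0 r0; have [] := continuous_c12 x0 r0 h.
  - exact: integrable_cstH.
  - by move=> x r _ /in0 r0; exact: c1_bound.
apply: (@continuous_Rintegral _ _ H P0 (fun u r => im_dlog1 u phi r) (fun=> 2 / kappa) t (t / 2) (t + 1)) => //.
- exact: halft.
- by move=> x _; exact: integrable_c2.
- by move=> x r /(half t0) x0 /in0 r0; have [] := continuous_c12 x0 r0 h.
- exact: integrable_cstH.
- by move=> x r _ /in0 r0; exact: c2_bound.
Qed.

Lemma RintegralH_bound (f : R -> R) (c : R) : measurable_fun [set: R] f ->
  (forall r, 0 < r -> `|f r| <= c) -> `|\int[H]_(r in P0) f r| <= c.
Proof.
move=> mf fc; have If := integrable_bounded mf fc.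
apply: (@le_trans _ _ (\int[H]_(r in P0) `|f r|)); first exact: le_normr_Rintegral.
rewrite -[leRHS](@Rintegral_EFin_cst _ _ H P0)//.
apply: le_Rintegral => //; last by move=> r /in0; exact: fc.
- by apply: (integrable_bounded (c := c)); [exact: measurableT_comp|move=> r r0; rewrite normr_id; exact: fc].
- exact: integrable_cstH.
Qed.

Lemma C12_bound (t phi : R) : `|phi| <= phimax -> `|re_dlog t phi| <= 2 / kappa /\ `|im_dlog t phi| <= 2 / kappa.
Proof.
move=> h; split; apply: RintegralH_bound.
- exact: measurable_c1.
- by move=> r r0; exact: c1_bound.
- exact: measurable_c2.
- by move=> r r0; exact: c2_bound.
Qed.

Lemma V_bound (t phi : R) : 0 < phi < phimax -> 0 <= Vpot t phi <= al * phi.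
Proof.
move=> h; have B r : 0 < r -> 0 <= arg_val t phi r <= al * phi by move=> r0; apply: parg_bound (powR_ge0 _ _) r0 (al_phi h).
apply/andP; split; first by apply: Rintegral_ge0 => r /in0 /B /andP[].
rewrite (le_trans (ler_norm _))//; apply: RintegralH_bound; first exact: measurable_ag.
by move=> r /B /andP[b0 b1]; rewrite ger0_norm.
Qed.

Lemma U_ge (t phi : R) : 0 < t -> `|phi| <= phimax -> 2^-1 * ln kappa + ln (t `^ al) <= Upot t phi.
Proof.
move=> t0 h; rewrite -[leLHS](@Rintegral_EFin_cst _ _ H P0)//.
apply: le_Rintegral => //; [exact: integrable_cstH|exact: integrable_lg|].
by move=> r /in0 r0; have [] := lg_ge t0 r0 h.
Qed.
(* [A + i B] is w f'(w) for f = F1 + i F2 at w = t e^(i phi); the equations are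
   the polar Cauchy-Riemann equations. *)
Definition polar_CR (F1 F2 : R -> R -> R) (A B t phi : R) :=
  [/\ is_derive t 1 (F1 ^~ phi) (A / t), is_derive t 1 (F2 ^~ phi) (B / t),
      is_derive phi 1 (F1 t) (- B) & is_derive phi 1 (F2 t) A].

Lemma hol_mul (F1 F2 G1 G2 : R -> R -> R) (A B A' B' t phi : R) :
  polar_CR F1 F2 A B t phi -> polar_CR G1 G2 A' B' t phi ->
  polar_CR (fun u p => F1 u p * G1 u p - F2 u p * G2 u p) (fun u p => F1 u p * G2 u p + F2 u p * G1 u p)
    (A * G1 t phi + F1 t phi * A' - (B * G2 t phi + F2 t phi * B'))
    (A * G2 t phi + F1 t phi * B' + (B * G1 t phi + F2 t phi * A')) t phi.
Proof.
move=> [a1 a2 a3 a4] [b1 b2 b3 b4]; split.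
- by apply: der_eq (der_add (der_mul a1 b1) (der_opp (der_mul a2 b2))) _; ring.
- by apply: der_eq (der_add (der_mul a1 b2) (der_mul a2 b1)) _; ring.
- by apply: der_eq (der_add (der_mul a3 b3) (der_opp (der_mul a4 b4))) _; ring.
- by apply: der_eq (der_add (der_mul a3 b4) (der_mul a4 b3)) _; ring.
Qed.

Lemma hol_sub (F1 F2 G1 G2 : R -> R -> R) (A B A' B' t phi : R) :
  polar_CR F1 F2 A B t phi -> polar_CR G1 G2 A' B' t phi ->
  polar_CR (fun u p => F1 u p - G1 u p) (fun u p => F2 u p - G2 u p) (A - A') (B - B') t phi.
Proof.
move=> [a1 a2 a3 a4] [b1 b2 b3 b4]; split.
- by apply: der_eq (der_add a1 (der_opp b1)) _; ring.
- by apply: der_eq (der_add a2 (der_opp b2)) _; ring.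
- by apply: der_eq (der_add a3 (der_opp b3)) _; ring.
- by apply: der_eq (der_add a4 (der_opp b4)) _; ring.
Qed.

Lemma hol_inv (F1 F2 : R -> R -> R) (A B t phi : R) :
  polar_CR F1 F2 A B t phi -> F1 t phi ^+ 2 + F2 t phi ^+ 2 != 0 ->
  polar_CR (fun u p => F1 u p / (F1 u p ^+ 2 + F2 u p ^+ 2)) (fun u p => - F2 u p / (F1 u p ^+ 2 + F2 u p ^+ 2))
   (- (A * (F1 t phi ^+ 2 - F2 t phi ^+ 2) + 2 * B * F1 t phi * F2 t phi) / (F1 t phi ^+ 2 + F2 t phi ^+ 2) ^+ 2)
   ((2 * A * F1 t phi * F2 t phi - B * (F1 t phi ^+ 2 - F2 t phi ^+ 2)) / (F1 t phi ^+ 2 + F2 t phi ^+ 2) ^+ 2) t phi.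
Proof.
move=> [a1 a2 a3 a4] n0.
have T := der_add (der_mul a1 a1) (der_mul a2 a2).
have P := der_add (der_mul a3 a3) (der_mul a4 a4).
split.
- apply: der_eq (@der_div _ (F1 ^~ phi) (fun u => F1 u phi ^+ 2 + F2 u phi ^+ 2) t _ _ n0 a1 T) _.
  by move: n0; move: (F1 t phi) (F2 t phi) (t^-1) => x y s n0; field.
- apply: der_eq (@der_div _ (fun u => - F2 u phi) (fun u => F1 u phi ^+ 2 + F2 u phi ^+ 2) t _ _ n0 (der_opp a2) T) _.
  by move: n0; move: (F1 t phi) (F2 t phi) (t^-1) => x y s n0; field.
- apply: der_eq (@der_div _ (F1 t) (fun u => F1 t u ^+ 2 + F2 t u ^+ 2) phi _ _ n0 a3 P) _.
  by move: n0; move: (F1 t phi) (F2 t phi) (t^-1) => x y s n0; field.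
- apply: der_eq (@der_div _ (fun u => - F2 t u) (fun u => F1 t u ^+ 2 + F2 t u ^+ 2) phi _ _ n0 (der_opp a4) P) _.
  by move: n0; move: (F1 t phi) (F2 t phi) (t^-1) => x y s n0; field.
Qed.

Lemma hol_translate (z t phi : R) : 0 < t ->
  polar_CR (fun u p => u * cos p - z) (fun u p => u * sin p) (t * cos phi) (t * sin phi) t phi.
Proof.
move=> t0; have tn0 : t != 0 by rewrite gt_eqF.
split.
- by apply: der_eq (der_add (der_mulr (cos phi) (der_id t)) (der_cst t (- z))) _; field.
- by apply: der_eq (der_mulr (sin phi) (der_id t)) _; field.
- by apply: der_eq (der_add (der_mull t (der_cos (der_id phi))) (der_cst phi (- z))) _; ring.
- by apply: der_eq (der_mull t (der_sin (der_id phi))) _; ring.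
Qed.

Lemma hol_rsqrt (k t phi : R) : 0 < t ->
  polar_CR (fun u p => k * u `^ (- 2^-1) * cos (p / 2)) (fun u p => - (k * u `^ (- 2^-1) * sin (p / 2)))
    (- 2^-1 * (k * t `^ (- 2^-1) * cos (phi / 2))) (2^-1 * (k * t `^ (- 2^-1) * sin (phi / 2))) t phi.
Proof.
move=> t0; have tn0 : t != 0 by rewrite gt_eqF.
have D : is_derive t 1 (fun u => u `^ (- 2^-1)) (- 2^-1 * t `^ (- 2^-1) / t).
  apply: der_eq (der_powR (- 2^-1) t0 (der_id t)) _.
  by rewrite mulr1 powRB ?powRr1 ?mulrA ?ltW// (gt_eqF t0) implybT.
have h := der_mulr 2^-1 (der_id phi).
split.
- by apply: der_eq (der_mulr (cos (phi / 2)) (der_mull k D)) _; ring.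
- by apply: der_eq (der_opp (der_mulr (sin (phi / 2)) (der_mull k D))) _; ring.
- by apply: der_eq (der_mull (k * t `^ (- 2^-1)) (der_cos h)) _; ring.
- by apply: der_eq (der_opp (der_mull (k * t `^ (- 2^-1)) (der_sin h))) _; ring.
Qed.

Context (th : R) (th0 : 0 < th).

(* [re_g + i im_g] is g(w) = exp (- th \int log (w^al + r) H(dr)), and
   [re_dg + i im_dg] is w g'(w). *)
Definition re_g (t phi : R) := expR (- (th * Upot t phi)) * cos (th * Vpot t phi).
Definition im_g (t phi : R) := - (expR (- (th * Upot t phi)) * sin (th * Vpot t phi)).
Definition re_dg (t phi : R) :=
  - (th * expR (- (th * Upot t phi)) * (re_dlog t phi * cos (th * Vpot t phi) + im_dlog t phi * sin (th * Vpot t phi))).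
Definition im_dg (t phi : R) :=
  - (th * expR (- (th * Upot t phi)) * (im_dlog t phi * cos (th * Vpot t phi) - re_dlog t phi * sin (th * Vpot t phi))).

Lemma hol_g (t phi : R) : 0 < t -> 0 < phi < phimax -> polar_CR re_g im_g (re_dg t phi) (im_dg t phi) t phi.
Proof.
move=> t0 h; have tn0 : t != 0 by rewrite gt_eqF.
have h' : `|phi| < phimax by case/andP : h => h0 h1; rewrite gtr0_norm.
have eT := der_expR (der_opp (der_mull th (der_U_t t0 (ltW h')))).
have eP := der_expR (der_opp (der_mull th (der_U_phi t0 h'))).
have vT := der_mull th (der_V_t t0 h).
have vP := der_mull th (der_V_phi t0 h).
rewrite /re_dg /im_dg; split.
- by apply: der_eq (der_mul eT (der_cos vT)) _; field.
- by apply: der_eq (der_opp (der_mul eT (der_sin vT))) _; field.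
- by apply: der_eq (der_mul eP (der_cos vP)) _; ring.
- by apply: der_eq (der_opp (der_mul eP (der_sin vP))) _; ring.
Qed.

Lemma abs_sin_cos (e : R) (x : R) : 0 <= e -> `|e * cos x| <= e /\ `|e * sin x| <= e.
Proof.
by move=> e0; rewrite !normrM (ger0_norm e0); split; apply: ler_piMr => //;
  [exact: cos_max|exact: sin_max].
Qed.

Lemma gPN_bound (t phi : R) : `|re_g t phi| <= expR (- (th * Upot t phi)) /\ `|im_g t phi| <= expR (- (th * Upot t phi)).
Proof. by rewrite /im_g normrN; apply: abs_sin_cos; exact: expR_ge0. Qed.

Lemma gAB_bound (t phi : R) : `|phi| <= phimax ->
  `|re_dg t phi| <= th * expR (- (th * Upot t phi)) * (4 / kappa) /\
  `|im_dg t phi| <= th * expR (- (th * Upot t phi)) * (4 / kappa).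
Proof.
move=> h; have [b1 b2] := C12_bound t h.
have e0 : 0 <= th * expR (- (th * Upot t phi)) by rewrite mulr_ge0 ?expR_ge0 ?ltW.
rewrite /re_dg /im_dg !normrN !normrM -!normrM (normrM (th * _)) (normrM (th * _)) (ger0_norm e0).
have E : 4 / kappa = 2 / kappa + 2 / kappa :> R by rewrite -mulrDl; congr (_ / _); ring.
split; rewrite ler_wpM2l// E.
- apply: le_trans (ler_normD _ _) _; rewrite !normrM; apply: lerD.
    by apply: le_trans b1; apply: ler_piMr => //; exact: cos_max.
  by apply: le_trans b2; apply: ler_piMr => //; exact: sin_max.
- apply: le_trans (ler_normB _ _) _; rewrite !normrM; apply: lerD.
    by apply: le_trans b2; apply: ler_piMr => //; exact: cos_max.
  by apply: le_trans b1; apply: ler_piMr => //; exact: sin_max.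
Qed.

Lemma expU_le (t phi : R) : 0 < t -> `|phi| <= phimax ->
  expR (- (th * Upot t phi)) <= expR (- (th * (2^-1 * ln kappa))) * t `^ (- (al * th)).
Proof.
move=> t0 h; rewrite {1}/powR gt_eqF// -expRD ler_expR.
have := U_ge t0 h; rewrite ln_powR => h2.
have := ler_wpM2l (ltW th0) h2; move: (Upot _ _) => u h3.
by rewrite (_ : - (th * (2^-1 * ln kappa)) + _ = - (th * (2^-1 * ln kappa + al * ln t))) ?lerN2//; ring.
Qed.
Context (z : R) (z0 : 0 < z).

Definition sqdist (t phi : R) := (t * cos phi - z) ^+ 2 + (t * sin phi) ^+ 2.
(* The kernel w / (w - z), and its derivative times w. *)
Definition re_ker (t phi : R) := (t * cos phi - 0) * ((t * cos phi - z) / sqdist t phi) - t * sin phi * (- (t * sin phi) / sqdist t phi).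
Definition im_ker (t phi : R) := (t * cos phi - 0) * (- (t * sin phi) / sqdist t phi) + t * sin phi * ((t * cos phi - z) / sqdist t phi).
Definition re_dker (t phi : R) := - (z * t * (cos phi * ((t * cos phi - z) ^+ 2 - (t * sin phi) ^+ 2) +
  2 * sin phi * (t * cos phi - z) * (t * sin phi))) / sqdist t phi ^+ 2.
Definition im_dker (t phi : R) := - (z * t * (sin phi * ((t * cos phi - z) ^+ 2 - (t * sin phi) ^+ 2) -
  2 * cos phi * (t * cos phi - z) * (t * sin phi))) / sqdist t phi ^+ 2.

Lemma hol_K (t phi : R) : 0 < t -> sqdist t phi != 0 -> polar_CR re_ker im_ker (re_dker t phi) (im_dker t phi) t phi.
Proof.
move=> t0 n0; have h := hol_mul (hol_translate 0 phi t0) (hol_inv (hol_translate z phi t0) n0).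
have [h1 h2 h3 h4] := h; rewrite /re_dker /im_dker /sqdist in n0 *.
split; [apply: der_eq h1 _|apply: der_eq h2 _|apply: der_eq h3 _|apply: der_eq h4 _].
all: by move: n0; move: (cos phi) (sin phi) (t^-1) => c s ti n0; field.
Qed.

Lemma EnE (t phi : R) : sqdist t phi = (t - z) ^+ 2 + 4 * t * z * sin (phi / 2) ^+ 2.
Proof.
have -> : phi = phi / 2 + phi / 2 by field.
rewrite /sqdist sinD cosD (_ : (phi / 2 + phi / 2) / 2 = phi / 2); last by field.
have := cos2Dsin2 (phi / 2); move: (cos _) (sin _) => c s h.
have cc : c * c = 1 - s ^+ 2 by rewrite -h; ring.
have -> : (t * (s * c + c * s)) ^+ 2 = 4 * t ^+ 2 * s ^+ 2 * (c * c) by ring.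
rewrite cc; ring.
Qed.

(** The half-angle formula splits |w - z|^2 into a radial and an angular part. Both are kept:
    together they dominate a multiple of (phi + |t - z|)^2, which matches the order to which g - s
    vanishes at z. *)
Lemma En_ge (t phi : R) : 0 < t -> 0 < phi <= pi ->
  [/\ (t - z) ^+ 2 <= sqdist t phi, t * z * (phi / 2) ^+ 2 <= sqdist t phi & 0 < sqdist t phi].
Proof.
move=> t0 /andP[p0 p1]; have := @sin_ge_half (phi / 2).
have h : 0 <= phi / 2 <= pi / 2 by rewrite divr_ge0 ?(ltW p0)//= ler_pM2r// invr_gt0.
move=> /(_ h) hs; rewrite EnE; set s := sin _ in hs *.
have tz : 0 < t * z by rewrite mulr_gt0.
have s2 : (phi / 2 / 2) ^+ 2 <= s ^+ 2.
  by rewrite ler_pXn2r ?nnegrE ?divr_ge0 ?(ltW p0)//; apply: le_trans hs; rewrite !divr_ge0 ?ltW.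
have E : t * z * (phi / 2) ^+ 2 = 4 * t * z * (phi / 2 / 2) ^+ 2 by field.
have l : t * z * (phi / 2) ^+ 2 <= 4 * t * z * s ^+ 2.
  by rewrite E ler_wpM2l// -mulrA mulr_ge0// ltW.
have pp : 0 < t * z * (phi / 2) ^+ 2 by rewrite mulr_gt0// exprn_gt0// divr_gt0.
have q := sqr_ge0 (t - z).
by split; lra.
Qed.

(** Uniform in t and valid past phi = pi, since differentiating in phi at pi takes a neighbourhood.
    With c = |cos phi0| >= cos phi, one has t^2 + z^2 - 2 t z c >= (1 - c) (t^2 + z^2). *)
Lemma En_ge_loc (phi0 t phi : R) : 0 < t -> 0 < phi0 <= pi -> phi0 <= phi < phimax ->
  phi0 < pi -> (1 - `|cos phi0|) * z ^+ 2 <= sqdist t phi.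
Proof.
move=> t0 /andP[p0 p1] /andP[h0 h1] p2.
have [_ _ bb] := phimax_bound.
have c : cos phi <= `|cos phi0|.
  have [pp|pp] := lerP phi pi.
    apply: le_trans (ler_norm _); rewrite leNgt ltr_cos ?in_itv/= -?leNgt//; lra.
  apply: le_trans (normr_ge0 _).
  have -> : phi = (phi - pi) + pi by rewrite subrK.
  rewrite cosDpi oppr_le0 cos_ge0_pihalf//; apply/andP; split; lra.
have -> : sqdist t phi = t ^+ 2 + z ^+ 2 - 2 * (t * z) * cos phi.
  have E : sqdist t phi = t ^+ 2 * (cos phi ^+ 2 + sin phi ^+ 2) + z ^+ 2 - 2 * (t * z) * cos phi by rewrite /sqdist; ring.
  by rewrite E cos2Dsin2 mulr1.
have c1' : `|cos phi0| <= 1 by exact: cos_max.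
have tz : 0 <= t * z by rewrite mulr_ge0 ?ltW.
move: c c1' (normr_ge0 (cos phi0)); move: (cos phi) `|_| => x y xy y1 y0.
have := ler_wpM2l tz xy; have := sqr_ge0 (t - z); have := sqr_ge0 t; nra.
Qed.

Lemma K_sq (t phi : R) : sqdist t phi != 0 -> re_ker t phi ^+ 2 + im_ker t phi ^+ 2 = t ^+ 2 / sqdist t phi.
Proof.
move=> n0; have E : re_ker t phi ^+ 2 + im_ker t phi ^+ 2 = (t ^+ 2 * (cos phi ^+ 2 + sin phi ^+ 2)) / sqdist t phi.
  by move: n0; rewrite /re_ker /im_ker /sqdist; move: (cos phi) (sin phi) => c s n0; field.
by rewrite E cos2Dsin2 mulr1.
Qed.

Lemma K_bound (t phi e : R) : 0 < t -> 0 < e -> e ^+ 2 <= sqdist t phi -> `|re_ker t phi| <= t / e /\ `|im_ker t phi| <= t / e.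
Proof.
move=> t0 e0 eE; have E0 : 0 < sqdist t phi by apply: lt_le_trans eE; exact: exprn_gt0.
have h : re_ker t phi ^+ 2 + im_ker t phi ^+ 2 <= (t / e) ^+ 2.
  rewrite K_sq ?gt_eqF// expr_div_n ler_wpM2l ?sqr_ge0// lef_pV2 ?posrE ?exprn_gt0//.
have te : 0 <= t / e by rewrite divr_ge0 ?ltW.
have a1 := sqr_ge0 (re_ker t phi); have a2 := sqr_ge0 (im_ker t phi).
by split; rewrite -(ler_pXn2r (n := 2)) ?nnegrE// real_normK ?num_real//; lra.
Qed.

Lemma KAB_bound (t phi : R) : 0 < t -> 0 < sqdist t phi ->
  `|re_dker t phi| <= 2 * z * t / sqdist t phi /\ `|im_dker t phi| <= 2 * z * t / sqdist t phi.
Proof.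
move=> t0 E0; rewrite /re_dker /im_dker.
have cm := cos_max phi; have sm := sin_max phi.
set X := t * cos phi - z; set Y := t * sin phi.
have EE : sqdist t phi = X ^+ 2 + Y ^+ 2 by [].
have d1 : `|X ^+ 2 - Y ^+ 2| <= sqdist t phi.
  by rewrite EE ler_norml; have := sqr_ge0 X; have := sqr_ge0 Y; move=> *; apply/andP; split; lra.
have d2 : `|2 * X * Y| <= sqdist t phi.
  by rewrite EE ler_norml; have := sqr_ge0 (X - Y); have := sqr_ge0 (X + Y); move=> *; apply/andP; split; nra.
have aux (c s x y : R) : `|c| <= 1 -> `|s| <= 1 -> `|x| <= sqdist t phi -> `|y| <= sqdist t phi ->
    `|- (z * t * (c * x + s * y)) / sqdist t phi ^+ 2| <= 2 * z * t / sqdist t phi.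
  move=> hc hs hx hy; rewrite normrM normrN normfV (ger0_norm (exprn_ge0 2 (ltW E0))).
  rewrite ler_pdivrMr ?exprn_gt0// (_ : 2 * z * t / sqdist t phi * sqdist t phi ^+ 2 = z * t * (sqdist t phi + sqdist t phi)); last first.
    by field; rewrite gt_eqF.
  rewrite normrM gtr0_norm ?mulr_gt0// ler_wpM2l ?mulr_ge0 ?(ltW z0) ?(ltW t0)//.
  apply: le_trans (ler_normD _ _) _; rewrite !normrM; apply: lerD.
    by rewrite -[leRHS]mul1r ler_pM.
  by rewrite -[leRHS]mul1r ler_pM.
split.
- have := aux _ _ _ _ cm sm d1 d2.
  by rewrite (_ : sin phi * (2 * X * Y) = 2 * sin phi * X * Y); last ring.
- have sm' : `|- cos phi| <= 1 by rewrite normrN.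
  have := aux _ _ _ _ sm sm' d1 d2.
  by rewrite (_ : - cos phi * (2 * X * Y) = - (2 * cos phi * X * Y)); last ring.
Qed.

Lemma continuous_KAB (t phi : R) : 0 < t -> sqdist t phi != 0 ->
  [/\ {for t, continuous (re_dker ^~ phi)}, {for t, continuous (im_dker ^~ phi)},
      {for t, continuous (re_ker ^~ phi)} & {for t, continuous (im_ker ^~ phi)}].
Proof.
move=> t0 n0; have [d1 d2 _ _] := hol_K t0 n0.
have X := der_add (der_mulr (cos phi) (der_id t)) (der_cst t (- z)).
have Y := der_mulr (sin phi) (der_id t).
have XX := der_mul X X; have YY := der_mul Y Y; have E := der_add XX YY.
have EE := der_mul E E; have ZT := der_mull z (der_id t).
have S := der_add XX (der_opp YY).
have n2 : sqdist t phi * sqdist t phi != 0 by rewrite mulf_neq0.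
split; [| |exact: der_continuous d1|exact: der_continuous d2].
- have N := der_opp (der_mul ZT (der_add (der_mull (cos phi) S) (der_mul (der_mull (2 * sin phi) X) Y))).
  exact: der_continuous (@der_div _ _ (fun u => sqdist u phi * sqdist u phi) t _ _ n2 N EE).
- have N := der_opp (der_mul ZT (der_add (der_mull (sin phi) S) (der_opp (der_mul (der_mull (2 * cos phi) X) Y)))).
  exact: der_continuous (@der_div _ _ (fun u => sqdist u phi * sqdist u phi) t _ _ n2 N EE).
Qed.

(** * Bounds for g near 0 and at infinity *)

Lemma powRN_cvg0 (p : R) : 0 < p -> x `^ (- p) @[x --> +oo] --> 0.
Proof.
move=> p0; apply/cvgr0Pnorm_le => e e0; near=> x.
have x0 : 0 < x by near: x; apply: nbhs_pinfty_gt; rewrite num_real.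
rewrite ger0_norm ?powR_ge0// powRN -[leRHS]invrK lef_pV2 ?posrE ?invr_gt0 ?powR_gt0//.
have <- : (e^-1 `^ p^-1) `^ p = e^-1.
  by rewrite -powRrM mulVf ?gt_eqF// powRr1// invr_ge0 ltW.
apply: ler_powR_base; rewrite ?powR_ge0 ?(ltW p0)//.
Unshelve. all: end_near. Qed.

Lemma cvg_addl_pinfty (c : R) (f : R -> R) (l : R) : f x @[x --> +oo] --> l -> f (c + x) @[x --> +oo] --> l.
Proof.
move=> fl; apply: (@cvg_comp _ _ _ (fun x => c + x) f _ +oo) => //.
by apply/cvgryPge => A; near=> x; rewrite -lerBlDl; near: x; apply: nbhs_pinfty_ge; rewrite num_real.
Unshelve. all: end_near. Qed.

Lemma integrable_rsqrt_decay (p : R) : 0 < p ->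
  lambda.-integrable (`]0, +oo[%classic : set RR) (fun t : R => (t `^ (- 2^-1) * (1 + t) `^ (- 2^-1 - p))%:E).
Proof.
move=> p0.
have m0 : measurable_fun [set: R] (fun t : R => t `^ (- 2^-1) * (1 + t) `^ (- 2^-1 - p)).
  by apply: measurable_funM; apply: measurable_fun_powR => //; exact: measurable_funD.
(* A majorant with elementary primitives, multiples of (t / (1 + t))^(1/2) and of (1 + t)^(- p). Its
   first term suffices for t <= 1, where 3 / (1 + t) >= 1, its second for t > 1, where t^(-1/2) <= 2
   (1 + t)^(-1/2). *)
pose h (t : R) := 3 * (t `^ (- 2^-1) * (1 + t) `^ (- (1 + 2^-1))) + 2 * (1 + t) `^ (- 1 - p).
have mh : measurable_fun [set: R] h.
  apply: measurable_funD; apply: measurable_funM => //; last first.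
    by apply: measurable_fun_powR; exact: measurable_funD.
  by apply: measurable_funM; apply: measurable_fun_powR => //; exact: measurable_funD.
have h0 t : 0 <= h t by rewrite addr_ge0// !mulr_ge0// powR_ge0.
pose F (t : R) := 6 * (1 - (1 + t) `^ (-1)) `^ 2^-1 - 2 / p * (1 + t) `^ (- p).
have Fh : (\int[lambda]_(x in (`]0%R, +oo[%classic : set RR)) (h x)%:E = (6 - - (2 / p))%:E)%E.
  have iE (t : R) : 0 < 1 + t -> (1 + t) `^ (-1) = (1 + t)^-1 by move=> t1; rewrite powR_inv1// ltW.
  apply: (@ge0_FTC_oy R h F).
  - by move=> t _; exact: h0.
  - move=> t t0; have t1 : 0 < 1 + t by rewrite addr_gt0.
    have n1 : 1 + t != 0 by rewrite gt_eqF.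
    have D1 := der_add (der_cst t 1) (der_id t).
    have w0 : 0 < 1 - (1 + t) `^ (-1) by rewrite iE// subr_gt0 invf_lt1// ltrDl.
    have Di := @der_powR _ (fun u => 1 + u) t _ (-1) t1 D1.
    have D2 := @der_powR _ (fun u => 1 - (1 + u) `^ (-1)) t _ 2^-1 w0 (der_add (der_cst t 1) (der_opp Di)).
    have D3 := @der_powR _ (fun u => 1 + u) t _ (- p) t1 D1.
    apply: der_eq (der_add (der_mull 6 D2) (der_opp (der_mull (2 / p) D3))) _.
    have -> : 1 - (1 + t) `^ (-1) = t / (1 + t) by rewrite iE//; field.
    rewrite /h (_ : (2^-1 - 1 = - 2^-1 :> R)); last by field.
    rewrite powRM ?invr_ge0 ?(ltW t0) ?(ltW t1)//.
    have -> : (1 + t)^-1 `^ (- 2^-1) = (1 + t) `^ 2^-1.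
      by rewrite -[(1 + t)^-1]iE// -powRrM; congr powR; field.
    have -> : (1 + t) `^ (- (1 + 2^-1)) = (1 + t) `^ 2^-1 * (1 + t) `^ (- 1 - 1).
      by rewrite -powRD ?(gt_eqF t1) ?implybT//; congr powR; field.
    have -> : - 1 - p = - p - 1 by ring.
    by field; rewrite gt_eqF.
  - move=> t t0; have t1 : 0 < 1 + t by rewrite addr_gt0.
    have D1 := der_add (der_cst t 1) (der_id t).
    have D2 := der_powR (- 2^-1) t0 (der_id t).
    have D3 := @der_powR _ (fun u => 1 + u) t _ (- (1 + 2^-1)) t1 D1.
    have D4 := @der_powR _ (fun u => 1 + u) t _ (- 1 - p) t1 D1.
    exact: der_continuous (der_add (der_mull 3 (der_mul D2 D3)) (der_mull 2 D4)).
  - rewrite (_ : - (2 / p) = 6 * 0 - 2 / p * (1 + 0) `^ (- p)); last by rewrite addr0 powR1; ring.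
    have D1 := der_add (der_cst (0 : R) 1) (der_id (0 : R)).
    have t1 : 0 < 1 + 0 :> R by rewrite addr0.
    have D3 (q : R) := @der_powR _ (fun u => 1 + u) (0 : R) _ q t1 D1.
    apply: cvgB; apply: cvgMr; last by apply: cvg_at_right_filter; exact: der_continuous (D3 (- p)).
    have cs : Num.sqrt (1 - (1 + x) `^ (-1)) @[x --> 0^'+] --> (0 : R).
      rewrite -[X in _ --> X](@sqrtr0 R); apply: continuous_cvg; first exact: sqrt_continuous.
      have c : {for (0 : R), continuous (fun u : R => 1 - (1 + u) `^ (-1))}.
        exact: der_continuous (der_add (der_cst (0 : R) 1) (der_opp (D3 (-1)))).
      by have := cvg_at_right_filter c; rewrite addr0 powR1 subrr.
    apply: cvg_trans cs; apply: near_eq_cvg; near=> x.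
    have x0 : 0 < x by near: x; exact: nbhs_right_gt.
    have x1 : 0 < 1 + x by rewrite addr_gt0.
    by rewrite powR12_sqrt// iE// subr_ge0 invf_le1// lerDl ltW.
  - rewrite (_ : 6 = 6 * 1 `^ 2^-1 - 2 / p * 0); last by rewrite powR1; ring.
    apply: cvgB; apply: cvgMr; last by apply: (@cvg_addl_pinfty 1 (fun x => x `^ (- p))); exact: powRN_cvg0.
    have D := der_powR 2^-1 (ltr01 : 0 < 1 :> R) (der_id (1 : R)).
    apply: (@cvg_comp _ _ _ (fun t => 1 - (1 + t) `^ (-1)) (fun b => b `^ 2^-1) _ (nbhs (1 : R))); last exact: der_continuous D.
    suff : 1 - (1 + t) `^ (-1) @[t --> +oo] --> (1 - 0 : R) by rewrite subr0.
    apply: cvgB; first exact: cvg_cst.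
    by apply: (@cvg_addl_pinfty 1 (fun x => x `^ (-1))); exact: powRN_cvg0.
have Ih : lambda.-integrable (`]0, +oo[%classic : set RR) (EFin \o h).
  apply/integrableP; split; first by apply/measurable_EFinP; exact: measurable_funTS.
  have -> : (\int[lambda]_(x in (`]0%R, +oo[%classic : set RR)) `|(EFin \o h) x| = (6 - - (2 / p))%:E)%E; last exact: ltry.
  by rewrite -Fh; apply: eq_integral => x _; rewrite /= ger0_norm.
apply: (le_integrable _ _ _ Ih) => //; first by apply/measurable_EFinP; exact: measurable_funTS.
move=> t /=; rewrite in_itv/= andbT => t0; have t1 : 0 < 1 + t by rewrite addr_gt0.
rewrite lee_fin !ger0_norm ?mulr_ge0 ?powR_ge0// /h.
have [tl|tl] := lerP t 1.
  apply: (@le_trans _ _ (3 * (t `^ (- 2^-1) * (1 + t) `^ (- (1 + 2^-1))))); last by rewrite lerDl mulr_ge0 ?powR_ge0.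
  rewrite mulrCA ler_wpM2l ?powR_ge0//.
  have -> : (1 + t) `^ (- (1 + 2^-1)) = (1 + t) `^ (- 2^-1 - p) * (1 + t) `^ (p - 1).
    by rewrite -powRD ?(gt_eqF t1) ?implybT//; congr powR; field.
  rewrite mulrCA ler_peMr ?powR_ge0//.
  apply: (@le_trans _ _ (3 * (1 + t)^-1)); first by rewrite ler_pdivlMr// mul1r; lra.
  rewrite ler_wpM2l// -powR_inv1 ?(ltW t1)// ler_powR//; first by rewrite lerDl ltW.
  by rewrite lerDr ltW.
apply: (@le_trans _ _ (2 * (1 + t) `^ (- 1 - p))); last by rewrite lerDr !mulr_ge0 ?powR_ge0.
have -> : (1 + t) `^ (- 1 - p) = (1 + t) `^ (- 2^-1) * (1 + t) `^ (- 2^-1 - p).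
  by rewrite -powRD ?(gt_eqF t1) ?implybT//; congr powR; field.
rewrite mulrA ler_wpM2r ?powR_ge0//.
have -> : t `^ (- 2^-1) = 2 `^ 2^-1 * (2 * t) `^ (- 2^-1).
  by rewrite powRM ?(ltW t0)// mulrA -powRD ?pnatr_eq0 ?implybT// subrr powRr0 mul1r.
apply: ler_pM; rewrite ?powR_ge0//.
  rewrite -[leRHS](@powRr1 _ 2)//; apply: ler_powR; rewrite ?ler1n//; lra.
by apply: ler_powRN_base => //; rewrite ?invr_ge0//; lra.
Unshelve. all: end_near. Qed.
Lemma normr_indic_le1 (A : set RR) (r : R) : `|\1_A r : R| <= 1.
Proof. by rewrite indicE normr_nat lern1 leq_b1. Qed.

Lemma H_small (e : R) : 0 < e -> exists2 d : R, 0 < d < 1 & fine (H `]0%R, d[%classic) <= e.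
Proof.
move=> e0; pose A n : set RR := `]0%R, n.+2%:R^-1[%classic.
have mA n : measurable (A n) by exact: measurable_itv.
have c : H (A n) @[n --> \oo] --> H (\bigcap_n A n).
  apply: nonincreasing_cvg_mu.
  - by rewrite (le_lt_trans (probability_le1 _ _)) ?ltry.
  - exact: mA.
  - by apply: bigcap_measurable => //; exact: mA.
  - move=> n m nm; apply/subsetPset => x; rewrite /A /= !in_itv/= => /andP[-> h] /=.
    by apply: lt_le_trans h _; rewrite lef_pV2 ?posrE// ler_nat !ltnS.
have A0 : \bigcap_n A n = set0.
  apply/seteqP; split => // x h; have := h 0 I; rewrite /A/= in_itv/= => /andP[x0 _].
  have [n _ hn] := near_infty_natSinv_lt (PosNum x0).
  have := h n I; rewrite /A/= in_itv/= x0/= => xn.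
  have := hn n (leqnn n) => /= h2; have := lt_trans xn (le_lt_trans _ h2).
  by rewrite lef_pV2 ?posrE// ler_nat leqnSn ltxx => /(_ isT).
move: c; rewrite A0 measure0 => /fine_cvgP[_] /cvgr0Pnorm_le /(_ e e0) [n _ /(_ n (leqnn n)) /= hn].
exists n.+2%:R^-1; first by rewrite invr_gt0 ltr0n /= invf_lt1// ltr1n.
by apply: le_trans hn; exact: ler_norm.
Qed.

(** Choose d with H(]0, d[) <= 1 / (2 al th). For t^al <= d, the integrand of U is at least al ln t
    on r < d and at least ln d elsewhere, up to constants. Hence U >= const + ln t / (2 th),
    whatever the behaviour of H at 0. *)
Lemma expU_small : exists C t1 : R, [/\ 0 < C, 0 < t1 <= 1 &
  forall t phi : R, 0 < t <= t1 -> `|phi| <= phimax -> expR (- (th * Upot t phi)) <= C * t `^ (- 2^-1)].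
Proof.
have [|d /andP[d0 d1] Hd] := @H_small (2^-1 / (al * th)); first by rewrite divr_gt0// mulr_gt0.
pose eta := fine (H `]0%R, d[%classic).
have eta0 : 0 <= eta by exact: fine_ge0.
exists (expR (- (th * (2^-1 * ln kappa + ln d)))), (d `^ al^-1); split.
- exact: expR_gt0.
- rewrite powR_gt0//=; apply: (@le_trans _ _ (1 `^ al^-1)); last by rewrite powR1.
  by apply: ler_powR_base; rewrite ?invr_ge0 ?ltW.
move=> t phi /andP[t0 td] h.
have xd : t `^ al <= d.
  have : t `^ al <= (d `^ al^-1) `^ al by apply: ler_powR_base => //; exact: ltW.
  by rewrite -powRrM mulVf ?gt_eqF// powRr1// ltW.
have ld : ln d <= 0 by rewrite ln_le0// ltW.
have lx : ln (t `^ al) <= 0 by rewrite ln_le0// (le_trans xd)// ltW.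
pose L r : R := 2^-1 * ln kappa + ln d + ln (t `^ al) * \1_(`]0%R, d[%classic : set RR) r.
have mL : measurable_fun [set: R] L by apply: measurable_funD => //; exact: measurable_funM.
have LU : 2^-1 * ln kappa + ln d + ln (t `^ al) * eta <= Upot t phi.
  have I1 : H.-integrable P0 (EFin \o (fun r => \1_(`]0%R, d[%classic : set RR) r : R)).
    apply: (@integrable_bounded _ 1); first exact: measurable_indic.
    by move=> r _; exact: normr_indic_le1.
  have I2 : H.-integrable P0 (EFin \o (fun r => ln (t `^ al) * \1_(`]0%R, d[%classic : set RR) r : R)).
    apply: (@integrable_bounded _ `|ln (t `^ al)|); first exact: measurable_funM.
    by move=> r _; rewrite normrM ler_piMr//; exact: normr_indic_le1.
  have -> : 2^-1 * ln kappa + ln d + ln (t `^ al) * eta = \int[H]_(r in P0) L r.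
    rewrite /L RintegralD//; last exact: integrable_cstH.
    rewrite (@Rintegral_EFin_cst _ _ H P0)// RintegralZl//; congr (_ + _ * _).
    rewrite /Rintegral integral_indic// /eta; congr (fine (H _)).
    by apply/seteqP; split => [x h'|x []//]; split => //; move: h'; rewrite /= !in_itv/= andbT => /andP[].
  apply: le_Rintegral => //; last 1 first.
  - move=> r /in0 r0; have [h1 h2] := lg_ge t0 r0 h.
    rewrite /L indicE; have [hr|hr] := boolP (r \in (`]0%R, d[%classic : set RR)); rewrite ?mulr1 ?mulr0; first lra.
    have : d <= r by rewrite leNgt; apply: contra hr => rd; rewrite inE /= in_itv/= r0.
    by rewrite -ler_ln ?posrE//; lra.
  - apply: (@integrable_bounded _ (`|2^-1 * ln kappa + ln d| + `|ln (t `^ al)|)) => //.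
    move=> r _.
    apply: le_trans (ler_normD _ _) _; rewrite lerD2l normrM ler_piMr//.
    exact: normr_indic_le1.
  - exact: integrable_lg.
rewrite {1}/powR gt_eqF// -expRD ler_expR.
have eta1 : th * al * eta <= 2^-1.
  move: Hd; rewrite -/eta ler_pdivlMr ?mulr_gt0//; lra.
have l2 : ln t <= 0.
  rewrite ln_le0// (le_trans td)//; apply: (@le_trans _ _ (1 `^ al^-1)); last by rewrite powR1.
  by apply: ler_powR_base; rewrite ?invr_ge0 ?ltW.
have := ler_wpM2l (ltW th0) LU; rewrite ln_powR.
have : 0 <= (2^-1 - th * al * eta) * - ln t by rewrite mulr_ge0 ?subr_ge0// oppr_ge0.
move: (Upot _ _) (ln t) (ln kappa) (ln d) => u x k l; nra.
Qed.

(* Since w^(1/2) g(w) stays bounded near 0 and g(w) = O(|w|^(- al * th)),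
   [decay] dominates g on the whole sector. *)
Definition decay_exp : R := Num.min (al * th) 2^-1.
Definition decay (t : R) : R := t `^ (- 2^-1) * (1 + t) `^ (2^-1 - decay_exp).

Lemma pexp_bound : 0 < decay_exp <= 2^-1.
Proof. by rewrite /decay_exp ge_min lexx orbT andbT lt_min mulr_gt0//= invr_gt0. Qed.

Lemma mdec_ge (t : R) : 0 < t -> t `^ (- 2^-1) <= decay t.
Proof.
move=> t0; rewrite /decay ler_peMr ?powR_ge0//.
apply: (@le_trans _ _ ((1 + t) `^ 0)); first by rewrite powRr0.
rewrite ler_powR ?lerDl ?(ltW t0)//.
by rewrite subr_ge0; case/andP: pexp_bound.
Qed.

Lemma expU_mdec : exists2 C : R, 0 < C & forall t phi : R, 0 < t -> `|phi| <= phimax ->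
  expR (- (th * Upot t phi)) <= C * decay t.
Proof.
have [C [t1 [C0 /andP[t10 t11] Ct]]] := expU_small.
pose c := expR (- (th * (2^-1 * ln kappa))).
have c0 : 0 < c by exact: expR_gt0.
(* One summand per range: C for t <= t1, c t1^(- al th) for t1 < t <= 1, and c for t > 1. *)
exists (C + c + c * t1 `^ (- (al * th))); first by rewrite !addr_gt0// mulr_gt0// powR_gt0.
move=> t phi t0 h; have m0 : 0 <= decay t by rewrite mulr_ge0 ?powR_ge0.
have q0 : 0 <= t1 `^ (- (al * th)) by exact: powR_ge0.
have /andP[pe0 pe1] := pexp_bound.
have [tt1|tt1] := lerP t t1.
  apply: le_trans (Ct t phi _ h) _; first by rewrite t0.
  apply: (@le_trans _ _ (C * decay t)); first by rewrite ler_wpM2l ?mdec_ge ?ltW.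
  by rewrite ler_wpM2r// -addrA lerDl addr_ge0 ?mulr_ge0// ltW.
apply: le_trans (expU_le t0 h) _; rewrite -/c.
have [t2|t2] := lerP t 1.
  apply: (@le_trans _ _ (c * t1 `^ (- (al * th)) * decay t)); last first.
    by rewrite ler_wpM2r// lerDr addr_ge0// ltW.
  rewrite -mulrA ler_wpM2l ?(ltW c0)//.
  apply: (@le_trans _ _ (t1 `^ (- (al * th)))); first by apply: ler_powRN_base; rewrite ?mulr_ge0 ?ltW.
  rewrite ler_peMr//; apply: le_trans (mdec_ge t0).
  apply: (@le_trans _ _ (1 `^ (- 2^-1))); first by rewrite powR1.
  by apply: ler_powRN_base => //; rewrite invr_ge0.
apply: (@le_trans _ _ (c * decay t)); last first.
  by rewrite ler_wpM2r// addrAC lerDr addr_ge0 ?mulr_ge0// ltW.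
rewrite ler_wpM2l ?(ltW c0)//.
apply: (@le_trans _ _ (t `^ (- 2^-1 + (2^-1 - decay_exp)))).
  apply: ler_powR; first exact: ltW.
  by rewrite addrA addNr add0r lerN2 /decay_exp ge_min lexx.
rewrite powRD ?(gt_eqF t0) ?implybT// /decay ler_wpM2l ?powR_ge0//.
by apply: ler_powR_base; [rewrite subr_ge0|exact: ltW|rewrite lerDr].
Qed.

(** * Removing the pole at z *)

Lemma MVT_lip (f df : R -> R) (lo hi C a b : R) : lo <= a <= hi -> lo <= b <= hi ->
  (forall x, lo <= x <= hi -> is_derive x 1 f (df x)) -> (forall x, lo <= x <= hi -> `|df x| <= C) ->
  `|f a - f b| <= C * `|a - b|.
Proof.
move=> aI bI D B; wlog ab : a b aI bI / b <= a.
  by move=> h; have /orP[ab|ab] := le_total b a; [exact: h _ _ aI bI ab|rewrite distrC [X in _ * X]distrC; exact: h _ _ bI aI ab].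
have sub x : b <= x <= a -> lo <= x <= hi.
  move=> /andP[bx xa]; move/andP : aI => [_ ah]; move/andP : bI => [lb _].
  by rewrite (le_trans lb)//= (le_trans xa).
rewrite [`|a - b|]ger0_norm ?subr_ge0//; apply: (@MVT_bound f df b a C ab).
- by move=> x /andP[bx xa]; apply/D/sub; rewrite !ltW.
- by apply: der_within => x /sub; exact: D.
- by move=> x /andP[bx xa]; apply/B/sub; rewrite !ltW.
Qed.

Lemma abs_sin_le (x : R) : `|sin x| <= `|x|.
Proof.
have aI : - `|x| <= x <= `|x| by rewrite -ler_norml.
have bI : - `|x| <= 0 <= `|x| by rewrite oppr_le0 normr_ge0.
have := MVT_lip aI bI (fun u _ => is_derive_sin u) (fun u _ => cos_max u).
by rewrite sin0 !subr0 mul1r.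
Qed.

Lemma abs_cos_sub1_le (x : R) : `|cos x - 1| <= `|x|.
Proof.
have aI : - `|x| <= x <= `|x| by rewrite -ler_norml.
have bI : - `|x| <= 0 <= `|x| by rewrite oppr_le0 normr_ge0.
have := MVT_lip aI bI (fun u _ => is_derive_cos u) (C := 1).
rewrite cos0 !subr0 mul1r; apply => u _.
by rewrite normrN; exact: sin_max.
Qed.

(* s(w) = g(z) (z / w)^(1/2) cancels the pole of g(w) w / (w - z) at z, and its
   own Stieltjes transform is explicit. *)
Definition sqrt_coef : R := expR (- (th * Upot z 0)) * z `^ 2^-1.
Definition re_s (t phi : R) := sqrt_coef * t `^ (- 2^-1) * cos (phi / 2).
Definition im_s (t phi : R) := - (sqrt_coef * t `^ (- 2^-1) * sin (phi / 2)).
Definition re_q (t phi : R) := re_g t phi - re_s t phi.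
Definition im_q (t phi : R) := im_g t phi - im_s t phi.

Lemma kz_gt0 : 0 < sqrt_coef. Proof. by rewrite mulr_gt0 ?expR_gt0// powR_gt0. Qed.

Let pi_phimax (phi : R) : 0 < phi <= pi -> 0 < phi < phimax.
Proof. by move=> /andP[-> h]; have [h2 _ _] := phimax_bound; exact: le_lt_trans h2. Qed.

Let pi_abs (phi : R) : 0 < phi <= pi -> `|phi| <= phimax.
Proof. by move=> /pi_phimax /andP[p0 /ltW p1]; rewrite gtr0_norm. Qed.

Let abs0 : `|0 : R| <= phimax.
Proof. by rewrite normr0; have [h _ _] := phimax_bound; rewrite (le_trans _ (ltW h))// pi_ge0. Qed.

Lemma q_mdec : exists2 C : R, 0 < C & forall t phi : R, 0 < t -> 0 < phi <= pi ->
  `|re_q t phi| <= C * decay t /\ `|im_q t phi| <= C * decay t.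
Proof.
have [C C0 hC] := expU_mdec; have k0 := kz_gt0.
exists (C + sqrt_coef); first by rewrite addr_gt0.
move=> t phi t0 hp; have h1 := hC t phi t0 (pi_abs hp); have h2 := mdec_ge t0.
have [g1 g2] := gPN_bound t phi.
have s0 : 0 <= sqrt_coef * t `^ (- 2^-1) by rewrite mulr_ge0 ?powR_ge0 ?ltW.
have [s1 s2] := abs_sin_cos (phi / 2) s0.
have h3 : sqrt_coef * t `^ (- 2^-1) <= sqrt_coef * decay t by rewrite ler_wpM2l// ltW.
rewrite mulrDl /re_q /im_q /re_s /im_s; split; apply: le_trans (ler_normB _ _) _; apply: lerD.
- exact: le_trans h1.
- exact: le_trans h3.
- exact: le_trans h1.
- by rewrite normrN; exact: le_trans h3.
Qed.

Lemma gN_lin (t phi : R) : 0 < t -> 0 < phi <= pi ->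
  `|im_g t phi| <= expR (- (th * Upot t phi)) * (th * al) * phi.
Proof.
move=> t0 hp; rewrite /im_g normrN normrM ger0_norm ?expR_ge0// -mulrA ler_wpM2l ?expR_ge0//.
apply: le_trans (abs_sin_le _) _.
have /andP[v0 v1] := V_bound t (pi_phimax hp).
by rewrite normrM (gtr0_norm th0) ger0_norm// -mulrA ler_wpM2l ?(ltW th0).
Qed.

Lemma gP_lin (M t phi : R) : 0 < t -> 0 < phi <= pi -> (forall p : R, `|p| <= phimax -> expR (- (th * Upot t p)) <= M) ->
  `|re_g t phi - expR (- (th * Upot t 0))| <= (M * (th * al) + M * (th * (2 / kappa))) * phi.
Proof.
move=> t0 hp hM; have /andP[p0 p1] := hp; have hphi := hM phi (pi_abs hp).
have M0 : 0 <= M by apply: le_trans hphi; exact: expR_ge0.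
have -> : re_g t phi - expR (- (th * Upot t 0)) = expR (- (th * Upot t phi)) * (cos (th * Vpot t phi) - 1) +
  (expR (- (th * Upot t phi)) - expR (- (th * Upot t 0))).
  by rewrite /re_g; move: (expR _) (expR _) (cos _) => *; ring.
rewrite mulrDl; apply: le_trans (ler_normD _ _) _; apply: lerD.
  rewrite normrM ger0_norm ?expR_ge0// -mulrA; apply: ler_pM; rewrite ?expR_ge0//.
  apply: le_trans (abs_cos_sub1_le _) _.
  have /andP[v0 v1] := V_bound t (pi_phimax hp).
  by rewrite normrM (gtr0_norm th0) ger0_norm// -mulrA ler_wpM2l ?(ltW th0).
have [bb _ _] := phimax_bound.
have lt (x : R) : 0 <= x <= phi -> `|x| < phimax.
  by move=> /andP[x0 xp]; rewrite ger0_norm// (le_lt_trans xp)// (le_lt_trans p1).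
have aI : 0 <= phi <= phi by apply/andP; split => //; exact: ltW.
have bI : 0 <= (0 : R) <= phi by apply/andP; split => //; exact: ltW.
have := @MVT_lip (fun p => expR (- (th * Upot t p))) (fun p => expR (- (th * Upot t p)) * - (th * - im_dlog t p)) 0 phi
  (M * (th * (2 / kappa))) phi 0 aI bI.
rewrite subr0 (ger0_norm (ltW p0)); apply.
  by move=> x /lt hx; exact: der_expR (der_opp (der_mull th (der_U_phi t0 hx))).
move=> x /lt /ltW hx; rewrite normrM ger0_norm ?expR_ge0// mulrN opprK normrM (gtr0_norm th0).
apply: ler_pM; [exact: expR_ge0|exact: mulr_ge0 (ltW th0) (normr_ge0 _)|exact: hM|].
by rewrite ler_wpM2l ?(ltW th0)//; have [_] := C12_bound t hx.
Qed.

(** g and s have the same value at w = z and vary at a bounded rate in t and phi nearby, so g - s =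
    O(phi + |t - z|), the order of w - z itself. This keeps (g - s) w / (w - z) bounded near z. *)
Lemma q_lip : exists2 C : R, 0 <= C & forall t phi : R, z / 2 <= t <= 2 * z -> 0 < phi <= pi ->
  `|re_q t phi| <= C * (phi + `|t - z|) /\ `|im_q t phi| <= C * (phi + `|t - z|).
Proof.
have z2 : 0 < z / 2 by rewrite divr_gt0.
pose M := expR (- (th * (2^-1 * ln kappa))) * (z / 2) `^ (- (al * th)).
have M0 : 0 <= M by rewrite mulr_ge0 ?expR_ge0 ?powR_ge0.
have hM (t p : R) : z / 2 <= t -> `|p| <= phimax -> expR (- (th * Upot t p)) <= M.
  move=> tz hp; have t0 : 0 < t by exact: lt_le_trans tz.
  apply: le_trans (expU_le t0 hp) _; rewrite ler_wpM2l ?expR_ge0//.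
  by apply: ler_powRN_base => //; rewrite mulr_ge0 ?ltW.
have k0 := kz_gt0; have k0' := ltW k0; have th0' := ltW th0.
pose S := sqrt_coef * (z / 2) `^ (- 2^-1).
have S0 : 0 <= S by rewrite mulr_ge0 ?powR_ge0.
have kapi : 0 <= 2 / kappa by rewrite divr_ge0// ltW.
pose a1 := M * (th * al) + M * (th * (2 / kappa)) + S.
pose a2 := M * (th * (2 / kappa)) / (z / 2) + S / (z / 2).
have m1 := mulr_ge0 M0 (mulr_ge0 th0' kapi).
have m2 := mulr_ge0 M0 (mulr_ge0 th0' (ltW al0)).
have a10 : 0 <= a1 by rewrite addr_ge0// addr_ge0.
have a20 : 0 <= a2 by rewrite addr_ge0// divr_ge0 ?(ltW z2).
exists (a1 + a2); first by rewrite addr_ge0.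
move=> t phi tz hp; have /andP[tz1 tz2] := tz; have t0 : 0 < t by exact: lt_le_trans tz1.
have /andP[p0 p1] := hp.
have St : sqrt_coef * t `^ (- 2^-1) <= S.
  by rewrite /S ler_wpM2l//; apply: ler_powRN_base => //; rewrite invr_ge0.
have st0 : 0 <= sqrt_coef * t `^ (- 2^-1) by rewrite mulr_ge0 ?powR_ge0.
have ph2 : `|phi / 2| <= phi by rewrite ger0_norm ?divr_ge0 ?(ltW p0)// ler_pdivrMr// ler_peMr ?(ltW p0)// ler1n.
have tz0 : 0 <= `|t - z| by [].
have dist : phi * a1 + `|t - z| * a2 <= (a1 + a2) * (phi + `|t - z|).
  have : 0 <= phi * a2 by rewrite mulr_ge0// ltW.
  have : 0 <= `|t - z| * a1 by rewrite mulr_ge0.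
  by move: a1 a2 {a10 a20} `|t - z| => *; lra.
have mono (x : R) : x <= phi * a1 -> x <= (a1 + a2) * (phi + `|t - z|).
  by move=> h; apply: le_trans dist; apply: le_trans h _; rewrite lerDl mulr_ge0.
split; last first.
  apply: mono; rewrite /im_q /im_s opprK; apply: le_trans (ler_normD _ _) _.
  have h1 := gN_lin t0 hp.
  have h2 : `|sqrt_coef * t `^ (- 2^-1) * sin (phi / 2)| <= S * phi.
    rewrite normrM (ger0_norm st0); apply: ler_pM => //; exact: le_trans (abs_sin_le _) ph2.
  have h3 : expR (- (th * Upot t phi)) * (th * al) * phi <= M * (th * al) * phi.
    by rewrite ler_wpM2r ?(ltW p0)// ler_wpM2r ?mulr_ge0 ?(ltW al0)// hM// pi_abs.
  have h4 : 0 <= M * (th * (2 / kappa)) * phi by rewrite mulr_ge0// ltW.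
  apply: le_trans (lerD (le_trans h1 h3) h2) _; rewrite /a1; move: h4; move: (M * (th * al)) (M * (th * (2 / kappa))) => *; lra.
pose e0 (u : R) := expR (- (th * Upot u 0)).
pose r0 (u : R) := sqrt_coef * u `^ (- 2^-1).
have ez : r0 z = e0 z.
  by rewrite /r0 /sqrt_coef -mulrA -powRD ?(gt_eqF z0) ?implybT// subrr powRr0 mulr1.
(* Two legs, for g and for s alike: along the arc from (t, phi) to (t, 0), then along the axis from
   (t, 0) to (z, 0). By [ez] the values at z cancel. *)
have -> : re_q t phi = (re_g t phi - e0 t) + (e0 t - e0 z) - ((r0 t - r0 z) + r0 t * (cos (phi / 2) - 1)).
  rewrite ez /re_q /re_s -/(r0 t).
  by move: (re_g t phi) (r0 t) (e0 t) (e0 z) (cos _) => *; ring.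
have zI : z / 2 <= z <= 2 * z by apply/andP; split; lra.
have pos (u : R) : z / 2 <= u <= 2 * z -> 0 < u by move=> /andP[h _]; exact: lt_le_trans h.
have inv (u : R) : z / 2 <= u <= 2 * z -> u^-1 <= (z / 2)^-1.
  by move=> h; have u0 := pos u h; rewrite lef_pV2 ?posrE//; case/andP: h.
have b1 := @gP_lin M t phi t0 hp (fun p hp' => hM t p tz1 hp').
have b2 : `|e0 t - e0 z| <= M * (th * (2 / kappa)) / (z / 2) * `|t - z|.
  apply: (@MVT_lip e0 (fun u => e0 u * - (th * (re_dlog u 0 / u))) _ _ _ _ _ tz zI) => u hu; have u0 := pos u hu.
    exact: der_expR (der_opp (der_mull th (der_U_t u0 abs0))).
  rewrite normrM ger0_norm ?expR_ge0// normrN !normrM normfV (gtr0_norm th0) (gtr0_norm u0).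
  rewrite -[leRHS]mulrA; apply: ler_pM; rewrite ?expR_ge0 ?mulr_ge0 ?invr_ge0 ?(ltW u0)//.
    by apply: hM => //; case/andP: hu.
  rewrite -[leRHS]mulrA ler_wpM2l//; apply: ler_pM; rewrite ?invr_ge0 ?(ltW u0) ?inv//.
  by case: (C12_bound u abs0).
have b3 : `|r0 t - r0 z| <= S / (z / 2) * `|t - z|.
  apply: (@MVT_lip r0 (fun u => sqrt_coef * (- 2^-1 * u `^ (- 2^-1 - 1) * 1)) _ _ _ _ _ tz zI) => u hu; have u0 := pos u hu.
    exact: der_mull (der_powR (- 2^-1) u0 (der_id u)).
  rewrite mulr1 powRD ?(gt_eqF u0) ?implybT// powR_inv1 ?(ltW u0)//.
  have -> : sqrt_coef * (- 2^-1 * (u `^ (- 2^-1) / u)) = - (sqrt_coef * (2^-1 * (u `^ (- 2^-1) / u))) by ring.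
  rewrite normrN ger0_norm ?mulr_ge0 ?powR_ge0 ?invr_ge0 ?(ltW u0)//.
  rewrite /S -mulrA ler_wpM2l//.
  have h : u `^ (- 2^-1) / u <= (z / 2) `^ (- 2^-1) / (z / 2).
    apply: ler_pM; rewrite ?powR_ge0 ?invr_ge0 ?(ltW u0) ?inv//.
    by apply: ler_powRN_base; rewrite ?invr_ge0//; case/andP: hu.
  apply: le_trans h; rewrite ler_piMl ?mulr_ge0 ?powR_ge0 ?invr_ge0 ?(ltW u0)//.
  by rewrite invf_le1// ler1n.
have b4 : `|r0 t * (cos (phi / 2) - 1)| <= S * phi.
  by rewrite normrM (ger0_norm st0); apply: ler_pM => //; exact: le_trans (abs_cos_sub1_le _) ph2.
apply: le_trans dist; apply: le_trans (ler_normB _ _) _.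
apply: le_trans (lerD (le_trans (ler_normD _ _) (lerD b1 b2)) (le_trans (ler_normD _ _) (lerD b3 b4))) _.
rewrite le_eqVlt; apply/orP; left; apply/eqP; rewrite /a1 /a2.
move: (M * (th * (2 / kappa))) (M * (th * al)) `|t - z| => x y u; ring.
Qed.

(** * Cauchy's theorem for the regularized integrand *)

Lemma cos_abs_lt1 (p : R) : 0 < p < pi -> `|cos p| < 1.
Proof.
move=> hp; rewrite lt_neqAle cos_max andbT; apply/negP => /eqP h.
have : cos p ^+ 2 = 1 by rewrite -real_normK ?num_real// h expr1n.
have := cos2Dsin2 p; have := sin_gt0_pi hp.
by move: (cos _) (sin _) => c s s0 h1 h2; have := exprn_gt0 2 s0; lra.
Qed.

Lemma En_gt0 (t phi : R) : 0 < t -> 0 < phi < phimax -> 0 < sqdist t phi.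
Proof.
move=> t0 /andP[p0 p1]; have [h|h] := lerP phi pi.
  by have [] := @En_ge t phi t0; rewrite ?p0.
have pp := pi_gt0 R.
have := @En_ge_loc (pi / 2) t phi t0; rewrite cos_pihalf normr0 subr0 mul1r.
have b1 : 0 < pi / 2 :> R by rewrite divr_gt0.
have b2 : pi / 2 < pi :> R by rewrite ltr_pdivrMr// ltr_pMr// ltr1n.
rewrite b1 (ltW b2) p1 (le_trans (ltW b2) (ltW h)) => /(_ isT isT b2).
by apply: lt_le_trans; exact: exprn_gt0.
Qed.

(** F = (g - s) w / (w - z), so that F / w is the integrand of Cauchy's formula. On phi = pi, where
    w = - t, the kernel is the real number t / (t + z), and [im_F] / t is a difference of Stieltjes
    integrands. *)
Definition re_F (t phi : R) := re_q t phi * re_ker t phi - im_q t phi * im_ker t phi.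
Definition im_F (t phi : R) := re_q t phi * im_ker t phi + im_q t phi * re_ker t phi.
Definition re_dq (t phi : R) := re_dg t phi - - 2^-1 * re_s t phi.
Definition im_dq (t phi : R) := im_dg t phi - 2^-1 * (sqrt_coef * t `^ (- 2^-1) * sin (phi / 2)).
Definition re_dF (t phi : R) := re_dq t phi * re_ker t phi + re_q t phi * re_dker t phi - (im_dq t phi * im_ker t phi + im_q t phi * im_dker t phi).

Lemma hol_q (t phi : R) : 0 < t -> 0 < phi < phimax -> polar_CR re_q im_q (re_dq t phi) (im_dq t phi) t phi.
Proof. by move=> t0 h; exact: hol_sub (hol_g t0 h) (hol_rsqrt sqrt_coef phi t0). Qed.

(** The explicit A is what [polar_cauchy] takes; continuity of [im_F] in t follows from the
    existence of B. *)
Lemma hol_F (t phi : R) : 0 < t -> 0 < phi < phimax -> exists B, polar_CR re_F im_F (re_dF t phi) B t phi.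
Proof.
move=> t0 h; have n0 : sqdist t phi != 0 by rewrite gt_eqF// En_gt0.
eexists; exact: hol_mul (hol_q t0 h) (hol_K t0 n0).
Qed.

Lemma continuous_qAB (t phi : R) : 0 < t -> 0 < phi < phimax ->
  {for t, continuous (re_dq ^~ phi)} /\ {for t, continuous (im_dq ^~ phi)}.
Proof.
move=> t0 h; have h' : `|phi| <= phimax by case/andP : h => h0 /ltW h1; rewrite gtr0_norm.
have cU := der_expR (der_opp (der_mull th (der_U_t t0 h'))).
have cV := der_mull th (der_V_t t0 h).
have cc := der_continuous (der_cos cV); have cs := der_continuous (der_sin cV).
have cE := der_continuous (der_mull th cU).
have [cC1 cC2] := continuous_C12 t0 h'.
have [d1 d2 _ _] := hol_rsqrt sqrt_coef phi t0.
split.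
- apply: continuousD; last exact: der_continuous (der_opp (der_mull (- 2^-1) d1)).
  apply: continuousN; apply: continuousM; first exact: cE.
  by apply: continuousD; apply: continuousM.
- apply: continuousD; last first.
    rewrite (_ : (fun x => _) = fun x => 2^-1 * im_s x phi); last by apply/funext => u; rewrite /im_s mulrN.
    exact: der_continuous (der_mull 2^-1 d2).
  apply: continuousN; apply: continuousM; first exact: cE.
  by apply: continuousD; [|apply: continuousN]; apply: continuousM.
Qed.

Lemma F_bound (t phi e Q : R) : 0 < t -> 0 < e -> e ^+ 2 <= sqdist t phi -> `|re_q t phi| <= Q -> `|im_q t phi| <= Q ->
  `|re_F t phi| <= 2 * Q * (t / e) /\ `|im_F t phi| <= 2 * Q * (t / e).
Proof.
move=> t0 e0 eE hP hN; have [k1 k2] := K_bound t0 e0 eE.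
have E : 2 * Q * (t / e) = Q * (t / e) + Q * (t / e) by ring.
rewrite E; split.
- by apply: le_trans (ler_normB _ _) _; rewrite !normrM; apply: lerD; apply: ler_pM.
- by apply: le_trans (ler_normD _ _) _; rewrite !normrM; apply: lerD; apply: ler_pM.
Qed.

Lemma mdec_small (t : R) : 0 < t <= 1 -> decay t <= 2 * t `^ (- 2^-1).
Proof.
move=> /andP[t0 t1]; rewrite /decay mulrC ler_wpM2r ?powR_ge0//.
have /andP[p0 p1] := pexp_bound.
apply: (@le_trans _ _ ((1 + t) `^ 1)).
  by rewrite ler_powR// ?lerDl ?(ltW t0)//; lra.
by rewrite powRr1 ?addr_ge0 ?(ltW t0)//; lra.
Qed.

Lemma mdec_large (t : R) : 1 <= t -> decay t <= 2 * t `^ (- decay_exp).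
Proof.
move=> t1; have t0 : 0 < t by exact: lt_le_trans t1.
have /andP[p0 p1] := pexp_bound.
have -> : t `^ (- decay_exp) = t `^ (- 2^-1) * t `^ (2^-1 - decay_exp).
  by rewrite -powRD ?(gt_eqF t0) ?implybT// addrA addNr add0r.
rewrite /decay mulrCA ler_wpM2l ?powR_ge0//.
apply: (@le_trans _ _ ((2 * t) `^ (2^-1 - decay_exp))).
  by apply: ler_powR_base; rewrite ?subr_ge0 ?addr_ge0 ?(ltW t0)//; lra.
rewrite powRM ?(ltW t0)// ler_wpM2r ?powR_ge0//.
by rewrite -[leRHS](@powRr1 _ 2)//; apply: ler_powR; rewrite ?ler1n//; lra.
Qed.

(** Near 0 the kernel is O(t) against t^(-1/2) for g - s; at infinity it is bounded while [decay]
    tends to 0. *)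
Lemma F1_small (e : R) : 0 < e -> exists e0 N0 : R, 0 < e0 /\
  forall t phi : R, 0 < phi <= pi -> 0 < t -> (t <= e0 \/ N0 <= t) -> `|re_F t phi| <= e.
Proof.
move=> e0; have [C C0 hC] := q_mdec; have /andP[p0 p1] := pexp_bound.
(* For t <= min(1, z / 2) the bound reads (8 C / z) t^(1/2), so t <= s^2 brings it below e. *)
pose s := e * z / (8 * C).
have s0 : 0 < s by rewrite divr_gt0// mulr_gt0.
have c8 : 0 < e / (8 * C) by rewrite divr_gt0// mulr_gt0.
have /cvgr0Pnorm_le /(_ _ c8) [N [_ hN]] := powRN_cvg0 p0.
exists (Num.min (Num.min 1 (z / 2)) (s ^+ 2)), (Num.max (Num.max 1 (2 * z)) (N + 1)); split.
  by rewrite !lt_min ltr01 divr_gt0//= exprn_gt0.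
move=> t phi hp t0; have [h1 h2] := hC t phi t0 hp; have [g1 _ _] := En_ge t0 hp.
rewrite !le_min !ge_max => -[/andP[/andP[t1 t2] t3]|/andP[/andP[t1 t2] t3]].
  have zz : 0 < z / 2 by rewrite divr_gt0.
  have zE : (z / 2) ^+ 2 <= sqdist t phi.
    apply: le_trans g1; rewrite -[leRHS]sqrrN opprB ler_pXn2r ?nnegrE ?(ltW zz)//; lra.
  have [+ _] := F_bound t0 zz zE h1 h2; move/le_trans; apply.
  have m : decay t <= 2 * t `^ (- 2^-1) by apply: mdec_small; rewrite t0.
  have ts : t `^ 2^-1 <= s.
    have <- : (s ^+ 2) `^ 2^-1 = s by rewrite powR12_sqrt ?sqr_ge0// sqrtr_sqr ger0_norm// ltW.
    by apply: ler_powR_base => //; exact: ltW.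
  have tt : t `^ (- 2^-1) * t = t `^ 2^-1.
    by rewrite -[X in _ * X](powRr1 (ltW t0)) -powRD ?(gt_eqF t0) ?implybT//; congr powR; field.
  apply: (@le_trans _ _ (2 * (C * (2 * t `^ (- 2^-1))) * (t / (z / 2)))).
    apply: ler_wpM2r; first by rewrite divr_ge0 ?(ltW t0) ?(ltW zz).
    by apply: ler_wpM2l => //; apply: ler_wpM2l; [exact: ltW|].
  have -> : 2 * (C * (2 * t `^ (- 2^-1))) * (t / (z / 2)) = 8 * C / z * (t `^ (- 2^-1) * t) by field; rewrite gt_eqF.
  rewrite tt; apply: (@le_trans _ _ (8 * C / z * s)); first by rewrite ler_wpM2l// divr_ge0 ?mulr_ge0 ?ltW.
  by rewrite /s le_eqVlt; apply/orP; left; apply/eqP; field; rewrite !gt_eqF.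
have tz : 0 < t / 2 by rewrite divr_gt0.
have zE : (t / 2) ^+ 2 <= sqdist t phi.
  apply: le_trans g1; rewrite ler_pXn2r ?nnegrE ?(ltW tz)//; lra.
have [+ _] := F_bound t0 tz zE h1 h2; move/le_trans; apply.
have m := mdec_large t1.
have ht : t `^ (- decay_exp) <= e / (8 * C).
  have := hN t; rewrite (lt_le_trans _ t3) ?ltrDl// => /(_ isT); apply: le_trans; exact: ler_norm.
have -> : 2 * (C * decay t) * (t / (t / 2)) = 4 * C * decay t by field; rewrite gt_eqF.
apply: (@le_trans _ _ (4 * C * (2 * (e / (8 * C))))).
  rewrite ler_wpM2l ?mulr_ge0 ?(ltW C0)//; apply: le_trans m _; rewrite ler_wpM2l//.
by rewrite le_eqVlt; apply/orP; left; apply/eqP; field; rewrite !gt_eqF.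
Qed.

(** Between z / 2 and 2 z, [q_lip] compensates the pole and im_F / t is bounded; elsewhere |w - z|
    >= c (1 + t), and the kernel gains a factor 1 / (1 + t) over [decay]. *)
Lemma F2_G : exists2 C : R, 0 < C & forall t phi : R, 0 < t -> 0 < phi <= pi ->
  `|im_F t phi / t| <= C * (t `^ (- 2^-1) * (1 + t) `^ (- 2^-1 - decay_exp)).
Proof.
have [C C0 hC] := q_mdec; have [Cl Cl0 hCl] := q_lip; have /andP[p0 p1] := pexp_bound.
(* For t < z / 2 one has z - t > z / 2 = c (1 + z) >= c (1 + t); for t > 2 z the bound c <= 1 / 2
   enters as well. *)
pose c := z / (2 * (1 + z)).
have z1 : 0 < 1 + z by rewrite addr_gt0.
have c0 : 0 < c by rewrite divr_gt0// mulr_gt0.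
have cE : c * (1 + z) = z / 2 by rewrite /c; field; rewrite gt_eqF.
(* 1 / 2 is for the radial and z / 6 for the angular bound of [En_ge]: when t >= z / 2, (z / 6)^2
   phi^2 is at most a quarter of t z (phi / 2)^2. *)
pose b := Num.min 2^-1 (z / 6).
have b0 : 0 < b by rewrite lt_min invr_gt0 ltr0n divr_gt0.
(* The least value of the majorant on [z / 2, 2 z]; dividing by it turns a constant bound into a
   multiple of the majorant. *)
pose g0 := (2 * z) `^ (- 2^-1) * (1 + 2 * z) `^ (- 2^-1 - decay_exp).
have zz : 0 < 2 * z by rewrite mulr_gt0.
have g00 : 0 < g0 by rewrite mulr_gt0 ?powR_gt0// addr_gt0.
have A1 : 0 < 2 * C / c by rewrite divr_gt0// mulr_gt0.
have A3 : 0 <= 2 * Cl / b by rewrite divr_ge0 ?mulr_ge0 ?(ltW b0).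
have A2 : 0 <= 2 * Cl / b / g0 by rewrite divr_ge0 ?(ltW g00).
exists (2 * C / c + 2 * Cl / b / g0); first exact: ltr_pwDl.
move=> t phi t0 hp; have /andP[ph0 _] := hp; have [g1 g2 _] := En_ge t0 hp.
set G0 := t `^ _ * _.
have G00 : 0 <= G0 by rewrite mulr_ge0 ?powR_ge0.
have t1 : 0 < 1 + t by rewrite addr_gt0.
rewrite normrM normfV (gtr0_norm t0) ler_pdivrMr//.
have [tz|tz] := boolP (z / 2 <= t <= 2 * z).
  have [h1 h2] := hCl t phi tz hp; have /andP[tz1 tz2] := tz.
  have d0 : 0 < phi + `|t - z| by rewrite ltr_pwDl.
  have e0 : 0 < b * (phi + `|t - z|) by rewrite mulr_gt0.
  have bE : (b * (phi + `|t - z|)) ^+ 2 <= sqdist t phi.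
    have b1 : b <= 2^-1 by rewrite ge_min lexx.
    have b2 : b <= z / 6 by rewrite ge_min lexx orbT.
    have n2 : `|t - z| ^+ 2 = (t - z) ^+ 2 by rewrite real_normK ?num_real.
    have s1 : b ^+ 2 <= 2^-1 ^+ 2 by rewrite ler_pXn2r ?nnegrE ?invr_ge0// ltW.
    have s2 : b ^+ 2 <= (z / 6) ^+ 2 by rewrite ler_pXn2r ?nnegrE ?divr_ge0 ?(ltW z0) ?(ltW b0).
    have u1 : b ^+ 2 * `|t - z| ^+ 2 <= 2^-1 ^+ 2 * (t - z) ^+ 2 by rewrite -n2 ler_wpM2r ?sqr_ge0.
    have u2 : b ^+ 2 * phi ^+ 2 <= (z / 6) ^+ 2 * phi ^+ 2 by rewrite ler_wpM2r ?sqr_ge0.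
    have u3 : (z / 6) ^+ 2 * phi ^+ 2 <= 4^-1 * (t * z * (phi / 2) ^+ 2).
      have : 0 <= (t - z / 2) * z * phi ^+ 2 by rewrite !mulr_ge0 ?sqr_ge0 ?subr_ge0// ltW.
      have : 0 <= z ^+ 2 * phi ^+ 2 by rewrite mulr_ge0 ?sqr_ge0.
      by move=> x1 x2; lra.
    have u4 : (b * (phi + `|t - z|)) ^+ 2 <= 2 * (b ^+ 2 * phi ^+ 2) + 2 * (b ^+ 2 * `|t - z| ^+ 2).
      have := sqr_ge0 (b * (phi - `|t - z|)); move: `|t - z| => y; nra.
    have q2 : 2^-1 ^+ 2 = 4^-1 :> R by field.
    rewrite q2 in u1; lra.
  have [_] := F_bound t0 e0 bE h1 h2; move/le_trans; apply.
  have -> : 2 * (Cl * (phi + `|t - z|)) * (t / (b * (phi + `|t - z|))) = 2 * Cl / b * t.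
    by field; rewrite !gt_eqF.
  rewrite ler_wpM2r ?(ltW t0)//.
  have gG : g0 <= G0.
    apply: ler_pM; rewrite ?powR_ge0//.
      by apply: ler_powRN_base => //; rewrite invr_ge0.
    rewrite -opprD; apply: ler_powRN_base => //; last by rewrite lerD2l.
    by rewrite addr_ge0 ?invr_ge0// ltW.
  apply: (@le_trans _ _ (2 * Cl / b / g0 * G0)).
    by rewrite -[leRHS]mulrA ler_peMr// mulrC ler_pdivlMr// mul1r.
  by rewrite ler_wpM2r// lerDr ltW.
have [h1 h2] := hC t phi t0 hp.
have e0 : 0 < c * (1 + t) by rewrite mulr_gt0.
have cE2 : (c * (1 + t)) ^+ 2 <= sqdist t phi.
  apply: le_trans g1; rewrite -[leRHS]real_normK ?num_real// ler_pXn2r ?nnegrE ?(ltW e0)//.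
  have chalf : c <= 2^-1 by rewrite /c ler_pdivrMr ?mulr_gt0//; lra.
  move: tz; rewrite negb_and -!ltNge => /orP[tz|tz].
    have a1 : c * (1 + t) <= c * (1 + z) by rewrite ler_wpM2l ?(ltW c0)//; lra.
    have a2 : t - z < 0 by lra.
    rewrite (ltr0_norm a2); lra.
  have a2 : 0 < t - z by lra.
  have a3 : 0 <= (2^-1 - c) * (t - 2 * z) by rewrite mulr_ge0// subr_ge0// ltW.
  have a4 : 0 <= c * z by rewrite mulr_ge0 ?ltW.
  rewrite (gtr0_norm a2); nra.
have [_] := F_bound t0 e0 cE2 h1 h2; move/le_trans; apply.
have GE : decay t = G0 * (1 + t).
  rewrite /decay /G0 -mulrA; congr (_ * _).
  by rewrite -[X in _ = _ * X](powRr1 (ltW t1)) -powRD ?(gt_eqF t1) ?implybT//; congr powR; field.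
rewrite GE (_ : 2 * (C * (G0 * (1 + t))) * (t / (c * (1 + t))) = 2 * C / c * G0 * t); last by field; rewrite !gt_eqF.
by rewrite ler_wpM2r ?(ltW t0)// ler_wpM2r// lerDl.
Qed.
(** g, s and the kernel are real on the positive axis, and at a fixed t different from z their
    imaginary parts are O(phi). *)
Lemma F2_lim (t : R) : 0 < t -> t != z -> im_F t phi @[phi --> 0^'+] --> 0.
Proof.
move=> t0 tz; have [C C0 hC] := q_mdec.
have d0 : 0 < `|t - z| by rewrite normr_gt0 subr_eq0.
have d2 : `|t - z| ^+ 2 = (t - z) ^+ 2 by rewrite real_normK ?num_real.
have p0 := pi_gt0 R.
pose M := expR (- (th * (2^-1 * ln kappa))) * t `^ (- (al * th)).
have k0 := kz_gt0.
have st0 : 0 <= sqrt_coef * t `^ (- 2^-1) by rewrite mulr_ge0 ?powR_ge0 ?ltW.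
pose L := C * decay t * (t * z / `|t - z| ^+ 2) + (M * (th * al) + sqrt_coef * t `^ (- 2^-1)) * (t / `|t - z|).
have m0 : 0 <= C * decay t by rewrite mulr_ge0 ?(ltW C0)// mulr_ge0 ?powR_ge0.
have M0 : 0 <= M by rewrite mulr_ge0 ?expR_ge0 ?powR_ge0.
have tz0 : 0 <= t * z by rewrite mulr_ge0 ?ltW.
have L0 : 0 <= L.
  rewrite addr_ge0// mulr_ge0//; first by rewrite divr_ge0 ?sqr_ge0.
    by rewrite addr_ge0// mulr_ge0// mulr_ge0 ?ltW.
  by rewrite divr_ge0// ltW.
have FL (phi : R) : 0 < phi <= pi -> `|im_F t phi| <= L * phi.
  move=> hp; have [h1 _] := hC t phi t0 hp; have [g1 _ g3] := En_ge t0 hp; have /andP[ph0 _] := hp.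
  have dE : `|t - z| ^+ 2 <= sqdist t phi by rewrite d2.
  have [k1 _] := K_bound t0 d0 dE.
  have hK2 : `|im_ker t phi| <= t * z / `|t - z| ^+ 2 * phi.
    have -> : im_ker t phi = - (t * z * sin phi) / sqdist t phi by rewrite /im_ker; field; rewrite gt_eqF.
    rewrite normrM normrN normfV (gtr0_norm g3) normrM (ger0_norm tz0).
    rewrite -!mulrA ler_wpM2l ?(ltW t0)// ler_wpM2l ?(ltW z0)// mulrC ler_pM ?invr_ge0 ?(ltW g3)//.
      by rewrite lef_pV2 ?posrE ?exprn_gt0// d2.
    by rewrite (le_trans (abs_sin_le _))// gtr0_norm.
  have hN : `|im_q t phi| <= (M * (th * al) + sqrt_coef * t `^ (- 2^-1)) * phi.
    rewrite /im_q mulrDl; apply: le_trans (ler_normB _ _) _; apply: lerD.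
      apply: le_trans (gN_lin t0 hp) _; rewrite ler_wpM2r ?(ltW ph0)// ler_wpM2r ?mulr_ge0 ?(ltW th0) ?(ltW al0)//.
      exact: expU_le t0 (pi_abs hp).
    rewrite /im_s normrN normrM (ger0_norm st0) ler_wpM2l// (le_trans (abs_sin_le _))//.
    by rewrite ger0_norm ?divr_ge0 ?(ltW ph0)// ler_pdivrMr// ler_peMr ?(ltW ph0)// ler1n.
  rewrite /im_F /L [leRHS]mulrDl; apply: le_trans (ler_normD _ _) _; rewrite !normrM; apply: lerD.
    by rewrite -mulrA; apply: ler_pM.
  by rewrite mulrAC; apply: ler_pM.
apply/cvgr0Pnorm_le => e e0; near=> phi.
have ph0 : 0 < phi by near: phi; exact: nbhs_right_gt.
have ph1 : phi <= pi by near: phi; exact: nbhs_right_le.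
have ph2 : phi <= e / (L + 1) by near: phi; apply: nbhs_right_le; rewrite divr_gt0// ltr_pwDr.
apply: (le_trans (FL phi _)); first by rewrite ph0.
have L1 : 0 < L + 1 by rewrite ltr_pwDr.
rewrite ler_pdivlMr// in ph2.
by apply: le_trans ph2; rewrite mulrC ler_wpM2l ?(ltW ph0)// lerDl.
Unshelve. all: end_near. Qed.

Lemma FA_loc (phi0 e N : R) : 0 < phi0 <= pi -> 0 < e -> exists C, forall t phi : R,
  e <= t <= N -> phi0 <= phi < phimax -> `|re_dF t phi| <= C.
Proof.
move=> /andP[p0 p1] e0.
(* phi0 may be pi, where 1 - |cos phi0| = 0; half of it keeps the constant of [En_ge_loc]
   positive. *)
pose p := phi0 / 2.
have pp : 0 < p by rewrite divr_gt0.
have pi0 := pi_gt0 R.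
have ppi : p < pi by rewrite /p; lra.
pose d := (1 - `|cos p|) * z ^+ 2.
have d0 : 0 < d by rewrite mulr_gt0 ?exprn_gt0// subr_gt0 cos_abs_lt1// pp.
pose M := expR (- (th * (2^-1 * ln kappa))) * e `^ (- (al * th)).
have k0 := kz_gt0; have k0' := ltW k0; have th0' := ltW th0.
pose S := sqrt_coef * e `^ (- 2^-1).
pose Q := M + S; pose Q' := th * M * (4 / kappa) + S.
exists (2 * (Q' * (N / Num.sqrt d) + Q * (2 * z * N / d))).
move=> t phi /andP[te tN] /andP[h0 h1]; have t0 : 0 < t by exact: lt_le_trans te.
have hphi : `|phi| <= phimax by rewrite ger0_norm ?ltW// (lt_le_trans p0).
have hE : d <= sqdist t phi.
  apply: En_ge_loc => //; first by rewrite pp ltW.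
  by rewrite h1 andbT (le_trans _ h0)// /p; lra.
have E0 : 0 < sqdist t phi by exact: lt_le_trans hE.
have hM : expR (- (th * Upot t phi)) <= M.
  apply: le_trans (expU_le t0 hphi) _; rewrite ler_wpM2l ?expR_ge0//.
  by apply: ler_powRN_base => //; rewrite mulr_ge0 ?ltW.
have hS : sqrt_coef * t `^ (- 2^-1) <= S by rewrite ler_wpM2l//; apply: ler_powRN_base => //; rewrite invr_ge0.
have s0 : 0 <= sqrt_coef * t `^ (- 2^-1) by rewrite mulr_ge0 ?powR_ge0.
have [s1 s2] := abs_sin_cos (phi / 2) s0.
have [g1 g2] := gPN_bound t phi; have [a1 a2] := gAB_bound t hphi.
have sd0 : 0 < Num.sqrt d by rewrite sqrtr_gt0.
have sdE : Num.sqrt d ^+ 2 <= sqdist t phi by rewrite sqr_sqrtr// ltW.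
have [k1 k2] := K_bound t0 sd0 sdE; have [k3 k4] := KAB_bound t0 E0.
have tk : t / Num.sqrt d <= N / Num.sqrt d by rewrite ler_wpM2r ?invr_ge0 ?(ltW sd0).
have tE : 2 * z * t / sqdist t phi <= 2 * z * N / d.
  have z2 : 0 <= 2 * z by rewrite mulr_ge0// ltW.
  apply: ler_pM; [exact: mulr_ge0 z2 (ltW t0)|by rewrite invr_ge0 ltW|exact: ler_wpM2l|].
  by rewrite lef_pV2 ?posrE.
have qPb : `|re_q t phi| <= Q.
  by apply: le_trans (ler_normB _ _) _; apply: lerD; [exact: le_trans g1 hM|exact: le_trans s1 hS].
have qNb : `|im_q t phi| <= Q.
  apply: le_trans (ler_normB _ _) _; apply: lerD; [exact: le_trans g2 hM|].
  by rewrite /im_s normrN; exact: le_trans s2 hS.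
have hM' : th * expR (- (th * Upot t phi)) * (4 / kappa) <= th * M * (4 / kappa).
  by rewrite ler_wpM2r ?divr_ge0 ?(ltW kap0)// ler_wpM2l.
have hh (x : R) : `|x| <= sqrt_coef * t `^ (- 2^-1) -> `|2^-1 * x| <= S.
  move=> hx; rewrite normrM ger0_norm ?invr_ge0//; apply: le_trans hS; apply: le_trans hx.
  by rewrite ler_piMl// invf_le1// ler1n.
have qAb : `|re_dq t phi| <= Q'.
  apply: le_trans (ler_normB _ _) _; apply: lerD; first exact: le_trans a1 hM'.
  by rewrite mulNr normrN; apply: hh.
have qBb : `|im_dq t phi| <= Q'.
  apply: le_trans (ler_normB _ _) _; apply: lerD; first exact: le_trans a2 hM'.
  exact: hh.
have b1 := le_trans k1 tk; have b2 := le_trans k2 tk; have b3 := le_trans k3 tE; have b4 := le_trans k4 tE.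
rewrite (_ : 2 * _ = (Q' * (N / Num.sqrt d) + Q * (2 * z * N / d)) + (Q' * (N / Num.sqrt d) + Q * (2 * z * N / d))); last first.
  by move: (Q' * _) (Q * _) => x y; ring.
rewrite /re_dF; apply: le_trans (ler_normB _ _) _; apply: lerD; apply: le_trans (ler_normD _ _) _.
  apply: lerD; rewrite normrM; apply: ler_pM; rewrite ?normr_ge0//.
apply: lerD; rewrite normrM; apply: ler_pM; rewrite ?normr_ge0//.
Qed.

Lemma cauchy_F : \int[lambda]_(t in `]0, +oo[) (im_F t pi / t) = 0.
Proof.
have [b1 _ _] := phimax_bound; have [C C0 hC] := F2_G; have /andP[p0 _] := pexp_bound.
have nE (t phi : R) : 0 < t -> 0 < phi < phimax -> sqdist t phi != 0 by move=> t0 h; rewrite gt_eqF// En_gt0.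
apply: (@polar_cauchy re_F im_F re_dF (fun t => C * (t `^ (- 2^-1) * (1 + t) `^ (- 2^-1 - decay_exp))) phimax z).
- exact: b1.
- by move=> t phi t0 h; have [B []] := hol_F t0 h.
- by move=> t phi t0 h; have [B []] := hol_F t0 h.
- move=> t phi t0 h; have [ct1 ct2 ct3 ct4] := continuous_KAB t0 (nE _ _ t0 h).
  have [c5 c6] := continuous_qAB t0 h; have [d1 d2 _ _] := hol_q t0 h.
  have c7 := der_continuous d1; have c8 := der_continuous d2.
  apply: continuousD; first by apply: continuousD; apply: continuousM.
  by apply: continuousN; apply: continuousD; apply: continuousM.
- by move=> t phi t0 h; have [B [_ h2 _ _]] := hol_F t0 h; exact: der_continuous h2.
- exact: FA_loc.
- exact: F1_small.
- exact: hC.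
- have I : lambda.-integrable (`]0, +oo[%classic : set RR)
      (fun t : R => C%:E * (t `^ (- 2^-1) * (1 + t) `^ (- 2^-1 - decay_exp))%:E)%E.
    by apply: integrableZl => //; exact: integrable_rsqrt_decay.
  exact: I.
- exact: F2_lim.
Qed.

Lemma cvg_sqrt_pinfty : x `^ 2^-1 @[x --> +oo] --> (+oo : set_system R).
Proof.
apply/cvgryPge => A; near=> x.
have A1 : (A ^+ 2) `^ 2^-1 = `|A| by rewrite powR12_sqrt ?sqr_ge0// sqrtr_sqr.
apply: le_trans (ler_norm _) _; rewrite -A1; apply: ler_powR_base; rewrite ?sqr_ge0 ?invr_ge0//.
Unshelve. all: end_near. Qed.

(** The contribution of the subtracted term s along the cut, up to [sqrt_coef]; a primitive is 2
    z^(-1/2) atan((t / z)^(1/2)). *)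
Lemma integral_rsqrt_stieltjes :
  (\int[lambda]_(t in `]0%R, +oo[) (t `^ (- 2^-1) / (t + z))%:E = (pi * z `^ (- 2^-1))%:E)%E.
Proof.
pose k := z `^ (- 2^-1).
have k2 : k * k = z^-1.
  by rewrite -powRD ?(gt_eqF z0) ?implybT// (_ : - 2^-1 + - 2^-1 = -1 :> R) ?powR_inv1 ?(ltW z0)//; field.
rewrite (_ : pi * _ = 2 * k * (pi / 2) - 2 * k * atan (0 * k)); last by rewrite mul0r atan0 -/k; field.
apply: (@ge0_FTC_oy R (fun t => t `^ (- 2^-1) / (t + z)) (fun t => 2 * k * atan (t `^ 2^-1 * k))).
- by move=> t t0; rewrite divr_ge0 ?powR_ge0// addr_ge0 ?ltW.
- move=> t t0; have D := der_mull (2 * k) (der_atan (der_mulr k (der_powR 2^-1 t0 (der_id t)))).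
  apply: der_eq D _.
  have t2 : t `^ 2^-1 * t `^ 2^-1 = t.
    by rewrite -powRD ?(gt_eqF t0) ?implybT// (_ : 2^-1 + 2^-1 = 1 :> R) ?powRr1 ?(ltW t0)//; field.
  have -> : 1 + (t `^ 2^-1 * k) ^+ 2 = (z + t) / z.
    by rewrite expr2 mulrACA t2 k2; field; rewrite gt_eqF.
  rewrite (_ : 2^-1 - 1 = - 2^-1 :> R); last by field.
  have zt : 0 < z + t by rewrite addr_gt0.
  have -> : 2 * k * (2^-1 * t `^ (- 2^-1) * 1 * k / ((z + t) / z)) = (k * k) * t `^ (- 2^-1) * z / (z + t).
    by field; rewrite !gt_eqF.
  by rewrite k2; field; rewrite !gt_eqF// addrC.
- move=> t t0; have tz : t + z != 0 by rewrite gt_eqF// addr_gt0.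
  exact: der_continuous (@der_div _ (fun u => u `^ (- 2^-1)) (fun u => u + z) t _ _ tz (der_powR (- 2^-1) t0 (der_id t)) (der_add (der_id t) (der_cst t z))).
- apply: cvgMr; apply: (@cvg_comp _ _ _ (fun t => t `^ 2^-1 * k) (@atan R) _ (nbhs (0 * k))); last exact: continuous_atan.
  apply: cvgMl.
  have cs : Num.sqrt x @[x --> 0^'+] --> (0 : R).
    by rewrite -[X in _ --> X](@sqrtr0 R); apply: cvg_at_right_filter; exact: sqrt_continuous.
  apply: cvg_trans cs; apply: near_eq_cvg; near=> x.
  by rewrite powR12_sqrt// ltW//; near: x; exact: nbhs_right_gt.
- apply: cvgMr; apply: (@cvg_comp _ _ _ (fun t => t `^ 2^-1 * k) (@atan R) _ +oo); last exact: cvgy_atan.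
  apply/cvgryPge => A; near=> x.
  have k0 : 0 < k by rewrite powR_gt0.
  by rewrite -ler_pdivrMr//; near: x; move/cvgryPge : cvg_sqrt_pinfty; apply.
Unshelve. all: end_near. Qed.

(** [cauchy_F] says that the imaginary parts of g and s on the cut have the same integral against 1
    / (t + z). Up to sign, that of s is g(z) z^(1/2) times pi z^(-1/2). *)
Lemma cauchy_stieltjes :
  lambda.-integrable (`]0, +oo[%classic : set RR) (fun t => (expR (- (th * Upot t pi)) * sin (th * Vpot t pi) / (t + z))%:E) /\
  \int[lambda]_(t in `]0, +oo[) (expR (- (th * Upot t pi)) * sin (th * Vpot t pi) / (t + z)) = pi * expR (- (th * Upot z 0)).
Proof.
have [b1 _ _] := phimax_bound; have p0 := pi_gt0 R; have hpi : 0 < (pi : R) <= pi by rewrite p0 lexx.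
have [C C0 hC] := F2_G; have /andP[pe0 _] := pexp_bound.
pose W t := expR (- (th * Upot t pi)) * sin (th * Vpot t pi) / (t + z).
have FE (t : R) : 0 < t -> im_F t pi / t = sqrt_coef * (t `^ (- 2^-1) / (t + z)) - W t.
  move=> t0; have tz : t + z != 0 by rewrite gt_eqF// addr_gt0.
  have tn0 : t != 0 by rewrite gt_eqF.
  have EE : sqdist t pi = (t + z) ^+ 2 by rewrite /sqdist cospi sinpi; ring.
  have k1 : re_ker t pi = t / (t + z) by rewrite /re_ker EE cospi sinpi; field.
  have k2 : im_ker t pi = 0 by rewrite /im_ker sinpi !(mulr0, mul0r, oppr0) addr0.
  rewrite /im_F k1 k2 mulr0 add0r /im_q /im_g /im_s sin_pihalf /W.
  by move: (expR _ * _) (t `^ _) => x y; field; rewrite tz tn0.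
have I1 : lambda.-integrable (`]0, +oo[%classic : set RR) (fun t => (t `^ (- 2^-1) / (t + z))%:E).
  apply/integrableP; split.
    apply/measurable_EFinP; apply: measurable_funTS; apply: measurable_funM; first exact: measurable_fun_powR.
    by apply: (measurableT_comp measurable_fun_inv); exact: measurable_funD.
  rewrite (_ : \int[lambda]_(x in _) _ = \int[lambda]_(t in `]0%R, +oo[) (t `^ (- 2^-1) / (t + z))%:E)%E.
    by rewrite integral_rsqrt_stieltjes ltry.
  apply: eq_integral => x; rewrite inE/= in_itv/= andbT => x0.
  by rewrite ger0_norm// divr_ge0 ?powR_ge0// addr_ge0 ?ltW.
have I2 : lambda.-integrable (`]0, +oo[%classic : set RR) (fun t => (sqrt_coef * (t `^ (- 2^-1) / (t + z)))%:E).
  have J : lambda.-integrable (`]0, +oo[%classic : set RR) (fun t => sqrt_coef%:E * (t `^ (- 2^-1) / (t + z))%:E)%E.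
    by apply: integrableZl.
  exact: J.
have cF (t : R) : 0 < t -> {for t, continuous (fun t => im_F t pi / t)}.
  move=> t0; have hb : 0 < (pi : R) < phimax by rewrite p0.
  have [B [_ h2 _ _]] := hol_F t0 hb.
  have tn0 : t != 0 by rewrite gt_eqF.
  exact: der_continuous (der_div tn0 h2 (der_id t)).
have I3 : lambda.-integrable (`]0, +oo[%classic : set RR) (fun t => (im_F t pi / t)%:E).
  have J : lambda.-integrable (`]0, +oo[%classic : set RR)
      (fun t : R => C%:E * (t `^ (- 2^-1) * (1 + t) `^ (- 2^-1 - decay_exp))%:E)%E.
    by apply: integrableZl => //; exact: integrable_rsqrt_decay.
  apply: (le_integrable _ _ _ J) => //.
    apply/measurable_EFinP; apply: subspace_continuous_measurable_fun => //.
    by apply: continuous_in_subspaceT => t; rewrite inE/= in_itv/= andbT; exact: cF.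
  move=> t /=; rewrite in_itv/= andbT => t0; rewrite lee_fin.
  exact: le_trans (hC t pi t0 hpi) (ler_norm _).
have WE (t : R) : 0 < t -> W t = sqrt_coef * (t `^ (- 2^-1) / (t + z)) - im_F t pi / t.
  by move=> t0; rewrite FE// opprB addrC subrK.
have eI : lambda.-integrable (`]0, +oo[%classic : set RR) (fun t => (sqrt_coef * (t `^ (- 2^-1) / (t + z)) - im_F t pi / t)%:E).
  have J : lambda.-integrable (`]0, +oo[%classic : set RR) ((fun t => (sqrt_coef * (t `^ (- 2^-1) / (t + z)))%:E) \- (fun t => (im_F t pi / t)%:E))%E.
    by apply: integrableB.
  exact: J.
split.
  apply: eq_integrable eI => // t; rewrite inE/= in_itv/= andbT => t0.
  by rewrite -WE.
transitivity (\int[lambda]_(t in `]0, +oo[) (sqrt_coef * (t `^ (- 2^-1) / (t + z)) - im_F t pi / t)).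
  by apply: eq_Rintegral => t; rewrite inE/= in_itv/= andbT => t0; rewrite -WE.
rewrite RintegralB// cauchy_F subr0 RintegralZl//.
have -> : \int[lambda]_(t in `]0, +oo[) (t `^ (- 2^-1) / (t + z)) = pi * z `^ (- 2^-1).
  by rewrite /Rintegral integral_rsqrt_stieltjes.
have zz : z `^ 2^-1 * z `^ (- 2^-1) = 1 by rewrite -powRD ?(gt_eqF z0) ?implybT// subrr powRr0.
rewrite /sqrt_coef (_ : _ * _ = pi * expR (- (th * Upot z 0)) * (z `^ 2^-1 * z `^ (- 2^-1))); last by ring.
by rewrite zz mulr1.
Qed.
End potential.
End cauchy.

(** * The density of X_alpha R^(1/alpha) *)

Section density_formulas.
Context {R : realType}.
Notation lambda := (@lebesgue_measure R).
Notation RR := (measurableTypeR R).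
Local Notation P0 := (`]0%R, +oo[%classic : set RR).

Lemma probability_of_measure (nu : {measure set RR -> \bar R}) :
  nu [set: RR] = 1%E -> exists P : probability RR R, forall A, P A = nu A.
Proof.
move=> nu1; exists (mnormalize nu (\d_(0 : RR) : probability RR R)) => A.
by rewrite /= /mnormalize nu1/= onee_eq0/= invr1 mule1.
Qed.

Lemma measure_eq_rays_pos (m1 m2 : {measure set RR -> \bar R}) :
  (forall x : R, 0 < x -> m1 `]-oo, x]%classic = m2 `]-oo, x]%classic) ->
  (forall x : R, (0 < x)%R -> m1 (`]-oo, x]%classic : set RR) < +oo)%E ->
  m1 (`]-oo, 0%R[%classic : set RR) = 0%E -> m2 (`]-oo, 0%R[%classic : set RR) = 0%E ->
  forall A : set RR, measurable A -> m1 A = m2 A.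
Proof.
move=> m12 m1fin m10 m20.
have neg (m : {measure set RR -> \bar R}) (x : R) : m `]-oo, 0%R[%classic = 0%E -> x < 0 -> m `]-oo, x]%classic = 0%E.
  move=> m0 x0; apply/eqP; rewrite -measure_le0 -m0; apply: le_measure; rewrite ?inE//.
  by move=> y /=; rewrite !in_itv/= => /le_lt_trans; apply.
have cap : `]-oo, 0%R]%classic = \bigcap_n (`]-oo, n.+1%:R^-1]%classic : set RR).
  apply/seteqP; split => x /=; rewrite in_itv/=.
    by move=> x0 n _ /=; rewrite in_itv/= (le_trans x0).
  move=> h; rewrite leNgt; apply/negP => x0.
  have [n _ hn] := near_infty_natSinv_lt (PosNum x0).
  have := h n I; rewrite /= in_itv/= leNgt; have := hn n (leqnn n) => /= ->.
  by [].
have cv (m : {measure set RR -> \bar R}) : (forall x : R, (0 < x)%R -> m (`]-oo, x]%classic : set RR) < +oo)%E ->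
    m `]-oo, n.+1%:R^-1]%classic @[n --> \oo] --> m `]-oo, 0%R]%classic.
  move=> mf; rewrite cap; apply: (@nonincreasing_cvg_mu _ _ _ m (fun n => `]-oo, n.+1%:R^-1]%classic : set RR)) => //.
  - by apply: mf; rewrite invr_gt0.
  - by rewrite -cap.
  - move=> n k nk; apply/subsetPset => x; rewrite /= !in_itv/= => /le_trans; apply.
    by rewrite lef_pV2 ?posrE// ler_nat ltnS.
have E0 : m1 `]-oo, 0%R]%classic = m2 `]-oo, 0%R]%classic.
  have cv1 := cv m1 m1fin.
  have cv2 : m2 `]-oo, n.+1%:R^-1]%classic @[n --> \oo] --> m2 `]-oo, 0%R]%classic.
    by apply: cv => x x0; rewrite -m12// m1fin.
  rewrite -(cvg_lim _ cv1)// -(cvg_lim _ cv2)//; congr (limn _).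
  by apply/funext => n; rewrite m12.
have f0 : (m1 `]-oo, 0%R]%classic < +oo)%E.
  apply: le_lt_trans (m1fin 1 ltr01); apply: le_measure; rewrite ?inE//.
  by move=> y /=; rewrite !in_itv/= => /le_trans; apply.
apply: measure_eq_rays => x.
  have [x0|x0|->] := ltgtP x 0; [|exact: m12|exact: E0].
  by rewrite !neg.
have [x0|x0|->] := ltgtP x 0; [|exact: m1fin|exact: f0].
by rewrite neg.
Qed.

(** * Dictionary between the functions of the statement and the boundary values at phi = pi *)

Section density_of_ratio.
Context (H : probability RR R) (al : R).
Context (al0 : 0 < al) (al1 : al < 1).
Context (H_pos : H `]0%R, +oo[%classic = 1%E).
Context (H_log : (\int[H]_(r in `]0%R, +oo[) (ln (1 + (r : R)))%:E < +oo)%E).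

Lemma pi_phimax_abs : `|pi : R| <= phimax al.
Proof. by rewrite ger0_norm ?pi_ge0//; have [/ltW] := phimax_bound al0 al1. Qed.

Lemma pi_phimax : 0 < (pi : R) < phimax al.
Proof. by rewrite pi_gt0; have [-> _ _] := phimax_bound al0 al1. Qed.

Lemma pnorm_pi (x r : R) : x `^ (2 * al) + 2 * x `^ al * r * cos (al * pi) + r ^+ 2 = pnorm (x `^ al) (al * pi) r.
Proof. by rewrite /pnorm (mulrC 2 al) powRrM powR_mulrn ?powR_ge0. Qed.

Lemma calSE (x : R) : 0 < x -> al * calS H al x = Upot H al x pi.
Proof.
move=> x0; rewrite /calS mulrA (_ : al * (2 * al)^-1 = 2^-1); last by field; rewrite gt_eqF.
rewrite /Upot /log_mod; have I := integrable_lg al0 al1 H_log x0 pi_phimax_abs.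
under [in LHS]eq_Rintegral do rewrite pnorm_pi.
under [in RHS]eq_Rintegral do rewrite -[2^-1 * ln _]mulrC.
have J : H.-integrable P0 (EFin \o (fun r : R => ln (pnorm (x `^ al) (al * pi) r))).
  have K : H.-integrable P0 (fun r : R => 2%:E * (log_mod al x pi r)%:E)%E by apply: integrableZl.
  apply: eq_integrable K => // r _; rewrite -EFinM /log_mod; congr EFin; by rewrite mulrA mulfV ?mul1r.
by rewrite RintegralZr// mulrC.
Qed.

Lemma UpsilonE (x : R) : 0 < x -> al * pi * Upsilon H al x = Vpot H al x pi.
Proof.
move=> x0; have p0 := pi_gt0 R.
have apos : al * pi != 0 by rewrite mulf_neq0 ?gt_eqF.
rewrite /Upsilon mulrBr mulr1 mulrA (mulrC pi al) mulfV// mul1r.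
have I := integrable_ag H al0 al1 x pi_phimax.
have E r : arg_val al x pi r = al * pi - acot (cot (al * pi) + x `^ al / r / sin (al * pi)) by [].
have J : H.-integrable P0 (EFin \o (fun r : R => acot (cot (al * pi) + x `^ al / r / sin (al * pi)))).
  have K : H.-integrable P0 ((EFin \o (fun=> (al * pi)%R)) \- (EFin \o (arg_val al x pi)))%E.
    by apply: integrableB => //; exact: integrable_cstH.
  apply: eq_integrable K => // r _; rewrite /= -EFinB; congr EFin.
  by rewrite E opprB addrC subrK.
rewrite /Vpot; under [in RHS]eq_Rintegral do rewrite E.
transitivity ((\int[H]_(r in P0) (al * pi))%R - \int[H]_(r in P0) acot (cot (al * pi) + x `^ al / r / sin (al * pi))).
  by rewrite (Rintegral_EFin_cst (P := H) (D := P0)).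
by rewrite -RintegralB//; exact: integrable_cstH.
Qed.

Lemma c2E (x r : R) : 0 < x -> 0 < r -> im_dlog1 al x pi r =
  al * sin (al * pi) * x * (x `^ (al - 1) * r / (x `^ (2 * al) + 2 * x `^ al * r * cos (al * pi) + r ^+ 2)).
Proof.
move=> x0 r0; rewrite pnorm_pi /im_dlog1 powRB ?(gt_eqF x0) ?implybT// powRr1 ?(ltW x0)//.
have := pnorm_pos al0 al1 (powR_ge0 x al) r0 pi_phimax_abs; move: (pnorm (x `^ al) (al * pi) r) (sin (al * pi)) (x `^ al) => D s y D0.
by field; rewrite !gt_eqF.
Qed.

Lemma c1E (x r : R) : 0 < x -> 0 < r -> re_dlog1 al x pi r =
  al * x * (x `^ (2 * al - 1) / (x `^ (2 * al) + 2 * x `^ al * r * cos (al * pi) + r ^+ 2)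
   + cos (al * pi) * (x `^ (al - 1) * r / (x `^ (2 * al) + 2 * x `^ al * r * cos (al * pi) + r ^+ 2))).
Proof.
move=> x0 r0; rewrite pnorm_pi /re_dlog1 !powRB ?(gt_eqF x0) ?implybT// !powRr1 ?(ltW x0)//.
rewrite (mulrC 2 al) powRrM powR_mulrn ?powR_ge0//.
have := pnorm_pos al0 al1 (powR_ge0 x al) r0 pi_phimax_abs; move: (pnorm (x `^ al) (al * pi) r) (cos (al * pi)) (x `^ al) => D s y D0.
by field; rewrite !gt_eqF.
Qed.

Lemma sin_al_gt0 : 0 < sin (al * pi).
Proof. exact: sin_gt0_pi (al_phi al0 al1 pi_phimax). Qed.

Let in0 (r : R) : P0 r -> 0 < r. Proof. by rewrite /= in_itv/= andbT. Qed.

Lemma integrable_b1 (x : R) : 0 < x -> H.-integrable P0 (EFin \o (fun r : R =>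
  x `^ (al - 1) * r / (x `^ (2 * al) + 2 * x `^ al * r * cos (al * pi) + r ^+ 2))).
Proof.
move=> x0; have s0 := sin_al_gt0.
have K : H.-integrable P0 (fun r : R => ((al * sin (al * pi) * x)^-1)%:E * (im_dlog1 al x pi r)%:E)%E.
  by apply: integrableZl => //; exact: integrable_c2 pi_phimax_abs.
apply: eq_integrable K => // r /set_mem/in0 r0; rewrite -EFinM; congr EFin.
by rewrite c2E// mulKf// !mulf_neq0// gt_eqF.
Qed.

Lemma integrable_b2 (x : R) : 0 < x -> H.-integrable P0 (EFin \o (fun r : R =>
  x `^ (2 * al - 1) / (x `^ (2 * al) + 2 * x `^ al * r * cos (al * pi) + r ^+ 2))).
Proof.
move=> x0.
have K : H.-integrable P0 ((fun r : R => ((al * x)^-1)%:E * (re_dlog1 al x pi r)%:E) \- (fun r : R => (cos (al * pi))%:E * (x `^ (al - 1) * r / (x `^ (2 * al) + 2 * x `^ al * r * cos (al * pi) + r ^+ 2))%:E))%E.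
  apply: integrableB => //; apply: integrableZl => //; first exact: integrable_c1 pi_phimax_abs.
  exact: integrable_b1.
apply: eq_integrable K => // r /set_mem/in0 r0; rewrite -!EFinM -EFinB; congr EFin.
by rewrite c1E// mulKf ?addrK// mulf_neq0// gt_eqF.
Qed.

Lemma C2E (x : R) : 0 < x -> im_dlog H al x pi = al * sin (al * pi) * x * B1 H al x.
Proof.
move=> x0; rewrite /B1 -RintegralZl//; last exact: integrable_b1.
by apply: eq_Rintegral => r /set_mem/in0 r0; exact: c2E.
Qed.

Lemma C1E (x : R) : 0 < x -> re_dlog H al x pi = al * x * (B2 H al x + cos (al * pi) * B1 H al x).
Proof.
move=> x0; rewrite /B2 /B1 -RintegralZl//; last exact: integrable_b1.
rewrite -RintegralD//; last 2 first.
- exact: integrable_b2.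
- have K : H.-integrable P0 (fun r : R => (cos (al * pi))%:E * (x `^ (al - 1) * r / (x `^ (2 * al) + 2 * x `^ al * r * cos (al * pi) + r ^+ 2))%:E)%E.
    by apply: integrableZl => //; exact: integrable_b1.
  exact: K.
rewrite -RintegralZl//; first by apply: eq_Rintegral => r /set_mem/in0 r0; exact: c1E.
have K : H.-integrable P0 (fun r : R => ((al * x)^-1)%:E * (re_dlog1 al x pi r)%:E)%E.
  by apply: integrableZl => //; exact: integrable_c1 pi_phimax_abs.
apply: eq_integrable K => // r /set_mem/in0 r0; rewrite -EFinM; congr EFin.
by rewrite c1E// mulKf// mulf_neq0// gt_eqF.
Qed.

(** By [der_V_t] and [UpsilonE] the right side is the derivative of [Upsilon], which is thus a
    primitive of [rhoH]. *)
Lemma rhoHE (x : R) : 0 < x -> rhoH H al x = (al * pi * x)^-1 * im_dlog H al x pi.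
Proof.
move=> x0; rewrite C2E// /rhoH -/(B1 H al x) (mulrC pi al).
have p0 := pi_gt0 R; have a0 := al0.
move: (B1 H al x) (sin (al * pi)) (pi : R) p0 => b s p p0.
by field; rewrite !gt_eqF.
Qed.

Lemma UE0 (z : R) : 0 < z -> Upot H al z 0 = \int[H]_(r in P0) ln (z `^ al + r).
Proof.
move=> z0; apply: eq_Rintegral => r /set_mem/in0 r0.
rewrite /log_mod /pnorm mulr0 cos0 mulr1 (_ : _ + _ + _ = (z `^ al + r) ^+ 2); last by ring.
have zr : 0 < z `^ al + r by rewrite addr_gt0// powR_gt0.
by rewrite expr2 lnM ?posrE//; field.
Qed.

End density_of_ratio.

End density_formulas.

(** * The case of a point mass at r: the law of X_alpha r^(1/alpha) *)

Section stable_ratio.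
Context {R : realType}.
Notation lambda := (@lebesgue_measure R).
Notation RR := (measurableTypeR R).
Local Notation P0 := (`]0%R, +oo[%classic : set RR).

Lemma Rintegral_dirac (r : R) (f : R -> R) : 0 < r -> measurable_fun setT f ->
  \int[\d_(r : RR)]_(s in P0) f s = f r.
Proof.
move=> r0 mf; rewrite /Rintegral integral_dirac//; last by apply: measurable_funTS; exact/measurable_EFinP.
by rewrite diracE mem_set ?mul1e//= in_itv/= r0.
Qed.

Lemma dirac_log_moment (r : R) : (\int[\d_(r : RR)]_(s in `]0%R, +oo[) (ln (1 + (s : R)))%:E < +oo)%E.
Proof.
rewrite integral_dirac//; first by rewrite diracE -EFinM ltry.
apply: measurable_funTS; apply/measurable_EFinP; apply: (measurableT_comp (@measurable_ln R)).
exact: measurable_funD.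
Qed.

Section ratio_kernel.
Context (al : R).
Context (al0 : 0 < al) (al1 : al < 1).

(** The density of X_alpha r^(1/alpha); the form with [im_dlog1] exhibits it as the derivative of
    [arg_val] / (al pi). *)
Definition ratio_density (r x : R) : R := (al * pi * x)^-1 * im_dlog1 al x pi r.

Let pabs := pi_phimax_abs al0 al1.
Let ppm := pi_phimax al0 al1.

Lemma rr_c2 (r x : R) : 0 < x -> ratio_density r x = (al * pi)^-1 * (im_dlog1 al x pi r / x).
Proof. by move=> x0; rewrite /ratio_density invfM -mulrA (mulrC x^-1). Qed.

Lemma rrE (r x : R) : 0 < x -> 0 < r ->
  ratio_density r x = pi^-1 * r * sin (al * pi) * x `^ al / pnorm (x `^ al) (al * pi) r / x.
Proof.
move=> x0 r0; rewrite /ratio_density /im_dlog1.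
have a0 := al0; have p0 := pi_gt0 R.
have := pnorm_pos al0 al1 (powR_ge0 x al) r0 pabs.
move: (pnorm _ _ _) (sin _) => D s; move: (x `^ al) => y D0.
by move: (pi : R) p0 => p p0; field; rewrite !gt_eqF.
Qed.

Lemma measurable_rr d (X : measurableType d) (a b : X -> R) :
  measurable_fun setT a -> measurable_fun setT b ->
  measurable_fun setT (fun p => ratio_density (a p) (b p)).
Proof.
move=> ma mb; have mp : measurable_fun setT (fun p => b p `^ al) by exact: measurable_fun_powR.
have minv (g : X -> R) : measurable_fun setT g -> measurable_fun setT (fun p => (g p)^-1).
  by move=> mg; exact: (measurableT_comp (@measurable_fun_inv R)).
apply: measurable_funM; first by apply: minv; exact: measurable_funM.
apply: measurable_funM.
  by apply: measurable_funM => //; apply: measurable_funM => //; exact: measurable_funM.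
apply: minv; apply: measurable_funD; last exact: measurable_funX.
apply: measurable_funD; first exact: measurable_funX.
by apply: measurable_funM => //; apply: measurable_funM => //; exact: measurable_funM.
Qed.

Lemma rr_ge0 (r x : R) : 0 < x -> 0 < r -> 0 <= ratio_density r x.
Proof.
move=> x0 r0; rewrite rrE//; have p0 := pi_ge0 R; have s0 := sin_al_gt0 al0 al1.
have D0 := pnorm_pos al0 al1 (powR_ge0 x al) r0 pabs.
by rewrite !mulr_ge0 ?invr_ge0 ?powR_ge0 ?(ltW D0) ?(ltW x0) ?(ltW r0) ?(ltW s0).
Qed.

(** Both sides are minus the imaginary part of 1 / (w^al + r) at w = t e^(i pi). *)
Lemma sin_ag (t r : R) : 0 < t -> 0 < r ->
  expR (- log_mod al t pi r) * sin (arg_val al t pi r) = t `^ al * sin (al * pi) / pnorm (t `^ al) (al * pi) r.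
Proof.
move=> t0 r0; rewrite /log_mod /arg_val /=.
have s0 := sin_al_gt0 al0 al1.
have D0 := pnorm_pos al0 al1 (powR_ge0 t al) r0 pabs.
rewrite /parg /acot; set c := cot _ + _; set D := pnorm _ _ _ in D0 *.
have -> : expR (- (2^-1 * ln D)) = (Num.sqrt D)^-1.
  by rewrite expRN -powR12_sqrt ?(ltW D0)// /powR gt_eqF.
have -> : al * pi - (pi / 2 - atan c) = al * pi + atan c - pi / 2 by ring.
have -> : sin (al * pi + atan c - pi / 2) = - cos (al * pi + atan c).
  by rewrite sinBpihalf.
have cE : c = (r * cos (al * pi) + t `^ al) / (r * sin (al * pi)).
  rewrite /c /cot; move: (sin (al * pi)) (cos (al * pi)) (t `^ al) s0 => s k y s0.
  by field; rewrite !gt_eqF.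
have c2E : 1 + c ^+ 2 = D / (r * sin (al * pi)) ^+ 2.
  have := cos2Dsin2 (al * pi); rewrite cE /D /pnorm.
  move: (sin (al * pi)) (cos (al * pi)) (t `^ al) s0 => s k y s0 sk.
  have -> : y ^+ 2 + 2 * y * r * k + r ^+ 2 = y ^+ 2 + 2 * y * r * k + r ^+ 2 * (k ^+ 2 + s ^+ 2) by rewrite sk mulr1.
  by field; rewrite !gt_eqF.
have sqE : Num.sqrt (1 + c ^+ 2) = Num.sqrt D / (r * sin (al * pi)).
  by rewrite c2E sqrtrM ?(ltW D0)// sqrtrV ?sqr_ge0// sqrtr_sqr ger0_norm// ltW// mulr_gt0.
have sA : sin (atan c) = c / Num.sqrt (1 + c ^+ 2).
  have := atanK c; rewrite /tan => /(congr1 (fun u => u * cos (atan c))).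
  have q0 : 0 < Num.sqrt (1 + c ^+ 2) by rewrite sqrtr_gt0 ltr_pwDl// sqr_ge0.
  by rewrite cos_atan mulfVK// gt_eqF// invr_gt0.
rewrite cosD sA cos_atan sqE cE.
have q0 : 0 < Num.sqrt D by rewrite sqrtr_gt0.
have qq : D = Num.sqrt D ^+ 2 by rewrite sqr_sqrtr// ltW.
rewrite [in RHS]qq.
move: (sin (al * pi)) (cos (al * pi)) (t `^ al) s0 (Num.sqrt D) q0 => s k y s0 q q0.
by field; rewrite !gt_eqF.
Qed.

Lemma parg0 (r : R) : parg 0 (al * pi) r = 0.
Proof.
have /andP[a1 a2] := al_phi al0 al1 ppm.
rewrite /parg !mul0r addr0 /acot; have -> : cot (al * pi) = tan (pi / 2 - al * pi).
  by rewrite /tan /cot -opprB sinN cosN sinBpihalf cosBpihalf opprK.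
rewrite tanK; first by ring.
by rewrite in_itv/=; apply/andP; split; lra.
Qed.

Lemma powR_cvg_pinfty (p : R) : 0 < p -> x `^ p @[x --> +oo] --> (+oo : set_system R).
Proof.
move=> p0; apply/cvgryPge => A; near=> x.
have A1 : (`|A| `^ p^-1) `^ p = `|A| by rewrite -powRrM mulVf ?gt_eqF// powRr1.
apply: le_trans (ler_norm _) _; rewrite -A1; apply: ler_powR_base; rewrite ?powR_ge0 ?(ltW p0)//.
Unshelve. all: end_near. Qed.

(** The primitive [arg_val] / (al pi) runs from 0 to 1: on the cut, the argument of w^al + r goes
    from 0 at w = 0 to al pi at infinity. *)
Lemma rr_mass (r : R) : 0 < r -> (\int[lambda]_(x in P0) (ratio_density r x)%:E = 1)%E.
Proof.
move=> r0; have a0 := al0; have p0 := pi_gt0 R.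
have apos : 0 < al * pi by rewrite mulr_gt0.
have D (x : R) : 0 < x -> is_derive x 1 (fun u : R => (al * pi)^-1 * arg_val al u pi r) (ratio_density r x).
  move=> x0; apply: der_eq (@der_mull _ (fun u : R => arg_val al u pi r) x _ (al * pi)^-1 (der_ag_t al0 al1 x0 r0 ppm)) _.
  by rewrite (rr_c2 r x0).
have s0 := sin_al_gt0 al0 al1.
have -> : 1%E = (1 - 0)%:E :> \bar R by rewrite subr0.
apply: (@ge0_FTC_oy _ (ratio_density r) (fun u : R => (al * pi)^-1 * arg_val al u pi r) 0 0 1).
- by move=> x x0; exact: rr_ge0.
- move=> x x0; apply: cvgM.
    apply: cvgV; first by rewrite !mulf_neq0 ?gt_eqF.
    by apply: cvgM; [exact: cvg_cst|exact: cvg_id].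
  by have [] := continuous_c12 al0 al1 x0 r0 pabs.
- have K : (al * pi)^-1 * arg_val al x pi r @[x --> 0^'+] --> (al * pi)^-1 * parg 0 (al * pi) r; last first.
    by move: K; rewrite parg0 mulr0.
  apply: cvgM; first exact: cvg_cst.
  apply: (@cvg_comp _ _ _ (fun u : R => u `^ al) (fun y => parg y (al * pi) r) _ _ _ (powR_cvg0 al0)).
  exact: der_continuous (der_parg_x 0 r0 (al_phi al0 al1 ppm)).
- have -> : 1 = (al * pi)^-1 * (al * pi - (pi / 2 - pi / 2)) by rewrite subrr subr0 mulVf ?gt_eqF.
  apply: cvgM; first exact: cvg_cst.
  apply: cvgB; first exact: cvg_cst.
  apply: cvgB; first exact: cvg_cst.
  apply: (@cvg_comp _ _ _ (fun u : R => cot (al * pi) + u `^ al / r / sin (al * pi)) atan _ _ _ _ (@cvgy_atan R)).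
  apply/cvgryPge => A; near=> u; rewrite -lerBlDl !ler_pdivlMr//.
  by near: u; move/cvgryPge : (powR_cvg_pinfty al0); apply.
Unshelve. all: end_near. Qed.

(** Take for H the point mass at r and theta = 1 in [cauchy_stieltjes]: g is then 1 / (z^al + r),
    and by [sin_ag] its boundary integrand is x times the density, up to the factor pi / r. *)
Lemma rr_stieltjes (r z : R) : 0 < r -> 0 < z ->
  (\int[lambda]_(x in P0) (ratio_density r x * (x / (x + z)))%:E = (r / (z `^ al + r))%:E)%E.
Proof.
move=> r0 z0; pose Hr : probability RR R := \d_(r : RR).
have P0r : P0 r by rewrite /= in_itv/= r0.
have H1 : Hr P0 = 1%E by rewrite /= diracE mem_set.
have p0 := pi_gt0 R.
have [I E] := cauchy_stieltjes al0 al1 H1 (dirac_log_moment r) ltr01 z0.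
have UE (t phi : R) : Upot Hr al t phi = log_mod al t phi r by apply: Rintegral_dirac => //; exact: measurable_lg.
have VE (t phi : R) : Vpot Hr al t phi = arg_val al t phi r by apply: Rintegral_dirac => //; exact: measurable_ag.
have K (t : R) : 0 < t -> ratio_density r t * (t / (t + z)) = r / pi * (expR (- (1 * Upot Hr al t pi)) * sin (1 * Vpot Hr al t pi) / (t + z)).
  move=> t0; rewrite UE VE !mul1r sin_ag// rrE//.
  have tz : 0 < t + z by exact: addr_gt0.
  have D0 := pnorm_pos al0 al1 (powR_ge0 t al) r0 pabs.
  move: D0 (sin (al * pi)); move: (pnorm _ _ _) => D D0 s; move: (t `^ al) (pi : R) p0 => y p p0.
  by field; rewrite !gt_eqF.
transitivity (\int[lambda]_(t in P0) ((r / pi)%:E * (expR (- (1 * Upot Hr al t pi)) * sin (1 * Vpot Hr al t pi) / (t + z))%:E))%E.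
  apply: eq_integral => t /set_mem; rewrite /= in_itv/= andbT => t0.
  by rewrite -EFinM K.
rewrite integralZl// EFin_Rintegral// E -EFinM; congr EFin.
rewrite UE mul1r /log_mod /pnorm mulr0 cos0 mulr1 (_ : _ + _ + _ = (z `^ al + r) ^+ 2); last by ring.
have zr : 0 < z `^ al + r by rewrite addr_gt0// powR_gt0.
have -> : 2^-1 * ln ((z `^ al + r) ^+ 2) = ln (z `^ al + r).
  by rewrite expr2 lnM ?posrE//; field.
rewrite expRN lnK ?posrE//; move: (z `^ al) zr (pi : R) p0 => y zr p p0.
by field; rewrite !gt_eqF.
Qed.

(** Write ln (1 + l x) as the integral of x / (1 + s x) over 0 < s < l. By Tonelli the inner
    integral is [rr_stieltjes] at z = 1 / s, and the resulting r s^(al - 1) / (1 + s^al r) is the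
    derivative of al^-1 ln (1 + s^al r). *)
Lemma rr_log (r l : R) : 0 < r -> 0 < l ->
  (\int[lambda]_(x in P0) ((ln (1 + l * x))%:E * (ratio_density r x)%:E) = (al^-1 * ln (1 + l `^ al * r))%:E)%E.
Proof.
move=> r0 l0.
have lnE (x : R) : 0 < x -> (\int[lambda]_(s in (`]0%R, l[%classic : set RR)) (x / (1 + s * x))%:E = (ln (1 + l * x))%:E)%E.
  move=> x0; have pos (s : R) : 0 <= s -> 0 < 1 + s * x by move=> s0; rewrite ltr_pwDl// mulr_ge0// ltW.
  have D (s : R) : 0 <= s -> is_derive s 1 (fun s : R => ln (1 + s * x)) (x / (1 + s * x)).
    move=> s0; apply: der_eq (@der_ln _ (fun s : R => 1 + s * x) s (0 + 1 * x) (pos s s0) _) _.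
      exact: (@der_add _ (fun=> 1) (fun s : R => s * x) s 0 (1 * x) (der_cst s 1) (der_mulr x (der_id s))).
    by rewrite add0r mul1r mulrC.
  have -> : ln (1 + l * x) = ln (1 + l * x) - ln (1 + 0 * x) by rewrite mul0r addr0 ln1 subr0.
  apply: (@ge0_FTC_oo _ (fun s => x / (1 + s * x)) (fun s : R => ln (1 + s * x)) 0 l).
  - exact: l0.
  - by move=> s /andP[s0 _]; rewrite divr_ge0 ?(ltW x0)// ltW// pos// ltW.
  - by move=> s /andP[s0 _]; apply: D; exact: ltW.
  - move=> s /andP[s0 _]; apply: cvgM; first exact: cvg_cst.
    apply: cvgV; first by rewrite gt_eqF// pos// ltW.
    by apply: cvgD; [exact: cvg_cst|apply: cvgM; [exact: cvg_id|exact: cvg_cst]].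
  - apply: cvg_at_right_filter; exact: der_continuous (D 0 (lexx 0)).
  - apply: cvg_at_left_filter; exact: der_continuous (D l (ltW l0)).
have E1 (x s k : R) : 0 < x -> 0 < s -> x / (1 + s * x) * k = s^-1 * (k * (x / (x + s^-1))).
  move=> x0 s0; have q0 : 0 < 1 + s * x by rewrite ltr_pwDl// mulr_ge0 ?ltW.
  have -> : x + s^-1 = (1 + s * x) / s by field; rewrite gt_eqF.
  by field; rewrite !gt_eqF.
have E2 (s : R) : 0 < s -> s^-1 * (r / (s^-1 `^ al + r)) = r * s `^ (al - 1) / (1 + s `^ al * r).
  move=> s0; rewrite powRB ?(gt_eqF s0) ?implybT// powRr1 ?ltW//.
  have -> : s^-1 `^ al = (s `^ al)^-1 by rewrite -[s^-1]powR_inv1 ?ltW// -powRrM mulN1r powRN.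
  have := powR_gt0 al s0; move: (s `^ al) => y y0.
  have q0 : 0 < 1 + y * r by rewrite ltr_pwDl// mulr_ge0 ?ltW.
  have -> : y^-1 + r = (1 + y * r) / y by field; rewrite gt_eqF.
  by field; rewrite !gt_eqF.
pose f (p : RR * RR) : \bar R := (`|p.1 / (1 + p.2 * p.1) * ratio_density r p.1|)%:E.
have minv d (X : measurableType d) (D : set X) (g : X -> R) : measurable_fun D g -> measurable_fun D (fun p => (g p)^-1).
  by move=> mg; exact: (measurableT_comp (@measurable_fun_inv R)).
have mf : measurable_fun setT f.
  apply/measurable_EFinP; apply: measurableT_comp => //; apply: measurable_funM.
    apply: measurable_funM => //; apply: minv; apply: measurable_funD => //.
    exact: measurable_funM.
  exact: measurable_rr.
transitivity (\int[lambda]_(x in P0) \int[lambda]_(s in (`]0%R, l[%classic : set RR)) f (x, s))%E.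
  apply: eq_integral => x /set_mem; rewrite /= in_itv/= andbT => x0.
  rewrite -lnE//.
  have s0 (s : R) : (`]0%R, l[%classic : set RR) s -> 0 <= x / (1 + s * x).
    rewrite /= in_itv/= => /andP[s0 _].
    by rewrite divr_ge0// ?addr_ge0 ?mulr_ge0 ?ltW.
  rewrite -ge0_integralZr//; last 2 first.
  - apply/measurable_EFinP; apply: measurable_funM => //; apply: minv; apply: measurable_funD => //.
    exact: measurable_funM.
  - by rewrite lee_fin rr_ge0.
  apply: eq_integral => s /set_mem /s0 xs.
  by rewrite /f /= -EFinM ger0_norm// mulr_ge0// rr_ge0.
rewrite fubini_tonelli_in//; last by move=> x y _ _; rewrite lee_fin.
transitivity (\int[lambda]_(s in (`]0%R, l[%classic : set RR)) (r * s `^ (al - 1) / (1 + s `^ al * r))%:E)%E.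
  apply: eq_integral => s /set_mem; rewrite /= in_itv/= => /andP[s0 _].
  transitivity ((s^-1)%:E * \int[lambda]_(x in P0) (ratio_density r x * (x / (x + s^-1)))%:E)%E.
    rewrite -ge0_integralZl_EFin//; last 3 first.
    - move=> x; rewrite /= in_itv/= andbT => x0.
      by rewrite lee_fin mulr_ge0 ?rr_ge0// divr_ge0 ?addr_ge0 ?invr_ge0 ?ltW.
    - apply/measurable_EFinP; apply: measurable_funM; first by apply: measurable_funTS; exact: measurable_rr.
      by apply: measurable_funM => //; apply: minv; exact: measurable_funD.
    - by rewrite invr_ge0 ltW.
    apply: eq_integral => x /set_mem; rewrite /= in_itv/= andbT => x0.
    have q0 : 0 < 1 + s * x by rewrite ltr_pwDl// mulr_ge0 ?ltW.
    rewrite /f /= ger0_norm; last by rewrite mulr_ge0 ?rr_ge0// divr_ge0 ?ltW.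
    by rewrite -EFinM E1.
  by rewrite rr_stieltjes ?invr_gt0// -EFinM E2.
have D (s : R) : 0 < s -> is_derive s 1 (fun s : R => al^-1 * ln (1 + s `^ al * r)) (r * s `^ (al - 1) / (1 + s `^ al * r)).
  move=> s0; have q0 : 0 < 1 + s `^ al * r by rewrite ltr_pwDl// mulr_ge0 ?ltW ?powR_gt0.
  have d1 := @der_powR _ (fun u : R => u) s 1 al s0 (der_id s).
  have d2 := @der_add _ (fun=> 1) (fun s : R => s `^ al * r) s 0 _ (der_cst s 1) (der_mulr r d1).
  apply: der_eq (@der_mull _ _ _ _ al^-1 (@der_ln _ (fun s : R => 1 + s `^ al * r) s _ q0 d2)) _.
  have a0 := al0; move: (s `^ (al - 1)) => w; move: (s `^ al) q0 => y q0.
  by field; rewrite !gt_eqF.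
have C (s : R) : 0 < s -> {for s, continuous (fun s : R => s `^ al)}.
  by move=> s0; exact: der_continuous (@der_powR _ (fun u : R => u) s 1 al s0 (der_id s)).
rewrite -[al^-1 * _]subr0.
apply: (@ge0_FTC_oo _ (fun s : R => r * s `^ (al - 1) / (1 + s `^ al * r)) (fun s : R => al^-1 * ln (1 + s `^ al * r)) 0 l).
- exact: l0.
- move=> s /andP[s0 _]; have q0 : 0 < 1 + s `^ al * r by rewrite ltr_pwDl// mulr_ge0 ?ltW ?powR_gt0.
  by rewrite divr_ge0 ?ltW// mulr_gt0 ?powR_gt0.
- by move=> s /andP[s0 _]; exact: D.
- move=> s /andP[s0 _]; have q0 : 0 < 1 + s `^ al * r by rewrite ltr_pwDl// mulr_ge0 ?ltW ?powR_gt0.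
  apply: cvgM.
    apply: cvgM; first exact: cvg_cst.
    exact: der_continuous (@der_powR _ (fun u : R => u) s 1 (al - 1) s0 (der_id s)).
  apply: cvgV; first by rewrite gt_eqF.
  apply: cvgD; first exact: cvg_cst.
  by apply: cvgM; [exact: C|exact: cvg_cst].
- have K : al^-1 * ln (1 + x `^ al * r) @[x --> 0^'+] --> al^-1 * ln (1 + 0 * r); last first.
    by move: K; rewrite mul0r addr0 ln1 mulr0.
  apply: cvgM; first exact: cvg_cst.
  apply: (@cvg_comp _ _ _ (fun u : R => 1 + u `^ al * r) (@ln R)); last first.
    by apply: continuous_ln; rewrite mul0r addr0.
  apply: cvgD; first exact: cvg_cst.
  by apply: cvgM; [exact: powR_cvg0|exact: cvg_cst].
- apply: cvg_at_left_filter; exact: der_continuous (D l l0).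
Qed.

End ratio_kernel.

End stable_ratio.

(** * Mixtures over H: logarithmic moments of the density rhoH *)

Section ratio_mixture.
Context {R : realType}.
Notation lambda := (@lebesgue_measure R).
Notation RR := (measurableTypeR R).
Local Notation P0 := (`]0%R, +oo[%classic : set RR).

Section density_law.
Context (H : probability RR R) (al : R).
Context (al0 : 0 < al) (al1 : al < 1).
Context (H_pos : H `]0%R, +oo[%classic = 1%E).
Context (H_log : (\int[H]_(r in `]0%R, +oo[) (ln (1 + (r : R)))%:E < +oo)%E).

Let in0 (r : R) : P0 r -> 0 < r. Proof. by rewrite /= in_itv/= andbT. Qed.
Let pabs := pi_phimax_abs al0 al1.

Lemma integrable_rr (x : R) : H.-integrable P0 (EFin \o (fun r => ratio_density al r x)).
Proof.
have K : H.-integrable P0 (fun r : R => ((al * pi * x)^-1)%:E * (im_dlog1 al x pi r)%:E)%E.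
  by apply: integrableZl => //; exact: (integrable_c2 H al0 al1 x pabs).
exact: K.
Qed.

Lemma rhoH_rr (x : R) : 0 < x -> rhoH H al x = \int[H]_(r in P0) ratio_density al r x.
Proof.
move=> x0; rewrite rhoHE// /im_dlog -RintegralZl//.
exact: (integrable_c2 H al0 al1 x pabs).
Qed.

Lemma rhoH_ge0 (x : R) : 0 < x -> 0 <= rhoH H al x.
Proof.
move=> x0; rewrite rhoH_rr//; apply: Rintegral_ge0 => r /in0 r0; exact: rr_ge0.
Qed.

Lemma measurable_rhoH : measurable_fun P0 (rhoH H al).
Proof.
apply: (@eq_measurable_fun _ _ _ _ _ (fun x => (al * pi * x)^-1 * im_dlog H al x pi)).
  by move=> x /set_mem/in0 x0; rewrite rhoHE.
apply: open_continuous_measurable_fun; first exact: interval_open.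
move=> x /set_mem/in0 x0; apply: cvgM.
  apply: cvgV; first by rewrite !mulf_neq0// gt_eqF ?pi_gt0.
  by apply: cvgM; [exact: cvg_cst|exact: cvg_id].
by have [] := continuous_C12 H al0 al1 x0 pabs.
Qed.

Lemma ge0_integral_rhoH (g : R -> R) : measurable_fun setT g ->
  (forall x, 0 < x -> 0 <= g x) ->
  (\int[lambda]_(x in P0) ((g x)%:E * (rhoH H al x)%:E) =
   \int[H]_(r in P0) \int[lambda]_(x in P0) ((g x)%:E * (ratio_density al r x)%:E))%E.
Proof.
move=> mg g0; pose f (p : RR * RR) : \bar R := (`|g p.1 * ratio_density al p.2 p.1|)%:E.
have mf : measurable_fun setT f.
  apply/measurable_EFinP; apply: measurableT_comp => //; apply: measurable_funM.
    exact: measurableT_comp.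
  exact: measurable_rr.
transitivity (\int[lambda]_(x in P0) \int[H]_(r in P0) f (x, r))%E.
  apply: eq_integral => x /set_mem/in0 x0.
  rewrite rhoH_rr// -EFin_Rintegral//; last exact: integrable_rr.
  rewrite -ge0_integralZl_EFin ?g0//; last 2 first.
  - by move=> r /in0 r0; rewrite lee_fin rr_ge0.
  - by apply/measurable_EFinP; apply: measurable_funTS; exact: measurable_rr.
  apply: eq_integral => r /set_mem/in0 r0; rewrite -EFinM /f /= ger0_norm//.
  by rewrite mulr_ge0 ?g0// rr_ge0.
have f0 (x y : RR) : P0 x -> P0 y -> (0 <= f (x, y))%E by move=> _ _; rewrite lee_fin.
apply: etrans (@fubini_tonelli_in _ _ _ _ _ lambda H P0 P0 f (measurable_itv _) (measurable_itv _) mf f0) _.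
apply: eq_integral => r /set_mem/in0 r0; apply: eq_integral => x /set_mem/in0 x0.
by rewrite -EFinM /f /= ger0_norm// mulr_ge0 ?g0// rr_ge0.
Qed.

Lemma rhoH_mass : (\int[lambda]_(x in P0) (rhoH H al x)%:E = 1)%E.
Proof.
transitivity (\int[lambda]_(x in P0) ((cst 1 x)%:E * (rhoH H al x)%:E))%E.
  by apply: eq_integral => x _; rewrite mul1e.
rewrite ge0_integral_rhoH//.
transitivity (\int[H]_(r in P0) ((cst 1 r)%:E))%E.
  apply: eq_integral => r /set_mem/in0 r0; rewrite -[RHS](rr_mass al0 al1 r0).
  by apply: eq_integral => x _; rewrite mul1e.
by rewrite (@integral_cst _ _ _ H P0 _ 1%:E)// mul1e.
Qed.

Lemma rhoH_law : exists K : probability RR R,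
  [/\ forall A : set RR, measurable A -> with_density (fun x => (rhoH H al x)%:E) A = K A,
      K `]-oo, 0%R[%classic = 0%E &
      forall l : R, 0 < l -> (\int[K]_(x in P0) (ln (1 + l * x))%:E =
        (al^-1)%:E * \int[H]_(r in P0) (ln (1 + l `^ al * r))%:E)%E].
Proof.
have m : measurable_fun P0 (EFin \o rhoH H al) by apply/measurable_EFinP; exact: measurable_rhoH.
have p : forall x : RR, P0 x -> (0 <= (EFin \o rhoH H al) x)%E by move=> x /in0 x0; rewrite lee_fin rhoH_ge0.
have [nu nuE] := density_measure lambda (measurable_itv `]0%R, +oo[) m p.
have [] := @probability_of_measure R nu.
  by rewrite nuE// setTI; exact: rhoH_mass.
move=> K KE; exists K; split.
- by move=> A mA; rewrite KE nuE.
- rewrite KE nuE// (_ : _ `&` _ = set0) ?integral_set0//.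
  apply/seteqP; split => x //= []; rewrite !in_itv/= andbT => x0 x1.
  by have := lt_trans x0 x1; rewrite ltxx.
move=> l l0.
(* [ge0_integral_density] wants a function nonnegative on the whole line, and ln (1 + l x) is
   negative just below 0. *)
pose g (x : R) := if 0 < x then ln (1 + l * x) else 0.
have mln (k : R) : measurable_fun setT (fun x : R => ln (1 + k * x)).
  by apply: (measurableT_comp (@measurable_ln R)); apply: measurable_funD => //; exact: measurable_funM.
have mg : measurable_fun setT g.
  apply: measurable_fun_ifT => //; exact: measurable_fun_ltr.
have g0 (x : R) : 0 <= g x.
  by rewrite /g; case: ifPn => // x0; rewrite ln_ge0// lerDl mulr_ge0 ?ltW.
transitivity (\int[K]_x (g x)%:E)%E.
  rewrite integral_mkcond; apply: eq_integral => x _; rewrite /patch /g.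
  case: ifPn => [/set_mem/in0 ->//|]; case: ifPn => // x0.
  by rewrite mem_set//= in_itv/= x0.
rewrite (@ge0_integral_density _ _ _ lambda K P0 (rhoH H al) (EFin \o g))//; last 3 first.
- exact: measurable_rhoH.
- by move=> A mA; exact: (eq_trans (KE A) (nuE A mA)).
- exact/measurable_EFinP.
rewrite /= ge0_integral_rhoH//.
rewrite -ge0_integralZl_EFin//; last 3 first.
- by move=> r /in0 r0; rewrite lee_fin ln_ge0// lerDl mulr_ge0 ?powR_ge0 ?ltW.
- by apply/measurable_EFinP; apply: measurable_funTS; exact: mln.
- by rewrite invr_ge0 ltW.
apply: eq_integral => r /set_mem/in0 r0; rewrite -EFinM -(rr_log al0 al1 r0 l0).
by apply: eq_integral => x /set_mem/in0 x0; rewrite /g x0.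
Qed.

Lemma rhoH_transform (tau : R) (mu : probability RR R) : 0 < tau ->
  dirichlet_mean_law tau (with_density (fun x => (rhoH H al x)%:E)) mu ->
  mu `]-oo, 0%R[%classic = 0%E /\
  forall l : R, 0 < l -> (\int[mu]_y ((1 + l * y) `^ (- tau))%:E =
    (expR (- (tau * (al^-1 * (\int[H]_(r in P0) ln (1 + l `^ al * r))%R))))%:E)%E.
Proof.
move=> tau0 muL; have [K [KE K0 Kl]] := rhoH_law.
have HI (k : R) (k0 : 0 < k) := integrable_ln1D k0 H_log.
have KlE (l : R) : 0 < l -> (\int[K]_(x in P0) (ln (1 + l * x))%:E =
    (al^-1 * (\int[H]_(r in P0) ln (1 + l `^ al * r))%R)%:E)%E.
  move=> l0; rewrite Kl// EFinM -EFin_Rintegral//; exact: HI (powR_gt0 al l0).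
have Kfin : (\int[K]_(x in `]0%R, +oo[) (ln (1 + x))%:E < +oo)%E.
  have -> : (\int[K]_(x in `]0%R, +oo[) (ln (1 + x))%:E = \int[K]_(x in P0) (ln (1 + 1 * x))%:E)%E.
    by apply: eq_integral => x _; rewrite mul1r.
  by rewrite KlE ?ltry.
have [mu0 muE] := markov_krein KE K0 Kfin tau0 muL.
split=> // l l0; rewrite muE//; congr (expR (- (_ * _)))%:E.
by rewrite /Rintegral KlE.
Qed.

End density_law.

End ratio_mixture.

(** * The functions Delta and dd *)

Section delta_function.
Context {R : realType}.
Notation lambda := (@lebesgue_measure R).
Notation RR := (measurableTypeR R).
Local Notation P0 := (`]0%R, +oo[%classic : set RR).

Section delta.
Context (H : probability RR R) (al th : R).
Context (al0 : 0 < al) (al1 : al < 1) (th0 : 0 < th).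
Context (H_pos : H `]0%R, +oo[%classic = 1%E).
Context (H_log : (\int[H]_(r in `]0%R, +oo[) (ln (1 + (r : R)))%:E < +oo)%E).

Let in0 (r : R) : P0 r -> 0 < r. Proof. by rewrite /= in_itv/= andbT. Qed.
Let pabs := pi_phimax_abs al0 al1.
Let ppm := pi_phimax al0 al1.

Lemma DeltaE (x : R) : 0 < x ->
  Delta H al th x = pi^-1 * (expR (- (th * Upot H al x pi)) * sin (th * Vpot H al x pi)).
Proof.
move=> x0; rewrite /Delta -mulrA [sin _ * _]mulrC; congr (_ * (expR (- _) * sin _)).
  by rewrite -mulrA calSE.
by rewrite -UpsilonE//; ring.
Qed.

(** [im_g] at phi = pi is the imaginary part of g on the upper side of the cut, so Delta is the
    function that Stieltjes inversion predicts. *)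
Lemma DeltaN (x : R) : 0 < x -> Delta H al th x = - pi^-1 * im_g H al th x pi.
Proof. by move=> x0; rewrite DeltaE// /im_g mulNr mulrN opprK. Qed.

(** With Delta = - Im g / pi, the polar equation for the t-derivative of the imaginary part makes
    the right side the derivative of Delta. The angle al pi - th V in [dd] comes from collecting the
    terms in B1. *)
Lemma ddE (x : R) : 0 < x -> dd H al th x = - pi^-1 * (im_dg H al th x pi / x).
Proof.
move=> x0; rewrite /dd /im_dg C1E// C2E//.
have -> : th * al * calS H al x = th * Upot H al x pi by rewrite -mulrA calSE.
have -> : pi * al * (1 - th * Upsilon H al x) = al * pi - th * Vpot H al x pi.
  by rewrite -UpsilonE//; ring.
have -> : pi * th * al * Upsilon H al x = th * Vpot H al x pi.
  by rewrite -UpsilonE//; ring.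
rewrite sinB; have p0 := pi_gt0 R.
move: (expR _) (sin (th * _)) (cos (th * _)) (sin (al * pi)) (cos (al * pi)) (B1 H al x) (B2 H al x) => e s c sa ca b1 b2.
by move: (pi : R) p0 => p p0; field; rewrite !gt_eqF.
Qed.

Lemma der_Delta (x : R) : 0 < x -> is_derive x 1 (Delta H al th) (dd H al th x).
Proof.
move=> x0; have [_ D _ _] := hol_g al0 al1 H_log th x0 ppm.
rewrite (ddE x0); apply: (@near_eq_is_derive _ _ _ (fun u : R => - pi^-1 * im_g H al th u pi)).
- by near=> u; rewrite DeltaN//; near: u; exact: lt_nbhsr.
Unshelve. all: end_near. Qed.

Lemma continuous_Delta (x : R) : 0 < x -> {for x, continuous (Delta H al th)}.
Proof. by move=> x0; exact: der_continuous (der_Delta x0). Qed.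

Lemma continuous_dd (x : R) : 0 < x -> {for x, continuous (dd H al th)}.
Proof.
move=> x0; have [k1 k2] := continuous_C12 H al0 al1 x0 pabs.
have cU := der_continuous (der_U_t al0 al1 H_log x0 pabs).
have cV := der_continuous (der_V_t H al0 al1 x0 ppm).
have cE : {for x, continuous (fun u : R => th * expR (- (th * Upot H al u pi)))}.
  apply: cvgM; first exact: cvg_cst.
  apply: (@cvg_comp _ _ _ (fun u : R => - (th * Upot H al u pi)) expR); last exact: continuous_expR.
  by apply: cvgN; apply: cvgM => //; exact: cvg_cst.
have cT : {for x, continuous (fun u : R => th * Vpot H al u pi)}.
  by apply: cvgM => //; exact: cvg_cst.
have K : {for x, continuous (fun u : R => - pi^-1 * (im_dg H al th u pi / u))}.
  apply: cvgM; first exact: cvg_cst.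
  apply: cvgM; last by apply: cvgV; [rewrite gt_eqF|exact: cvg_id].
  apply: cvgN; apply: cvgM => //; apply: cvgB; apply: cvgM => //.
    by apply: (@cvg_comp _ _ _ (fun u : R => th * Vpot H al u pi) cos); [exact: cT|exact: continuous_cos].
  by apply: (@cvg_comp _ _ _ (fun u : R => th * Vpot H al u pi) sin); [exact: cT|exact: continuous_sin].
have K' : - pi^-1 * (im_dg H al th u pi / u) @[u --> x] --> dd H al th x by rewrite (ddE x0); exact: K.
apply: cvg_trans K'; apply: near_eq_cvg.
by near=> u; rewrite ddE//; near: u; exact: lt_nbhsr.
Unshelve. all: end_near. Qed.

(** From the bound of g by [decay], with the exponent of 1 + t rounded up to 1. This is crude at
    infinity, but for integrals over ]0, x[ the behaviour at 0 is what matters. *)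
Lemma Delta_le : exists2 C : R, 0 < C & forall t, 0 < t -> `|Delta H al th t| <= C * (t `^ (- 2^-1) * (1 + t)).
Proof.
have [C C0 CE] := expU_mdec al0 al1 H_pos H_log th0; exists (pi^-1 * C).
  by rewrite mulr_gt0// invr_gt0 pi_gt0.
move=> t t0; rewrite DeltaE// normrM ger0_norm ?invr_ge0 ?pi_ge0// -mulrA ler_wpM2l ?invr_ge0 ?pi_ge0//.
rewrite normrM ger0_norm ?expR_ge0//.
apply: (@le_trans _ _ (expR (- (th * Upot H al t pi)) * 1)).
  by rewrite ler_wpM2l ?expR_ge0// ler_norml sin_geN1 sin_le1.
rewrite mulr1; apply: le_trans (CE t pi t0 pabs) _; rewrite ler_wpM2l ?(ltW C0)//.
rewrite /decay ler_wpM2l ?powR_ge0//.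
have h : 0 < decay_exp al th by rewrite /decay_exp lt_min mulr_gt0//= invr_gt0.
rewrite -[leRHS]powRr1; last by rewrite addr_ge0 ?ltW.
by apply: ler_powR; [rewrite lerDl ltW|lra].
Qed.

(** The angle th V stays in [0, th al pi]. Beyond th al = 1 it may pass pi, and Delta may change
    sign. *)
Lemma Delta_ge0 (t : R) : th * al <= 1 -> 0 < t -> 0 <= Delta H al th t.
Proof.
move=> tal t0; rewrite DeltaE// mulr_ge0 ?invr_ge0 ?pi_ge0// mulr_ge0 ?expR_ge0//.
have /andP[v0 v1] := V_bound al0 al1 H_pos t ppm.
apply: sin_ge0_pi; rewrite mulr_ge0 ?(ltW th0)//=.
apply: (@le_trans _ _ (th * (al * pi))); first by rewrite ler_wpM2l ?(ltW th0).
by rewrite mulrA ler_piMl ?pi_ge0.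
Qed.

Lemma measurable_Delta : measurable_fun P0 (Delta H al th).
Proof.
apply: open_continuous_measurable_fun; first exact: interval_open.
by move=> x /set_mem/in0 x0; exact: continuous_Delta.
Qed.

Lemma measurable_dd : measurable_fun P0 (dd H al th).
Proof.
apply: open_continuous_measurable_fun; first exact: interval_open.
by move=> x /set_mem/in0 x0; exact: continuous_dd.
Qed.

Lemma Delta_stieltjes (z : R) : 0 < z ->
  lambda.-integrable P0 (fun t => (Delta H al th t / (t + z))%:E) /\
  \int[lambda]_(t in P0) (Delta H al th t / (t + z)) =
    expR (- (th * \int[H]_(r in P0) ln (z `^ al + r))).
Proof.
move=> z0; have [I E] := cauchy_stieltjes al0 al1 H_pos H_log th0 z0.
have K : lambda.-integrable P0 (fun t : R => (pi^-1)%:E * (expR (- (th * Upot H al t pi)) * sin (th * Vpot H al t pi) / (t + z))%:E)%E.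
  by apply: integrableZl.
have KE : {in P0, (fun t : R => (pi^-1)%:E * (expR (- (th * Upot H al t pi)) * sin (th * Vpot H al t pi) / (t + z))%:E)%E =1
    (fun t => (Delta H al th t / (t + z))%:E)}.
  by move=> t /set_mem/in0 t0; rewrite -EFinM DeltaE//; congr EFin; rewrite -[in RHS]mulrA.
split; first exact: eq_integrable KE K.
transitivity (pi^-1 * (pi * expR (- (th * Upot H al z 0)))).
  rewrite -E -RintegralZl//; apply: eq_Rintegral => t t0.
  by have /(congr1 fine) := KE t t0 => /= <-.
by rewrite mulKf ?gt_eqF ?pi_gt0// UE0.
Qed.

End delta.

End delta_function.

(** * Distribution functions from Stieltjes transforms *)

Section beta_convolution.
Context {R : realType}.
Notation lambda := (@lebesgue_measure R).
Notation RR := (measurableTypeR R).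
Local Notation P0 := (`]0%R, +oo[%classic : set RR).

Lemma integral_scale (c : R) (f : R -> R) : 0 < c -> measurable_fun setT f ->
  lambda.-integrable P0 (EFin \o f) ->
  lambda.-integrable P0 (EFin \o (fun s => f (c * s))) /\
  \int[lambda]_(s in P0) f (c * s) = c^-1 * \int[lambda]_(t in P0) f t.
Proof.
move=> c0 mf If.
have mfe : measurable_fun setT (EFin \o f) by exact/measurable_EFinP.
have mc : measurable_fun setT (fun s : R => f (c * s)).
  by apply: (measurableT_comp mf); exact: measurable_funM.
have Ic : lambda.-integrable P0 (EFin \o (fun s => f (c * s))).
  apply/integrableP; split; first by apply/measurable_EFinP; exact: measurable_funTS.
  rewrite /= (@ge0_integral_scale _ c (fun t => `|(f t)%:E|%E))//; last exact: measurableT_comp.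
  by rewrite lte_mul_pinfty ?lee_fin ?invr_ge0 ?(ltW c0)//; have /integrableP[] := If.
split=> //; rewrite /Rintegral integralE [in RHS]integralE.
have P1 : (\int[lambda]_(s in P0) ((fun s => (f (c * s))%:E)^\+ s) = (c^-1)%:E * \int[lambda]_(t in P0) ((EFin \o f)^\+ t))%E.
  rewrite -(@ge0_integral_scale _ c ((EFin \o f)^\+)%E c0 (measurable_funepos mfe) (fun x => funepos_ge0 _ x)).
  by apply: eq_integral => s _; rewrite !funeposE.
have P2 : (\int[lambda]_(s in P0) ((fun s => (f (c * s))%:E)^\- s) = (c^-1)%:E * \int[lambda]_(t in P0) ((EFin \o f)^\- t))%E.
  rewrite -(@ge0_integral_scale _ c ((EFin \o f)^\-)%E c0 (measurable_funeneg mfe) (fun x => funeneg_ge0 _ x)).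
  by apply: eq_integral => s _; rewrite !funenegE.
rewrite P1 P2 -muleBr//.
  rewrite fineM// -integralE; exact: integrable_fin_num.
rewrite fin_num_adde_defr//; exact: integrable_pos_fin_num.
Qed.

Lemma integrable_pow01 (p : R) : 0 < p ->
  lambda.-integrable (`]0%R, 1%R[%classic : set RR) (fun s => (s `^ (p - 1))%:E) /\
  lambda.-integrable (`]0%R, 1%R[%classic : set RR) (fun s => ((1 - s) `^ (p - 1))%:E).
Proof.
move=> p0.
have D (s : R) : 0 < s -> is_derive s 1 (fun s : R => p^-1 * s `^ p) (s `^ (p - 1)).
  move=> s0; apply: der_eq (@der_mull _ _ s _ p^-1 (@der_powR _ (fun u : R => u) s 1 p s0 (der_id s))) _.
  by rewrite mulr1 mulKf ?gt_eqF.
have D' (s : R) : s < 1 -> is_derive s 1 (fun s : R => - (p^-1 * (1 - s) `^ p)) ((1 - s) `^ (p - 1)).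
  move=> s1; have q0 : 0 < 1 - s by rewrite subr_gt0.
  have d1 := @der_add _ (fun=> 1) (fun s : R => - s) s 0 (- 1) (der_cst s 1) (der_opp (der_id s)).
  apply: der_eq (der_opp (@der_mull _ _ s _ p^-1 (@der_powR _ (fun u : R => 1 - u) s _ p q0 d1))) _.
  by rewrite add0r mulrN1 mulrN opprK mulKf ?gt_eqF.
have I1 : (\int[lambda]_(s in (`]0%R, 1%R[%classic : set RR)) (s `^ (p - 1))%:E = (p^-1 - 0)%:E)%E.
  apply: (@ge0_FTC_oo _ (fun s => s `^ (p - 1)) (fun s : R => p^-1 * s `^ p) 0 1).
  - exact: ltr01.
  - by move=> s _; exact: powR_ge0.
  - by move=> s /andP[s0 _]; exact: D.
  - by move=> s /andP[s0 _]; exact: der_continuous (@der_powR _ (fun u : R => u) s 1 (p - 1) s0 (der_id s)).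
  - have K : p^-1 * x `^ p @[x --> 0^'+] --> p^-1 * 0; last by move: K; rewrite mulr0.
    by apply: cvgM; [exact: cvg_cst|exact: powR_cvg0].
  - have K : {for 1, continuous (fun s : R => p^-1 * s `^ p)} := der_continuous (D 1 ltr01).
    have := cvg_at_left_filter K.
    by rewrite /= powR1 mulr1.
have I2 : (\int[lambda]_(s in (`]0%R, 1%R[%classic : set RR)) ((1 - s) `^ (p - 1))%:E = (0 - (- (p^-1)))%:E)%E.
  apply: (@ge0_FTC_oo _ (fun s => (1 - s) `^ (p - 1)) (fun s : R => - (p^-1 * (1 - s) `^ p)) 0 1).
  - exact: ltr01.
  - by move=> s _; exact: powR_ge0.
  - by move=> s /andP[_ s1]; exact: D'.
  - move=> s /andP[_ s1]; have q0 : 0 < 1 - s by rewrite subr_gt0.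
    have d1 := @der_add _ (fun=> 1) (fun s : R => - s) s 0 (- 1) (der_cst s 1) (der_opp (der_id s)).
    exact: der_continuous (@der_powR _ (fun u : R => 1 - u) s _ (p - 1) q0 d1).
  - have K : {for 0, continuous (fun s : R => - (p^-1 * (1 - s) `^ p))} := der_continuous (D' 0 ltr01).
    have := cvg_at_right_filter K.
    by rewrite /= subr0 powR1 mulr1.
  - have K : - (p^-1 * (1 - x) `^ p) @[x --> 1^'-] --> - (p^-1 * 0); last by move: K; rewrite mulr0 oppr0.
    apply: cvgN; apply: cvgM; first exact: cvg_cst.
    apply/cvgrPdist_lt => e e0; near=> x.
    have x1 : 0 < 1 - x by rewrite subr_gt0; near: x; exact: nbhs_left_lt.
    rewrite sub0r normrN ger0_norm ?powR_ge0//.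
    have eE : (e `^ p^-1) `^ p = e by rewrite -powRrM mulVf ?gt_eqF// powRr1 ?ltW.
    rewrite -eE.
    apply: gt0_ltr_powR => //; rewrite ?nnegrE ?powR_ge0 ?(ltW x1)//.
    rewrite ltrBlDl -ltrBlDr; near: x; apply: nbhs_left_gt.
    by rewrite ltrBlDr ltrDl powR_gt0.
have int (f : R -> R) (c : R) : measurable_fun setT f -> (forall s, 0 <= f s) ->
    (\int[lambda]_(s in (`]0%R, 1%R[%classic : set RR)) (f s)%:E = c%:E)%E ->
    lambda.-integrable (`]0%R, 1%R[%classic : set RR) (fun s => (f s)%:E).
  move=> mf f0 E; apply/integrableP; split; first by apply/measurable_EFinP; exact: measurable_funTS.
  have -> : (\int[lambda]_(x in (`]0%R, 1%R[%classic : set RR)) `|(f x)%:E| = c%:E)%E.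
    by rewrite -E; apply: eq_integral => s _; rewrite gee0_abs// lee_fin.
  exact: ltry.
split.
- by apply: int I1 => [|s]; [exact: measurable_fun_powR|exact: powR_ge0].
- apply: int I2 => [|s]; last exact: powR_ge0.
  by apply: measurable_fun_powR; exact: measurable_funB.
Unshelve. all: end_near. Qed.

Lemma integrable_beta (tau : R) : 0 < tau ->
  lambda.-integrable (`]0%R, 1%R[%classic : set RR) (fun s => ((1 - s) `^ (tau - 1) * s `^ (- 2^-1))%:E).
Proof.
move=> t0; have h0 : 0 < (2^-1 : R) by rewrite invr_gt0.
have [I1 _] := integrable_pow01 h0; have [_ I2] := integrable_pow01 t0.
(* On s <= 1 / 2 the factor (1 - s)^(tau - 1) is at most 1 if tau >= 1 and at most 2^(1 - tau)
   otherwise; on s > 1 / 2 the other factor s^(-1/2) is at most c'. *)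
pose c := Num.max 1 (2^-1 `^ (tau - 1)); pose c' := 2^-1 `^ (- 2^-1) : R.
have K : lambda.-integrable (`]0%R, 1%R[%classic : set RR)
    ((fun s : R => c%:E * (s `^ (2^-1 - 1))%:E) \+ (fun s : R => c'%:E * ((1 - s) `^ (tau - 1))%:E))%E.
  by apply: integrableD => //; apply: integrableZl.
apply: le_integrable K => //.
  apply/measurable_EFinP; apply: measurable_funTS; apply: measurable_funM; apply: measurable_fun_powR => //.
  exact: measurable_funB.
move=> s; rewrite /= in_itv/= => /andP[s0 s1].
have cc : 0 <= c by rewrite /c le_max ler01.
rewrite /= lee_fin !ger0_norm ?addr_ge0 ?mulr_ge0 ?powR_ge0//.
have -> : 2^-1 - 1 = - 2^-1 :> R by field.
have [sh|sh] := leP s 2^-1.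
  apply: (@le_trans _ _ (c * s `^ (- 2^-1))); last by rewrite lerDl mulr_ge0 ?powR_ge0.
  rewrite ler_wpM2r ?powR_ge0// /c le_max.
  have [tau1|tau1] := leP 1 tau.
    have o1 : 1 `^ (tau - 1) = 1 by rewrite powR1.
    apply/orP; left; apply: (@le_trans _ _ (1 `^ (tau - 1))); last by rewrite o1.
    apply: ler_powR_base; lra.
  apply/orP; right; rewrite (_ : tau - 1 = - (1 - tau)); last by ring.
  apply: ler_powRN_base; lra.
apply: (@le_trans _ _ (c' * (1 - s) `^ (tau - 1))); last by rewrite lerDr mulr_ge0 ?powR_ge0.
rewrite mulrC ler_wpM2r ?powR_ge0//.
apply: ler_powRN_base; lra.
Qed.

(** * Integrals against the kernel (x - t)^(tau - 1) *)

Section beta_transform.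
Context (tau : R) (D : R -> R) (tau0 : 0 < tau).
Context (D_meas : measurable_fun [set: R] D).
Context (D_cont : forall x : R, 0 < x -> {for x, continuous D}).
Context (D_le : exists2 C : R, 0 < C & forall t, 0 < t -> `|D t| <= C * (t `^ (- 2^-1) * (1 + t))).

Let in0 (r : R) : P0 r -> 0 < r. Proof. by rewrite /= in_itv/= andbT. Qed.

(* The cut-off is needed because [powR] is 1, not 0, on negative arguments. *)
Definition bkern (x t : R) : R := if (0 < t) && (t < x) then (x - t) `^ (tau - 1) else 0.

Lemma bkern_ge0 x t : 0 <= bkern x t.
Proof. by rewrite /bkern; case: ifPn => // _; exact: powR_ge0. Qed.

Lemma measurable_bkern d (X : measurableType d) (a b : X -> R) :
  measurable_fun setT a -> measurable_fun setT b ->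
  measurable_fun setT (fun p => bkern (a p) (b p)).
Proof.
move=> ma mb; apply: measurable_fun_ifT => //.
  by apply: measurable_and; exact: measurable_fun_ltr.
by apply: measurable_fun_powR; exact: measurable_funB.
Qed.

Lemma bkern_scale (x s : R) : 0 < x -> bkern x (x * s) = x `^ (tau - 1) * bkern 1 s.
Proof.
move=> x0; rewrite /bkern pmulr_rgt0// gtr_pMr//.
case: ifPn => [/andP[s0 s1]|]; last by rewrite mulr0.
by rewrite -{1}[x]mulr1 -mulrBr powRM ?subr_ge0 ?ltW.
Qed.

(** A majorant in s whose dependence on x in ]0, b] is the single factor x^(-1/2); [integrable_beta]
    makes it integrable. *)
Let dom_ex (b : R) : exists2 C, 0 < C & forall x s, 0 < x <= b -> 0 < s ->
  `|bkern 1 s * D (x * s)| <= C * x `^ (- 2^-1) * (bkern 1 s * s `^ (- 2^-1)).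
Proof.
have [C C0 CE] := D_le.
exists (C * (1 + `|b|)); first by rewrite mulr_gt0// ltr_pwD.
move=> x s /andP[x0 xb] s0; rewrite normrM ger0_norm ?bkern_ge0//.
have [s1|s1] := ltP s 1; last by rewrite /bkern [s < 1]ltNge s1 andbF !mul0r mulr0.
have xs : 0 < x * s by rewrite mulr_gt0.
rewrite [leRHS]mulrCA ler_wpM2l ?bkern_ge0//; apply: le_trans (CE _ xs) _.
have -> : C * (1 + `|b|) * x `^ (- 2^-1) * s `^ (- 2^-1) = C * ((x `^ (- 2^-1) * s `^ (- 2^-1)) * (1 + `|b|)) by ring.
rewrite (powRM _ (ltW x0) (ltW s0)) ler_wpM2l ?(ltW C0)// ler_wpM2l ?mulr_ge0 ?powR_ge0// lerD2l.
apply: (@le_trans _ _ x); first by rewrite ler_piMr ?ltW.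
exact: le_trans xb (ler_norm b).
Qed.

Let int_dom : lambda.-integrable P0 (EFin \o (fun s => bkern 1 s * s `^ (- 2^-1))).
Proof.
have E (s : R) : 0 < s -> ((fun s : R => ((1 - s) `^ (tau - 1) * s `^ (- 2^-1))%:E) \_ `]0%R, 1%R[%classic) s = (bkern 1 s * s `^ (- 2^-1))%:E.
  move=> s0; rewrite /patch /bkern s0/=; case: ifPn.
    by move=> /set_mem; rewrite /= in_itv/= => /andP[_ ->].
  move=> /negP h; case: ifPn => [s1|]; last by rewrite mul0r.
  by exfalso; apply: h; rewrite inE/= in_itv/= s0.
apply: (@eq_integrable _ _ _ lambda P0 _ ((fun s : R => ((1 - s) `^ (tau - 1) * s `^ (- 2^-1))%:E) \_ `]0%R, 1%R[%classic)) => //.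
  by move=> s /set_mem/in0 s0; rewrite E.
apply/(integrable_restrict lambda) => //.
rewrite (_ : _ `&` _ = `]0%R, 1%R[%classic); first exact: integrable_beta.
by apply: setIidr => s; rewrite /= !in_itv/= andbT => /andP[].
Qed.

Lemma integrable_bkern1 (x : R) : 0 < x -> lambda.-integrable P0 (EFin \o (fun s => bkern 1 s * D (x * s))).
Proof.
move=> x0; have [C C0 CE] := dom_ex x.
have K : lambda.-integrable P0 (fun s : R => (C * x `^ (- 2^-1))%:E * (bkern 1 s * s `^ (- 2^-1))%:E)%E.
  by apply: integrableZl => //; exact: int_dom.
apply: le_integrable K => //.
  apply/measurable_EFinP; apply: measurable_funTS; apply: measurable_funM; first exact: measurable_bkern.
  by apply: (measurableT_comp D_meas); exact: measurable_funM.
move=> s /in0 s0; rewrite /= lee_fin; apply: le_trans (ler_norm _); apply: CE => //.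
by rewrite x0 lexx.
Qed.

Definition beta_int (x : R) : R := \int[lambda]_(t in P0) (bkern x t * D t).

(** After t = x s the singular kernel no longer depends on x, which enters only through x^tau and
    D(x s); continuity of [beta_int] then follows from that of D. *)
Lemma beta_int_scale (x : R) : 0 < x ->
  lambda.-integrable P0 (EFin \o (fun t => bkern x t * D t)) /\
  beta_int x = x `^ (tau) * \int[lambda]_(s in P0) (bkern 1 s * D (x * s)).
Proof.
move=> x0; have I := integrable_bkern1 x0.
pose f s := x `^ (tau - 1) * (bkern 1 s * D (x * s)).
have mf : measurable_fun setT f.
  apply: measurable_funM => //; apply: measurable_funM; first exact: measurable_bkern.
  by apply: (measurableT_comp D_meas); exact: measurable_funM.
have If : lambda.-integrable P0 (EFin \o f).
  have K : lambda.-integrable P0 (fun s : R => (x `^ (tau - 1))%:E * (bkern 1 s * D (x * s))%:E)%E.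
    exact: integrableZl.
  exact: K.
have xi : 0 < x^-1 by rewrite invr_gt0.
have [J JE] := integral_scale xi mf If.
have fE t : f (x^-1 * t) = bkern x t * D t.
  by rewrite /f mulrA -bkern_scale// mulrA mulfV ?mul1r// gt_eqF.
split; first by apply: eq_integrable J => // t _ /=; rewrite fE.
rewrite /beta_int; under eq_Rintegral do rewrite -fE.
rewrite JE invrK /f RintegralZl// mulrA; congr (_ * _).
by rewrite powRB ?(gt_eqF x0) ?implybT// powRr1 ?ltW// mulrC mulfVK// gt_eqF.
Qed.

Lemma continuous_beta_int (x : R) : 0 < x -> {for x, continuous beta_int}.
Proof.
move=> x0; have [C C0 CE] := dom_ex (x + 1).
have ct1 : {for x, continuous (fun y : R => \int[lambda]_(s in P0) (bkern 1 s * D (y * s)))}.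
  apply: (@continuous_Rintegral _ _ _ lambda P0 (fun (y : R) (s : R) => bkern 1 s * D (y * s))
    (fun s : R => C * (x / 2) `^ (- 2^-1) * (bkern 1 s * s `^ (- 2^-1))) x (x / 2) (x + 1)) => //.
  - by apply/andP; split; lra.
  - by move=> y /andP[y0 _]; apply: integrable_bkern1; lra.
  - move=> y s /andP[y0 _] /in0 s0; have yp : 0 < y by lra.
    apply: cvgM; first exact: cvg_cst.
    have ys : 0 < y * s by exact: mulr_gt0.
    apply: (@cvg_comp _ _ _ (fun u : R => u * s) D _ _ _ _ (D_cont ys)).
    by apply: cvgM; [exact: cvg_id|exact: cvg_cst].
  - have K : lambda.-integrable P0 (fun s : R => (C * (x / 2) `^ (- 2^-1))%:E * (bkern 1 s * s `^ (- 2^-1))%:E)%E.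
      by apply: integrableZl => //; exact: int_dom.
    exact: K.
  - move=> y s /andP[y0 y1] /in0 s0; have yp : 0 < y by lra.
    apply: le_trans (CE y s _ s0) _; first by rewrite yp ltW.
    rewrite ler_wpM2r ?mulr_ge0 ?bkern_ge0 ?powR_ge0//.
    rewrite ler_wpM2l ?(ltW C0)//; apply: ler_powRN_base; lra.
have ct2 : {for x, continuous (fun y : R => y `^ (tau))}.
  exact: der_continuous (@der_powR _ (fun u : R => u) x 1 (tau) x0 (der_id x)).
have K : x `^ (tau) * \int[lambda]_(s in P0) (bkern 1 s * D (x * s)) = beta_int x.
  by have [_ ->] := beta_int_scale x0.
have KK : y `^ tau * (\int[lambda]_(s in P0) (bkern 1 s * D (y * s))) @[y --> x] --> beta_int x.
  by rewrite -K; exact: cvgM ct2 ct1.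
apply: cvg_trans KK; apply: near_eq_cvg.
near=> y; have y0 : 0 < y by near: y; exact: lt_nbhsr.
by have [_ ->] := beta_int_scale y0.
Unshelve. all: end_near. Qed.
Context (D_stieltjes : forall z : R, 0 < z ->
  lambda.-integrable P0 (fun t : R => (D t / (t + z))%:E)).

(** ((x - t) / (z + x))^tau / (tau (z + t)) is a primitive in x; the power goes from 0 at x = t to 1
    at infinity. *)
Lemma bkern_stieltjes (z t : R) : 0 < z -> 0 < t ->
  (\int[lambda]_(x in P0) ((z + x) `^ (- (tau + 1)) * bkern x t)%:E = ((tau * (z + t))^-1)%:E)%E.
Proof.
move=> z0 t0; have T0 := tau0; have zt : 0 < z + t by exact: addr_gt0.
pose q (x : R) := (x - t) / (z + x).
have zx (x : R) : t <= x -> 0 < z + x by move=> tx; rewrite addr_gt0// (lt_le_trans t0).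
transitivity (\int[lambda]_(x in (`]t, +oo[%classic : set RR)) ((z + x) `^ (- (tau + 1)) * (x - t) `^ (tau - 1))%:E)%E.
  rewrite [RHS]integral_mkcond [LHS]integral_mkcond; apply: eq_integral => x _; rewrite /patch /bkern t0/=.
  have [tx|tx] := ltP t x.
    by rewrite !mem_set//= in_itv/= andbT// (lt_trans t0).
  have n1 : (x \in (`]t, +oo[%classic : set RR)) = false.
    by apply/negP => /set_mem; rewrite /= in_itv/= andbT ltNge tx.
  by rewrite n1 mulr0; case: ifP.
have dq (x : R) : t <= x -> is_derive x 1 q ((z + t) / (z + x) ^+ 2).
  move=> tx; have n0 : z + x != 0 by rewrite gt_eqF// zx.
  have d1 := @der_add _ (fun u : R => u) (fun=> - t) x 1 0 (der_id x) (der_cst x (- t)).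
  have d2 := @der_add _ (fun=> z) (fun u : R => u) x 0 1 (der_cst x z) (der_id x).
  apply: der_eq (@der_div _ (fun u : R => u - t) (fun u : R => z + u) x _ _ n0 d1 d2) _.
  by field.
have q0 (x : R) : t < x -> 0 < q x by move=> tx; rewrite divr_gt0 ?subr_gt0 ?zx ?ltW.
rewrite -[(tau * _)^-1]subr0.
apply: (@ge0_FTC_oy _ (fun x => (z + x) `^ (- (tau + 1)) * (x - t) `^ (tau - 1)) (fun x => (tau * (z + t))^-1 * q x `^ tau) t).
- by move=> x _; rewrite mulr_ge0 ?powR_ge0.
- move=> x tx; apply: der_eq (@der_mull _ _ x _ (tau * (z + t))^-1 (@der_powR _ q x _ tau (q0 _ tx) (dq _ (ltW tx)))) _.
  have zx0 := zx _ (ltW tx).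
  rewrite /q powRM ?subr_ge0 ?invr_ge0 ?ltW//.
  have -> : (z + x)^-1 `^ (tau - 1) = ((z + x) `^ (tau - 1))^-1.
    by rewrite -[(z + x)^-1]powR_inv1 ?ltW// -powRrM mulN1r powRN.
  have -> : (z + x) `^ (- (tau + 1)) = ((z + x) `^ (tau - 1))^-1 * ((z + x) ^+ 2)^-1.
    rewrite -powR_mulrn ?ltW// -!powRN -powRD ?(gt_eqF zx0) ?implybT//; congr powR; ring.
  have := powR_gt0 (tau - 1) zx0; move: ((z + x) `^ (tau - 1)) ((x - t) `^ (tau - 1)) => a b a0.
  by move: (z + x) (z + t) zx0 zt => m k m0 k0; field; rewrite !gt_eqF.
- move=> x tx; have zx0 := zx _ (ltW tx); have xt : 0 < x - t by rewrite subr_gt0.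
  have d1 := @der_add _ (fun u : R => u) (fun=> - t) x 1 0 (der_id x) (der_cst x (- t)).
  have d2 := @der_add _ (fun=> z) (fun u : R => u) x 0 1 (der_cst x z) (der_id x).
  apply: cvgM.
    exact: der_continuous (@der_powR _ (fun u : R => z + u) x _ (- (tau + 1)) zx0 d2).
  exact: der_continuous (@der_powR _ (fun u : R => u - t) x _ (tau - 1) xt d1).
- have K : (tau * (z + t))^-1 * q x `^ tau @[x --> t^'+] --> (tau * (z + t))^-1 * 0; last by move: K; rewrite mulr0.
  apply: cvgM; first exact: cvg_cst.
  have qt : q x @[x --> t^'+] --> q t by apply: cvg_at_right_filter; exact: der_continuous (dq t (lexx t)).
  have q00 : q t = 0 by rewrite /q subrr mul0r.
  apply/cvgrPdist_lt => e e0; near=> x.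
  have x1 : 0 < q x by apply: q0; near: x; exact: nbhs_right_gt.
  rewrite sub0r normrN ger0_norm ?powR_ge0//.
  have eE : (e `^ tau^-1) `^ tau = e by rewrite -powRrM mulVf ?gt_eqF// powRr1 ?ltW.
  rewrite -eE; apply: gt0_ltr_powR => //; rewrite ?nnegrE ?powR_ge0 ?(ltW x1)//.
  rewrite -[q x]ger0_norm ?ltW// -[X in `|X|]opprK normrN -[X in `|X|]add0r -q00.
  near: x; move/cvgrPdist_lt : qt; apply; exact: powR_gt0.
- have K : (tau * (z + t))^-1 * q x `^ tau @[x --> +oo] --> (tau * (z + t))^-1 * 1 `^ tau; last first.
    by move: K; rewrite powR1 mulr1.
  apply: cvgM; first exact: cvg_cst.
  apply: (@cvg_comp _ _ _ q (fun u : R => u `^ tau)); last first.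
    exact: der_continuous (@der_powR _ (fun u : R => u) 1 1 tau ltr01 (der_id 1)).
  have cvq : 1 - (z + t) * (z + x)^-1 @[x --> +oo] --> 1 - (z + t) * (0 : R).
    apply: cvgB; first exact: cvg_cst.
    apply: cvgM; first exact: cvg_cst.
    apply: (@cvg_addl_pinfty _ z (fun x => x^-1)).
    have := @powRN_cvg0 R 1 ltr01; apply: cvg_trans; apply: near_eq_cvg; near=> x.
    by rewrite powR_inv1//; near: x; apply: nbhs_pinfty_ge; rewrite num_real.
  move: cvq; rewrite mulr0 subr0; apply: cvg_trans; apply: near_eq_cvg; near=> x.
  have zx0 : 0 < z + x by apply: zx; near: x; apply: nbhs_pinfty_ge; rewrite num_real.
  by rewrite /q; move: zx0 => zx0; field; rewrite gt_eqF.
Unshelve. all: end_near. Qed.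

(* \int_t^oo (z + x)^(- tau - 1) (x - t)^(tau - 1) dx = 1 / (tau (z + t)). *)
Lemma beta_int_stieltjes (z : R) : 0 < z ->
  lambda.-integrable P0 (fun x : R => ((z + x) `^ (- (tau + 1)) * beta_int x)%:E) /\
  \int[lambda]_(x in P0) ((z + x) `^ (- (tau + 1)) * beta_int x) =
    tau^-1 * \int[lambda]_(t in P0) (D t / (t + z)).
Proof.
move=> z0; have T0 := tau0.
pose w (x : R) := (z + x) `^ (- (tau + 1)).
pose f (p : RR * RR) : \bar R := (w p.1 * bkern p.1 p.2 * D p.2)%:E.
have mw d (X : measurableType d) (a : X -> R) : measurable_fun setT a -> measurable_fun setT (fun p => w (a p)).
  by move=> ma; apply: measurable_fun_powR; exact: measurable_funD.
have mf : measurable_fun setT f.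
  apply/measurable_EFinP; apply: measurable_funM; last exact: (measurableT_comp D_meas).
  by apply: measurable_funM; [exact: mw|exact: measurable_bkern].
have k0 x t : 0 <= w x * bkern x t by rewrite mulr_ge0 ?powR_ge0 ?bkern_ge0.
have mk t : measurable_fun setT (fun x : R => w x * bkern x t).
  by apply: measurable_funM; [exact: mw|exact: measurable_bkern].
have I := D_stieltjes z0.
have fin : (\int[lambda]_(x in P0) \int[lambda]_(t in P0) `|f (x, t)| < +oo)%E.
  rewrite (@fubini_tonelli_in _ _ _ _ _ lambda lambda P0 P0 (fun p => `|f p|%E))//; last exact: measurableT_comp.
  have -> : (\int[lambda]_(t in P0) \int[lambda]_(x in P0) `|f (x, t)| =
      \int[lambda]_(t in P0) ((tau^-1)%:E * `|(D t / (t + z))%:E|))%E.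
    apply: eq_integral => t /set_mem/in0 t0.
    transitivity (\int[lambda]_(x in P0) ((w x * bkern x t)%:E * (`|D t|)%:E))%E.
      by apply: eq_integral => x _; rewrite /f /= normrM ger0_norm.
    rewrite ge0_integralZr//; last 2 first.
    - by apply/measurable_EFinP; apply: measurable_funTS; exact: mk.
    - by move=> x _; rewrite lee_fin.
    have zt : 0 < z + t by exact: addr_gt0.
    rewrite bkern_stieltjes// /= -!EFinM; congr EFin.
    by rewrite normrM normfV (addrC t z) (gtr0_norm zt); field; rewrite !gt_eqF.
  have /integrableP[mI] := I; rewrite ge0_integralZl_EFin ?invr_ge0 ?ltW//; last exact: measurableT_comp.
  by move=> h; rewrite lte_mul_pinfty ?lee_fin ?invr_ge0 ?ltW.
have [_ J E] := @fubini_in _ _ _ _ _ lambda lambda P0 P0 f (measurable_itv _) (measurable_itv _) mf fin.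
have E1 (x : R) : 0 < x -> (\int[lambda]_(t in P0) f (x, t) = (w x * beta_int x)%:E)%E.
  move=> x0; have [Ix _] := beta_int_scale x0.
  rewrite EFinM /beta_int -EFin_Rintegral// -integralZl//.
  by apply: eq_integral => t _; rewrite /f /= -EFinM mulrA.
have K : lambda.-integrable P0 (fun x : R => (w x * beta_int x)%:E).
  by apply: eq_integrable J => // x /set_mem/in0 x0; rewrite E1.
split=> //; apply: EFin_inj; rewrite -EFin_Rintegral//.
transitivity (\int[lambda]_(x in P0) \int[lambda]_(t in P0) f (x, t))%E.
  by apply: eq_integral => x /set_mem/in0 x0; rewrite E1.
rewrite E EFinM -EFin_Rintegral// -integralZl//.
apply: eq_integral => t /set_mem/in0 t0.
transitivity (\int[lambda]_(x in P0) ((D t)%:E * (w x * bkern x t)%:E))%E.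
  by apply: eq_integral => x _; rewrite /f /= -EFinM mulrC.
have zt : 0 < z + t by exact: addr_gt0.
have Iw : lambda.-integrable P0 (fun x : R => (w x * bkern x t)%:E).
  apply/integrableP; split; first by apply/measurable_EFinP; apply: measurable_funTS; exact: mk.
  have -> : (\int[lambda]_(x in P0) `|(w x * bkern x t)%:E| = ((tau * (z + t))^-1)%:E)%E.
    by rewrite -bkern_stieltjes//; apply: eq_integral => x _; rewrite gee0_abs// lee_fin.
  exact: ltry.
rewrite integralZl// bkern_stieltjes// -!EFinM; congr EFin.
by rewrite (addrC t z); move: (z + t) zt => k k0'; field; rewrite !gt_eqF.
Qed.

(** * Identification of the distribution function *)

Context (mu : probability RR R) (mu0 : mu `]-oo, 0%R[%classic = 0%E).
Context (mu_transform : forall z : R, 0 < z -> (\int[mu]_y ((1 + z^-1 * y) `^ (- tau))%:E =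
  (z `^ tau * (\int[lambda]_(t in P0) (D t / (t + z)))%R)%:E)%E).

Let N : set RR := `[0%R, +oo[%classic.
Let mN : measurable N. Proof. exact: measurable_itv. Qed.
Let inN (y : R) : N y -> 0 <= y. Proof. by rewrite /N /= in_itv/= andbT. Qed.

Let muN (A : set RR) : measurable A -> mu A = mu (A `&` N).
Proof.
move=> mA; rewrite (measureDI _ mA mN) [X in (X + _)%E](_ : _ = 0%E) ?add0e//.
apply: (subset_measure0 _ _ _ mu0) => //; first exact: measurableD.
by move=> y [_]; rewrite /N /= !in_itv/= andbT => /negP; rewrite -ltNge.
Qed.

Lemma integral_nonneg_carrier (g : R -> \bar R) : measurable_fun setT g -> (forall y, 0 <= g y)%E ->
  (\int[mu]_y g y = \int[mu]_(y in N) g y)%E.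
Proof.
move=> mg g0.
have -> : [set: RR] = N `|` `]-oo, 0%R[%classic.
  apply/seteqP; split => // y _; rewrite /N /= !in_itv/= andbT.
  by have [|] := leP 0 (y : R); [left|right].
rewrite ge0_integral_setU//.
- by rewrite [X in (_ + X)%E]null_set_integral ?adde0//; exact: measurable_funTS.
- exact: measurable_funTS.
- apply/disj_setPS => y []; rewrite /N /= !in_itv/= andbT => y0 y1.
  by have := le_lt_trans y0 y1; rewrite ltxx.
Qed.

(** The open ray gives the left limit of the cdf. It matches the strict comparison y < x in the
    kernels and differs from the cdf at countably many x at most. *)
Let Fm (x : R) : R := fine (mu `]-oo, x[%classic).

Let FmE (x : R) : (Fm x)%:E = mu `]-oo, x[%classic.
Proof. by rewrite /Fm fineK// fin_num_measure. Qed.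

Lemma integral_ray_kernel (z y : R) : 0 < z -> 0 <= y ->
  (\int[lambda]_(x in P0) ((z + x) `^ (- (tau + 1)) * (if y < x then 1 else 0))%:E =
   (tau^-1 * (z + y) `^ (- tau))%:E)%E.
Proof.
move=> z0 y0; have T0 := tau0.
have zx (x : R) : y <= x -> 0 < z + x by move=> yx; rewrite ltr_pwDl// (le_trans y0).
transitivity (\int[lambda]_(x in (`]y, +oo[%classic : set RR)) ((z + x) `^ (- (tau + 1)))%:E)%E.
  rewrite [RHS]integral_mkcond [LHS]integral_mkcond; apply: eq_integral => x _; rewrite /patch.
  have [yx|yx] := ltP y x.
    by rewrite !mem_set//= ?in_itv/= ?andbT// ?(le_lt_trans y0)// mulr1.
  have n1 : (x \in (`]y, +oo[%classic : set RR)) = false.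
    by apply/negP => /set_mem; rewrite /= in_itv/= andbT ltNge yx.
  by rewrite n1 mulr0; case: ifP.
have D1 (x : R) : y <= x -> is_derive x 1 (fun x : R => - (tau^-1 * (z + x) `^ (- tau))) ((z + x) `^ (- (tau + 1))).
  move=> yx; have d2 := @der_add _ (fun=> z) (fun u : R => u) x 0 1 (der_cst x z) (der_id x).
  apply: der_eq (der_opp (@der_mull _ _ x _ tau^-1 (@der_powR _ (fun u : R => z + u) x _ (- tau) (zx _ yx) d2))) _.
  rewrite (_ : - tau - 1 = - (tau + 1)); last by ring.
  by move: (_ `^ _) => a; field; rewrite gt_eqF.
have -> : tau^-1 * (z + y) `^ (- tau) = 0 - (- (tau^-1 * (z + y) `^ (- tau))) by rewrite sub0r opprK.
apply: (@ge0_FTC_oy _ (fun x => (z + x) `^ (- (tau + 1))) (fun x : R => - (tau^-1 * (z + x) `^ (- tau))) y).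
- by move=> x _; exact: powR_ge0.
- by move=> x /ltW; exact: D1.
- move=> x /ltW yx; have d2 := @der_add _ (fun=> z) (fun u : R => u) x 0 1 (der_cst x z) (der_id x).
  exact: der_continuous (@der_powR _ (fun u : R => z + u) x _ (- (tau + 1)) (zx _ yx) d2).
- by apply: cvg_at_right_filter; exact: der_continuous (D1 y (lexx y)).
- have K : - (tau^-1 * (z + x) `^ (- tau)) @[x --> +oo] --> - (tau^-1 * 0); last by move: K; rewrite mulr0 oppr0.
  apply: cvgN; apply: cvgM; first exact: cvg_cst.
  apply: (@cvg_addl_pinfty _ z (fun x => x `^ (- tau))); exact: powRN_cvg0.
Qed.

(** (z + y)^(- tau) / tau is the integral of (z + x)^(- tau - 1) over x > y, so by Tonelli the left
    side is the mean of (z + y)^(- tau) under mu, divided by tau. The value obtained is the one of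
    [beta_int_stieltjes]. *)
Lemma ray_stieltjes (z : R) : 0 < z ->
  (\int[lambda]_(x in P0) ((z + x) `^ (- (tau + 1)) * Fm x)%:E =
   (tau^-1 * (\int[lambda]_(t in P0) (D t / (t + z)))%R)%:E)%E.
Proof.
move=> z0; have T0 := tau0.
pose f (p : RR * RR) : \bar R := ((z + p.1) `^ (- (tau + 1)) * (if p.2 < p.1 then 1 else 0))%:E.
have mf : measurable_fun setT f.
  apply/measurable_EFinP; apply: measurable_funM.
    by apply: measurable_fun_powR; exact: measurable_funD.
  by apply: measurable_fun_ifT => //; exact: measurable_fun_ltr.
have f0 x y : (0 <= f (x, y))%E by rewrite /f lee_fin mulr_ge0 ?powR_ge0//=; case: ifP.
transitivity (\int[lambda]_(x in P0) \int[mu]_(y in N) f (x, y))%E.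
  apply: eq_integral => x /set_mem/in0 x0.
  rewrite EFinM FmE muN// -(integral_indic mu mN)//.
  rewrite -ge0_integralZl_EFin ?powR_ge0//; last exact/measurable_EFinP/measurable_funTS.
  apply: eq_integral => y _; rewrite /f /= -EFinM; congr (_ * _)%:E.
  by rewrite indicE mem_setE/= in_itv/=; case: ltP.
rewrite (@fubini_tonelli_in _ _ _ _ _ lambda mu P0 N f)//.
transitivity (\int[mu]_(y in N) ((tau^-1 * z `^ (- tau))%:E * ((1 + z^-1 * y) `^ (- tau))%:E))%E.
  apply: eq_integral => y /set_mem/inN y0; rewrite /f /= integral_ray_kernel// -EFinM; congr EFin.
  have y1 : 0 <= 1 + z^-1 * y by rewrite addr_ge0// mulr_ge0 ?invr_ge0 ?(ltW z0).
  have -> : z + y = z * (1 + z^-1 * y) by rewrite mulrDr mulr1 mulrA mulfV ?mul1r// gt_eqF.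
  by rewrite (powRM _ (ltW z0) y1) mulrA.
have mg : measurable_fun setT (fun y : RR => ((1 + z^-1 * y) `^ (- tau))%:E).
  apply/measurable_EFinP; apply: measurable_fun_powR; apply: measurable_funD => //.
rewrite ge0_integralZl_EFin//; last 3 first.
- by move=> y _; rewrite lee_fin powR_ge0.
- exact: measurable_funTS.
- by rewrite mulr_ge0 ?powR_ge0 ?invr_ge0 ?ltW.
rewrite -integral_nonneg_carrier//; last by move=> y; rewrite lee_fin powR_ge0.
rewrite mu_transform// -EFinM; congr EFin.
rewrite powRN; have := powR_gt0 tau z0; move: (z `^ tau) (\int[lambda]_(t in P0) _) => a b a0.
by field; rewrite !gt_eqF.
Qed.

Lemma ray_beta_int_ae : {ae lambda, forall x : RR, 0 < x -> Fm x = beta_int x}.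
Proof.
have T0 := tau0; have T1 : 0 < tau + 1 by rewrite addr_gt0.
pose f : R -> R := (fun x : R => Fm x - beta_int x) \_ P0.
have fE x : 0 < x -> f x = Fm x - beta_int x.
  by move=> x0; rewrite /f /patch mem_set//= in_itv/= x0.
have mF : measurable_fun setT Fm.
  apply: nondecreasing_measurable => // x y xy; rewrite -lee_fin !FmE.
  apply: le_measure; rewrite ?inE//; move=> u /=; rewrite !in_itv/= => /lt_le_trans; exact.
have mG : measurable_fun P0 beta_int.
  apply: open_continuous_measurable_fun; first exact: interval_open.
  by move=> x /set_mem/in0 x0; exact: continuous_beta_int.
have mf : measurable_fun setT f.
  have mf0 : measurable_fun P0 (fun x : R => Fm x - beta_int x).
    by apply: measurable_funB => //; exact: measurable_funTS.
  exact: ((measurable_restrictT _ (measurable_itv `]0%R, +oo[)).1 mf0).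
have IF (z : R) : 0 < z -> lambda.-integrable P0 (fun x : R => ((z + x) `^ (- (tau + 1)) * Fm x)%:E).
  move=> z0; apply/integrableP; split.
    apply/measurable_EFinP; apply: measurable_funTS; apply: measurable_funM => //.
    by apply: measurable_fun_powR; exact: measurable_funD.
  under eq_integral do rewrite gee0_abs ?lee_fin ?mulr_ge0 ?powR_ge0 ?fine_ge0//.
  by rewrite ray_stieltjes// ltry.
have K (z : R) : 0 < z -> lambda.-integrable P0 (fun x : R => ((z + x) `^ (- (tau + 1)) * f x)%:E) /\
    \int[lambda]_(x in P0) ((z + x) `^ (- (tau + 1)) * f x) = 0.
  move=> z0; have [IG EG] := beta_int_stieltjes z0; have If := IF z z0.
  have J : lambda.-integrable P0 ((fun x : R => ((z + x) `^ (- (tau + 1)) * Fm x)%:E) \-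
      (fun x : R => ((z + x) `^ (- (tau + 1)) * beta_int x)%:E))%E.
    by apply: integrableB.
  have E (x : R) : 0 < x -> (z + x) `^ (- (tau + 1)) * f x =
      (z + x) `^ (- (tau + 1)) * Fm x - (z + x) `^ (- (tau + 1)) * beta_int x.
    by move=> x0; rewrite fE// mulrBr.
  split.
    by apply: eq_integrable J => // x /set_mem/in0 x0; rewrite E// EFinB.
  transitivity (\int[lambda]_(x in P0) ((z + x) `^ (- (tau + 1)) * Fm x - (z + x) `^ (- (tau + 1)) * beta_int x)).
    by apply: eq_Rintegral => x /set_mem/in0 x0; rewrite E.
  by rewrite RintegralB// EG /Rintegral ray_stieltjes//= subrr.
have [I1 _] := K 1 ltr01.
have [A [mA A0 hA]] := stieltjes_unique T1 mf I1 (fun z z0 => (K z z0).2).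
exists A; split => // x nx; apply: hA => /= h; apply: nx => /= x0; have := h x0; rewrite fE// => /eqP.
by rewrite subr_eq0 => /eqP.
Qed.

(* Equality almost everywhere extends to every x since the cdf is monotone and
   right-continuous and [beta_int D] is continuous. *)
Lemma cdf_beta_int (x : R) : 0 < x -> mu `]-oo, x]%classic = (beta_int x)%:E.
Proof.
move=> x0; pose L := fine (mu (`]-oo, x]%classic : set RR)).
have LE : L%:E = mu (`]-oo, x]%classic : set RR) by rewrite /L fineK// fin_num_measure.
(* A set of full measure meets every interval of positive length. *)
have good (a b : R) : 0 <= a -> a < b -> exists2 y : R, a < y < b & Fm y = beta_int y.
  move=> a0 ab; have [A [mA A0 hA]] := ray_beta_int_ae; apply: contrapT => no.
  have sub : (`]a, b[%classic : set RR) `<=` A.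
    move=> y; rewrite /= in_itv/= => /andP[ay yb]; apply: hA => /= h; apply: no; exists y.
      by rewrite ay.
    by apply: h; exact: le_lt_trans a0 ay.
  have lab : lambda (`]a, b[%classic : set R) = (b - a)%:E.
    by rewrite lebesgue_measure_itv/= lte_fin ab EFinB.
  have ba : b - a = 0 := EFin_inj (etrans (esym lab) (@subset_measure0 _ _ _ lambda _ _ (measurable_itv `]a, b[) mA sub A0)).
  by move: ab; rewrite -subr_gt0 ba ltxx.
have cx := continuous_beta_int x0.
rewrite -LE; congr EFin; apply/eqP; rewrite eq_le; apply/andP; split; rewrite leNgt; apply/negP => h.
  (* If the cdf were larger at x, then Fm y >= L for all y > x, while [beta_int] stays below L near
     x; a point of agreement just after x contradicts this. *)
  have /nbhs_ballP[d /= d0 hd] : \forall y \near x, beta_int y < L by apply: (cvgr_lt _ cx).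
  have [y /andP[xy yd] Fy] := good x (x + d) (ltW x0) (ltac:(by rewrite ltrDl)).
  have := hd y; rewrite /ball/= -Fy => /(_ _)/wrap[].
    by rewrite distrC ger0_norm ?subr_ge0 ?(ltW xy)// ltrBlDl.
  rewrite ltNge => /negP; apply; rewrite -lee_fin LE FmE; apply: le_measure; rewrite ?inE//.
  by move=> u /=; rewrite !in_itv/= => /le_lt_trans; apply.
(* If it were smaller, right-continuity keeps the cdf below the midpoint m just after x, while
   [beta_int] stays above m there. *)
pose m := (L + beta_int x) / 2.
have /nbhs_ballP[d /= d0 hd] : \forall y \near x, m < beta_int y.
  by apply: (cvgr_gt _ cx); rewrite /m; lra.
have cap : (`]-oo, x]%classic : set RR) = \bigcap_n (`]-oo, x + n.+1%:R^-1]%classic : set RR).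
  apply/seteqP; split => u /=; rewrite in_itv/=.
    by move=> ux n _ /=; rewrite in_itv/= (le_trans ux)// lerDl.
  move=> hu; rewrite leNgt; apply/negP => xu.
  have ux0 : 0 < u - x by rewrite subr_gt0.
  have [n _ hn] := near_infty_natSinv_lt (PosNum ux0).
  have := hu n I; rewrite /= in_itv/= leNgt; have := hn n (leqnn n) => /= hh.
  by rewrite -ltrBrDl hh.
have cv : mu (`]-oo, x + n.+1%:R^-1]%classic : set RR) @[n --> \oo] --> L%:E.
  rewrite LE cap; apply: (@nonincreasing_cvg_mu _ _ _ mu (fun n => `]-oo, x + n.+1%:R^-1]%classic : set RR)) => //.
  - by apply: le_lt_trans (probability_le1 _ _) _ => //; exact: ltry.
  - by rewrite -cap.
  - move=> n k nk; apply/subsetPset => u; rewrite /= !in_itv/= => /le_trans; apply.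
    by rewrite lerD2l lef_pV2 ?posrE// ler_nat ltnS.
have Lm : (L%:E < m%:E)%E by rewrite lte_fin /m; lra.
have [n _ hn] : \forall n \near \oo, (mu (`]-oo, (x + n.+1%:R^-1)%R]%classic : set RR) < m%:E)%E.
  have /fine_cvgP[_ cvr] := cv; have Lm' : L < m by rewrite -lte_fin.
  apply: filterS (cvgr_lt L cvr m Lm') => n /= h'.
  by rewrite -[X in (X < _)%E]fineK ?lte_fin// fin_num_measure.
have e0 : 0 < Num.min d n.+1%:R^-1 by rewrite lt_min d0/= invr_gt0.
have [y /andP[xy yd] Fy] := good x (x + Num.min d n.+1%:R^-1) (ltW x0) (ltac:(by rewrite ltrDl)).
move: yd; rewrite -ltrBlDl lt_min => /andP[yd yn].
have := hd y; rewrite /ball/= -Fy => /(_ _)/wrap[].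
  by rewrite distrC ger0_norm ?subr_ge0 ?(ltW xy)//.
apply/negP; rewrite -leNgt -lee_fin FmE; apply: le_trans (ltW (hn n (leqnn n))).
apply: le_measure; rewrite ?inE//.
by move=> u /=; rewrite !in_itv/= => uy; apply/ltW/(lt_le_trans uy); rewrite -lerBlDl ltW.
Qed.
End beta_transform.

End beta_convolution.

(** * Laws of Dirichlet means *)

Section mean_laws.
Context {R : realType}.
Notation lambda := (@lebesgue_measure R).
Notation RR := (measurableTypeR R).
Local Notation P0 := (`]0%R, +oo[%classic : set RR).

(** With H the point mass at 1, the first factor of the product becomes an instance of the general
    case. *)
Lemma rho_rhoH (al : R) : 0 < al -> al < 1 ->
  with_density (fun y => (rho al y)%:E) =
  with_density (fun x => (rhoH (\d_(1 : RR) : probability RR R) al x)%:E).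
Proof.
move=> al0 al1; apply/funext => A; apply: eq_integral => x /set_mem[_]; rewrite /= in_itv/= andbT => x0.
rewrite (rhoH_rr _ al0 al1 x0) Rintegral_dirac//; last exact: measurable_rr.
have pabs := pi_phimax_abs al0 al1.
have D0 := pnorm_pos al0 al1 (powR_ge0 x al) ltr01 pabs.
rewrite rrE// /rho; congr EFin; rewrite powRB ?(gt_eqF x0) ?implybT// powRr1 ?(ltW x0)//.
rewrite (mulrC 2 al) powRrM powR_mulrn ?powR_ge0// (mulrC pi al).
have -> : x `^ al ^+ 2 + 2 * x `^ al * cos (al * pi) + 1 = pnorm (x `^ al) (al * pi) 1.
  by rewrite /pnorm; ring.
move: D0; move: (pnorm _ _ _) (sin _) => D s D0; move: (x `^ al) => y.
by have := pi_gt0 R; move: (pi : R) => p p0; field; rewrite !gt_eqF.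
Qed.

Lemma ray_integral (f : R -> \bar R) (x : R) : 0 < x -> measurable_fun P0 f ->
  (\int[lambda]_(t in `]-oo, x] `&` P0) f t = \int[lambda]_(t in `]0%R, x[) f t)%E.
Proof.
move=> x0 mf; rewrite (_ : _ `&` _ = `]0%R, x]%classic).
  apply/esym/integral_itv_bndo_bndc; apply: measurable_funS mf => //.
  by move=> t; rewrite /= !in_itv/= andbT => /andP[].
by apply/seteqP; split => t /=; rewrite !in_itv/= andbT; [move=> [-> ->]|move=> /andP[-> ->]].
Qed.

Lemma negative_ray_integral (f : R -> \bar R) :
  (\int[lambda]_(t in (`]-oo, 0%R[%classic : set RR) `&` P0) f t = 0)%E.
Proof.
rewrite (_ : _ `&` _ = set0) ?integral_set0//; apply/seteqP; split => t //= [].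
by rewrite !in_itv/= andbT => t0 t1; have := lt_trans t0 t1; rewrite ltxx.
Qed.

Section law_of_mean.
Context (H : probability RR R) (al th : R).
Context (al0 : 0 < al) (al1 : al < 1) (th0 : 0 < th).
Context (H_pos : H `]0%R, +oo[%classic = 1%E).
Context (H_log : (\int[H]_(r in `]0%R, +oo[) (ln (1 + (r : R)))%:E < +oo)%E).

Let in0 (r : R) : P0 r -> 0 < r. Proof. by rewrite /= in_itv/= andbT. Qed.
Let tau0 : 0 < al * th. Proof. exact: mulr_gt0. Qed.

(** The function D of the general results is measurable on the whole line, whereas Delta is studied
    on ]0, oo[; hence the extension by 0. *)
Definition Delta0 (t : R) : R := if 0 < t then Delta H al th t else 0.

Lemma Delta0E (t : R) : 0 < t -> Delta0 t = Delta H al th t.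
Proof. by rewrite /Delta0 => ->. Qed.

Lemma measurable_Delta0 : measurable_fun setT Delta0.
Proof.
have := (measurable_restrictT (Delta H al th) (measurable_itv `]0%R, +oo[)).1 (measurable_Delta th al0 al1 H_pos H_log).
apply: eq_measurable_fun => t _; rewrite /patch /Delta0.
case: ifPn => [/set_mem/in0 ->//|]; case: ifPn => // t0.
by rewrite mem_set//= in_itv/= t0.
Qed.

Lemma continuous_Delta0 (t : R) : 0 < t -> {for t, continuous Delta0}.
Proof.
move=> t0; have K : Delta H al th u @[u --> t] --> Delta0 t.
  by rewrite Delta0E//; exact: continuous_Delta.
apply: cvg_trans K; apply: near_eq_cvg; near=> u.
by rewrite Delta0E//; near: u; exact: lt_nbhsr.
Unshelve. all: end_near. Qed.

Lemma Delta0_le : exists2 C : R, 0 < C & forall t, 0 < t -> `|Delta0 t| <= C * (t `^ (- 2^-1) * (1 + t)).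
Proof.
have [C C0 CE] := Delta_le al0 al1 th0 H_pos H_log; exists C => // t t0.
by rewrite Delta0E//; exact: CE.
Qed.

Lemma Delta0_stieltjes (z : R) : 0 < z ->
  lambda.-integrable P0 (fun t : R => (Delta0 t / (t + z))%:E) /\
  \int[lambda]_(t in P0) (Delta0 t / (t + z)) = expR (- (th * \int[H]_(r in P0) ln (z `^ al + r))).
Proof.
move=> z0; have [I E] := Delta_stieltjes al0 al1 th0 H_pos H_log z0; split.
  by apply: eq_integrable I => // t /set_mem/in0 t0; rewrite Delta0E.
by rewrite -E; apply: eq_Rintegral => t /set_mem/in0 t0; rewrite Delta0E.
Qed.

Lemma beta_int_Delta (x : R) : 0 < x -> ((beta_int (al * th) Delta0 x)%:E =
  \int[lambda]_(t in `]0%R, x[) ((x - t) `^ (al * th - 1) * Delta H al th t)%:E)%E.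
Proof.
move=> x0; have [I _] := beta_int_scale tau0 measurable_Delta0 Delta0_le x0.
pose f (t : R) := ((x - t) `^ (al * th - 1) * Delta H al th t)%:E.
have E (t : R) : 0 < t -> (bkern (al * th) x t * Delta0 t)%:E = (f \_ `]0%R, x[%classic) t.
  move=> t0; have M : (t \in (`]0%R, x[%classic : set R)) = (t < x) by rewrite mem_setE/= in_itv/= t0.
  by rewrite /patch M /bkern Delta0E// t0/=; case: ifP => // _; rewrite mul0r.
rewrite /beta_int -EFin_Rintegral//.
have -> : (`]0%R, x[%classic : set R) = P0 `&` `]0%R, x[%classic.
  by apply/esym/setIidr => s; rewrite /= !in_itv/= andbT => /andP[].
by rewrite [RHS]integral_mkcondr; apply: eq_integral => t /set_mem/in0 t0; rewrite E.
Qed.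

(** The hypotheses concern the support and the transform of mu, so that the product law of
    [mean_law_product] is covered as well. With l = 1 / z, the factor z^(al th) turns the mean of ln
    (z^al + r) into that of ln (1 + z^(- al) r). *)
Lemma cdf_Delta (mu : probability RR R) : mu `]-oo, 0%R[%classic = 0%E ->
  (forall l : R, 0 < l -> (\int[mu]_y ((1 + l * y) `^ (- (al * th)))%:E =
     (expR (- (th * (\int[H]_(r in P0) ln (1 + l `^ al * r))%R)))%:E)%E) ->
  forall x : R, 0 < x -> (mu `]-oo, x]%classic =
    \int[lambda]_(t in `]0%R, x[) ((x - t) `^ (al * th - 1) * Delta H al th t)%:E)%E.
Proof.
move=> mu0 muE x x0; rewrite -beta_int_Delta//.
apply: (cdf_beta_int tau0 measurable_Delta0 continuous_Delta0 Delta0_le) => //.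
  by move=> z z0; have [] := Delta0_stieltjes z0.
move=> z z0; have [_ ->] := Delta0_stieltjes z0.
have zi : 0 < z^-1 by rewrite invr_gt0.
rewrite muE//; congr EFin.
have za : 0 < z `^ al by exact: powR_gt0.
have ziE : z^-1 `^ al = (z `^ al)^-1 by rewrite -[z^-1]powR_inv1 ?ltW// -powRrM mulN1r powRN.
have zia : 0 < (z `^ al)^-1 by rewrite invr_gt0.
have Il := integrable_ln1D zia H_log.
have -> : \int[H]_(r in P0) ln (z `^ al + r) = \int[H]_(r in P0) (ln (z `^ al) + ln (1 + z^-1 `^ al * r)).
  apply: eq_Rintegral => r /set_mem/in0 r0; rewrite ziE -lnM ?posrE//.
    by rewrite mulrDr mulr1 mulrA mulfV ?mul1r// gt_eqF.
  by rewrite ltr_pwDl// mulr_ge0 ?ltW.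
rewrite ziE RintegralD//; last exact: integrable_cstH.
rewrite (Rintegral_EFin_cst (P := H) (D := P0))// ln_powR mulrDr opprD expRD mulrA.
have -> : z `^ (al * th) = expR (th * (al * ln z)) by rewrite /powR (gt_eqF z0); congr expR; ring.
by rewrite -expRD subrr expR0 mul1r.
Qed.

Lemma mean_law_transform (mu : probability RR R) :
  dirichlet_mean_law (al * th) (with_density (fun x => (rhoH H al x)%:E)) mu ->
  mu `]-oo, 0%R[%classic = 0%E /\
  forall l : R, 0 < l -> (\int[mu]_y ((1 + l * y) `^ (- (al * th)))%:E =
     (expR (- (th * (\int[H]_(r in P0) ln (1 + l `^ al * r))%R)))%:E)%E.
Proof.
move=> muL; have [mu0 muE] := rhoH_transform al0 al1 H_pos H_log tau0 muL; split => // l l0.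
rewrite muE//; congr (expR (- _))%:E; move: (\int[H]_(_ in _) _) => I.
by have a0 := al0; field; rewrite gt_eqF.
Qed.

(** Given the second factor y, the transform of the first at l y^(1/al) is (1 + l^al y)^(- th);
    integrating over y gives the transform of M_theta(H) at l^al, which is that of mu at l. By
    [cdf_Delta] equal transforms give equal distribution functions. *)
Lemma mean_law_product (mu mu1 mu2 : probability RR R) :
  dirichlet_mean_law (al * th) (with_density (fun x => (rhoH H al x)%:E)) mu ->
  dirichlet_mean_law (al * th) (with_density (fun y => (rho al y)%:E)) mu1 ->
  dirichlet_mean_law th H mu2 ->
  forall A : set RR, measurable A ->
    mu A = (mu1 \x mu2)%E [set p | A ((p.1 : R) * (p.2 : R) `^ al^-1)].
Proof.
move=> muL mu1L mu2L; have [mu0 muE] := mean_law_transform muL.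
pose d1 : probability RR R := \d_(1 : RR).
have [mu10 mu1E] : mu1 `]-oo, 0%R[%classic = 0%E /\
    forall l : R, 0 < l -> (\int[mu1]_y ((1 + l * y) `^ (- (al * th)))%:E = ((1 + l `^ al) `^ (- th))%:E)%E.
  move: mu1L; rewrite rho_rhoH// => mu1L.
  have d1p : d1 `]0%R, +oo[%classic = 1%E by rewrite /d1/= diracE mem_set//= in_itv/= ltr01.
  have [h0 hE] := rhoH_transform al0 al1 d1p (dirac_log_moment 1) tau0 mu1L; split => // l l0.
  rewrite hE// Rintegral_dirac//; last first.
    apply: (measurableT_comp (@measurable_ln R)); apply: measurable_funD => //.
  rewrite mulr1 /powR (gt_eqF (ltr_pwDl ltr01 (powR_ge0 l al))); congr (expR _)%:E.
  by move: (ln _) => u; have a0 := al0; field; rewrite gt_eqF.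
have H0 : H `]-oo, 0%R[%classic = 0%E.
  have : H (~` `]0%R, +oo[%classic) = 0%E by rewrite probability_setC// H_pos subee.
  apply: subset_measure0 => //; first exact: measurableC.
  by move=> r; rewrite /= !in_itv/= andbT => r0 r1; have := lt_trans r0 r1; rewrite ltxx.
have [mu20 mu2E] := markov_krein (fun A _ => erefl (H A)) H0 H_log th0 mu2L.
pose m (p : RR * RR) : RR := (p.1 : R) * (p.2 : R) `^ al^-1.
have mm : measurable_fun setT m.
  by apply: measurable_funM => //; exact: measurable_fun_powR.
pose X : {mfun (RR * RR)%type >-> RR} := mfun_Sub (mem_set mm).
pose nu : probability RR R := distribution (mu1 \x mu2)%E X.
have nuE (A : set RR) : nu A = (mu1 \x mu2)%E [set p | A ((p.1 : R) * (p.2 : R) `^ al^-1)] by [].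
have nu0 : nu `]-oo, 0%R[%classic = 0%E.
  rewrite nuE; apply: (@subset_measure0 _ _ _ (mu1 \x mu2)%E _ (`]-oo, 0%R[%classic `*` setT)).
  - by have := mm measurableT _ (measurable_itv `]-oo, 0%R[); rewrite setTI.
  - exact: measurableX.
  - move=> [u v] /=; rewrite !in_itv/= => uv; split => //; rewrite ltNge; apply/negP => u0.
    by move: uv; rewrite ltNge mulr_ge0 ?powR_ge0.
  - apply: etrans (product_measure1E mu1 mu2 (measurable_itv `]-oo, 0%R[) measurableT) _.
    by rewrite [X in (X * _)%E]mu10 mul0e.
have mpow (l : R) : measurable_fun setT (fun y : RR => ((1 + l * y) `^ (- (al * th)))%:E).
  by apply/measurable_EFinP; apply: measurable_fun_powR; apply: measurable_funD => //.
have nuT (l : R) : 0 < l -> (\int[nu]_y ((1 + l * y) `^ (- (al * th)))%:E =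
     (expR (- (th * (\int[H]_(r in P0) ln (1 + l `^ al * r))%R)))%:E)%E.
  move=> l0; rewrite ge0_integral_distribution//; last by move=> y; rewrite lee_fin powR_ge0.
  rewrite fubini_tonelli2; last 2 first.
  - exact: (measurableT_comp (mpow l) mm).
  - by move=> y; rewrite lee_fin powR_ge0.
  rewrite -mu2E ?powR_gt0//.
  have mg : measurable_fun setT (fun y : RR => ((1 + l `^ al * y) `^ (- th))%:E).
    by apply/measurable_EFinP; apply: measurable_fun_powR; apply: measurable_funD => //.
  rewrite [LHS](integral_nonneg_carrier mu20); last 2 first.
  - have mf := measurableT_comp (mpow l) mm.
    have f0 (p : RR * RR) : (0 <= ((fun y : RR => ((1 + l * y) `^ (- (al * th)))%:E) \o m) p)%E.
      by rewrite lee_fin powR_ge0.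
    exact: (@measurable_fun_fubini_tonelli_G _ _ _ _ _ mu1 _ mf f0).
  - by move=> y; apply: integral_ge0 => x _; rewrite lee_fin powR_ge0.
  rewrite [RHS](integral_nonneg_carrier mu20)//; last by move=> y; rewrite lee_fin powR_ge0.
  (* y = 0 is treated apart, for the transform of [mu1] is known at positive arguments. *)
  apply: eq_integral => y /set_mem; rewrite /= in_itv/= andbT le_eqVlt => /predU1P[<-|y0].
    rewrite mulr0 addr0 powR1 /fubini_G/= /m/= powR0 ?invr_eq0 ?gt_eqF//.
    transitivity (\int[mu1]_x (cst 1%:E x))%E.
      by apply: eq_integral => x _; rewrite !mulr0 addr0 powR1.
    by rewrite integral_cst// mul1e; exact: probability_setT.
  have ly : 0 < l * y `^ al^-1 by rewrite mulr_gt0// powR_gt0.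
  have -> : l `^ al * y = (l * y `^ al^-1) `^ al.
    by rewrite powRM ?powR_ge0 ?(ltW l0)// -powRrM mulVf ?gt_eqF// powRr1// ltW.
  have mE (x : R) : ((1 + l * m (x, y)) `^ (- (al * th)))%:E = ((1 + l * y `^ al^-1 * x) `^ (- (al * th)))%:E.
    by rewrite /m /= mulrCA mulrC.
  rewrite -(mu1E _ ly); apply: eq_integral => x _; exact: mE.
apply: (measure_eq_rays_pos (m1 := mu) (m2 := nu)) => //.
- by move=> x x0; exact: etrans (cdf_Delta mu0 muE x0) (esym (cdf_Delta nu0 nuT x0)).
- by move=> x _; apply: le_lt_trans (probability_le1 _ _) (ltry _).
Qed.

Lemma mean_law_density (mu : probability RR R) : al * th = 1 ->
  dirichlet_mean_law (al * th) (with_density (fun x => (rhoH H al x)%:E)) mu ->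
  forall A : set RR, measurable A ->
    mu A = with_density (fun x => (Delta H al th x)%:E) A.
Proof.
move=> alth muL; have [mu0 muE] := mean_law_transform muL.
have m : measurable_fun P0 (EFin \o Delta H al th) by apply/measurable_EFinP; exact: measurable_Delta.
have p : forall x : RR, P0 x -> (0 <= (EFin \o Delta H al th) x)%E.
  by move=> x /in0 x0; rewrite lee_fin Delta_ge0// mulrC alth.
have [nu nuE] := density_measure lambda (measurable_itv `]0%R, +oo[) m p.
move=> A mA; rewrite -[RHS]nuE//; apply: (measure_eq_rays_pos (m1 := mu) (m2 := nu)) => //.
- move=> x x0; apply: etrans (cdf_Delta mu0 muE x0) _.
  rewrite nuE// ray_integral//; apply: eq_integral => t _.
  by rewrite alth subrr powRr0 mul1r.
- by move=> x _; apply: le_lt_trans (probability_le1 _ _) (ltry _).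
- by rewrite nuE// negative_ray_integral.
Qed.

End law_of_mean.

End mean_laws.

(** * Regularity at 0 from a logarithmic moment at 0 *)

Section regularity_at_zero.
Context {R : realType}.
Notation lambda := (@lebesgue_measure R).
Notation RR := (measurableTypeR R).
Local Notation P0 := (`]0%R, +oo[%classic : set RR).

Section regularity.
Context (H : probability RR R) (al th : R).
Context (al0 : 0 < al) (al1 : al < 1) (th0 : 0 < th).
Context (H_pos : H `]0%R, +oo[%classic = 1%E).
Context (H_log : (\int[H]_(r in `]0%R, +oo[) (ln (1 + (r : R)))%:E < +oo)%E).
Context (H_ln : H.-integrable P0 (fun r : R => (ln r)%:E)).

Let in0 (r : R) : P0 r -> 0 < r. Proof. by rewrite /= in_itv/= andbT. Qed.
Let pabs := pi_phimax_abs al0 al1.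
Let ppm := pi_phimax al0 al1.
Let s0 := sin_al_gt0 al0 al1.
Let psi := al_phi al0 al1 ppm.

(** In the variable y = x^al the integrand extends to y < 0 with [parg] still bounded. Dominated
    convergence gives continuity at the interior point y = 0, where [parg] vanishes. *)
Lemma V_cvg0 : Vpot H al x pi @[x --> 0^'+] --> 0.
Proof.
have W0 : \int[H]_(r in P0) parg 0 (al * pi) r = 0.
  by transitivity (\int[H]_(r in P0) (0 : R)); [apply: eq_Rintegral => r _; rewrite parg0|rewrite (Rintegral_EFin_cst (P := H) (D := P0))].
have mW (y : R) : measurable_fun setT (parg y (al * pi)).
  apply: measurable_funB => //; apply: measurable_funB => //; apply: measurableT_comp.
    by apply: continuous_measurable_fun => u; exact: continuous_atan.
  apply: measurable_funD => //; apply: measurable_funM => //; apply: measurable_funM => //.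
  exact: measurable_fun_inv.
have bW (y r : R) : `|parg y (al * pi) r| <= al * pi + pi.
  have a1 := atan_ltpi2 (cot (al * pi) + y / r / sin (al * pi)).
  have a2 := atan_gtNpi2 (cot (al * pi) + y / r / sin (al * pi)).
  move: a1 a2; rewrite /parg /acot; move: (atan _) => a a1 a2.
  have /andP[b1 b2] := psi; move: (al * pi) b1 b2 => q b1 b2.
  by rewrite ler_norml; apply/andP; split; lra.
have cW : {for 0, continuous (fun y : R => \int[H]_(r in P0) parg y (al * pi) r)}.
  apply: (@continuous_Rintegral _ _ _ H P0 (fun y r : R => parg y (al * pi) r) (fun=> al * pi + pi) 0 (-1) 1) => //.
  - by apply/andP; split; lra.
  - by move=> y _; apply: (integrable_bounded H (c := al * pi + pi)) => // r _; exact: bW.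
  - by move=> y r _ /in0 r0; exact: der_continuous (der_parg_x y r0 psi).
  - exact: integrable_cstH.
move: cW; rewrite /prop_for /continuous_at W0 => cW.
exact: (@cvg_comp _ _ _ (fun u : R => u `^ al) (fun y : R => \int[H]_(r in P0) parg y (al * pi) r) _ _ _ (powR_cvg0 al0) cW).
Qed.

(* \int log |y e^(i al pi) + r| H(dr) is continuous at y = 0, from both sides. *)
Lemma U_cvg : exists l : R, Upot H al x pi @[x --> 0^'+] --> l.
Proof.
pose W (y : R) := \int[H]_(r in P0) (2^-1 * ln (pnorm y (al * pi) r)).
exists (W 0).
have mW (y : R) : measurable_fun setT (fun r : R => 2^-1 * ln (pnorm y (al * pi) r)).
  apply: measurable_funM => //; apply: (measurableT_comp (@measurable_ln R)).
  apply: measurable_funD; last exact: measurable_funX.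
  by apply: measurable_funD => //; exact: measurable_funM.
pose G (r : R) := ln (1 + r) + (`|ln r| + `|ln (sin (al * pi))|).
have IG : H.-integrable P0 (EFin \o G).
  have I1 : H.-integrable P0 (fun r : R => (ln (1 + r))%:E).
    by have I := integrable_ln1D ltr01 H_log; apply: eq_integrable I => // r _; rewrite mul1r.
  have I2 : H.-integrable P0 (fun r : R => (`|ln r|)%:E) by exact: integrable_norm H_ln.
  have K : H.-integrable P0 ((fun r : R => (ln (1 + r))%:E) \+ ((fun r : R => (`|ln r|)%:E) \+ (EFin \o (fun=> `|ln (sin (al * pi))|%R))))%E.
    by apply: integrableD => //; apply: integrableD => //; exact: integrable_cstH.
  exact: K.
(* Below, [pnorm] is at least (r sin(al pi))^2 whatever the sign of y; above, it is at most (1 +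
   r)^2 for |y| < 1. *)
have bW (y r : R) : -1 < y < 1 -> 0 < r -> `|2^-1 * ln (pnorm y (al * pi) r)| <= G r.
  move=> /andP[y0 y1] r0; have srp : 0 < r * sin (al * pi) by exact: mulr_gt0.
  have p1 : (r * sin (al * pi)) ^+ 2 <= pnorm y (al * pi) r by rewrite pnormE lerDr sqr_ge0.
  have p0 : 0 < pnorm y (al * pi) r by apply: lt_le_trans p1; rewrite exprn_gt0.
  have p2 : pnorm y (al * pi) r <= (1 + r) ^+ 2.
    have yr : y * r * cos (al * pi) <= r.
      apply: le_trans (ler_norm _) _; rewrite !normrM (ger0_norm (ltW r0)) -[leRHS]mulr1.
      rewrite mulrAC [leRHS]mulrC; apply: ler_wpM2r; first exact: ltW.
      by rewrite -[leRHS]mulr1 ler_pM// ?ler_norml ?cos_geN1 ?cos_le1// !ltW.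
    have y2 : y ^+ 2 <= 1 by rewrite -ler_sqrt// sqrtr_sqr sqrtr1 ler_norml !ltW.
    rewrite /pnorm; have -> : 2 * y * r * cos (al * pi) = 2 * (y * r * cos (al * pi)) by ring.
    have -> : (1 + r) ^+ 2 = 1 + 2 * r + r ^+ 2 by ring.
    by rewrite lerD2r; lra.
  have l2 : 2^-1 * ln (pnorm y (al * pi) r) <= ln (1 + r).
    have q : 0 < 1 + r by exact: addr_gt0.
    have : ln (pnorm y (al * pi) r) <= ln ((1 + r) ^+ 2) by rewrite ler_ln ?posrE ?exprn_gt0.
    by rewrite expr2 lnM ?posrE//; lra.
  have l1 : ln r + ln (sin (al * pi)) <= 2^-1 * ln (pnorm y (al * pi) r).
    have : ln ((r * sin (al * pi)) ^+ 2) <= ln (pnorm y (al * pi) r) by rewrite ler_ln ?posrE ?exprn_gt0.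
    by rewrite expr2 lnM ?posrE// lnM ?posrE//; lra.
  have n0 : 0 <= ln (1 + r) by rewrite ln_ge0// lerDl ltW.
  have n1 := ler_norm (ln r); have n2 := ler_norm (ln (sin (al * pi))).
  have n3 : - ln r <= `|ln r| by rewrite -normrN ler_norm.
  have n4 : - ln (sin (al * pi)) <= `|ln (sin (al * pi))| by rewrite -normrN ler_norm.
  have n5 := normr_ge0 (ln r); have n6 := normr_ge0 (ln (sin (al * pi))).
  by rewrite /G ler_norml; apply/andP; split; lra.
have cW : {for 0, continuous W}.
  apply: (@continuous_Rintegral _ _ _ H P0 (fun y r : R => 2^-1 * ln (pnorm y (al * pi) r)) G 0 (-1) 1) => //.
  - by apply/andP; split; lra.
  - move=> y hy; have m : measurable_fun P0 (EFin \o (fun r : R => 2^-1 * ln (pnorm y (al * pi) r))).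
      by apply/measurable_EFinP; apply: measurable_funTS; exact: mW.
    apply: (le_integrable _ m _ IG) => //.
    by move=> r /in0 r0; rewrite /= lee_fin; apply: le_trans (ler_norm _); exact: bW.
  - move=> y r _ /in0 r0; have p0 := pnorm_gt0 y r0 s0.
    exact: der_continuous (@der_mull _ _ y _ 2^-1 (@der_ln _ (fun u : R => pnorm u (al * pi) r) y _ p0 (der_pnorm_x y (al * pi) r))).
  - by move=> y r hy /in0 r0; exact: bW.
exact: (@cvg_comp _ _ _ (fun u : R => u `^ al) W _ _ _ (powR_cvg0 al0) cW).
Qed.

Lemma expU_bounded : exists c, forall t, 0 < t -> expR (- (th * Upot H al t pi)) <= c.
Proof.
pose u0 := 2^-1 * ln (kappa al) + \int[H]_(r in P0) ln r.
exists (expR (- (th * u0))) => t t0; rewrite ler_expR lerN2 ler_wpM2l ?(ltW th0)//.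
rewrite /u0 -(Rintegral_EFin_cst (P := H) (D := P0) (2^-1 * ln (kappa al)))//.
rewrite -RintegralD//; last exact: integrable_cstH.
apply: le_Rintegral => //.
- have K : H.-integrable P0 ((EFin \o (fun=> (2^-1 * ln (kappa al))%R)) \+ (fun r : R => (ln r)%:E))%E.
    by apply: integrableD => //; exact: integrable_cstH.
  exact: K.
- exact: (integrable_lg al0 al1 H_log t0 pabs).
- by move=> r /in0 r0; have [] := lg_ge al0 al1 t0 r0 pabs.
Qed.

Lemma Delta_cvg0 : Delta H al th t @[t --> 0^'+] --> (0 : R).
Proof.
have [c cE] := expU_bounded.
have c0 : 0 <= c by apply: le_trans (cE 1 ltr01); exact: expR_ge0.
have K : pi^-1 * c * (th * Vpot H al x pi) @[x --> 0^'+] --> pi^-1 * c * (th * 0).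
  by apply: cvgM; [exact: cvg_cst|apply: cvgM; [exact: cvg_cst|exact: V_cvg0]].
rewrite !mulr0 in K.
apply: norm_cvg0; apply: (@squeeze_cvgr _ _ _ _ (fun=> 0) (fun x => pi^-1 * c * (th * Vpot H al x pi))) => //; last exact: cvg_cst.
near=> t; have t0 : 0 < t by near: t; exact: nbhs_right_gt.
have /andP[v0 _] := V_bound al0 al1 H_pos t ppm.
rewrite normr_ge0/= DeltaE// !normrM (ger0_norm (expR_ge0 _)) ger0_norm ?invr_ge0 ?pi_ge0//.
rewrite -[leRHS]mulrA ler_wpM2l ?invr_ge0 ?pi_ge0//; apply: ler_pM; rewrite ?expR_ge0//.
  exact: cE.
by apply: le_trans (abs_sin_le _) _; rewrite ger0_norm// mulr_ge0// ltW.
Unshelve. all: end_near. Qed.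

(** |dd| is at most a constant times B1 + B2, which is nonnegative and the derivative of a
    combination of U and V. These have finite limits at 0 when ln r is integrable, so B1 + B2 is
    integrable there. *)
Lemma regular_at_0_of_ln : regular_at_0 H al th.
Proof.
split; last exact: Delta_cvg0.
have [c cE] := expU_bounded; have [l lE] := U_cvg.
(* Chosen to make 1 of cos(al pi) + k sin(al pi), the coefficient of B1 in [re_dlog] + k [im_dlog]
   after division by al x. *)
pose k := (1 - cos (al * pi)) / sin (al * pi).
have k0 : 0 <= k by rewrite divr_ge0 ?subr_ge0 ?cos_le1// ltW.
pose F x := al^-1 * (Upot H al x pi + k * Vpot H al x pi).
pose f x := al^-1 * (re_dlog H al x pi / x + k * (im_dlog H al x pi / x)).
have B0 (x : R) : 0 < x -> 0 <= B1 H al x /\ 0 <= B2 H al x.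
  move=> x0; split; apply: Rintegral_ge0 => r /in0 r0; rewrite pnorm_pi divr_ge0 ?mulr_ge0 ?powR_ge0 ?(ltW r0)//;
  by apply/ltW/(pnorm_pos al0 al1 (powR_ge0 x al) r0 pabs).
have fE (x : R) : 0 < x -> f x = B1 H al x + B2 H al x.
  move=> x0; rewrite /f C1E// C2E// /k.
  have := s0; move: (sin _) (cos _) (B1 H al x) (B2 H al x) => s co b1 b2 s0'.
  by have a0 := al0; field; rewrite !gt_eqF.
have D (x : R) : 0 < x -> is_derive x 1 F (f x).
  move=> x0; apply: der_mull; apply: der_add; first exact: (der_U_t al0 al1 H_log x0 pabs).
  apply: der_mull; exact: (der_V_t H al0 al1 x0 ppm).
have cf (x : R) : 0 < x -> {for x, continuous f}.
  move=> x0; have [k1 k2] := continuous_C12 H al0 al1 x0 pabs.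
  have ci : {for x, continuous (fun u : R => u^-1)} by apply: cvgV; [rewrite gt_eqF|exact: cvg_id].
  apply: cvgM; first exact: cvg_cst.
  by apply: cvgD; [exact: cvgM k1 ci|apply: cvgM; [exact: cvg_cst|exact: cvgM k2 ci]].
have I : (\int[lambda]_(x in (`]0%R, 1%R[%classic : set RR)) (f x)%:E = (F 1 - al^-1 * (l + k * 0))%:E)%E.
  apply: (@ge0_FTC_oo _ f F 0 1).
  - exact: ltr01.
  - by move=> x /andP[x0 _]; rewrite fE//; have [b1 b2] := B0 x x0; exact: addr_ge0.
  - by move=> x /andP[x0 _]; exact: D.
  - by move=> x /andP[x0 _]; exact: cf.
  - apply: cvgM; first exact: cvg_cst.
    by apply: cvgD => //; apply: cvgM; [exact: cvg_cst|exact: V_cvg0].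
  - by apply: cvg_at_left_filter; exact: der_continuous (D 1 ltr01).
have mf : measurable_fun (`]0%R, 1%R[%classic : set RR) f.
  apply: open_continuous_measurable_fun; first exact: interval_open.
  by move=> x /set_mem; rewrite /= in_itv/= => /andP[x0 _]; exact: cf.
have If : lambda.-integrable (`]0%R, 1%R[%classic : set RR) (EFin \o f).
  apply/integrableP; split; first exact/measurable_EFinP.
  have -> : (\int[lambda]_(x in (`]0%R, 1%R[%classic : set RR)) `|(EFin \o f) x| = (F 1 - al^-1 * (l + k * 0))%:E)%E.
    rewrite -I; apply: eq_integral => x /set_mem; rewrite /= in_itv/= => /andP[x0 _].
    by rewrite ger0_norm// fE//; have [b1 b2] := B0 x x0; exact: addr_ge0.
  exact: ltry.
have K : lambda.-integrable (`]0%R, 1%R[%classic : set RR) (fun x : R => (al * th / pi * c)%:E * (f x)%:E)%E.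
  exact: integrableZl.
apply: le_integrable K => //.
  apply/measurable_EFinP; apply: measurable_funS (measurable_dd th al0 al1 H_pos H_log) => //.
  by move=> x; rewrite /= !in_itv/= andbT => /andP[].
have key (x : R) : 0 < x -> `|dd H al th x| <= al * th / pi * c * f x.
  move=> x0; have [b1 b2] := B0 x x0.
  have q0 : 0 <= al * th / pi by rewrite divr_ge0 ?pi_ge0// mulr_ge0 ?ltW.
  have e0 := expR_ge0 (- (th * Upot H al x pi)); have ec := cE x x0.
  rewrite /dd; have -> : th * al * calS H al x = th * Upot H al x pi by rewrite -mulrA calSE.
  rewrite normrM; have -> : `|al * th / pi * expR (- (th * Upot H al x pi))| = al * th / pi * expR (- (th * Upot H al x pi)).
    by rewrite ger0_norm// mulr_ge0.
  apply: ler_pM => //; first exact: mulr_ge0.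
    by rewrite ler_wpM2l.
  rewrite fE//; apply: le_trans (ler_normB _ _) _; rewrite !normrM (ger0_norm b1) (ger0_norm b2).
  by apply: lerD; rewrite ler_piMl// ler_norml sin_geN1 sin_le1.
move=> x; rewrite /= in_itv/= => /andP[x0 _]; rewrite lee_fin.
exact: le_trans (key x x0) (ler_norm _).
Qed.

End regularity.

End regularity_at_zero.

(** * The density in terms of dd *)

Section densities.
Context {R : realType}.
Notation lambda := (@lebesgue_measure R).
Notation RR := (measurableTypeR R).
Local Notation P0 := (`]0%R, +oo[%classic : set RR).

(* The sign of f is not known beforehand: f^+ and mu + f^- are compared as
   measures, and the set {f < 0} then shows that f^- vanishes. *)
Lemma density_of_rays (mu : probability RR R) (f : R -> \bar R) :
  mu `]-oo, 0%R[%classic = 0%E ->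
  (forall x : R, 0 < x -> lambda.-integrable (`]0%R, x[%classic : set RR) f /\
     (\int[lambda]_(t in `]0%R, x[) f t = mu `]-oo, x]%classic)%E) ->
  forall A : set RR, measurable A -> mu A = with_density f A.
Proof.
move=> mu0 fE.
have mf : measurable_fun P0 f.
  have -> : P0 = \bigcup_n (`]0%R, n.+1%:R[%classic : set RR).
    apply/seteqP; split => t /=; rewrite in_itv/= ?andbT.
      move=> t0; have [n _ hn] := nbhs_infty_ger (t + 1).
      have := hn n (leqnn n) => /= h; exists n => //=; rewrite in_itv/= t0/=.
      by apply: lt_le_trans (_ : t + 1 <= _); rewrite ?ltrDl// (le_trans h)// ler_nat.
    by move=> [n _] /=; rewrite !in_itv/= => /andP[->].
  apply/measurable_fun_bigcup => // n.
  by have [/integrableP[]] := fE n.+1%:R (ltr0Sn _ _).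
have mp := measurable_funepos mf; have mn := measurable_funeneg mf.
have [m1 m1E] := density_measure lambda (measurable_itv `]0%R, +oo[) mp (fun x _ => funepos_ge0 f x).
have [m2 m2E] := density_measure lambda (measurable_itv `]0%R, +oo[) mn (fun x _ => funeneg_ge0 f x).
pose m3 := measure_add m2 mu.
have m3E (A : set RR) : m3 A = (m2 A + mu A)%E by rewrite /m3 measure_addE.
have fin (x : R) : 0 < x -> (m1 (`]-oo, x]%classic : set RR) < +oo)%E.
  move=> x0; have [I _] := fE x x0; rewrite m1E// ray_integral//.
  exact: integral_funepos_lt_pinfty I.
have E : forall A : set RR, measurable A -> m1 A = m3 A.
  apply: measure_eq_rays_pos => //.
  - move=> x x0; have [I IE] := fE x x0.
    apply: etrans _ (esym (m3E _)); rewrite -IE m1E// m2E// !ray_integral//.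
    rewrite [in RHS](integralE lambda _ f) [RHS]addeC subeK//.
    exact: integrable_neg_fin_num I.
  - by rewrite m1E// negative_ray_integral.
  - by apply: etrans (m3E _) _; rewrite mu0 adde0 m2E// negative_ray_integral.
pose N := P0 `&` [set t | (f t < 0)%E].
have mN : measurable N by apply: emeasurable_fun_infty_o => //.
have m1N : m1 N = 0%E.
  rewrite m1E//; apply: integral0_eq => t [[_ /= ft] _].
  by rewrite funeposE; apply/max_idPr; exact: ltW.
have m2N : m2 N = 0%E.
  have := E N mN; rewrite m1N m3E => /esym/eqP.
  by rewrite padde_eq0 ?measure_ge0// => /andP[/eqP].
have m20 (A : set RR) : measurable A -> m2 A = 0%E.
  move=> mA; have z : m2 (A `\` N) = 0%E.
    rewrite m2E; last exact: measurableD.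
    apply: integral0_eq => t [[_ Nt] t0]; rewrite funenegE; apply/max_idPr.
    rewrite oppe_le0 leNgt; apply/negP => ft; exact: Nt.
  apply: etrans (measureDI m2 mA mN) _; rewrite [X in (X + _)%E]z add0e.
  by apply: (subset_measure0 _ _ _ m2N) => //; exact: measurableI.
move=> A mA; have := E A mA; rewrite m3E m20// add0e => <-.
rewrite m1E// /with_density [RHS]integralE.
by have := m20 A mA; rewrite m2E// => ->; rewrite sube0.
Qed.

(** Applied to two kernels with the same integral [w] over their first variable, it equates the two
    iterated integrals. *)
Lemma fubini_kernel (K : R * R -> R) (w d : R -> R) :
  measurable_fun [set: RR * RR] K -> measurable_fun setT d ->
  (forall s u, 0 <= K (s, u)) ->
  (forall u : R, 0 < u -> (\int[lambda]_(s in P0) (K (s, u))%:E = (w u)%:E)%E) ->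
  lambda.-integrable P0 (fun u : R => (w u * d u)%:E) ->
  lambda.-integrable P0 (fun s : R => (\int[lambda]_(u in P0) (K (s, u) * d u)%:E)%E) /\
  (\int[lambda]_(s in P0) \int[lambda]_(u in P0) (K (s, u) * d u)%:E =
   \int[lambda]_(u in P0) (w u * d u)%:E)%E.
Proof.
move=> mK md K0 KE I.
have in0 (r : R) : P0 r -> 0 < r by rewrite /= in_itv/= andbT.
pose f (p : RR * RR) : \bar R := (K p * d p.2)%:E.
have mf : measurable_fun setT f.
  by apply/measurable_EFinP; apply: measurable_funM => //; exact: (measurableT_comp md).
have mKu (u : R) : measurable_fun setT (fun s : R => K (s, u)).
  exact: (measurableT_comp mK (measurable_pair2 u)).
have w0 (u : R) : 0 < u -> 0 <= w u.
  by move=> u0; rewrite -lee_fin -KE//; apply: integral_ge0 => s _; rewrite lee_fin.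
have fin : (\int[lambda]_(s in P0) \int[lambda]_(u in P0) `|f (s, u)| < +oo)%E.
  rewrite (@fubini_tonelli_in _ _ _ _ _ lambda lambda P0 P0 (fun p => `|f p|%E))//; last exact: measurableT_comp.
  have -> : (\int[lambda]_(u in P0) \int[lambda]_(s in P0) `|f (s, u)| =
      \int[lambda]_(u in P0) `|(w u * d u)%:E|)%E.
    apply: eq_integral => u /set_mem/in0 u0.
    transitivity (\int[lambda]_(s in P0) ((K (s, u))%:E * (`|d u|)%:E))%E.
      by apply: eq_integral => s _; rewrite /f /= normrM ger0_norm.
    rewrite ge0_integralZr//; last 2 first.
    - by apply/measurable_EFinP; apply: measurable_funTS; exact: mKu.
    - by move=> s _; rewrite lee_fin.
    by rewrite KE// /= normrM (ger0_norm (w0 u u0)).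
  by have /integrableP[_] := I.
have [_ J E] := @fubini_in _ _ _ _ _ lambda lambda P0 P0 f (measurable_itv _) (measurable_itv _) mf fin.
split; first exact: J.
apply: etrans E _; apply: eq_integral => u /set_mem/in0 u0.
have IK : lambda.-integrable P0 (fun s : R => (K (s, u))%:E).
  apply/integrableP; split; first by apply/measurable_EFinP; apply: measurable_funTS; exact: mKu.
  have -> : (\int[lambda]_(s in P0) `|(K (s, u))%:E| = (w u)%:E)%E.
    by rewrite -KE//; apply: eq_integral => s _; rewrite gee0_abs// lee_fin.
  exact: ltry.
by rewrite /f /=; under eq_integral do rewrite EFinM; rewrite integralZr// KE// EFinM.
Qed.
Section density_of_mean.
Context (H : probability RR R) (al th : R).
Context (al0 : 0 < al) (al1 : al < 1) (th0 : 0 < th).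
Context (H_pos : H `]0%R, +oo[%classic = 1%E).
Context (H_log : (\int[H]_(r in `]0%R, +oo[) (ln (1 + (r : R)))%:E < +oo)%E).
Context (reg : regular_at_0 H al th).

Let in0 (r : R) : P0 r -> 0 < r. Proof. by rewrite /= in_itv/= andbT. Qed.
Let tau0 : 0 < al * th. Proof. exact: mulr_gt0. Qed.

Lemma integrable_dd (x : R) : lambda.-integrable (`]0%R, x[%classic : set RR) (EFin \o dd H al th).
Proof.
have [I _] := reg.
have ct : {within `[2^-1, x], continuous (dd H al th)}.
  apply: within_continuous => u /andP[u0 _].
  have u1 : 0 < u by apply: lt_le_trans u0; rewrite invr_gt0.
  exact: continuous_dd.
have J := integrable_within ct.
pose S : set RR := `[2^-1, x]%classic.
have mS : measurable S by exact: measurable_itv.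
have mx : measurable (`]0%R, x[%classic : set RR) by exact: measurable_itv.
have I1 : lambda.-integrable (`]0%R, x[%classic : set RR) ((EFin \o dd H al th) \_ `]0%R, 1%R[%classic).
  apply/(integrable_restrict lambda) => //.
  by apply: integrableS I => //; apply: measurableI.
have I2 : lambda.-integrable (`]0%R, x[%classic : set RR) ((EFin \o dd H al th) \_ S).
  apply/(integrable_restrict lambda mS mx).
  exact: (integrableS mS (measurableI _ _ mx mS) (@subIsetr _ _ _) J).
have K : lambda.-integrable (`]0%R, x[%classic : set RR)
    ((fun s => `|((EFin \o dd H al th) \_ `]0%R, 1%R[%classic) s|) \+ (fun s => `|((EFin \o dd H al th) \_ S) s|))%E.
  by apply: integrableD => //; apply: integrable_abse.
apply: le_integrable K => //.
  apply/measurable_EFinP; apply: measurable_funS (measurable_dd th al0 al1 H_pos H_log) => //.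
  by move=> u; rewrite /= !in_itv/= andbT => /andP[].
have key (s : R) : 0 < s -> s < x -> (`|(dd H al th s)%:E| <= `|((EFin \o dd H al th) \_ `]0%R, 1%R[%classic) s| + `|((EFin \o dd H al th) \_ S) s|)%E.
  move=> s0 sx; have [s1|s1] := ltP s 1.
    by rewrite {1}/patch mem_set ?leeDl//= in_itv/= s0.
  rewrite [X in (_ + `|X|)%E]/patch mem_set ?leeDr// /S/= in_itv/= (ltW sx) andbT.
  by apply: le_trans s1; rewrite invf_le1// ler1n.
move=> s; rewrite /= in_itv/= => /andP[s0 sx].
by rewrite [leRHS]gee0_abs ?adde_ge0//; exact: key.
Qed.

(** On [a n, t] the primitive Delta applies; [regular_at_0] supplies both the domination by |dd| and
    the limit 0 of Delta (a n). *)
Lemma integral_dd (t : R) : 0 < t -> \int[lambda]_(u in `]0%R, t[) dd H al th u = Delta H al th t.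
Proof.
move=> t0; have [_ D0] := reg.
have mt : measurable (`]0%R, t]%classic : set RR) by exact: measurable_itv.
have md : measurable_fun (`]0%R, t]%classic : set RR) (dd H al th).
  apply: measurable_funS (measurable_dd th al0 al1 H_pos H_log) => //.
  by move=> u; rewrite /= !in_itv/= andbT => /andP[].
have I : lambda.-integrable (`]0%R, t]%classic : set RR) (EFin \o dd H al th).
  apply: integrableS (integrable_dd (t + 1)) => //.
  by move=> u; rewrite /= !in_itv/= => /andP[-> ut]; rewrite (le_lt_trans ut)// ltrDl.
have -> : \int[lambda]_(u in `]0%R, t[) dd H al th u = \int[lambda]_(u in `]0%R, t]) dd H al th u.
  congr fine; apply: integral_itv_bndo_bndc; apply/measurable_EFinP; apply: measurable_funS md => //.
  by move=> u; rewrite /= !in_itv/= => /andP[-> /ltW].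
pose a (n : nat) := t / n.+2%:R.
have a0 n : 0 < a n by rewrite divr_gt0.
have at_ n : a n < t by rewrite ltr_pdivrMr// ltr_pMr// ltr1n.
have E n : \int[lambda]_(u in `]0%R, t]) ((dd H al th \_ `[a n, t]%classic) u) = Delta H al th t - Delta H al th (a n).
  rewrite -Rintegral_mkcondr (_ : _ `&` _ = `[a n, t]%classic); last first.
    by apply: setIidr => u; rewrite /= !in_itv/= => /andP[au ->]; rewrite (lt_le_trans (a0 n)).
  apply: (@FTC_der _ (Delta H al th) (dd H al th) (a n) t (at_ n)).
    by move=> u /andP[u0 _]; have u1 := lt_le_trans (a0 n) u0; exact: der_Delta.
  by apply: within_continuous => u /andP[u0 _]; have u1 := lt_le_trans (a0 n) u0; exact: continuous_dd.
have cva : a n @[n --> \oo] --> 0^'+.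
  move=> A [d /= d0 hd]; have K : \forall n \near \oo, A (a n); last exact: K.
  near=> n; apply: hd => //=.
  rewrite sub0r normrN gtr0_norm// ltr_pdivrMr// mulrC -ltr_pdivrMr//.
  apply: le_lt_trans (_ : _ <= n%:R) _; last by rewrite ltr_nat.
  near: n; exact: nbhs_infty_ger.
have cv1 : Delta H al th t - Delta H al th (a n) @[n --> \oo] --> Delta H al th t - 0.
  by apply: cvgB; [exact: cvg_cst|exact: (cvg_comp _ _ cva D0)].
have cv2 : \int[lambda]_(u in `]0%R, t]) ((dd H al th \_ `[a n, t]%classic) u) @[n --> \oo] --> \int[lambda]_(u in `]0%R, t]) dd H al th u.
  apply: (@Rdominated_cvg _ _ _ lambda (`]0%R, t]%classic : set RR) (fun n => dd H al th \_ `[a n, t]%classic) (dd H al th) (fun u => `|dd H al th u|)) => //.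
  - move=> n; apply: measurable_funTS.
    apply: ((measurable_restrictT (dd H al th) (measurable_itv `[a n, t])).1 _).
    apply: measurable_funS md => //.
    by move=> u; rewrite /= !in_itv/= => /andP[au ->]; rewrite (lt_le_trans (a0 n)).
  - apply: aeW => u; rewrite /= in_itv/= => /andP[u0 ut].
    apply: cvg_near_cst; near=> n; rewrite /patch mem_set//= in_itv/= ut andbT.
    rewrite /a ler_pdivrMr// mulrC -ler_pdivrMr//.
    apply: le_trans (_ : n%:R <= _); last by rewrite ler_nat ltnW.
    near: n; exact: nbhs_infty_ger.
  - exact: integrable_abse I.
  - move=> n u _; rewrite /patch; case: ifP => // _; rewrite normr0 //.
have cv3 : Delta H al th t - Delta H al th (a n) @[n --> \oo] --> \int[lambda]_(u in `]0%R, t]) dd H al th u.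
  by apply: cvg_trans cv2; apply: near_eq_cvg; near=> n; rewrite E.
by rewrite -[RHS]subr0; exact: (cvg_unique (@Rhausdorff R) cv3 cv1).
Unshelve. all: end_near. Qed.

(* (s - u)^(p - 1) and (x - s)^(p - 1) have the same integral over ]u, x[; this
   identifies the primitive of \int (s - u)^(p - 1) dd(u) du with
   \int (x - t)^(p - 1) Delta(t) dt. *)
Lemma integral_bkern (x u : R) : 0 < u ->
  (\int[lambda]_(s in P0) (if s < x then bkern (al * th) s u else 0)%:E =
    (if u < x then (al * th)^-1 * (x - u) `^ (al * th) else 0)%:E)%E /\
  (\int[lambda]_(t in P0) (bkern (al * th) x t * (if u < t then 1 else 0))%:E =
    (if u < x then (al * th)^-1 * (x - u) `^ (al * th) else 0)%:E)%E.
Proof.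
move=> u0; pose p := al * th; have p0 : 0 < p by [].
have P0E (f g : R -> R) : (forall s, 0 < s -> f s = if (u < s) && (s < x) then g s else 0) ->
    (\int[lambda]_(s in P0) (f s)%:E = \int[lambda]_(s in (`]u, x[%classic : set RR)) (g s)%:E)%E.
  move=> fg; have -> : (`]u, x[%classic : set R) = P0 `&` `]u, x[%classic.
    by apply/esym/setIidr => s; rewrite /= !in_itv/= andbT => /andP[us _]; rewrite (lt_trans u0).
  rewrite [RHS]integral_mkcondr; apply: eq_integral => s /set_mem/in0 s0.
  have M : (s \in (`]u, x[%classic : set R)) = (u < (s : R)) && ((s : R) < x) by rewrite mem_setE/= in_itv.
  by rewrite /patch M fg//; case: ifP.
have [ux|ux] := ltP u x; last first.
  have e0 (s : R) : (u < s) && (s < x) = false by apply/negP => /andP[us sx]; have := lt_trans us sx; rewrite ltNge ux.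
  split.
    apply: integral0_eq => s /in0 s0; congr EFin; case: ifP => // sx; rewrite /bkern u0/=; case: ifP => // us.
    by have := e0 s; rewrite us sx.
  apply: integral0_eq => s /in0 s0; congr EFin; rewrite /bkern; case: ifP => [/andP[_ sx]|]; last by rewrite mul0r.
  case: ifP => us; last by rewrite mulr0.
  by have := e0 s; rewrite us sx.
have dF1 (s : R) : u < s -> is_derive s 1 (fun s : R => p^-1 * (s - u) `^ p) ((s - u) `^ (p - 1)).
  move=> us; have q0 : 0 < s - u by rewrite subr_gt0.
  have d1 := @der_add _ (fun s : R => s) (fun=> - u) s 1 0 (der_id s) (der_cst s (- u)).
  apply: der_eq (@der_mull _ _ s _ p^-1 (@der_powR _ (fun s : R => s - u) s _ p q0 d1)) _.
  by rewrite addr0 mulr1 mulKf ?gt_eqF.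
have dF2 (s : R) : s < x -> is_derive s 1 (fun s : R => - (p^-1 * (x - s) `^ p)) ((x - s) `^ (p - 1)).
  move=> sx; have q0 : 0 < x - s by rewrite subr_gt0.
  have d1 := @der_add _ (fun=> x) (fun s : R => - s) s 0 (- 1) (der_cst s x) (der_opp (der_id s)).
  apply: der_eq (der_opp (@der_mull _ _ s _ p^-1 (@der_powR _ (fun s : R => x - s) s _ p q0 d1))) _.
  by rewrite add0r mulrN1 mulrN opprK mulKf ?gt_eqF.
have small (f : R -> R) (F : set_system R) : Filter F -> (\forall s \near F, 0 <= f s) ->
    f s @[s --> F] --> 0 -> f s `^ p @[s --> F] --> 0.
  move=> FF f0 cf; apply/cvgrPdist_lt => e e0; near=> s.
  have fs : 0 <= f s by near: s.
  rewrite sub0r normrN ger0_norm ?powR_ge0//.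
  have eE : (e `^ p^-1) `^ p = e by rewrite -powRrM mulVf ?gt_eqF// powRr1 ?ltW.
  rewrite -eE; apply: gt0_ltr_powR => //; rewrite ?nnegrE ?powR_ge0//.
  have -> : f s = `|0 - f s| by rewrite sub0r normrN ger0_norm.
  near: s; move/cvgrPdist_lt : cf; apply; exact: powR_gt0.
split.
  rewrite (P0E _ (fun s => (s - u) `^ (p - 1))); last first.
    by move=> s s0; rewrite /bkern u0/=; case: (u < s); case: (s < x).
  have -> : p^-1 * (x - u) `^ p = p^-1 * (x - u) `^ p - p^-1 * 0 by rewrite mulr0 subr0.
  apply: (@ge0_FTC_oo _ (fun s => (s - u) `^ (p - 1)) (fun s : R => p^-1 * (s - u) `^ p) u x).
  - exact: ux.
  - by move=> s _; exact: powR_ge0.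
  - by move=> s /andP[us _]; exact: dF1.
  - move=> s /andP[us _]; have q0 : 0 < s - u by rewrite subr_gt0.
    have d1 := @der_add _ (fun s : R => s) (fun=> - u) s 1 0 (der_id s) (der_cst s (- u)).
    exact: der_continuous (@der_powR _ (fun s : R => s - u) s _ (p - 1) q0 d1).
  - apply: cvgM; first exact: cvg_cst.
    apply: small; first by near=> s; rewrite subr_ge0 ltW//; near: s; exact: nbhs_right_gt.
    rewrite -(subrr u); apply: cvgB; last exact: cvg_cst.
    by apply: cvg_at_right_filter; exact: cvg_id.
  - by apply: cvg_at_left_filter; exact: der_continuous (dF1 x ux).
rewrite (P0E _ (fun s => (x - s) `^ (p - 1))); last first.
  move=> s s0; rewrite /bkern s0/=; case: (s < x); last by rewrite mul0r andbF.
  by rewrite andbT; case: (u < s); rewrite ?mulr1// mulr0.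
have -> : p^-1 * (x - u) `^ p = - (p^-1 * 0) - - (p^-1 * (x - u) `^ p) by rewrite mulr0 oppr0 sub0r opprK.
apply: (@ge0_FTC_oo _ (fun s => (x - s) `^ (p - 1)) (fun s : R => - (p^-1 * (x - s) `^ p)) u x).
- exact: ux.
- by move=> s _; exact: powR_ge0.
- by move=> s /andP[_ sx]; exact: dF2.
- move=> s /andP[_ sx]; have q0 : 0 < x - s by rewrite subr_gt0.
  have d1 := @der_add _ (fun=> x) (fun s : R => - s) s 0 (- 1) (der_cst s x) (der_opp (der_id s)).
  exact: der_continuous (@der_powR _ (fun s : R => x - s) s _ (p - 1) q0 d1).
- by apply: cvg_at_right_filter; exact: der_continuous (dF2 u ux).
- apply: cvgN; apply: cvgM; first exact: cvg_cst.
  apply: small; first by near=> s; rewrite subr_ge0 ltW//; near: s; exact: nbhs_left_lt.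
  rewrite -(subrr x); apply: cvgB; first exact: cvg_cst.
  by apply: cvg_at_left_filter; exact: cvg_id.
Unshelve. all: end_near. Qed.

Lemma integral_cut (g : R -> \bar R) (x : R) :
  (\int[lambda]_(t in P0) (if (t < x)%R then g t else 0) = \int[lambda]_(t in `]0%R, x[) g t)%E.
Proof.
have -> : (`]0%R, x[%classic : set R) = P0 `&` `]0%R, x[%classic.
  by apply/esym/setIidr => s; rewrite /= !in_itv/= andbT => /andP[].
rewrite [RHS]integral_mkcondr.
have E (t : R) : 0 < t -> (if t < x then g t else 0%E) = (g \_ `]0%R, x[%classic) t.
  move=> t0; have M : (t \in (`]0%R, x[%classic : set R)) = (t < x) by rewrite mem_setE/= in_itv/= t0.
  by rewrite /patch M.
by apply: eq_integral => t /set_mem/in0 t0; rewrite E.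
Qed.

(** Integrating the candidate density over ]0, x[ gives a double integral of dd(u) against (s -
    u)^(p - 1). By [integral_bkern] it equals the one against (x - t)^(p - 1) over u < t < x, in
    which the integral of dd over u < t is Delta(t). The result is the cdf of mu by [cdf_Delta], and
    [density_of_rays] passes from rays to Borel sets although the sign of the candidate is
    unknown. *)
Lemma mean_law_density_dd (mu : probability RR R) :
  dirichlet_mean_law (al * th) (with_density (fun x => (rhoH H al x)%:E)) mu ->
  forall A : set RR, measurable A -> mu A = with_density (fun x =>
    (\int[lambda]_(t in `]0%R, x[) ((x - t) `^ (al * th - 1) * dd H al th t)%:E)%E) A.
Proof.
move=> muL; have [mu0 muE] := mean_law_transform al0 al1 th0 H_pos H_log muL.
apply: density_of_rays => // x x0.
pose p := al * th; have p0 : 0 < p by [].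
pose d0 t := if 0 < t then dd H al th t else 0.
have d0E t : 0 < t -> d0 t = dd H al th t by rewrite /d0 => ->.
have md0 : measurable_fun setT d0.
  have := (measurable_restrictT (dd H al th) (measurable_itv `]0%R, +oo[)).1 (measurable_dd th al0 al1 H_pos H_log).
  apply: eq_measurable_fun => t _; rewrite /patch /d0.
  case: ifPn => [/set_mem/in0 ->//|]; case: ifPn => // t0.
  by rewrite mem_set//= in_itv/= t0.
have Icut (c : R) : lambda.-integrable P0 (fun u : R => (if u < c then d0 u else 0)%:E).
  have K : lambda.-integrable P0 ((EFin \o dd H al th) \_ `]0%R, c[%classic).
    apply/(integrable_restrict lambda) => //.
    rewrite (_ : _ `&` _ = `]0%R, c[%classic); first exact: integrable_dd.
    by apply: setIidr => s; rewrite /= !in_itv/= andbT => /andP[].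
  have E (t : R) : 0 < t -> ((EFin \o dd H al th) \_ `]0%R, c[%classic) t = (if t < c then d0 t else 0)%:E.
    move=> t0; have M : (t \in (`]0%R, c[%classic : set R)) = (t < c) by rewrite mem_setE/= in_itv/= t0.
    by rewrite /patch M d0E//; case: ifP.
  by apply: eq_integrable K => // t /set_mem/in0 t0; rewrite E.
pose w (u : R) := if u < x then p^-1 * (x - u) `^ p else 0.
have Iw : lambda.-integrable P0 (fun u : R => (w u * d0 u)%:E).
  have K : lambda.-integrable P0 (fun u : R => (p^-1 * x `^ p)%:E * (if u < x then d0 u else 0)%:E)%E.
    exact: integrableZl.
  apply: le_integrable K => //.
    apply/measurable_EFinP; apply: measurable_funTS; apply: measurable_funM => //.
    apply: measurable_fun_ifT => //; first exact: measurable_fun_ltr.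
    by apply: measurable_funM => //; apply: measurable_fun_powR; exact: measurable_funB.
  have key (u : R) : 0 < u -> `|w u * d0 u| <= `|p^-1 * x `^ p * (if u < x then d0 u else 0)|.
    move=> u0; rewrite /w; case: ifPn => ux; last by rewrite mul0r !mulr0.
    rewrite !normrM ler_wpM2r// !ger0_norm ?invr_ge0 ?powR_ge0 ?(ltW p0)//.
    rewrite ler_wpM2l ?invr_ge0 ?(ltW p0)//; apply: ler_powR_base; rewrite ?(ltW p0) ?subr_ge0 ?(ltW ux)//.
    by rewrite lerBlDr lerDl ltW.
  by move=> u /in0 u0; rewrite lee_fin; exact: key.
pose ker1 (q : R * R) := if q.1 < x then bkern p q.1 q.2 else 0.
pose ker2 (q : R * R) := bkern p x q.1 * (if q.2 < q.1 then 1 else 0).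
have mK1 : measurable_fun [set: RR * RR] ker1.
  by apply: measurable_fun_ifT => //; [exact: measurable_fun_ltr|exact: measurable_bkern].
have mK2 : measurable_fun [set: RR * RR] ker2.
  apply: measurable_funM; first exact: measurable_bkern.
  by apply: measurable_fun_ifT => //; exact: measurable_fun_ltr.
have K10 s u : 0 <= ker1 (s, u) by rewrite /ker1 /=; case: ifP => // _; exact: bkern_ge0.
have K20 s u : 0 <= ker2 (s, u) by rewrite /ker2 mulr_ge0 ?bkern_ge0//=; case: ifP.
have [J1 E1] := fubini_kernel mK1 md0 K10 (fun u u0 => (integral_bkern x u0).1) Iw.
have [_ E2] := fubini_kernel mK2 md0 K20 (fun u u0 => (integral_bkern x u0).2) Iw.
pose f (s : R) := (\int[lambda]_(t in `]0%R, s[) ((s - t) `^ (p - 1) * dd H al th t)%:E)%E.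
have inner1 (s : R) : 0 < s -> (\int[lambda]_(u in P0) (ker1 (s, u) * d0 u)%:E = if (s < x)%R then f s else 0)%E.
  move=> s0; rewrite /ker1 /=; case: ifPn => sx; last by apply: integral0_eq => u _; rewrite mul0r.
  rewrite /f -integral_cut.
  have E (u : R) : 0 < u -> (bkern p s u * d0 u)%:E = (if u < s then ((s - u) `^ (p - 1) * dd H al th u)%:E else 0%E).
    by move=> u0; rewrite /bkern u0 d0E//=; case: ifP => // _; rewrite mul0r.
  by apply: eq_integral => u /set_mem/in0 u0; rewrite E.
have inner2 (t : R) : 0 < t -> (\int[lambda]_(u in P0) (ker2 (t, u) * d0 u)%:E = (bkern p x t * Delta H al th t)%:E)%E.
  move=> t0; rewrite /ker2 /=.
  transitivity (\int[lambda]_(u in P0) ((bkern p x t)%:E * (if u < t then d0 u else 0)%:E))%E.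
    apply: eq_integral => u _; rewrite -EFinM -mulrA; congr (_ * _)%:E.
    by case: ifP => _; rewrite ?mul1r ?mul0r.
  rewrite integralZl// EFinM; congr (_ * _)%E.
  rewrite -integral_dd// -EFin_Rintegral//; last exact: integrable_dd.
  rewrite -integral_cut.
  have E (u : R) : 0 < u -> (if u < t then d0 u else 0)%:E = (if u < t then (dd H al th u)%:E else 0%E).
    by move=> u0; rewrite d0E//; case: ifP.
  by apply: eq_integral => u /set_mem/in0 u0; rewrite E.
split.
  have sub : (`]0%R, x[%classic : set RR) `<=` P0 by move=> s; rewrite /= !in_itv/= andbT => /andP[].
  have J : lambda.-integrable (`]0%R, x[%classic : set RR)
      (fun s : R => (\int[lambda]_(u in P0) (ker1 (s, u) * d0 u)%:E)%E).
    by apply: integrableS J1.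
  have E (s : R) : 0 < s < x -> (\int[lambda]_(u in P0) (ker1 (s, u) * d0 u)%:E = f s)%E.
    by move=> /andP[s0 sx]; rewrite inner1// sx.
  by apply: eq_integrable J => // s /set_mem; rewrite /= in_itv/= => sx; rewrite E.
apply: etrans _ (esym (cdf_Delta al0 al1 th0 H_pos H_log mu0 muE x0)).
rewrite -[LHS]integral_cut.
transitivity (\int[lambda]_(s in P0) \int[lambda]_(u in P0) (ker1 (s, u) * d0 u)%:E)%E.
  by apply: eq_integral => s /set_mem/in0 s0; rewrite inner1.
rewrite E1 -E2 -[RHS]integral_cut.
have E (t : R) : 0 < t -> (bkern p x t * Delta H al th t)%:E = (if t < x then ((x - t) `^ (p - 1) * Delta H al th t)%:E else 0%E).
  by move=> t0; rewrite /bkern t0/=; case: ifP => // _; rewrite mul0r.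
by apply: eq_integral => t /set_mem/in0 t0; rewrite inner2// E.
Qed.

End density_of_mean.

End densities.

Unset Implicit Arguments.
Set Strict Implicit.
Set Printing Implicit Defensive.

Theorem theorem5p1 (R : realType) (alpha theta : R)
  (H : probability (measurableTypeR R) R)
  (alpha_gt0 : 0 < alpha) (alpha_lt1 : alpha < 1) (theta_gt0 : 0 < theta)
  (H_pos : H [set r : R | 0 < r] = 1%E)
  (H_log : (\int[H]_(r in `]0%R, +oo[) (ln (1 + (r : R)))%:E < +oo)%E)
  (mu : probability (measurableTypeR R) R)
  (mu_law : dirichlet_mean_law (alpha * theta)
              (with_density (fun x => (rhoH H alpha x)%:E)) mu) :
  (forall mu1 mu2 : probability (measurableTypeR R) R,
     dirichlet_mean_law (alpha * theta)
       (with_density (fun y => (rho alpha y)%:E)) mu1 ->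
     dirichlet_mean_law theta H mu2 ->
     forall A : set (measurableTypeR R), measurable A ->
       mu A = (mu1 \x mu2)%E
                [set p | A ((p.1 : R) * (p.2 : R) `^ alpha^-1)])
  /\
  (forall x : R, 0 < x ->
     mu [set y : R | y <= x] =
     (\int[lebesgue_measure]_(t in `]0%R, x[)
        ((x - t) `^ (alpha * theta - 1) * Delta H alpha theta t)%:E)%E)
  /\
  (alpha * theta = 1 ->
   forall A : set (measurableTypeR R), measurable A ->
     mu A = with_density (fun x => (Delta H alpha theta x)%:E) A)
  /\
  (H.-integrable `]0, +oo[ (fun r => (ln (r : R))%:E) ->
   regular_at_0 H alpha theta)
  /\
  (regular_at_0 H alpha theta ->
   forall A : set (measurableTypeR R), measurable A ->
     mu A = with_density (fun x =>
       (\int[lebesgue_measure]_(t in `]0%R, x[)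
          ((x - t) `^ (alpha * theta - 1) * dd H alpha theta t)%:E)%E) A).
Proof.
have ray x : [set y : R | y <= x] = `]-oo, x]%classic by rewrite set_itvE.
have Hp : H `]0%R, +oo[%classic = 1%E by rewrite -H_pos set_itvE.
have [mu0 muE] := mean_law_transform alpha_gt0 alpha_lt1 theta_gt0 Hp H_log mu_law.
split.
  by move=> mu1 mu2 L1 L2; exact: (mean_law_product alpha_gt0 alpha_lt1 theta_gt0 Hp H_log mu_law L1 L2).
split; first by move=> x x0; rewrite ray; exact: (cdf_Delta alpha_gt0 alpha_lt1 theta_gt0 Hp H_log mu0 muE x0).
split; first by move=> at1; exact: mean_law_density.
split; first by move=> H_ln; exact: regular_at_0_of_ln.
by move=> reg; exact: mean_law_density_dd.
Qed.
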